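(* Let $K\ge 1$, $k=\frac{K-1}{K+1}$, and $0<p<\infty$. Suppose $f=h+\overline{g}\in \mathcal{K}_H^0$ is $K$-quasiconformal. Then for every $0<r<1$, $$M_p(r,h')\le M_p(r,H_k)\quad\text{and}\quad M_p(r,g')\le M_p(r,G_k),$$ where $$H_k(z)=\frac{1+z}{(1-z)^2(1-kz)},\qquad G_k(z)=\frac{kz(1+z)}{(1-z)^2(1-kz)}.$$
   Context: $\mathbb{D}=\{z\in\mathbb{C}:|z|<1\}$. Every complex-valued harmonic function $f$ in $\mathbb{D}$ has a unique representation $f=h+\overline{g}$ with $h,g$ analytic in $\mathbb{D}$ and $g(0)=0$. $\mathcal{S}_H$ denotes the class of sense-preserving univalent harmonic functions $f=h+\overline{g}$ in $\mathbb{D}$ with $h(0)=g(0)=0$, $h'(0)=1$; $\mathcal{S}_H^0=\{f\in\mathcal{S}_H: g'(0)=0\}$. $\mathcal{K}_H^0$ is the subclass of $\mathcal{S}_H^0$ of functions mapping $\mathbb{D}$ onto a convex domain. For $K\ge1$, a sense-preserving harmonic $f=h+\overline g$ is $K$-quasiconformal if it is a homeomorphism of $\mathbb{D}$ and its analytic dilatation $\omega=g'/h'$ satisfies $|\omega(z)|\le k=\frac{K-1}{K+1}$ for all $z\in\mathbb{D}$. For $F$ analytic in $\mathbb{D}$ and $0<p<\infty$, $M_p(r,F)=\left(\frac{1}{2\pi}\int_0^{2\pi}|F(re^{i\theta})|^p\,d\theta\right)^{1/p}$. *)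

(* Defs.v *)
From Stdlib Require Import Reals.
From Coquelicot Require Import Coquelicot.
Open Scope R_scope.

Definition inD (z : C) : Prop := Cmod z < 1.

Definition has_deriv_on_D (F F' : C -> C) : Prop :=
  forall z : C, inD z -> @is_derive C_AbsRing C_NormedModule F z (F' z).

Definition harm (h g : C -> C) (z : C) : C := Cplus (h z) (Cconj (g z)).

Definition homeo_on_D (f : C -> C) : Prop :=
  (forall z w : C, inD z -> inD w -> f z = f w -> z = w) /\
  (forall w : C, inD w -> forall eps : R, 0 < eps -> exists delta : R, 0 < delta /\
     forall z : C, inD z -> Cmod (Cminus z w) < delta -> Cmod (Cminus (f z) (f w)) < eps) /\
  (forall w : C, inD w -> forall eps : R, 0 < eps -> exists delta : R, 0 < delta /\
     forall z : C, inD z -> Cmod (Cminus (f z) (f w)) < delta -> Cmod (Cminus z w) < eps).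

Definition convex_image (f : C -> C) : Prop :=
  forall z1 z2 : C, inD z1 -> inD z2 -> forall t : R, 0 <= t <= 1 ->
    exists z : C, inD z /\
      f z = Cplus (Cmult (RtoC (1 - t)) (f z1)) (Cmult (RtoC t) (f z2)).

Definition in_KH0 (h g h' g' : C -> C) : Prop :=
  has_deriv_on_D h h' /\ has_deriv_on_D g g' /\
  h (RtoC 0) = RtoC 0 /\ g (RtoC 0) = RtoC 0 /\ h' (RtoC 0) = RtoC 1 /\ g' (RtoC 0) = RtoC 0 /\
  (forall z w : C, inD z -> inD w -> harm h g z = harm h g w -> z = w) /\
  (* sense-preserving: Jacobian |h'|^2 - |g'|^2 > 0 *)
  (forall z : C, inD z -> Cmod (g' z) < Cmod (h' z)) /\
  convex_image (harm h g).

Definition K_qc (K : R) (h g h' g' : C -> C) : Prop :=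
  homeo_on_D (harm h g) /\
  forall z : C, inD z -> Cmod (Cdiv (g' z) (h' z)) <= (K - 1) / (K + 1).

(* x^y for x >= 0, y > 0, with 0^y = 0 *)
Definition rpow (x y : R) : R := if Req_EM_T x 0 then 0 else Rpower x y.

Definition polar (r t : R) : C := (r * cos t, r * sin t).

Definition Mp (p r : R) (F : C -> C) : R :=
  rpow (/ (2 * PI) * RInt (fun t => rpow (Cmod (F (polar r t))) p) 0 (2 * PI)) (/ p).

Definition Hk (k : R) (z : C) : C :=
  Cdiv (Cplus (RtoC 1) z)
       (Cmult (Cmult (Cminus (RtoC 1) z) (Cminus (RtoC 1) z))
              (Cminus (RtoC 1) (Cmult (RtoC k) z))).

Definition Gk (k : R) (z : C) : C :=
  Cdiv (Cmult (Cmult (RtoC k) z) (Cplus (RtoC 1) z))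
       (Cmult (Cmult (Cminus (RtoC 1) z) (Cminus (RtoC 1) z))
              (Cminus (RtoC 1) (Cmult (RtoC k) z))).

(* Main.v *)
(* The shear [F_a = e^(i a) h + e^(-i a) g] has the same real part as [e^(i a) f], and since the image [Om] of [f] is convex the
 increments of [h] and [g] between the preimages of two points of [Om] still satisfy [|dg| <= k |dh|]. With Koebe's lemma on arcs this
 shows that sequences tending to the circle along which [f] escapes in the same direction have the same limit. The intermediate
 value theorem gives a support direction of [Om] such that the extremal points for this direction and for the opposite one
 correspond to antipodal points of the circle. A maximum principle for the comparison of [F_a] with its vertical translates
 then yields [a] and [b] with [Re (e^(i b) (1 - e^(-2 i b) z^2) F_a' z) >= 0]. Hence [|h'|] is, up to a factor [1 + e], at most
 the modulus of a product of functions subordinate to [1 + z], [1 / (1 - z)], [1 / (1 - z)] and [1 / (1 - k z)]. On circles the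
 moduli of these four functions are symmetric and decreasing in [|arg z|], so their powers are dominated by positive combinations
 of harmonic measures of arcs centred at 1, and a rearrangement argument bounds the integral of the product by that of [H_k].
 The bound for [g'] follows from the Schwarz lemma for [g' / h']. *)

Require Import Defs.
From Stdlib Require Import ZArith Reals Lra Lia List ClassicalEpsilon Ranalysis5.
From Coquelicot Require Import Coquelicot.
Open Scope R_scope.

Ltac C_ring := unfold Re, Im; simpl; ring.
Ltac smooth := apply (ex_derive_continuous (V := R_NormedModule)); auto_derive; auto.
(** Meant for ranks that are sums of thresholds: every bound [N <= n] is then found by [lia], so all
    the eventual properties in the context are instantiated at one common rank. *)
Ltac at_rank n := repeat match goal with X : forall m : nat, @?P m -> @?Q m |- _ => match P with fun m => (?N <= m)%nat => idtac | fun m => (m >= ?N)%nat => idtac end;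
 specialize (X n ltac:(unfold ge in *; repeat match goal with m := _ : nat |- _ => subst m end; lia)) end.
Ltac pos_div := apply Rdiv_lt_0_compat; lra.
Tactic Notation "Cnneg" constr(z) := pose proof (Cmod_ge_0 z).
Tactic Notation "Cnneg" constr(z) "as" ident(H) := pose proof (Cmod_ge_0 z) as H.
Tactic Notation "lt_via" uconstr(t) := eapply Rle_lt_trans; [apply t|].
Notation ex_RInt_continuous_R := (ex_RInt_continuous (V := R_CompleteNormedModule)).
Tactic Notation "le_via" uconstr(t) := eapply Rle_trans; [apply t|].
Tactic Notation "le_via" uconstr(t) "," uconstr(u) := eapply Rle_trans; [apply t, u|].
Notation lt_min_l H := (Rlt_le_trans _ _ _ H (Rmin_l _ _)).
Notation lt_min_r H := (Rlt_le_trans _ _ _ H (Rmin_r _ _)).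
Notation lt_min_rl H := (Rlt_le_trans _ _ _ H (Rle_trans _ _ _ (Rmin_r _ _) (Rmin_l _ _))).
Notation lt_min_rr H := (Rlt_le_trans _ _ _ H (Rle_trans _ _ _ (Rmin_r _ _) (Rmin_r _ _))).
Notation cis := (polar 1).
Notation circle_pow p r F := (fun t => rpow (Cmod (F (polar r t))) p).
Notation continuous_Rmult := (continuous_mult (K := R_AbsRing)).
Notation RInt_Chasles_R := (RInt_Chasles (V := R_CompleteNormedModule)).

(** The condition Re (e^(i b) (1 - e^(-2 i b) z^2) F_a') >= 0 is an analytic form of convexity of
    F_a in the vertical direction. In general the quadratic factor of such a condition has two
    unrelated zeros on the circle. Antipodal zeros are wanted because 1 - e^(-2 i b) z^2 is then a
    single factor 1 - s with a Schwarz function s, which supplies one of the two factors 1 / (1 - z)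
    of H_k. The other one and 1 + z come from the positive real part, and 1 / (1 - k z) from F_a' =
    e^(i a) h' (1 + e^(-2 i a) g' / h'). This is why the direction a cannot be arbitrary. The
    obstacle is that f has no boundary values at hand and that its image may be unbounded. Boundary
    points are therefore handled by sequences tending to the circle, and boundary points of the
    image, finite or infinite, by the direction in which they are seen from 0. The plane topology is
    reduced to two crossing lemmas proved with continuous arguments. *)

Lemma Rdiv_le_1 x y : 0 < y -> x <= y -> x / y <= 1.
Proof. intros Hy H. apply Rmult_le_reg_r with y; auto. unfold Rdiv. rewrite Rmult_assoc, Rinv_l; lra. Qed.

Lemma Rdiv_01 x y : 0 < y -> 0 <= x <= y -> 0 <= x / y <= 1.
Proof.
 intros Hy H. split; [|apply Rdiv_le_1; lra]. apply Rmult_le_pos; [lra|]. apply Rlt_le, Rinv_0_lt_compat; auto.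
Qed.

(** * Complex differentiability *)

(** Increment form with a non-strict bound: it includes w = z and contains no division, so that
    sums, products and compositions are plain estimates. *)
Definition Cder (F : C -> C) (z l : C) : Prop :=
 forall eps, 0 < eps -> exists delta, 0 < delta /\
  forall w, Cmod (w - z) < delta ->
   Cmod (F w - F z - l * (w - z)) <= eps * Cmod (w - z).

Definition Ccont (F : C -> C) (z : C) : Prop :=
 forall eps, 0 < eps -> exists delta, 0 < delta /\
  forall w, Cmod (w - z) < delta -> Cmod (F w - F z) < eps.

Lemma Ceq (x y : C) : Re x = Re y -> Im x = Im y -> x = y.
Proof. destruct x, y; simpl; intros -> ->; reflexivity. Qed.

Ltac C_eq := apply Ceq; C_ring.

Lemma Cmod_minus_sym (x y : C) : Cmod (x - y) = Cmod (y - x).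
Proof. rewrite <- Cmod_opp. f_equal. ring. Qed.

Lemma Cmod_triangle_rev (x y : C) : Cmod x - Cmod y <= Cmod (x - y).
Proof.
 assert (H := Cmod_triangle (x - y) y).
 replace (x - y + y)%C with x in H by ring. lra.
Qed.

Lemma Cmod_triangle3 (x y z : C) : Cmod (x - z) <= Cmod (x - y) + Cmod (y - z).
Proof. replace (x - z)%C with ((x - y) + (y - z))%C by ring. apply Cmod_triangle. Qed.

Lemma Cmod_minus_le (x y : C) : Cmod (x - y) <= Cmod x + Cmod y.
Proof. rewrite <- (Cmod_opp y). apply Cmod_triangle. Qed.

Lemma Cmod_sqr (x : C) : Cmod x * Cmod x = Re x * Re x + Im x * Im x.
Proof. assert (H := Cmod2_alt x). simpl in H. lra. Qed.

Lemma Cmod_diag z : Cmod (z - z) = 0.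
Proof. replace (z - z)%C with (RtoC 0) by ring. apply Cmod_0. Qed.

Lemma Cmod_scal (c : R) (z : C) : 0 <= c -> Cmod (RtoC c * z) = c * Cmod z.
Proof. intros Hc. rewrite Cmod_mult, Cmod_R, Rabs_right; lra. Qed.

Lemma im_le_Cmod (c : C) : Rabs (Im c) <= Cmod c.
Proof.
 eapply Rle_trans; [apply (Rmax_r (Rabs (fst c)))|apply Rmax_Cmod].
Qed.

Lemma Cmod_le_re_im (c : C) : Cmod c <= Rabs (Re c) + Rabs (Im c).
Proof.
 assert (H := Cmod_sqr c).
 Cnneg c; pose proof (Rabs_pos (Re c)); pose proof (Rabs_pos (Im c)).
 assert (Re c * Re c = Rabs (Re c) * Rabs (Re c)).
 { rewrite <- Rabs_mult. symmetry. apply Rabs_right. nra. }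
 assert (Im c * Im c = Rabs (Im c) * Rabs (Im c)).
 { rewrite <- Rabs_mult. symmetry. apply Rabs_right. nra. }
 apply Rnot_lt_le; intros Hc. nra.
Qed.

Lemma re_minus (x y : C) : Re (x - y) = Re x - Re y.
Proof. reflexivity. Qed.
Lemma im_minus (x y : C) : Im (x - y) = Im x - Im y.
Proof. reflexivity. Qed.

Lemma inD0 : inD 0.
Proof. unfold inD. rewrite Cmod_0. lra. Qed.

Lemma has_deriv_on_D_Cder (F F' : C -> C) :
 has_deriv_on_D F F' -> forall z, inD z -> Cder F z (F' z).
Proof.
 intros H z Hz eps He. destruct (H z Hz) as [_ Hd].
 destruct (Hd z (fun P HP => HP) (mkposreal eps He)) as [d Hd'].
 exists d. split. apply cond_pos.
 intros w Hw. specialize (Hd' w Hw). simpl in Hd'.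
 replace (F w - F z - F' z * (w - z))%C with
  (minus (minus (F w) (F z)) (scal (minus w z) (F' z))).
 - exact Hd'.
 - unfold scal, minus, plus, opp; simpl. unfold mult; simpl. ring.
Qed.

Lemma Cder_cont F z l : Cder F z l -> Ccont F z.
Proof.
 intros H eps He. destruct (H 1 Rlt_0_1) as [d [Hd Hw]].
 assert (Hl := Cmod_ge_0 l).
 exists (Rmin d (eps / (2 + Cmod l))). split.
 - apply Rmin_pos; auto. pos_div.
 - intros w Hlt.
  assert (H1 : Cmod (w - z) < d) by (eapply Rlt_le_trans; [exact Hlt|apply Rmin_l]).
  assert (H2 : Cmod (w - z) < eps / (2 + Cmod l)) by (eapply Rlt_le_trans; [exact Hlt|apply Rmin_r]).
  specialize (Hw w H1).
  replace (F w - F z)%C with ((F w - F z - l * (w - z)) + l * (w - z))%C by ring.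
  lt_via Cmod_triangle. rewrite Cmod_mult.
  assert (Cmod (w - z) * (2 + Cmod l) < eps).
  { apply Rmult_lt_reg_r with (/ (2 + Cmod l)). apply Rinv_0_lt_compat; lra.
   rewrite Rmult_assoc, Rinv_r by lra. unfold Rdiv in H2. lra. }
  Cnneg (w - z)%C. nra.
Qed.

Lemma Cder_ext_loc F G z l :
 (exists d, 0 < d /\ forall w, Cmod (w - z) < d -> F w = G w) -> Cder F z l -> Cder G z l.
Proof.
 intros [d [Hd HFG]] H eps He. destruct (H eps He) as [d' [Hd' Hw]].
 exists (Rmin d d'). split. apply Rmin_pos; auto.
 intros w Hlt. rewrite <- (HFG w), <- (HFG z).
 - apply Hw. eapply Rlt_le_trans; [exact Hlt|apply Rmin_r].
 - rewrite Cmod_diag; auto.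
 - eapply Rlt_le_trans; [exact Hlt|apply Rmin_l].
Qed.

Lemma Cder_ext F G z l : (forall w, F w = G w) -> Cder F z l -> Cder G z l.
Proof. intros H. apply Cder_ext_loc. exists 1. split; [lra|auto]. Qed.

Lemma Cder_const c z : Cder (fun _ => c) z 0.
Proof.
 intros eps He. exists 1; split; [lra|]. intros w _.
 replace (c - c - 0 * (w - z))%C with (RtoC 0) by ring. rewrite Cmod_0.
 Cnneg (w - z)%C. nra.
Qed.

Lemma Cder_id z : Cder (fun w => w) z 1.
Proof.
 intros eps He. exists 1; split; [lra|]. intros w _.
 replace (w - z - 1 * (w - z))%C with (RtoC 0) by ring. rewrite Cmod_0.
 Cnneg (w - z)%C. nra.
Qed.

Lemma Cder_plus F G z l m : Cder F z l -> Cder G z m -> Cder (fun w => F w + G w)%C z (l + m).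
Proof.
 intros HF HG eps He.
 destruct (HF (eps / 2)) as [d [Hd H1]]; [lra|].
 destruct (HG (eps / 2)) as [d' [Hd' H2]]; [lra|].
 exists (Rmin d d'). split. apply Rmin_pos; auto. intros w Hw.
 specialize (H1 w (lt_min_l Hw)).
 specialize (H2 w (lt_min_r Hw)).
 replace (F w + G w - (F z + G z) - (l + m) * (w - z))%C with
  ((F w - F z - l * (w - z)) + (G w - G z - m * (w - z)))%C by ring.
 le_via Cmod_triangle. lra.
Qed.

Lemma Cder_comp F G z l m : Cder F z l -> Cder G (F z) m -> Cder (fun w => G (F w)) z (m * l).
Proof.
 intros HF HG eps He.
 Cnneg l as Hl. Cnneg m as Hm.
 set (e1 := eps / (2 * (1 + Cmod l))). set (e2 := Rmin 1 (eps / (2 * (1 + Cmod m)))).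
 assert (He1 : 0 < e1) by pos_div.
 assert (He2 : 0 < e2) by (apply Rmin_pos; [lra|pos_div]).
 destruct (HG e1 He1) as [d1 [Hd1 H1]].
 destruct (HF e2 He2) as [d2 [Hd2 H2]].
 destruct (Cder_cont _ _ _ HF d1 Hd1) as [d3 [Hd3 H3]].
 exists (Rmin d2 d3). split. apply Rmin_pos; auto. intros w Hw.
 specialize (H2 w (lt_min_l Hw)).
 specialize (H3 w (lt_min_r Hw)).
 specialize (H1 (F w) H3).
 set (D := (F w - F z)%C) in *. set (dz := (w - z)%C) in *.
 replace (G (F w) - G (F z) - m * l * dz)%C with
  ((G (F w) - G (F z) - m * D) + m * (D - l * dz))%C by ring.
 le_via Cmod_triangle. rewrite Cmod_mult.
 assert (HD : Cmod D <= (1 + Cmod l) * Cmod dz).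
 { replace D with ((D - l * dz) + l * dz)%C by ring.
  le_via Cmod_triangle. rewrite Cmod_mult.
  assert (e2 <= 1) by apply Rmin_l. Cnneg dz. nra. }
 assert (e2 <= eps / (2 * (1 + Cmod m))) by apply Rmin_r.
 assert (X1 : e1 * (1 + Cmod l) = eps / 2) by (unfold e1; field; lra).
 assert (X2 : eps / (2 * (1 + Cmod m)) * (1 + Cmod m) = eps / 2) by (field; lra).
 Cnneg dz.
 assert (Cmod m * (e2 * Cmod dz) <= eps / 2 * Cmod dz).
 { rewrite <- X2. assert (Cmod m * e2 <= eps / (2 * (1 + Cmod m)) * (1 + Cmod m)).
  { rewrite Rmult_comm. apply Rmult_le_compat; lra. } nra. }
 assert (e1 * Cmod D <= eps / 2 * Cmod dz) by (rewrite <- X1; nra).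
 nra.
Qed.

Lemma Cder_mult F G z l m : Cder F z l -> Cder G z m ->
 Cder (fun w => F w * G w)%C z (l * G z + F z * m).
Proof.
 intros HF HG eps He.
 Cnneg l as Hl. Cnneg m as Hm.
 Cnneg (F z) as Hf. Cnneg (G z) as Hg.
 set (M := 4 * (1 + Cmod l + Cmod m + Cmod (F z) + Cmod (G z))).
 set (e := eps / M).
 assert (HM : 0 < M) by (unfold M; lra).
 assert (He0 : 0 < e) by pos_div.
 destruct (HF e He0) as [d1 [Hd1 H1]].
 destruct (HG e He0) as [d2 [Hd2 H2]].
 assert (He1 : 0 < Rmin 1 e) by (apply Rmin_pos; lra).
 destruct (Cder_cont _ _ _ HF _ He1) as [d3 [Hd3 H3]].
 exists (Rmin d1 (Rmin d2 d3)). split. repeat apply Rmin_pos; auto. intros w Hw.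
 specialize (H1 w (lt_min_l Hw)).
 specialize (H2 w (lt_min_rl Hw)).
 specialize (H3 w (lt_min_rr Hw)).
 set (dz := (w - z)%C) in *.
 replace (F w * G w - F z * G z - (l * G z + F z * m) * dz)%C with
  ((F w - F z - l * dz) * G z + F z * (G w - G z - m * dz)
   + (F w - F z) * (G w - G z - m * dz) + (F w - F z) * (m * dz))%C by ring.
 le_via Cmod_triangle.
 eapply Rle_trans; [apply Rplus_le_compat_r, Cmod_triangle|].
 eapply Rle_trans; [apply Rplus_le_compat_r, Rplus_le_compat_r, Cmod_triangle|].
 rewrite !Cmod_mult.
 set (A := Cmod (F w - F z - l * dz)) in *. set (B := Cmod (G w - G z - m * dz)) in *.
 set (Dl := Cmod (F w - F z)) in *.
 assert (Dl <= 1 /\ Dl <= e).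
 { split; eapply Rlt_le, Rlt_le_trans; try exact H3; [apply Rmin_l|apply Rmin_r]. }
 assert (HdZ := Cmod_ge_0 dz). assert (HA : 0 <= A) by apply Cmod_ge_0.
 assert (HB : 0 <= B) by apply Cmod_ge_0. assert (HDl : 0 <= Dl) by apply Cmod_ge_0.
 assert (X : e * M = eps) by (unfold e; field; lra).
 assert (A * Cmod (G z) <= e * Cmod dz * Cmod (G z)) by nra.
 assert (Cmod (F z) * B <= e * Cmod dz * Cmod (F z)) by nra.
 assert (Dl * B <= e * Cmod dz) by nra.
 assert (Dl * (Cmod m * Cmod dz) <= e * Cmod dz * Cmod m).
 { replace (e * Cmod dz * Cmod m) with (e * (Cmod m * Cmod dz)) by ring.
  apply Rmult_le_compat_r; [nra|lra]. }
 rewrite <- X. unfold M. assert (0 <= e * Cmod dz) by nra. nra.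
Qed.

Lemma Cder_inv (z : C) : z <> 0 -> Cder (fun w => / w)%C z (- / (z * z)).
Proof.
 intros Hz eps He.
 assert (Hm : 0 < Cmod z) by (apply Cmod_gt_0; auto).
 exists (Rmin (Cmod z / 2) (eps * (Cmod z * Cmod z * Cmod z) / 2)). split.
 { apply Rmin_pos; [lra|]. assert (0 < Cmod z * Cmod z * Cmod z) by (repeat apply Rmult_lt_0_compat; auto). nra. }
 intros w Hw.
 assert (H1 := Rlt_le_trans _ _ _ Hw (Rmin_l _ _)).
 assert (H2 := Rlt_le_trans _ _ _ Hw (Rmin_r _ _)).
 assert (Hw2 : Cmod z / 2 < Cmod w).
 { assert (X := Cmod_triangle_rev z w). rewrite Cmod_minus_sym in X. lra. }
 assert (Hw0 : w <> 0) by (apply Cmod_gt_0; lra).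
 replace (/ w - / z - - / (z * z) * (w - z))%C with ((w - z) * (w - z) / (z * z * w))%C
  by (field; auto).
 rewrite Cmod_div by (repeat apply Cmult_neq_0; auto). rewrite !Cmod_mult.
 set (d := Cmod (w - z)) in *. assert (0 <= d) by apply Cmod_ge_0.
 set (a := Cmod z) in *. set (b := Cmod w) in *.
 assert (0 < a * a) by nra.
 apply Rmult_le_reg_r with (a * a * b). nra.
 unfold Rdiv. rewrite Rmult_assoc, Rinv_l by nra.
 assert (eps * (a * a * a) / 2 <= eps * (a * a * b)).
 { replace (eps * (a * a * a) / 2) with (eps * (a * a * (a / 2))) by field.
  apply Rmult_le_compat_l; [lra|]. apply Rmult_le_compat_l; lra. }
 nra.
Qed.

Lemma Cder_opp F z l : Cder F z l -> Cder (fun w => - F w)%C z (- l).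
Proof.
 intros H. apply Cder_ext with (fun w => (-(1)) * F w)%C. intros; ring.
 replace (- l)%C with (0 * F z + (-(1)) * l)%C by ring.
 apply (Cder_mult (fun _ => (-(1))%C) F); [apply Cder_const|exact H].
Qed.

Lemma Cder_minus F G z l m : Cder F z l -> Cder G z m -> Cder (fun w => F w - G w)%C z (l - m).
Proof. intros HF HG. apply Cder_plus; auto. apply Cder_opp; auto. Qed.

Lemma Cder_scal c F z l : Cder F z l -> Cder (fun w => c * F w)%C z (c * l).
Proof.
 intros H. replace (c * l)%C with (0 * F z + c * l)%C by ring.
 apply (Cder_mult (fun _ => c) F); [apply Cder_const|exact H].
Qed.

Lemma Cder_div (F G : C -> C) (z l m : C) : G z <> 0 -> Cder F z l -> Cder G z m ->
 Cder (fun w => F w / G w)%C z ((l * G z - F z * m) / (G z * G z)).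
Proof.
 intros H0 HF HG.
 replace ((l * G z - F z * m) / (G z * G z))%C with
  (l * / G z + F z * (- / (G z * G z) * m))%C by (field; auto).
 apply (Cder_mult F (fun w => / G w)%C); auto.
 apply (Cder_comp G (fun w => / w)%C); auto. apply Cder_inv; auto.
Qed.

Lemma Cder_unique F z l m : Cder F z l -> Cder F z m -> l = m.
Proof.
 intros H1 H2. apply NNPP; intros Hne.
 assert (Hp : 0 < Cmod (l - m)).
 { apply Cmod_gt_0. intros E. apply Hne. apply Ceq_minus; auto. }
 set (e := Cmod (l - m) / 4).
 destruct (H1 e) as [d1 [Hd1 X1]]; [unfold e; lra|].
 destruct (H2 e) as [d2 [Hd2 X2]]; [unfold e; lra|].
 set (d := Rmin d1 d2 / 2).
 assert (Hd : 0 < d) by (unfold d; assert (0 < Rmin d1 d2) by (apply Rmin_pos; auto); lra).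
 assert (D1 : d < d1) by (unfold d in *; pose proof (Rmin_l d1 d2); lra).
 assert (D2 : d < d2) by (unfold d in *; pose proof (Rmin_r d1 d2); lra).
 assert (E : (z + d - z)%C = d) by ring.
 specialize (X1 (z + d)%C). specialize (X2 (z + d)%C). rewrite E in *.
 rewrite Cmod_R, Rabs_right in X1, X2 by lra.
 specialize (X1 D1). specialize (X2 D2).
 assert (Cmod ((l - m) * d) <= 2 * e * d).
 { replace ((l - m) * d)%C with
   ((F (z + d) - F z - m * d) - (F (z + d) - F z - l * d))%C by ring.
  le_via Cmod_minus_le. lra. }
 rewrite Cmod_mult, Cmod_R, Rabs_right in H by lra. unfold e in H. nra.
Qed.

Lemma Ccont_plus F G z : Ccont F z -> Ccont G z -> Ccont (fun w => F w + G w)%C z.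
Proof.
 intros HF HG eps He.
 destruct (HF (eps / 2)) as [d [Hd H1]]; [lra|].
 destruct (HG (eps / 2)) as [d' [Hd' H2]]; [lra|].
 exists (Rmin d d'). split. apply Rmin_pos; auto. intros w Hw.
 specialize (H1 w (lt_min_l Hw)).
 specialize (H2 w (lt_min_r Hw)).
 replace (F w + G w - (F z + G z))%C with ((F w - F z) + (G w - G z))%C by ring.
 lt_via Cmod_triangle. lra.
Qed.

Lemma Ccont_mult F G z : Ccont F z -> Ccont G z -> Ccont (fun w => F w * G w)%C z.
Proof.
 intros HF HG eps He.
 Cnneg (F z). Cnneg (G z).
 set (M := 2 + Cmod (F z) + Cmod (G z)).
 set (e := Rmin 1 (eps / M)).
 assert (HM : 0 < M) by (unfold M; lra).
 assert (He0 : 0 < e) by (apply Rmin_pos; [lra|pos_div]).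
 destruct (HF e He0) as [d [Hd H1]].
 destruct (HG e He0) as [d' [Hd' H2]].
 exists (Rmin d d'). split. apply Rmin_pos; auto. intros w Hw.
 specialize (H1 w (lt_min_l Hw)).
 specialize (H2 w (lt_min_r Hw)).
 replace (F w * G w - F z * G z)%C with
  ((F w - F z) * (G w - G z) + F z * (G w - G z) + (F w - F z) * G z)%C by ring.
 lt_via Cmod_triangle.
 eapply Rle_lt_trans; [apply Rplus_le_compat_r, Cmod_triangle|]. rewrite !Cmod_mult.
 set (a := Cmod (F w - F z)) in *. set (b := Cmod (G w - G z)) in *.
 assert (0 <= a) by apply Cmod_ge_0. assert (0 <= b) by apply Cmod_ge_0.
 assert (e <= 1) by apply Rmin_l. assert (e <= eps / M) by apply Rmin_r.
 assert (eps / M * M = eps) by (field; lra).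
 assert (e * M <= eps) by nra. unfold M in *.
 assert (a * b <= e * 1) by (apply Rmult_le_compat; lra).
 assert (Cmod (F z) * b <= Cmod (F z) * e) by (apply Rmult_le_compat_l; lra).
 assert (a * Cmod (G z) <= e * Cmod (G z)) by (apply Rmult_le_compat_r; lra).
 lra.
Qed.

Lemma Ccont_comp F G z : Ccont F z -> Ccont G (F z) -> Ccont (fun w => G (F w)) z.
Proof.
 intros HF HG eps He. destruct (HG eps He) as [d [Hd H]].
 destruct (HF d Hd) as [d' [Hd' H']]. exists d'. split; auto.
Qed.

Lemma Ccont_const c z : Ccont (fun _ => c) z.
Proof. apply (Cder_cont _ _ _ (Cder_const c z)). Qed.

Lemma Ccont_id z : Ccont (fun w => w) z.
Proof. apply (Cder_cont _ _ _ (Cder_id z)). Qed.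

Lemma Ccont_conj z : Ccont Cconj z.
Proof.
 intros eps He. exists eps. split; auto. intros w Hw.
 rewrite <- Cminus_conj, Cmod_conj. exact Hw.
Qed.

Lemma Ccont_inv (z : C) : z <> 0 -> Ccont (fun w => / w)%C z.
Proof. intros H. exact (Cder_cont _ _ _ (Cder_inv z H)). Qed.

(** * Curves and complex-valued integrals *)

(** Continuity by coordinates, because complex integrals are formed from two real [RInt];
    [curve_eps] gives the metric form back. *)
Definition curve (f : R -> C) (t : R) : Prop :=
 continuous (fun s => Re (f s)) t /\ continuous (fun s => Im (f s)) t.

Lemma continuous_Reps (u : R -> R) t :
 continuous u t <-> forall eps, 0 < eps -> exists d, 0 < d /\
  forall s, Rabs (s - t) < d -> Rabs (u s - u t) < eps.
Proof.
 split.
 - intros H eps He. apply continuity_pt_filterlim in H.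
  destruct (H eps He) as [d [Hd X]]. exists d; split; auto.
  intros s Hs. destruct (Req_dec s t) as [->|Hne].
  + rewrite Rminus_diag, Rabs_R0; auto.
  + apply X. repeat split; auto.
 - intros H. apply continuity_pt_filterlim. intros eps He.
  destruct (H eps He) as [d [Hd X]]. exists d; split; auto.
  intros s [_ Hs]. apply X. exact Hs.
Qed.

Lemma curve_eps (f : R -> C) t :
 curve f t <-> forall eps, 0 < eps -> exists d, 0 < d /\
  forall s, Rabs (s - t) < d -> Cmod (f s - f t) < eps.
Proof.
 unfold curve. rewrite !continuous_Reps. split.
 - intros [H1 H2] eps He.
  destruct (H1 (eps / 2)) as [d1 [Hd1 X1]]; [lra|].
  destruct (H2 (eps / 2)) as [d2 [Hd2 X2]]; [lra|].
  exists (Rmin d1 d2). split. apply Rmin_pos; auto. intros s Hs.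
  specialize (X1 s (lt_min_l Hs)).
  specialize (X2 s (lt_min_r Hs)).
  lt_via Cmod_le_re_im. rewrite re_minus, im_minus. lra.
 - intros H. split; intros eps He; destruct (H eps He) as [d [Hd X]]; exists d; split; auto;
   intros s Hs; eapply Rle_lt_trans; try apply (X s Hs).
  + rewrite <- re_minus. apply re_le_Cmod.
  + rewrite <- im_minus. apply im_le_Cmod.
Qed.

Lemma curve_comp (F : C -> C) (f : R -> C) t : curve f t -> Ccont F (f t) -> curve (fun s => F (f s)) t.
Proof.
 rewrite !curve_eps. intros Hf HF eps He. destruct (HF eps He) as [d [Hd X]].
 destruct (Hf d Hd) as [d' [Hd' Y]]. exists d'. split; auto.
Qed.

Lemma curve_plus f g t : curve f t -> curve g t -> curve (fun s => f s + g s)%C t.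
Proof.
 intros [H1 H2] [H3 H4]. split; simpl.
 - apply (continuous_plus (fun s => Re (f s)) (fun s => Re (g s))); auto.
 - apply (continuous_plus (fun s => Im (f s)) (fun s => Im (g s))); auto.
Qed.

Lemma curve_mult f g t : curve f t -> curve g t -> curve (fun s => f s * g s)%C t.
Proof.
 intros [H1 H2] [H3 H4]. split; simpl.
 - apply (continuous_minus (fun s => Re (f s) * Re (g s)) (fun s => Im (f s) * Im (g s)));
  apply (continuous_Rmult); auto.
 - apply (continuous_plus (fun s => Re (f s) * Im (g s)) (fun s => Im (f s) * Re (g s)));
  apply (continuous_Rmult); auto.
Qed.

Lemma curve_const c t : curve (fun _ => c) t.
Proof. split; apply continuous_const. Qed.

Lemma curve_opp f t : curve f t -> curve (fun s => - f s)%C t.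
Proof.
 intros [H1 H2]; split; simpl; [apply (continuous_opp (fun s => Re (f s)))|apply (continuous_opp (fun s => Im (f s)))]; auto.
Qed.

Lemma curve_minus f g t : curve f t -> curve g t -> curve (fun s => f s - g s)%C t.
Proof. intros; apply curve_plus; auto. apply curve_opp; auto. Qed.

Lemma curve_inv f t : curve f t -> f t <> 0 -> curve (fun s => / f s)%C t.
Proof. intros H H0. apply (curve_comp (fun z => / z)%C); auto. apply Ccont_inv; auto. Qed.

Lemma curve_RtoC (u : R -> R) t : continuous u t -> curve (fun s => RtoC (u s)) t.
Proof. intros H; split; simpl; [exact H|apply continuous_const]. Qed.

Lemma continuous_Cmod f t : curve f t -> continuous (fun s => Cmod (f s)) t.
Proof.
 rewrite curve_eps, continuous_Reps. intros H eps He. destruct (H eps He) as [d [Hd X]].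
 exists d; split; auto. intros s Hs. specialize (X s Hs).
 assert (A := Cmod_triangle_rev (f s) (f t)). assert (B := Cmod_triangle_rev (f t) (f s)).
 rewrite (Cmod_minus_sym (f t)) in B. apply Rabs_def1; lra.
Qed.

(** Chain rule mixing a real parameter with a complex derivative. The first-order estimate is proved
    for complex increments in [Key] and then read through any real-linear [p] dominated by the
    modulus, here [Re] and [Im]. *)
Lemma curve_Cder (f : R -> C) (F : C -> C) t l m :
 is_derive (fun s => Re (f s)) t (Re l) -> is_derive (fun s => Im (f s)) t (Im l) ->
 Cder F (f t) m ->
 is_derive (fun s => Re (F (f s))) t (Re (m * l)) /\ is_derive (fun s => Im (F (f s))) t (Im (m * l)).
Proof.
 intros H1 H2 HF.
 assert (Key : forall eps, 0 < eps -> exists d, 0 < d /\ forall s, Rabs (s - t) < d ->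
   Cmod (F (f s) - F (f t) - (m * l) * RtoC (s - t)) <= eps * Rabs (s - t)).
 { assert (Kf : forall eps, 0 < eps -> exists d, 0 < d /\ forall s, Rabs (s - t) < d ->
   Cmod (f s - f t - l * RtoC (s - t)) <= eps * Rabs (s - t)).
  { intros eps He.
   destruct H1 as [_ H1]. destruct H2 as [_ H2].
   assert (Hl : is_filter_lim (locally t) t) by (intros P HP; exact HP).
   assert (He2 : 0 < eps / 2) by lra.
   destruct (H1 t Hl (mkposreal _ He2)) as [d1 X1].
   destruct (H2 t Hl (mkposreal _ He2)) as [d2 X2].
   exists (Rmin d1 d2). split. apply Rmin_pos; apply cond_pos. intros s Hs.
   specialize (X1 s (lt_min_l Hs)).
   specialize (X2 s (lt_min_r Hs)).
   unfold norm, minus, plus, opp, scal in X1, X2; simpl in X1, X2.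
   unfold mult, abs in X1, X2; simpl in X1, X2.
   le_via Cmod_le_re_im.
   unfold Re, Im in *; simpl in *.
   replace (fst (f s) + - fst (f t) + - (fst l * (s - t) - snd l * 0)) with
    (fst (f s) + - fst (f t) + - ((s + - t) * fst l)) by ring.
   replace (snd (f s) + - snd (f t) + - (fst l * 0 + snd l * (s - t))) with
    (snd (f s) + - snd (f t) + - ((s + - t) * snd l)) by ring.
   unfold Rminus. lra. }
  intros eps He.
  Cnneg l as Hl. Cnneg m as Hm.
  set (e1 := eps / (2 * (1 + Cmod l))). set (e2 := Rmin 1 (eps / (2 * (1 + Cmod m)))).
  assert (He1 : 0 < e1) by pos_div.
  assert (He2 : 0 < e2) by (apply Rmin_pos; [lra|pos_div]).
  destruct (HF e1 He1) as [d1 [Hd1 X1]].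
  destruct (Kf e2 He2) as [d2 [Hd2 X2]].
  exists (Rmin d2 (d1 / (1 + Cmod l))). split.
  { apply Rmin_pos; auto. pos_div. }
  intros s Hs.
  assert (Hs2 := Rlt_le_trans _ _ _ Hs (Rmin_r _ _)).
  specialize (X2 s (lt_min_l Hs)).
  set (D := (f s - f t)%C) in *. set (x := Rabs (s - t)) in *.
  assert (Hx : 0 <= x) by apply Rabs_pos.
  assert (HD : Cmod D <= (1 + Cmod l) * x).
  { replace D with ((D - l * RtoC (s - t)) + l * RtoC (s - t))%C by ring.
   le_via Cmod_triangle. rewrite Cmod_mult, Cmod_R. fold x.
   assert (e2 <= 1) by apply Rmin_l. nra. }
  assert (HD1 : Cmod D < d1).
  { apply Rle_lt_trans with (1 := HD). apply Rlt_le_trans with ((1 + Cmod l) * (d1 / (1 + Cmod l))).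
   apply Rmult_lt_compat_l; lra. right; field; lra. }
  specialize (X1 (f s) HD1). fold D in X1.
  replace (F (f s) - F (f t) - m * l * RtoC (s - t))%C with
   ((F (f s) - F (f t) - m * D) + m * (D - l * RtoC (s - t)))%C by ring.
  le_via Cmod_triangle. rewrite Cmod_mult.
  assert (e2 <= eps / (2 * (1 + Cmod m))) by apply Rmin_r.
  assert (Y1 : e1 * (1 + Cmod l) = eps / 2) by (unfold e1; field; lra).
  assert (Y2 : eps / (2 * (1 + Cmod m)) * (1 + Cmod m) = eps / 2) by (field; lra).
  assert (Cmod m * (e2 * x) <= eps / 2 * x).
  { rewrite <- Y2. assert (Cmod m * e2 <= eps / (2 * (1 + Cmod m)) * (1 + Cmod m)).
   { rewrite Rmult_comm. apply Rmult_le_compat; lra. } nra. }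
  assert (e1 * Cmod D <= eps / 2 * x) by (rewrite <- Y1; nra).
  nra. }
 assert (Gen : forall (p : C -> R), (forall c, Rabs (p c) <= Cmod c) ->
   (forall a b, p (a - b)%C = p a - p b) -> (forall a (x : R), p (a * RtoC x)%C = p a * x) ->
   is_derive (fun s => p (F (f s))) t (p (m * l)%C)).
 { intros p Hp Hs Hsc. split. apply is_linear_scal_l.
  intros x Hx. assert (x = t).
  { symmetry. apply (is_filter_lim_locally_unique t x). exact Hx. } subst x.
  intros eps. destruct (Key eps (cond_pos eps)) as [d [Hd X]].
  exists (mkposreal d Hd). intros s Hs'. specialize (X s Hs').
  unfold norm, minus, plus, opp, scal; simpl. unfold mult, abs; simpl.
  replace (p (F (f s)) + - p (F (f t)) + - ((s + - t) * p (m * l)%C)) with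
   (p (F (f s) - F (f t) - m * l * RtoC (s - t))%C).
  - le_via Hp. exact X.
  - rewrite !Hs, Hsc. ring. }
 split.
 - apply Gen. apply re_le_Cmod. intros; reflexivity. intros; simpl; unfold Re; simpl; ring.
 - apply Gen. apply im_le_Cmod. intros; reflexivity. intros; simpl; unfold Im; simpl; ring.
Qed.

Definition CInt (f : R -> C) (a b : R) : C :=
 (RInt (fun t => Re (f t)) a b, RInt (fun t => Im (f t)) a b).

Definition curve_on (f : R -> C) (a b : R) : Prop := forall t, a <= t <= b -> curve f t.

Lemma curve_on_ex_re f a b : a <= b -> curve_on f a b -> ex_RInt (fun t => Re (f t)) a b.
Proof.
 intros Hab H. apply ex_RInt_continuous_R.
 intros t Ht. rewrite Rmin_left, Rmax_right in Ht by auto. apply (H t Ht).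
Qed.

Lemma curve_on_ex_im f a b : a <= b -> curve_on f a b -> ex_RInt (fun t => Im (f t)) a b.
Proof.
 intros Hab H. apply ex_RInt_continuous_R.
 intros t Ht. rewrite Rmin_left, Rmax_right in Ht by auto. apply (H t Ht).
Qed.

Lemma CInt_ext f g a b : a <= b -> (forall t, a <= t <= b -> f t = g t) -> CInt f a b = CInt g a b.
Proof.
 intros Hab H. unfold CInt. f_equal; apply RInt_ext; intros t Ht;
 rewrite Rmin_left, Rmax_right in Ht by auto; rewrite H; auto; lra.
Qed.

Lemma CInt_plus f g a b : a <= b -> curve_on f a b -> curve_on g a b ->
 CInt (fun t => f t + g t)%C a b = (CInt f a b + CInt g a b)%C.
Proof.
 intros Hab Hf Hg. unfold CInt. apply Ceq; simpl.
 - apply (RInt_plus (V := R_CompleteNormedModule) (fun t => Re (f t)) (fun t => Re (g t)));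
  apply curve_on_ex_re; auto.
 - apply (RInt_plus (V := R_CompleteNormedModule) (fun t => Im (f t)) (fun t => Im (g t)));
  apply curve_on_ex_im; auto.
Qed.

Lemma RInt_minus_R (f g : R -> R) a b : ex_RInt f a b -> ex_RInt g a b ->
 RInt (fun t => f t - g t) a b = RInt f a b - RInt g a b.
Proof. intros. apply (RInt_minus (V := R_CompleteNormedModule)); auto. Qed.
Lemma RInt_plus_R (f g : R -> R) a b : ex_RInt f a b -> ex_RInt g a b ->
 RInt (fun t => f t + g t) a b = RInt f a b + RInt g a b.
Proof. intros. apply (RInt_plus (V := R_CompleteNormedModule)); auto. Qed.
Lemma RInt_scal_R (f : R -> R) a b c : ex_RInt f a b ->
 RInt (fun t => c * f t) a b = c * RInt f a b.
Proof. intros. apply (RInt_scal (V := R_CompleteNormedModule)); auto. Qed.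
Lemma ex_RInt_scal_R (f : R -> R) a b c : ex_RInt f a b -> ex_RInt (fun t => c * f t) a b.
Proof. intros. apply (ex_RInt_scal (V := R_NormedModule)); auto. Qed.
Lemma ex_RInt_plus_R (f g : R -> R) a b : ex_RInt f a b -> ex_RInt g a b ->
 ex_RInt (fun t => f t + g t) a b.
Proof. intros. apply (ex_RInt_plus (V := R_NormedModule)); auto. Qed.

Lemma CInt_scal c f a b : a <= b -> curve_on f a b ->
 CInt (fun t => c * f t)%C a b = (c * CInt f a b)%C.
Proof.
 intros Hab Hf.
 assert (E1 := curve_on_ex_re _ _ _ Hab Hf). assert (E2 := curve_on_ex_im _ _ _ Hab Hf).
 unfold CInt. apply Ceq; unfold Re, Im in *; simpl.
 - rewrite RInt_minus_R by (apply ex_RInt_scal_R; auto). rewrite !RInt_scal_R; auto.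
 - rewrite RInt_plus_R by (apply ex_RInt_scal_R; auto). rewrite !RInt_scal_R; auto.
Qed.

Lemma CInt_minus f g a b : a <= b -> curve_on f a b -> curve_on g a b ->
 CInt (fun t => f t - g t)%C a b = (CInt f a b - CInt g a b)%C.
Proof.
 intros Hab Hf Hg.
 rewrite (CInt_ext _ (fun t => f t + (-(1)) * g t)%C); auto.
 2:{ intros; ring. }
 rewrite CInt_plus, CInt_scal; auto. ring.
 intros t Ht. apply curve_mult; auto. apply curve_const.
Qed.

Lemma CInt_const c a b : CInt (fun _ => c) a b = (RtoC (b - a) * c)%C.
Proof.
 unfold CInt. apply Ceq; unfold Re, Im; simpl; rewrite RInt_const; unfold scal; simpl; unfold mult; simpl; ring.
Qed.

Lemma unit_direction (z : C) : exists u : C, Cmod u = 1 /\ (u * z)%C = RtoC (Cmod z).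
Proof.
 destruct (Req_dec (Cmod z) 0) as [H|H].
 - exists 1. split. apply Cmod_1. rewrite H. rewrite (Cmod_eq_0 z H). ring.
 - exists (Cconj z / Cmod z)%C.
  assert (RtoC (Cmod z) <> 0) by (intros E; apply H, RtoC_inj; auto).
  split.
  + rewrite Cmod_div, Cmod_conj, Cmod_R, Rabs_right; auto. field; auto.
   apply Rle_ge, Cmod_ge_0.
  + replace (Cconj z / Cmod z * z)%C with ((z * Cconj z) / Cmod z)%C by (field; auto).
   rewrite <- Cmod2_conj. rewrite RtoC_pow. field; auto.
Qed.

(** A rotation makes the integral real and nonnegative, and it is then the integral of a real part
    bounded by M. Adding bounds for the two coordinates would lose a factor. *)
Lemma CInt_norm f a b M : a <= b -> curve_on f a b -> (forall t, a <= t <= b -> Cmod (f t) <= M) ->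
 Cmod (CInt f a b) <= M * (b - a).
Proof.
 intros Hab Hf HM.
 destruct (unit_direction (CInt f a b)) as [u [Hu E]].
 assert (E2 : Cmod (CInt f a b) = RInt (fun t => Re (u * f t)) a b).
 { rewrite <- CInt_scal in E by auto.
  apply (f_equal fst) in E. simpl in E. symmetry; exact E. }
 rewrite E2.
 replace (M * (b - a)) with (RInt (fun _ => M) a b).
 2:{ rewrite RInt_const. unfold scal; simpl; unfold mult; simpl; ring. }
 apply RInt_le; auto.
 - apply (curve_on_ex_re (fun t => u * f t)%C); auto. intros t Ht. apply curve_mult; auto. apply curve_const.
 - apply ex_RInt_const.
 - intros t Ht. le_via Rle_abs. le_via re_le_Cmod.
  rewrite Cmod_mult, Hu, Rmult_1_l. apply HM; lra.
Qed.

Lemma CInt_FTC (P p : R -> C) a b : a <= b ->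
 (forall t, a <= t <= b -> is_derive (fun s => Re (P s)) t (Re (p t)) /\ is_derive (fun s => Im (P s)) t (Im (p t))) ->
 curve_on p a b -> CInt p a b = (P b - P a)%C.
Proof.
 intros Hab HP Hp. unfold CInt. apply Ceq.
 - apply (is_RInt_unique (V := R_CompleteNormedModule)).
  apply (is_RInt_derive (V := R_CompleteNormedModule) (fun t => Re (P t)) (fun t => Re (p t)));
  intros t Ht; rewrite Rmin_left, Rmax_right in Ht by auto; [apply HP|apply Hp]; auto.
 - apply (is_RInt_unique (V := R_CompleteNormedModule)).
  apply (is_RInt_derive (V := R_CompleteNormedModule) (fun t => Im (P t)) (fun t => Im (p t)));
  intros t Ht; rewrite Rmin_left, Rmax_right in Ht by auto; [apply HP|apply Hp]; auto.
Qed.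

Lemma CInt_Chasles f a b c : a <= b -> b <= c -> curve_on f a c ->
 (CInt f a b + CInt f b c)%C = CInt f a c.
Proof.
 intros H1 H2 Hf.
 assert (A : curve_on f a b) by (intros t Ht; apply Hf; lra).
 assert (B : curve_on f b c) by (intros t Ht; apply Hf; lra).
 unfold CInt. apply Ceq.
 - apply (RInt_Chasles (V := R_CompleteNormedModule) (fun t => Re (f t))); apply curve_on_ex_re; auto.
 - apply (RInt_Chasles (V := R_CompleteNormedModule) (fun t => Im (f t))); apply curve_on_ex_im; auto.
Qed.

(** * Sequences and compactness in the plane *)

Definition Clim (u : nat -> C) (l : C) : Prop :=
 forall eps, 0 < eps -> exists N, forall n, (N <= n)%nat -> Cmod (u n - l) < eps.

Definition extraction (s : nat -> nat) : Prop := forall n, (s n < s (S n))%nat.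

Lemma extraction_ge s : extraction s -> forall n, (n <= s n)%nat.
Proof. intros H n. induction n. lia. specialize (H n). lia. Qed.

Lemma extraction_comp s t : extraction s -> extraction t -> extraction (fun n => s (t n)).
Proof.
 intros Hs Ht n. assert (M : forall a b, (a < b)%nat -> (s a < s b)%nat).
 { intros a b Hab. induction Hab. apply Hs. eapply Nat.lt_trans; [exact IHHab|apply Hs]. }
 apply M, Ht.
Qed.

Lemma Clim_ext_sub u l s : extraction s -> Clim u l -> Clim (fun n => u (s n)) l.
Proof.
 intros Hs H eps He. destruct (H eps He) as [N HN]. exists N. intros n Hn. apply HN.
 pose proof (extraction_ge s Hs n). lia.
Qed.

Lemma Un_cv_ext_sub u l s : extraction s -> Un_cv u l -> Un_cv (fun n => u (s n)) l.
Proof.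
 intros Hs H eps He. destruct (H eps He) as [N HN]. exists N. intros n Hn. apply HN.
 pose proof (extraction_ge s Hs n). lia.
Qed.

Lemma inv_INR_small eps : 0 < eps -> exists N, forall n, (N <= n)%nat -> / INR (S n) < eps.
Proof.
 intros He. destruct (archimed_cor1 eps He) as [N [H1 H2]].
 exists N. intros n Hn. eapply Rlt_trans; [|exact H1].
 apply Rinv_lt_contravar. apply Rmult_lt_0_compat; apply lt_0_INR; lia. apply lt_INR; lia.
Qed.

Lemma inv_INR_pos n : 0 < / INR (S n).
Proof. apply Rinv_0_lt_compat, lt_0_INR; lia. Qed.

(** The next index is sought beyond the previous one. Since the property may depend on the rank [k],
    this yields subsequences along a frequent event as well as subsequences converging at the rate
    1/(k+1). *)
Lemma extract_diagonal (Q : nat -> nat -> Prop) :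
 (forall k N, exists n, (N <= n)%nat /\ Q k n) -> exists s, extraction s /\ forall k, Q k (s k).
Proof.
 intros H.
 assert (H' : forall k N, {n | (N <= n)%nat /\ Q k n})
  by (intros k N; apply constructive_indefinite_description, H).
 set (s := fix s n := match n with O => proj1_sig (H' O O) | S k => proj1_sig (H' (S k) (S (s k))) end).
 exists s. split.
 - intros n. change (s (S n)) with (proj1_sig (H' (S n) (S (s n)))).
  destruct (proj2_sig (H' (S n) (S (s n)))). lia.
 - intros [|n]; apply (proj2_sig (H' _ _)).
Qed.

Lemma infinitely_often_extraction (P : nat -> Prop) :
 (forall N, exists n, (N <= n)%nat /\ P n) -> exists s, extraction s /\ forall n, P (s n).
Proof. intros H. apply (extract_diagonal (fun _ n => P n)). intros _ N. apply H. Qed.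

Lemma BW_R (u : nat -> R) a b : (forall n, a <= u n <= b) ->
 exists s l, extraction s /\ Un_cv (fun n => u (s n)) l /\ a <= l <= b.
Proof.
 intros Hu.
 destruct (Bolzano_Weierstrass u (fun c => a <= c <= b) (compact_P3 a b) Hu) as [l Hl].
 destruct (extract_diagonal (fun k n => Rabs (u n - l) < / INR (S k))) as [s [Hs H]].
 { intros k N. destruct (Hl (fun x => Rabs (x - l) < / INR (S k)) N) as [p [Hp H]].
  - exists (mkposreal _ (inv_INR_pos k)). intros x Hx. exact Hx.
  - exists p; auto. }
 exists s, l. split; auto.
 assert (Hcv : Un_cv (fun n => u (s n)) l).
 { intros eps He. destruct (inv_INR_small eps He) as [N HN]. exists N. intros n Hn.
  unfold Rdist. eapply Rlt_trans; [apply H|]. apply HN; lia. }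
 split; auto. split; apply Rnot_lt_le; intros Hc.
 - destruct (Hcv (a - l)) as [N HN]; [lra|]. specialize (HN N (Nat.le_refl _)).
  unfold Rdist in HN. apply Rabs_def2 in HN. specialize (Hu (s N)). lra.
 - destruct (Hcv (l - b)) as [N HN]; [lra|]. specialize (HN N (Nat.le_refl _)).
  unfold Rdist in HN. apply Rabs_def2 in HN. specialize (Hu (s N)). lra.
Qed.

Lemma Clim_re_im u l : Un_cv (fun n => Re (u n)) (Re l) -> Un_cv (fun n => Im (u n)) (Im l) -> Clim u l.
Proof.
 intros H1 H2 eps He.
 destruct (H1 (eps / 2)) as [N1 X1]; [lra|]. destruct (H2 (eps / 2)) as [N2 X2]; [lra|].
 exists (N1 + N2)%nat. intros n Hn.
 at_rank n. unfold Rdist in *.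
 lt_via Cmod_le_re_im. rewrite re_minus, im_minus. lra.
Qed.

Lemma BW_C (u : nat -> C) M : (forall n, Cmod (u n) <= M) ->
 exists s l, extraction s /\ Clim (fun n => u (s n)) l.
Proof.
 intros Hu.
 destruct (BW_R (fun n => Re (u n)) (- M) M) as [s [x [Hs [Hx _]]]].
 { intros n. apply Rabs_le_between. eapply Rle_trans; [apply re_le_Cmod|apply Hu]. }
 destruct (BW_R (fun n => Im (u (s n))) (- M) M) as [t [y [Ht [Hy _]]]].
 { intros n. apply Rabs_le_between. eapply Rle_trans; [apply im_le_Cmod|apply Hu]. }
 exists (fun n => s (t n)), (x, y). split. apply extraction_comp; auto.
 apply Clim_re_im; auto. apply (Un_cv_ext_sub (fun n => Re (u (s n)))); auto.
Qed.

Lemma Clim_unique u l m : Clim u l -> Clim u m -> l = m.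
Proof.
 intros H1 H2. apply NNPP; intros Hne.
 assert (Hp : 0 < Cmod (l - m)).
 { apply Cmod_gt_0. intros E. apply Hne. apply Ceq_minus; auto. }
 destruct (H1 (Cmod (l - m) / 2)) as [N1 X1]; [lra|].
 destruct (H2 (Cmod (l - m) / 2)) as [N2 X2]; [lra|].
 at_rank (N1 + N2)%nat.
 assert (X := Cmod_triangle3 l (u (N1 + N2)%nat) m). rewrite (Cmod_minus_sym l (u _)) in X. lra.
Qed.

Lemma Clim_cont F u l : Ccont F l -> Clim u l -> Clim (fun n => F (u n)) (F l).
Proof.
 intros HF Hu eps He. destruct (HF eps He) as [d [Hd X]]. destruct (Hu d Hd) as [N HN].
 exists N. intros n Hn. apply X, HN, Hn.
Qed.

Lemma Clim_Cmod u l : Clim u l -> Un_cv (fun n => Cmod (u n)) (Cmod l).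
Proof.
 intros H eps He. destruct (H eps He) as [N HN]. exists N. intros n Hn. specialize (HN n Hn).
 unfold Rdist. assert (A := Cmod_triangle_rev (u n) l). assert (B := Cmod_triangle_rev l (u n)).
 rewrite (Cmod_minus_sym l) in B. apply Rabs_def1; lra.
Qed.

Lemma Clim_Re u l : Clim u l -> Un_cv (fun n => Re (u n)) (Re l).
Proof.
 intros H eps He. destruct (H eps He) as [N HN]. exists N. intros n Hn.
 unfold Rdist. rewrite <- re_minus. eapply Rle_lt_trans; [apply re_le_Cmod|apply HN, Hn].
Qed.

Lemma Clim_Im u l : Clim u l -> Un_cv (fun n => Im (u n)) (Im l).
Proof.
 intros H eps He. destruct (H eps He) as [N HN]. exists N. intros n Hn.
 unfold Rdist. rewrite <- im_minus. eapply Rle_lt_trans; [apply im_le_Cmod|apply HN, Hn].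
Qed.

Lemma Clim_const c : Clim (fun _ => c) c.
Proof.
 intros eps He. exists O. intros. rewrite Cmod_diag; auto.
Qed.

Lemma Clim_plus u v l m : Clim u l -> Clim v m -> Clim (fun n => u n + v n)%C (l + m).
Proof.
 intros H1 H2. apply Clim_re_im; simpl.
 - apply (CV_plus (fun n => Re (u n)) (fun n => Re (v n))); apply Clim_Re; auto.
 - apply (CV_plus (fun n => Im (u n)) (fun n => Im (v n))); apply Clim_Im; auto.
Qed.

Lemma Clim_mult u v l m : Clim u l -> Clim v m -> Clim (fun n => u n * v n)%C (l * m).
Proof.
 intros H1 H2.
 assert (A := Clim_Re _ _ H1). assert (A' := Clim_Im _ _ H1).
 assert (B := Clim_Re _ _ H2). assert (B' := Clim_Im _ _ H2).
 apply Clim_re_im; simpl.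
 - apply (CV_minus (fun n => Re (u n) * Re (v n)) (fun n => Im (u n) * Im (v n)));
  [apply (CV_mult (fun n => Re (u n)) (fun n => Re (v n)))|apply (CV_mult (fun n => Im (u n)) (fun n => Im (v n)))]; auto.
 - apply (CV_plus (fun n => Re (u n) * Im (v n)) (fun n => Im (u n) * Re (v n)));
  [apply (CV_mult (fun n => Re (u n)) (fun n => Im (v n)))|apply (CV_mult (fun n => Im (u n)) (fun n => Re (v n)))]; auto.
Qed.

Lemma Un_cv_le (u v : nat -> R) l m : Un_cv u l -> Un_cv v m ->
 (exists N, forall n, (N <= n)%nat -> u n <= v n) -> l <= m.
Proof.
 intros Hu Hv [N0 H]. apply Rnot_lt_le. intros Hc.
 destruct (Hu ((l - m) / 2)) as [N1 X1]; [lra|]. destruct (Hv ((l - m) / 2)) as [N2 X2]; [lra|].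
 at_rank (N0 + N1 + N2)%nat. unfold Rdist in *.
 apply Rabs_def2 in X1. apply Rabs_def2 in X2. lra.
Qed.

Lemma Un_cv_const (c : R) : Un_cv (fun _ => c) c.
Proof. intros eps He. exists O. intros. unfold Rdist. rewrite Rminus_diag, Rabs_R0; auto. Qed.

Lemma unif_cont_disc F r : (forall z, Cmod z <= r -> Ccont F z) ->
 forall eps, 0 < eps -> exists delta, 0 < delta /\
  forall z w, Cmod z <= r -> Cmod w <= r -> Cmod (w - z) < delta -> Cmod (F w - F z) < eps.
Proof.
 intros HF eps He. apply NNPP. intros Hn.
 assert (H : forall n, exists p : C * C, Cmod (fst p) <= r /\ Cmod (snd p) <= r /\
   Cmod (snd p - fst p) < / INR (S n) /\ eps <= Cmod (F (snd p) - F (fst p))).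
 { intros n. apply NNPP. intros H. apply Hn. exists (/ INR (S n)). split. apply inv_INR_pos.
  intros z w Hz Hw Hd. apply Rnot_le_lt. intros Hc. apply H. exists (z, w). simpl. auto. }
 apply choice in H. destruct H as [p Hp].
 destruct (BW_C (fun n => fst (p n)) r) as [s [l [Hs Hl]]]. { intros n. apply Hp. }
 assert (Hlr : Cmod l <= r).
 { apply (Un_cv_le _ _ _ _ (Clim_Cmod _ _ Hl) (Un_cv_const r)). exists O. intros. apply Hp. }
 destruct (HF l Hlr (eps / 2)) as [d [Hd X]]; [lra|].
 destruct (Hl (d / 2)) as [N1 HN1]; [lra|].
 destruct (inv_INR_small (d / 2)) as [N2 HN2]; [lra|].
 set (n := (N1 + N2)%nat).
 specialize (HN1 n ltac:(unfold n; lia)).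
 pose proof (extraction_ge s Hs n).
 specialize (HN2 (s n) ltac:(unfold n in *; lia)).
 destruct (Hp (s n)) as [_ [_ [H1 H2]]].
 set (a := fst (p (s n))) in *. set (b := snd (p (s n))) in *.
 assert (A : Cmod (F a - F l) < eps / 2) by (apply X; lra).
 assert (B : Cmod (F b - F l) < eps / 2).
 { apply X. lt_via (Cmod_triangle3 b a l). lra. }
 assert (Y := Cmod_triangle3 (F b) (F l) (F a)). rewrite (Cmod_minus_sym (F l)) in Y. lra.
Qed.

(** A mean value inequality for curves that are merely continuous, such as preimages of segments.
    The supremum of the times up to which the bound from 0 holds satisfies the bound itself, and the
    local bound there pushes it further unless it is 1. *)
Lemma local_to_global_Lipschitz (phi : R -> C) rho :
 (forall t, 0 <= t <= 1 -> exists d, 0 < d /\ forall s, 0 <= s <= 1 -> Rabs (s - t) < d ->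
   Cmod (phi s - phi t) <= rho * Rabs (s - t)) ->
 Cmod (phi 1 - phi 0) <= rho.
Proof.
 intros H.
 set (P := fun t => 0 <= t <= 1 /\ forall s, 0 <= s <= t -> Cmod (phi s - phi 0) <= rho * s).
 assert (P0 : P 0).
 { split; [lra|]. intros s Hs. replace s with 0 by lra.
  replace (phi 0 - phi 0)%C with (RtoC 0) by ring. rewrite Cmod_0. lra. }
 destruct (completeness P) as [m [Hub Hlub]].
 { exists 1. intros t [Ht _]. lra. }
 { exists 0. exact P0. }
 assert (Hm : 0 <= m <= 1).
 { split. apply Hub, P0. apply Hlub. intros t [Ht _]; lra. }
 destruct (H m Hm) as [d [Hd X]].
 assert (Hex : exists t, P t /\ m - d < t).
 { apply NNPP. intros Hn. assert (m <= m - d); [|lra]. apply Hlub. intros t Ht.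
  apply Rnot_lt_le. intros Hc. apply Hn. exists t; auto. }
 destruct Hex as [t [[Ht1 Ht2] Ht3]].
 assert (Htm : t <= m) by (apply Hub; split; auto).
 assert (Hbelow : forall s, 0 <= s < m -> Cmod (phi s - phi 0) <= rho * s).
 { intros s Hs. apply NNPP. intros Hn. assert (m <= s); [|lra]. apply Hlub. intros t' [_ Ht'].
  apply Rnot_lt_le. intros Hc. apply Hn. apply Ht'. lra. }
 assert (Hmm : Cmod (phi m - phi 0) <= rho * m).
 { le_via (Cmod_triangle3 _ (phi t) _).
  assert (A := Ht2 t ltac:(lra)).
  assert (B : Cmod (phi m - phi t) <= rho * (m - t)).
  { rewrite Cmod_minus_sym. replace (m - t) with (Rabs (t - m)).
   apply X; [lra|]. rewrite Rabs_left1; lra. rewrite Rabs_left1; lra. }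
  lra. }
 destruct (Rle_lt_dec 1 m) as [H1|H1]. { replace m with 1 in Hmm by lra. lra. }
 exfalso. set (m' := Rmin 1 (m + d / 2)).
 assert (m < m') by (unfold m'; apply Rmin_glb_lt; lra).
 assert (m' <= 1) by apply Rmin_l. assert (m' <= m + d / 2) by apply Rmin_r.
 assert (P m'); [|assert (m' <= m) by (apply Hub; auto); lra].
 split; [lra|]. intros s Hs. destruct (Rlt_le_dec s m) as [Hsm|Hsm].
 - apply Hbelow. lra.
 - le_via (Cmod_triangle3 _ (phi m) _).
  assert (B : Cmod (phi s - phi m) <= rho * (s - m)).
  { replace (s - m) with (Rabs (s - m)) at 1. apply X; [lra|]. rewrite Rabs_right; lra. rewrite Rabs_right; lra. }
  lra.
Qed.

(** * Cauchy's theorem in the unit disc *)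

Definition seg (a b : C) (t : R) : C := (a + RtoC t * (b - a))%C.
(** Contour integral of [F] along the oriented segment from a to b. *)
Definition SInt (F : C -> C) (a b : C) : C := ((b - a) * CInt (fun t => F (seg a b t)) 0 1)%C.

Lemma seg_disc a b r t : Cmod a <= r -> Cmod b <= r -> 0 <= t <= 1 -> Cmod (seg a b t) <= r.
Proof.
 intros Ha Hb Ht. unfold seg.
 replace (a + t * (b - a))%C with (RtoC (1 - t) * a + RtoC t * b)%C.
 2:{ rewrite RtoC_minus. ring. }
 le_via Cmod_triangle. rewrite !Cmod_mult, !Cmod_R, !Rabs_right by lra. nra.
Qed.

Lemma seg_inD a b t : inD a -> inD b -> 0 <= t <= 1 -> inD (seg a b t).
Proof.
 unfold inD. intros Ha Hb Ht.
 apply Rle_lt_trans with (Rmax (Cmod a) (Cmod b)).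
 - apply seg_disc; auto. apply Rmax_l. apply Rmax_r.
 - apply Rmax_lub_lt; auto.
Qed.

Lemma seg_curve a b t : curve (seg a b) t.
Proof.
 apply curve_plus. apply curve_const. apply curve_mult; [|apply curve_const].
 apply curve_RtoC. apply continuous_id.
Qed.

Lemma seg_F_curve F a b : (forall z, inD z -> Ccont F z) -> inD a -> inD b ->
 curve_on (fun t => F (seg a b t)) 0 1.
Proof.
 intros HF Ha Hb t Ht. apply curve_comp. apply seg_curve. apply HF, seg_inD; auto.
Qed.

Lemma CInt_comp_lin (f : R -> C) (u v a b : R) : a <= b ->
 (forall t, Rmin (u * a + v) (u * b + v) <= t <= Rmax (u * a + v) (u * b + v) -> curve f t) ->
 (RtoC u * CInt (fun t => f (u * t + v)%R) a b)%C = CInt f (u * a + v) (u * b + v).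
Proof.
 intros Hab Hf.
 assert (E1 : ex_RInt (fun t => Re (f t)) (u * a + v) (u * b + v)).
 { apply ex_RInt_continuous_R. intros t Ht. apply (Hf t Ht). }
 assert (E2 : ex_RInt (fun t => Im (f t)) (u * a + v) (u * b + v)).
 { apply ex_RInt_continuous_R. intros t Ht. apply (Hf t Ht). }
 assert (Hu : forall t, a <= t <= b -> Rmin (u * a + v) (u * b + v) <= u * t + v <= Rmax (u * a + v) (u * b + v)).
 { intros t Ht. pose proof (Rmin_l (u * a + v) (u * b + v)). pose proof (Rmin_r (u * a + v) (u * b + v)).
  pose proof (Rmax_l (u * a + v) (u * b + v)). pose proof (Rmax_r (u * a + v) (u * b + v)).
  destruct (Rle_lt_dec 0 u).
  - assert (u * a <= u * t) by (apply Rmult_le_compat_l; lra).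
   assert (u * t <= u * b) by (apply Rmult_le_compat_l; lra). lra.
  - assert (u * t <= u * a) by nra. assert (u * b <= u * t) by nra. lra. }
 assert (Hc : curve_on (fun t => f (u * t + v)) a b).
 { intros t Ht. specialize (Hf _ (Hu t Ht)). rewrite curve_eps in *. intros eps He.
  destruct (Hf eps He) as [d [Hd X]]. pose proof (Rabs_pos u).
  exists (d / (1 + Rabs u)). split. pos_div.
  intros s Hs. apply X. replace (u * s + v - (u * t + v)) with (u * (s - t)) by ring.
  rewrite Rabs_mult. apply Rle_lt_trans with (Rabs u * (d / (1 + Rabs u))).
  apply Rmult_le_compat_l; lra.
  apply Rlt_le_trans with ((1 + Rabs u) * (d / (1 + Rabs u))).
  apply Rmult_lt_compat_r. pos_div. lra. right; field; lra. }
 unfold CInt. apply Ceq; unfold Re, Im in *; simpl.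
 - rewrite Rmult_0_l, Rminus_0_r. rewrite <- RInt_scal_R by (apply (curve_on_ex_re _ a b Hab Hc)).
  rewrite <- (RInt_comp_lin (V := R_CompleteNormedModule) (fun t => fst (f t)) u v a b E1). reflexivity.
 - rewrite Rmult_0_l, Rplus_0_r. rewrite <- RInt_scal_R by (apply (curve_on_ex_im _ a b Hab Hc)).
  rewrite <- (RInt_comp_lin (V := R_CompleteNormedModule) (fun t => snd (f t)) u v a b E2). reflexivity.
Qed.

Lemma CInt_swap f a b : a <= b -> curve_on f a b -> (CInt f b a = - CInt f a b)%C.
Proof.
 intros Hab Hf. unfold CInt. apply Ceq; unfold Re, Im; simpl; symmetry.
 - apply (opp_RInt_swap (V := R_CompleteNormedModule) (fun t => Re (f t))). apply curve_on_ex_re; auto.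
 - apply (opp_RInt_swap (V := R_CompleteNormedModule) (fun t => Im (f t))). apply curve_on_ex_im; auto.
Qed.

Lemma SInt_swap F a b : (forall z, inD z -> Ccont F z) -> inD a -> inD b ->
 SInt F b a = (- SInt F a b)%C.
Proof.
 intros HF Ha Hb. unfold SInt.
 assert (H := CInt_comp_lin (fun t => F (seg a b t)) (-(1)) 1 0 1 ltac:(lra)).
 replace (-(1) * 0 + 1) with 1 in H by ring. replace (-(1) * 1 + 1) with 0 in H by ring.
 rewrite (CInt_swap _ 0 1) in H; [|lra|apply seg_F_curve; auto].
 rewrite (CInt_ext (fun t => F (seg b a t)) (fun t => F (seg a b (-(1) * t + 1)))); [|lra|].
 2:{ intros t _. f_equal. unfold seg. rewrite RtoC_plus, RtoC_mult, RtoC_opp. ring. }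
 assert (E : forall x y : C, (RtoC (-(1)) * x = - y -> x = y)%C).
 { intros x y E. rewrite RtoC_opp in E. replace x with (- (- (1) * x))%C by ring. rewrite E. ring. }
 rewrite (E _ _ (H ltac:(intros t Ht; rewrite Rmin_right, Rmax_left in Ht by lra; apply seg_F_curve; auto; lra))).
 ring.
Qed.

Definition mid (a b : C) : C := ((a + b) / 2)%C.

Lemma C2_neq_0 : RtoC 2 <> 0.
Proof. intros E. apply RtoC_inj in E. lra. Qed.

Lemma SInt_mid F a b : (forall z, inD z -> Ccont F z) -> inD a -> inD b ->
 SInt F a b = (SInt F a (mid a b) + SInt F (mid a b) b)%C.
Proof.
 intros HF Ha Hb. unfold SInt.
 assert (Hc : curve_on (fun t => F (seg a b t)) 0 1) by (apply seg_F_curve; auto).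
 assert (H1 := CInt_comp_lin (fun t => F (seg a b t)) (1/2) 0 0 1 ltac:(lra)).
 assert (H2 := CInt_comp_lin (fun t => F (seg a b t)) (1/2) (1/2) 0 1 ltac:(lra)).
 replace (1/2 * 0 + 0) with 0 in H1 by field. replace (1/2 * 1 + 0) with (1/2) in H1 by field.
 replace (1/2 * 0 + 1/2) with (1/2) in H2 by field. replace (1/2 * 1 + 1/2) with 1 in H2 by field.
 rewrite (CInt_ext (fun t => F (seg a (mid a b) t)) (fun t => F (seg a b (1/2 * t + 0)))); [|lra|].
 2:{ intros t _. f_equal. unfold seg, mid. rewrite RtoC_plus, RtoC_mult, RtoC_div by lra. field. }
 rewrite (CInt_ext (fun t => F (seg (mid a b) b t)) (fun t => F (seg a b (1/2 * t + 1/2)))); [|lra|].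
 2:{ intros t _. f_equal. unfold seg, mid. rewrite RtoC_plus, RtoC_mult, RtoC_div by lra. field. }
 rewrite <- (CInt_Chasles _ 0 (1/2) 1); auto; try lra.
 rewrite <- H1, <- H2.
 - unfold mid. rewrite RtoC_div by lra. field.
 - intros t Ht. rewrite Rmin_left, Rmax_right in Ht by lra. apply Hc; lra.
 - intros t Ht. rewrite Rmin_left, Rmax_right in Ht by lra. apply Hc; lra.
Qed.

Lemma SInt_norm F a b M : (forall z, inD z -> Ccont F z) -> inD a -> inD b ->
 (forall t, 0 <= t <= 1 -> Cmod (F (seg a b t)) <= M) -> Cmod (SInt F a b) <= M * Cmod (b - a).
Proof.
 intros HF Ha Hb HM. unfold SInt. rewrite Cmod_mult, Rmult_comm.
 apply Rmult_le_compat_r. apply Cmod_ge_0.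
 replace M with (M * (1 - 0)) by ring. apply CInt_norm; auto. lra. apply seg_F_curve; auto.
Qed.

Lemma SInt_minus F G a b : (forall z, inD z -> Ccont F z) -> (forall z, inD z -> Ccont G z) ->
 inD a -> inD b -> SInt (fun z => F z - G z)%C a b = (SInt F a b - SInt G a b)%C.
Proof.
 intros HF HG Ha Hb. unfold SInt. rewrite (CInt_minus (fun t => F (seg a b t)) (fun t => G (seg a b t))).
 ring. lra. apply seg_F_curve; auto. apply seg_F_curve; auto.
Qed.

Lemma seg_derive a b t : is_derive (fun s => Re (seg a b s)) t (Re (b - a)) /\
 is_derive (fun s => Im (seg a b s)) t (Im (b - a)).
Proof.
 unfold seg, Re, Im; simpl. split; auto_derive; auto; ring.
Qed.

Lemma SInt_primitive P F a b : (forall z, inD z -> Cder P z (F z)) -> (forall z, inD z -> Ccont F z) ->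
 inD a -> inD b -> SInt F a b = (P b - P a)%C.
Proof.
 intros HP HF Ha Hb. unfold SInt.
 rewrite <- CInt_scal; [|lra|apply seg_F_curve; auto].
 rewrite (CInt_FTC (fun t => P (seg a b t))).
 - f_equal; [|f_equal]; f_equal; unfold seg; ring.
 - lra.
 - intros t Ht. destruct (seg_derive a b t) as [H1 H2].
  replace ((b - a) * F (seg a b t))%C with (F (seg a b t) * (b - a))%C by ring.
  apply (curve_Cder (seg a b) P t (b - a) (F (seg a b t))); auto. apply HP, seg_inD; auto.
 - intros t Ht. apply curve_mult. apply curve_const. apply seg_F_curve; auto.
Qed.

Definition TInt (F : C -> C) (a b c : C) : C := (SInt F a b + SInt F b c + SInt F c a)%C.

Lemma mid_inD a b : inD a -> inD b -> inD (mid a b).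
Proof.
 intros Ha Hb. replace (mid a b) with (seg a b (1/2)). apply seg_inD; auto; lra.
 unfold seg, mid. rewrite RtoC_div by lra. field.
Qed.

Lemma TInt_subdivide F a b c : (forall z, inD z -> Ccont F z) -> inD a -> inD b -> inD c ->
 TInt F a b c = (TInt F a (mid a b) (mid c a) + TInt F (mid a b) b (mid b c)
  + TInt F (mid c a) (mid b c) c + TInt F (mid a b) (mid b c) (mid c a))%C.
Proof.
 intros HF Ha Hb Hc. unfold TInt.
 pose proof (mid_inD a b Ha Hb). pose proof (mid_inD b c Hb Hc). pose proof (mid_inD c a Hc Ha).
 rewrite (SInt_mid F a b), (SInt_mid F b c), (SInt_mid F c a) by auto.
 rewrite (SInt_swap F (mid c a) (mid a b)) by auto.
 rewrite (SInt_swap F (mid a b) (mid b c)) by auto.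
 rewrite (SInt_swap F (mid b c) (mid c a)) by auto. ring.
Qed.

(** Boundedness provides a limit point, and the telescoped tail bound [T] transfers the geometric
    rate from the subsequence to the whole sequence. *)
Lemma geometric_Cauchy (u : nat -> C) M : (forall n, Cmod (u (S n) - u n) <= M / 2 ^ n) ->
 exists l, forall n, Cmod (u n - l) <= 4 * M / 2 ^ n.
Proof.
 intros H. assert (P : forall n, 0 < / 2 ^ n) by (intros; apply Rinv_0_lt_compat, pow_lt; lra).
 assert (HM : 0 <= M). { specialize (H O). simpl in H. Cnneg (u 1%nat - u O)%C. lra. }
 assert (T : forall n j, Cmod (u (n + j)%nat - u n) <= 2 * M / 2 ^ n - 2 * M / 2 ^ (n + j)).
 { intros n. induction j.
  - rewrite Nat.add_0_r. replace (u n - u n)%C with (RtoC 0) by ring. rewrite Cmod_0. lra.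
  - rewrite Nat.add_succ_r. le_via (Cmod_triangle3 _ (u (n + j)%nat)). specialize (H (n + j)%nat).
   replace (2 * M / 2 ^ S (n + j)) with (M / 2 ^ (n + j)) by (simpl; field; apply pow_nonzero; lra).
   unfold Rdiv in *. lra. }
 destruct (BW_C u (Cmod (u O) + 2 * M)) as [s [l [Hs Hl]]].
 { intros n. specialize (T O n). pose proof (P n). pose proof (Cmod_triangle_rev (u n) (u O)). simpl in T. unfold Rdiv in T.
  assert (0 <= 2 * M * / 2 ^ n) by (apply Rmult_le_pos; lra). lra. }
 exists l. intros n. apply Rle_trans with (2 * M / 2 ^ n).
 2:{ pose proof (P n). unfold Rdiv. apply Rmult_le_compat_r; lra. }
 assert (L : Un_cv (fun m => Cmod (u n - u (s m))) (Cmod (u n - l))).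
 { apply Clim_Cmod. intros e He. destruct (Hl e He) as [N X]. exists N. intros m Hm.
  replace (u n - u (s m) - (u n - l))%C with (- (u (s m) - l))%C by ring. rewrite Cmod_opp. auto. }
 apply (Un_cv_le _ _ _ _ L (Un_cv_const _)). exists n. intros m Hm. pose proof (extraction_ge s Hs m).
 specialize (T n (s m - n)%nat). replace (n + (s m - n))%nat with (s m) in T by lia. pose proof (P (s m)).
 rewrite Cmod_minus_sym. assert (0 <= 2 * M / 2 ^ s m) by (apply Rmult_le_pos; lra). lra.
Qed.

(** Bisection: one of the four half-size triangles carries at least a quarter of the integral, while
    the perimeter is halved. The triangles shrink to a point [l] of the disc, near which [F] differs
    from an affine function by a small multiple of the perimeter. Affine functions have primitives,
    so the integral is small compared with the square of the perimeter. *)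
Theorem Goursat F F' a b c : (forall z, inD z -> Cder F z (F' z)) -> inD a -> inD b -> inD c ->
 TInt F a b c = 0.
Proof.
 intros HF Ha Hb Hc.
 assert (HC : forall z, inD z -> Ccont F z) by (intros z Hz; apply (Cder_cont _ _ _ (HF z Hz))).
 set (rho := Rmax (Cmod a) (Rmax (Cmod b) (Cmod c))).
 assert (Hrho : rho < 1) by (repeat apply Rmax_lub_lt; auto).
 set (per := fun T : C * C * C => let '(x, y, z) := T in Cmod (y - x) + Cmod (z - y) + Cmod (x - z)).
 set (ti := fun T : C * C * C => let '(x, y, z) := T in TInt F x y z).
 set (ok := fun T : C * C * C => let '(x, y, z) := T in Cmod x <= rho /\ Cmod y <= rho /\ Cmod z <= rho).
 set (v0 := fun T : C * C * C => fst (fst T)).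
 assert (Hmid : forall x y, Cmod x <= rho -> Cmod y <= rho -> Cmod (mid x y) <= rho).
 { intros x y Hx Hy. replace (mid x y) with (seg x y (1/2)). apply seg_disc; auto; lra.
  unfold seg, mid. rewrite RtoC_div by lra. field. }
 assert (Hhalf : forall x y : C, Cmod ((x - y) / 2) = Cmod (x - y) / 2).
 { intros x y. rewrite Cmod_div by apply C2_neq_0. rewrite Cmod_R, Rabs_right; lra. }
 (* The choice of a subtriangle is made a total function on triples, so that it can be iterated;
    outside [ok] it returns its argument. The vertex [v0] is what follows the shrinking triangles to
    their limit. *)
 assert (Hstep : forall T, {T' | ok T -> ok T' /\ per T' = per T / 2 /\ Cmod (ti T) <= 4 * Cmod (ti T')
   /\ Cmod (v0 T' - v0 T) <= per T}).
 { intros T. apply constructive_indefinite_description. destruct T as [[x y] z].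
  destruct (classic (ok (x, y, z))) as [[Hx [Hy Hz]]|Hn]; [|exists (x, y, z); tauto].
  assert (Ix : inD x) by (unfold inD; lra). assert (Iy : inD y) by (unfold inD; lra).
  assert (Iz : inD z) by (unfold inD; lra).
  assert (E := TInt_subdivide F x y z HC Ix Iy Iz).
  set (T1 := TInt F x (mid x y) (mid z x)) in *. set (T2 := TInt F (mid x y) y (mid y z)) in *.
  set (T3 := TInt F (mid z x) (mid y z) z) in *. set (T4 := TInt F (mid x y) (mid y z) (mid z x)) in *.
  assert (B : Cmod (TInt F x y z) <= Cmod T1 + Cmod T2 + Cmod T3 + Cmod T4).
  { rewrite E. le_via Cmod_triangle. apply Rplus_le_compat_r.
   le_via Cmod_triangle. apply Rplus_le_compat_r. apply Cmod_triangle. }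
  Cnneg (y - x)%C. Cnneg (z - y)%C. Cnneg (x - z)%C.
  assert (M : Cmod (TInt F x y z) <= 4 * Cmod T1 \/ Cmod (TInt F x y z) <= 4 * Cmod T2 \/
   Cmod (TInt F x y z) <= 4 * Cmod T3 \/ Cmod (TInt F x y z) <= 4 * Cmod T4) by lra.
  assert (P1 : (mid x y - x = (y - x) / 2)%C) by (unfold mid; field).
  destruct M as [M|[M|[M|M]]].
  - exists (x, mid x y, mid z x). intros _. unfold ok, per, ti, v0; simpl. repeat split; auto.
   + replace (mid z x - mid x y)%C with ((z - y) / 2)%C by (unfold mid; field).
    replace (x - mid z x)%C with ((x - z) / 2)%C by (unfold mid; field).
    rewrite P1, !Hhalf. field.
   + rewrite Cmod_diag. lra.
  - exists (mid x y, y, mid y z). intros _. unfold ok, per, ti, v0; simpl. repeat split; auto.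
   + replace (y - mid x y)%C with ((y - x) / 2)%C by (unfold mid; field).
    replace (mid y z - y)%C with ((z - y) / 2)%C by (unfold mid; field).
    replace (mid x y - mid y z)%C with ((x - z) / 2)%C by (unfold mid; field).
    rewrite !Hhalf. field.
   + rewrite P1, Hhalf. lra.
  - exists (mid z x, mid y z, z). intros _. unfold ok, per, ti, v0; simpl. repeat split; auto.
   + replace (mid y z - mid z x)%C with ((y - x) / 2)%C by (unfold mid; field).
    replace (z - mid y z)%C with ((z - y) / 2)%C by (unfold mid; field).
    replace (mid z x - z)%C with ((x - z) / 2)%C by (unfold mid; field).
    rewrite !Hhalf. field.
   + replace (mid z x - x)%C with ((z - x) / 2)%C by (unfold mid; field).
    rewrite Hhalf, (Cmod_minus_sym z x). lra.
  - exists (mid x y, mid y z, mid z x). intros _. unfold ok, per, ti, v0; simpl. repeat split; auto.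
   + replace (mid y z - mid x y)%C with ((z - x) / 2)%C by (unfold mid; field).
    replace (mid z x - mid y z)%C with ((x - y) / 2)%C by (unfold mid; field).
    replace (mid x y - mid z x)%C with ((y - z) / 2)%C by (unfold mid; field).
    rewrite !Hhalf, (Cmod_minus_sym z x), (Cmod_minus_sym x y), (Cmod_minus_sym y z). field.
   + rewrite P1, Hhalf. lra. }
 set (T := fix T n := match n with O => (a, b, c) | S k => proj1_sig (Hstep (T k)) end).
 assert (HT : forall n, ok (T n)).
 { induction n. simpl. unfold rho. repeat split.
  apply Rmax_l. eapply Rle_trans; [apply Rmax_l|apply Rmax_r]. eapply Rle_trans; [apply Rmax_r|apply Rmax_r].
  apply (proj2_sig (Hstep (T n)) IHn). }
 assert (HS : forall n, per (T (S n)) = per (T n) / 2 /\ Cmod (ti (T n)) <= 4 * Cmod (ti (T (S n)))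
   /\ Cmod (v0 (T (S n)) - v0 (T n)) <= per (T n)).
 { intros n. apply (proj2_sig (Hstep (T n)) (HT n)). }
 set (L := per (a, b, c)).
 assert (Hper : forall n, per (T n) = L / 2 ^ n).
 { induction n. simpl. unfold L. simpl. field. rewrite (proj1 (HS n)), IHn. simpl. field.
  apply pow_nonzero; lra. }
 assert (Hti : forall n, Cmod (TInt F a b c) <= 4 ^ n * Cmod (ti (T n))).
 { induction n. simpl. lra. eapply Rle_trans; [exact IHn|].
  change (4 ^ S n) with (4 * 4 ^ n).
  assert (0 < 4 ^ n) by (apply pow_lt; lra). destruct (HS n) as [_ [A _]]. nra. }
 destruct (geometric_Cauchy (fun n => v0 (T n)) L) as [l Hl].
 { intros n. rewrite <- Hper. apply HS. }
 assert (HL : 0 <= L).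
 { unfold L, per. Cnneg (b - a)%C. Cnneg (c - b)%C. Cnneg (a - c)%C. lra. }
 assert (Hsmall : forall e, 0 < e -> exists n, L / 2 ^ n < e).
 { intros e He. destruct (pow_lt_1_zero (1/2)) with (y := e / (1 + L)) as [N HN].
  rewrite Rabs_right; lra. pos_div.
  exists N. specialize (HN N (Nat.le_refl _)). rewrite Rabs_right in HN by (apply Rle_ge, pow_le; lra).
  replace (L / 2 ^ N) with (L * (1/2) ^ N).
  2:{ unfold Rdiv. rewrite Rpow_mult_distr, pow1, pow_inv. ring. }
  apply Rle_lt_trans with (L * (e / (1 + L))). apply Rmult_le_compat_l; lra.
  apply Rlt_le_trans with ((1 + L) * (e / (1 + L))). apply Rmult_lt_compat_r. pos_div. lra.
  right; field; lra. }
 assert (Hlrho : Cmod l <= rho).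
 { apply Rnot_lt_le. intros Hlt. destruct (Hsmall ((Cmod l - rho) / 8)) as [n Hn]; [lra|].
  specialize (Hl n). assert (A := Cmod_triangle_rev l (v0 (T n))). rewrite Cmod_minus_sym in A.
  assert (B : Cmod (v0 (T n)) <= rho). { specialize (HT n). destruct (T n) as [[x y] z]. apply HT. }
  unfold Rdiv in *. lra. }
 assert (Il : inD l) by (unfold inD; lra).
 apply Cmod_eq_0. apply Rle_antisym; [|apply Cmod_ge_0].
 apply Rnot_lt_le. intros Hpos.
 (* With this value the final estimate 5 e L^2 is at most half of the modulus that it would have to
    dominate. *)
 set (e := Cmod (TInt F a b c) / (10 * (1 + L) * (1 + L))).
 assert (He : 0 < e) by (apply Rdiv_lt_0_compat; nra).
 destruct (HF l Il e He) as [d [Hd X]].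
 destruct (Hsmall (d / 10)) as [n Hn]; [lra|].
 assert (Hbound : Cmod (ti (T n)) <= e * (5 * (L / 2 ^ n)) * (L / 2 ^ n)).
 { specialize (Hl n). specialize (Hper n). specialize (HT n). cbv beta in Hl. unfold v0 in Hl.
  destruct (T n) as [[x y] z]. simpl in Hl, Hper. destruct HT as [Hx [Hy Hz]]. simpl.
  assert (Ix : inD x) by (unfold inD; lra). assert (Iy : inD y) by (unfold inD; lra).
  assert (Iz : inD z) by (unfold inD; lra).
  set (q := L / 2 ^ n) in *.
  assert (Hq : 4 * L / 2 ^ n = 4 * q) by (unfold q, Rdiv; ring). rewrite Hq in Hl.
  Cnneg (y - x)%C. Cnneg (z - y)%C. Cnneg (x - z)%C.
  set (G := fun w => (F l + F' l * (w - l))%C).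
  assert (HG : forall w, inD w -> Ccont G w).
  { intros w _. apply Ccont_plus. apply Ccont_const. apply Ccont_mult. apply Ccont_const.
   apply Ccont_plus. apply Ccont_id. apply Ccont_const. }
  set (Pr := fun w => (F l * w + F' l * ((w - l) * (w - l) / 2))%C).
  assert (HPr : forall w, inD w -> Cder Pr w (G w)).
  { intros w _. unfold Pr, G.
   replace (F l + F' l * (w - l))%C with (F l * 1 + F' l * (((1 - 0) * (w - l) + (w - l) * (1 - 0)) * / 2 + ((w - l) * (w - l)) * 0))%C
    by field.
   apply (Cder_plus (fun w => F l * w)%C (fun w => F' l * ((w - l) * (w - l) / 2))%C).
   apply (Cder_scal (F l) (fun w => w)); apply Cder_id.
   apply (Cder_scal (F' l) (fun w => (w - l) * (w - l) / 2)%C).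
   apply (Cder_mult (fun w => (w - l) * (w - l))%C (fun _ => / 2)%C); [|apply Cder_const].
   assert (Q : Cder (fun w => w - l)%C w (1 - 0)) by (apply (Cder_minus (fun w => w) (fun _ => l)); [apply Cder_id|apply Cder_const]).
   apply (Cder_mult (fun w => w - l)%C (fun w => w - l)%C); exact Q. }
  assert (HTG : TInt G x y z = 0).
  { unfold TInt. rewrite !(SInt_primitive Pr G) by auto. ring. }
  assert (Hdiff : TInt F x y z = TInt (fun w => F w - G w)%C x y z).
  { transitivity (TInt F x y z - TInt G x y z)%C. rewrite HTG; ring.
   unfold TInt. rewrite !(SInt_minus F G) by auto. ring. }
  assert (HFG : forall w, inD w -> Ccont (fun w => F w - G w)%C w).
  { intros w Hw. apply Ccont_plus; auto. apply (Ccont_comp G Copp); auto.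
   apply (Cder_cont _ _ _ (Cder_opp _ _ _ (Cder_id (G w)))). }
  assert (Hpt : forall w, Cmod (w - x) <= q -> Cmod (F w - G w) <= e * (5 * q)).
  { intros w Hw. unfold G.
   replace (F w - (F l + F' l * (w - l)))%C with (F w - F l - F' l * (w - l))%C by ring.
   assert (Cmod (w - l) <= 5 * q) by (eapply Rle_trans; [apply (Cmod_triangle3 w x l)|]; lra).
   eapply Rle_trans; [apply X; lra|]. nra. }
  assert (Sx : forall p r t, Cmod (p - x) <= q -> Cmod (r - x) <= q -> 0 <= t <= 1 -> Cmod (seg p r t - x) <= q).
  { intros p r t Hp Hr Ht. replace (seg p r t - x)%C with (seg (p - x) (r - x) t) by (unfold seg; ring).
   apply seg_disc; auto. }
  assert (Xx : Cmod (x - x) <= q) by (rewrite Cmod_diag; lra).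
  assert (Yx : Cmod (y - x) <= q) by lra.
  assert (Zx : Cmod (z - x) <= q) by (rewrite Cmod_minus_sym; lra).
  rewrite Hdiff. unfold TInt.
  le_via Cmod_triangle.
  eapply Rle_trans; [apply Rplus_le_compat_r, Cmod_triangle|].
  assert (B1 : Cmod (SInt (fun w => F w - G w)%C x y) <= e * (5 * q) * Cmod (y - x)) by (apply SInt_norm; auto).
  assert (B2 : Cmod (SInt (fun w => F w - G w)%C y z) <= e * (5 * q) * Cmod (z - y)) by (apply SInt_norm; auto).
  assert (B3 : Cmod (SInt (fun w => F w - G w)%C z x) <= e * (5 * q) * Cmod (x - z)) by (apply SInt_norm; auto).
  assert (HH : e * (5 * q) * q = e * (5 * q) * Cmod (y - x) + e * (5 * q) * Cmod (z - y) + e * (5 * q) * Cmod (x - z)).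
  { rewrite <- Hper at 2. ring. }
  lra. }
 specialize (Hti n).
 assert (H4 : 4 ^ n = 2 ^ n * 2 ^ n). { rewrite <- Rpow_mult_distr. f_equal; lra. }
 assert (H2 : 0 < 2 ^ n) by (apply pow_lt; lra).
 assert (Cmod (TInt F a b c) <= 5 * e * (L * L)).
 { eapply Rle_trans; [exact Hti|]. eapply Rle_trans. apply Rmult_le_compat_l; [apply pow_le; lra|exact Hbound].
  rewrite H4. right. field. lra. }
 assert (e * ((1 + L) * (1 + L)) = Cmod (TInt F a b c) / 10) by (unfold e; field; lra).
 nra.
Qed.

(** Goursat on the triangle 0, z, w turns the increment of the integral from 0 into the integral
    over the segment from z to w, on which [F] is close to [F z]. *)
Theorem primitive_exists F F' : (forall z, inD z -> Cder F z (F' z)) ->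
 exists P : C -> C, P 0 = 0 /\ forall z, inD z -> Cder P z (F z).
Proof.
 intros HF.
 assert (HC : forall z, inD z -> Ccont F z) by (intros z Hz; apply (Cder_cont _ _ _ (HF z Hz))).
 exists (fun z => SInt F 0 z). split. unfold SInt. ring.
 intros z Hz eps He.
 destruct (HC z Hz eps He) as [d [Hd X]].
 exists (Rmin d (1 - Cmod z)). unfold inD in Hz. split. apply Rmin_pos; lra.
 intros w Hw.
 assert (Hw1 := Rlt_le_trans _ _ _ Hw (Rmin_l _ _)). assert (Hw2 := Rlt_le_trans _ _ _ Hw (Rmin_r _ _)).
 assert (Iw : inD w) by (unfold inD; assert (A := Cmod_triangle_rev w z); lra).
 assert (E := Goursat F F' 0 z w HF inD0 Hz Iw). unfold TInt in E.
 rewrite (SInt_swap F 0 w) in E by (auto using inD0).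
 replace (SInt F 0 w - SInt F 0 z)%C with (SInt F z w).
 2:{ transitivity (SInt F z w - (SInt F 0 z + SInt F z w + - SInt F 0 w))%C. rewrite E; ring. ring. }
 replace (F z * (w - z))%C with (SInt (fun _ => F z) z w).
 2:{ unfold SInt. rewrite CInt_const, Rminus_0_r. ring. }
 rewrite <- (SInt_minus F (fun _ => F z)); auto.
 2:{ intros; apply Ccont_const. }
 apply SInt_norm; auto.
 - intros v Hv. apply Ccont_plus; auto. apply Ccont_const.
 - intros t Ht. apply Rlt_le, X.
  replace (seg z w t - z)%C with (RtoC t * (w - z))%C by (unfold seg; ring).
  rewrite Cmod_scal by lra. Cnneg (w - z)%C. nra.
Qed.

(** * Cauchy's integral formula and its consequences *)

Definition holo (F F' : C -> C) : Prop := forall z, inD z -> Cder F z (F' z).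

Lemma holo_cont F F' : holo F F' -> forall z, inD z -> Ccont F z.
Proof. intros H z Hz. exact (Cder_cont _ _ _ (H z Hz)). Qed.

(** The first-order error is Lipschitz along the segment from p to q, with a constant given by the
    oscillation of [F']. Uniformity in the base point p is what permits differentiation under the
    integral sign in Cauchy's formula. *)
Lemma unif_Cder F F' r : holo F F' -> (forall z, inD z -> Ccont F' z) -> r < 1 ->
 forall eps, 0 < eps -> exists delta, 0 < delta /\ forall p q, Cmod p <= r -> Cmod q <= r ->
  Cmod (q - p) < delta -> Cmod (F q - F p - F' p * (q - p)) <= eps * Cmod (q - p).
Proof.
 intros HF HF' Hr eps He.
 assert (HF'r : forall z, Cmod z <= r -> Ccont F' z) by (intros z Hz; apply HF'; unfold inD; lra).
 destruct (unif_cont_disc F' r HF'r (eps / 2)) as [d [Hd X]]; [lra|].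
 exists d; split; auto. intros p q Hp Hq Hpq.
 set (phi := fun t => (F (seg p q t) - RtoC t * (F' p * (q - p)))%C).
 replace (F q - F p - F' p * (q - p))%C with (phi 1 - phi 0)%C.
 2:{ unfold phi, seg. replace (p + 1 * (q - p))%C with q by ring.
   replace (p + 0 * (q - p))%C with p by ring. ring. }
 apply local_to_global_Lipschitz. intros t Ht.
 set (m := seg p q t).
 assert (Hm : Cmod m <= r) by (apply seg_disc; auto).
 destruct (HF m ltac:(unfold inD; lra) (eps / 2)) as [d' [Hd' Y]]; [lra|].
 Cnneg (q - p)%C.
 exists (d' / (1 + Cmod (q - p))). split. pos_div.
 intros s Hs Hst.
 assert (E : (seg p q s - m = RtoC (s - t) * (q - p))%C) by (unfold m, seg; rewrite RtoC_minus; ring).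
 assert (En : Cmod (seg p q s - m) = Rabs (s - t) * Cmod (q - p)) by (rewrite E, Cmod_mult, Cmod_R; auto).
 assert (Hlt : Cmod (seg p q s - m) < d').
 { rewrite En. apply Rle_lt_trans with (Rabs (s - t) * (1 + Cmod (q - p))).
  apply Rmult_le_compat_l. apply Rabs_pos. lra.
  apply Rmult_lt_reg_r with (/ (1 + Cmod (q - p))). apply Rinv_0_lt_compat; lra.
  rewrite Rmult_assoc, Rinv_r by lra. unfold Rdiv in Hst. lra. }
 specialize (Y _ Hlt). rewrite En in Y.
 assert (Z : Cmod (F' m - F' p) < eps / 2).
 { apply X; auto. replace (m - p)%C with (RtoC t * (q - p))%C by (unfold m, seg; ring).
  rewrite Cmod_scal by lra. nra. }
 replace (phi s - phi t)%C with
  ((F (seg p q s) - F m - F' m * (seg p q s - m)) + (F' m - F' p) * (seg p q s - m))%C.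
 2:{ unfold phi. fold m. rewrite E. rewrite RtoC_minus. ring. }
 le_via Cmod_triangle. rewrite Cmod_mult, En.
 assert (0 <= Rabs (s - t) * Cmod (q - p)) by (apply Rmult_le_pos; auto; apply Rabs_pos).
 nra.
Qed.

Lemma polar_curve r t : curve (polar r) t.
Proof.
 split; unfold polar, Re, Im; simpl; smooth.
Qed.

Lemma polar_derive r t : is_derive (fun s => Re (polar r s)) t (Re (Ci * polar r t)) /\
 is_derive (fun s => Im (polar r s)) t (Im (Ci * polar r t)).
Proof. unfold polar, Re, Im, Ci; simpl. split; auto_derive; auto; ring. Qed.

Lemma Cmod_polar r t : 0 <= r -> Cmod (polar r t) = r.
Proof.
 intros Hr. assert (H := Cmod_sqr (polar r t)). unfold polar, Re, Im in H; simpl in H.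
 pose proof (sin2_cos2 t) as E. unfold Rsqr in E.
 Cnneg (polar r t). unfold polar in *.
 assert (Cmod (r * cos t, r * sin t) * Cmod (r * cos t, r * sin t) = r * r).
 { rewrite H. replace (r * cos t * (r * cos t) + r * sin t * (r * sin t)) with (r * r * (sin t * sin t + cos t * cos t)) by ring.
  rewrite E. ring. }
 nra.
Qed.

Lemma polar_2PI r : polar r (2 * PI) = polar r 0.
Proof. unfold polar. rewrite cos_2PI, sin_2PI, cos_0, sin_0. reflexivity. Qed.

Lemma two_PI_pos : 0 < 2 * PI.
Proof. pose proof PI_RGT_0. lra. Qed.

Lemma CInt_closed (P p : R -> C) a b : a <= b ->
 (forall t, a <= t <= b -> is_derive (fun s => Re (P s)) t (Re (p t)) /\ is_derive (fun s => Im (P s)) t (Im (p t))) ->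
 curve_on p a b -> P a = P b -> CInt p a b = 0.
Proof. intros Hab HP Hp E. rewrite (CInt_FTC P p a b Hab HP Hp), E. ring. Qed.

Lemma curve_on_bounded f a b : a <= b -> curve_on f a b -> exists M, 0 < M /\ forall t, a <= t <= b -> Cmod (f t) <= M.
Proof.
 intros Hab Hf.
 destruct (continuity_ab_maj (fun t => Cmod (f t)) a b Hab) as [x [Hx _]].
 { intros c Hc. apply continuity_pt_filterlim. apply (continuous_Cmod f c). apply Hf; auto. }
 exists (1 + Cmod (f x)). Cnneg (f x). split; [lra|]. intros t Ht. specialize (Hx t Ht). lra.
Qed.

(** For x = 1/(zeta - z), y = 1/(zeta - w) and d = w - z the hypothesis on y - x is the resolvent
    identity, and n d x^(n+1) is the linear part of the change of the n-th power. The error is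
    quadratic in d, uniformly in zeta, so a Cauchy integral can be differentiated under the integral
    sign. *)
Lemma resolvent_power_estimate M n : 0 <= M -> exists A, 0 <= A /\ forall x y d : C,
 Cmod x <= M -> Cmod y <= M -> (y - x = d * x * y)%C ->
 Cmod (y ^ n - x ^ n - RtoC (INR n) * d * x ^ S n) <= A * (Cmod d * Cmod d).
Proof.
 intros HM. induction n as [|n [A [HA IH]]].
 - exists 0. split; [lra|]. intros x y d _ _ _.
  replace (y ^ 0 - x ^ 0 - RtoC (INR 0) * d * x ^ 1)%C with (RtoC 0) by (simpl; ring).
  rewrite Cmod_0. lra.
 - exists (M * A + INR (S n) * M ^ (n + 3)). split.
  { assert (0 <= INR (S n)) by apply pos_INR. assert (0 <= M ^ (n + 3)) by (apply pow_le; auto). nra. }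
  intros x y d Hx Hy E. specialize (IH x y d Hx Hy E).
  replace (y ^ S n - x ^ S n - RtoC (INR (S n)) * d * x ^ S (S n))%C with
   (y * (y ^ n - x ^ n - RtoC (INR n) * d * x ^ S n) + RtoC (INR (S n)) * (d * d) * (x ^ S (S n) * y))%C.
  + le_via Cmod_triangle. rewrite !Cmod_mult, Cmod_pow, Cmod_R, Rabs_right by apply Rle_ge, pos_INR.
   assert (P1 : Cmod x ^ S (S n) * Cmod y <= M ^ (n + 3)).
   { replace (n + 3)%nat with (S (S (S n))) by lia. change (M ^ S (S (S n))) with (M * M ^ S (S n)).
    rewrite Rmult_comm. apply Rmult_le_compat; auto using Cmod_ge_0. apply pow_le, Cmod_ge_0.
    apply pow_incr. split; auto using Cmod_ge_0. }
   assert (P2 : Cmod y * Cmod (y ^ n - x ^ n - RtoC (INR n) * d * x ^ S n) <= M * (A * (Cmod d * Cmod d))).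
   { apply Rmult_le_compat; auto using Cmod_ge_0. }
   Cnneg d. assert (0 <= INR (S n)) by apply pos_INR.
   assert (INR (S n) * (Cmod d * Cmod d) * (Cmod x ^ S (S n) * Cmod y) <= INR (S n) * (Cmod d * Cmod d) * M ^ (n + 3)).
   { apply Rmult_le_compat_l; auto. apply Rmult_le_pos; nra. }
   nra.
  + rewrite S_INR, RtoC_plus. simpl Cpow.
   set (xn := (x ^ n)%C). set (yn := (y ^ n)%C). set (N := RtoC (INR n)).
   assert (Ed : (d * x * y = y - x)%C) by auto.
   replace ((N + 1) * (d * d) * (x * (x * xn) * y))%C with ((N + 1) * d * x * xn * (d * x * y))%C by ring.
   rewrite Ed.
   replace (y * (yn - xn - N * d * (x * xn)) + (N + 1) * d * x * xn * (y - x))%C with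
    (y * yn - y * xn + xn * (d * x * y) - (N + 1) * d * x * xn * x)%C by ring.
   rewrite Ed. ring.
Qed.

(** Cauchy integral in the angular variable: as d zeta = i zeta dt, the density for a function F is
    F(zeta) zeta, and the factor 2 pi i becomes 2 pi. The exponent n is free so that derivatives
    stay in the same family. *)
Definition CauchyK (b : R -> C) (r : R) (n : nat) (z : C) : C :=
 CInt (fun t => b t * (/ (polar r t - z)) ^ n)%C 0 (2 * PI).

Lemma polar_minus_lower r z t : Cmod z < r -> r - Cmod z <= Cmod (polar r t - z).
Proof.
 intros Hz. Cnneg z. assert (A := Cmod_triangle_rev (polar r t) z).
 rewrite Cmod_polar in A by lra. lra.
Qed.

Lemma polar_minus_neq r z t : Cmod z < r -> (polar r t - z)%C <> 0.
Proof. intros Hz. apply Cmod_gt_0. pose proof (polar_minus_lower r z t Hz). lra. Qed.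

Lemma curve_pow f t n : curve f t -> curve (fun s => f s ^ n)%C t.
Proof. intros H. induction n; simpl. apply curve_const. apply curve_mult; auto. Qed.

Lemma CauchyK_curve b r n z : curve_on b 0 (2 * PI) -> Cmod z < r ->
 curve_on (fun t => b t * (/ (polar r t - z)) ^ n)%C 0 (2 * PI).
Proof.
 intros Hb Hz t Ht. apply curve_mult. apply Hb; auto. apply curve_pow, curve_inv.
 apply curve_minus. apply polar_curve. apply curve_const. apply polar_minus_neq; auto.
Qed.

Lemma CauchyK_Cder b r n z : curve_on b 0 (2 * PI) -> Cmod z < r ->
 Cder (CauchyK b r n) z (RtoC (INR n) * CauchyK b r (S n) z).
Proof.
 intros Hb Hz eps He. pose proof two_PI_pos as HP.
 destruct (curve_on_bounded b 0 (2 * PI)) as [B [HB Bb]]; [lra|auto|].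
 set (m := (r - Cmod z) / 2). assert (Hm : 0 < m) by (unfold m; lra).
 destruct (resolvent_power_estimate (/ m) n) as [A [HA Est]].
 { apply Rlt_le, Rinv_0_lt_compat; auto. }
 set (K := B * A * (2 * PI) + 1).
 assert (HK : 0 < K) by (unfold K; assert (0 <= B * A) by (apply Rmult_le_pos; lra); assert (0 <= B * A * (2 * PI)) by (apply Rmult_le_pos; lra); lra).
 exists (Rmin m (eps / K)). split. apply Rmin_pos; auto. apply Rdiv_lt_0_compat; auto.
 intros w Hw. assert (Hw1 := Rlt_le_trans _ _ _ Hw (Rmin_l _ _)). assert (Hw2 := Rlt_le_trans _ _ _ Hw (Rmin_r _ _)).
 assert (Hwr : Cmod w < r).
 { assert (X := Cmod_triangle_rev w z). unfold m in *. lra. }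
 assert (Low : forall t, m <= Cmod (polar r t - w) /\ m <= Cmod (polar r t - z)).
 { intros t. pose proof (polar_minus_lower r z t Hz). pose proof (polar_minus_lower r w t Hwr).
  assert (X := Cmod_triangle_rev w z). unfold m in *. lra. }
 unfold CauchyK.
 replace (RtoC (INR n) * CInt (fun t => b t * (/ (polar r t - z)) ^ S n) 0 (2 * PI) * (w - z))%C with
  (CInt (fun t => (RtoC (INR n) * (w - z)) * (b t * (/ (polar r t - z)) ^ S n))%C 0 (2 * PI)).
 2:{ rewrite CInt_scal. ring. lra. apply CauchyK_curve; auto. }
 assert (C1 := CauchyK_curve b r n w Hb Hwr). assert (C2 := CauchyK_curve b r n z Hb Hz).
 assert (C3 := CauchyK_curve b r (S n) z Hb Hz).
 assert (C4 : curve_on (fun t => (RtoC (INR n) * (w - z)) * (b t * (/ (polar r t - z)) ^ S n))%C 0 (2 * PI)).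
 { intros t Ht. apply curve_mult. apply curve_const. apply C3; auto. }
 rewrite <- CInt_minus by (auto; lra).
 rewrite <- CInt_minus; auto; try lra.
 2:{ intros t Ht. apply curve_minus; auto. }
 eapply Rle_trans.
 - apply (CInt_norm _ 0 (2 * PI) (B * (A * (Cmod (w - z) * Cmod (w - z))))). lra.
  + intros t Ht. apply curve_minus; [apply curve_minus|]; auto.
  + intros t Ht. set (x := (/ (polar r t - z))%C). set (y := (/ (polar r t - w))%C).
   replace (b t * y ^ n - b t * x ^ n - RtoC (INR n) * (w - z) * (b t * x ^ S n))%C with
    (b t * (y ^ n - x ^ n - RtoC (INR n) * (w - z) * x ^ S n))%C by ring.
   rewrite Cmod_mult. apply Rmult_le_compat; auto using Cmod_ge_0. apply Est.
   * unfold x. rewrite Cmod_inv by (apply polar_minus_neq; auto). apply Rinv_le_contravar; auto. apply Low.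
   * unfold y. rewrite Cmod_inv by (apply polar_minus_neq; auto). apply Rinv_le_contravar; auto. apply Low.
   * unfold x, y. field. split; apply polar_minus_neq; auto.
 - set (d := Cmod (w - z)) in *. assert (0 <= d) by apply Cmod_ge_0.
  replace (B * (A * (d * d)) * (2 * PI - 0)) with ((B * A * (2 * PI)) * d * d) by ring.
  assert (d * K <= eps).
  { apply Rmult_le_reg_r with (/ K). apply Rinv_0_lt_compat; auto. rewrite Rmult_assoc, Rinv_r by lra.
   unfold Rdiv in Hw2. lra. }
  unfold K in *. nra.
Qed.

(** The derivative in z is the integral of an exact t-derivative over a full period, hence zero, and
    at the centre the integrand is 1. *)
Lemma CInt_resolvent r z : Cmod z < r -> CauchyK (polar r) r 1 z = RtoC (2 * PI).
Proof.
 intros Hz. pose proof two_PI_pos as HP. Cnneg z as Hz0.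
 assert (Hb : curve_on (polar r) 0 (2 * PI)) by (intros t _; apply polar_curve).
 assert (D0 : forall w, Cmod w < r -> Cder (CauchyK (polar r) r 1) w 0).
 { intros w Hw. replace (RtoC 0) with (RtoC (INR 1) * CauchyK (polar r) r 2 w)%C.
  apply CauchyK_Cder; auto.
  assert (E : CauchyK (polar r) r 2 w = 0).
  { unfold CauchyK. apply (CInt_closed (fun t => Ci * / (polar r t - w))%C).
   - lra.
   - intros t Ht. destruct (polar_derive r t) as [H1 H2].
    replace (polar r t * (/ (polar r t - w)) ^ 2)%C with
     ((Ci * (- / ((polar r t - w) * (polar r t - w)) * (1 - 0))) * (Ci * polar r t))%C.
    + apply (curve_Cder (polar r) (fun x => Ci * / (x - w))%C); auto.
     apply (Cder_scal Ci (fun x => / (x - w))%C).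
     apply (Cder_comp (fun x => x - w)%C (fun x => / x)%C).
     apply (Cder_minus (fun x => x) (fun _ => w)); [apply Cder_id|apply Cder_const].
     apply Cder_inv. apply polar_minus_neq; auto.
    + assert (Ei : (Ci * Ci = - (1))%C) by (unfold Ci, Cmult, Copp; simpl; f_equal; ring).
     transitivity ((Ci * Ci) * (- polar r t * (/ (polar r t - w)) ^ 2))%C.
     * simpl. field. apply polar_minus_neq; auto.
     * rewrite Ei. ring.
   - apply CauchyK_curve; auto.
   - rewrite polar_2PI. reflexivity. }
  rewrite E. ring. }
 assert (E0 : CauchyK (polar r) r 1 0 = RtoC (2 * PI)).
 { unfold CauchyK. rewrite (CInt_ext _ (fun _ => RtoC 1)).
  - rewrite CInt_const. rewrite Rminus_0_r. ring.
  - lra.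
  - intros t _. simpl. field.
   assert (X := polar_minus_neq r 0 t). rewrite Cmod_0 in X. specialize (X ltac:(lra)).
   intros E. apply X. rewrite E. ring. }
 rewrite <- E0. apply Ceq_minus. apply Cmod_eq_0. apply Rle_antisym; [|apply Cmod_ge_0].
 apply Rnot_lt_le. intros Hc.
 set (phi := fun s : R => CauchyK (polar r) r 1 (RtoC s * z)).
 assert (Ephi : (CauchyK (polar r) r 1 z - CauchyK (polar r) r 1 0)%C = (phi 1 - phi 0)%C).
 { unfold phi. f_equal. f_equal. ring. f_equal. f_equal. ring. }
 rewrite Ephi in Hc.
 (* A function with zero derivative obeys the Lipschitz bound with every positive constant; the
    constant taken is half of the increment to be bounded. *)
 assert (Cmod (phi 1 - phi 0) <= Cmod (phi 1 - phi 0) / 2); [|lra].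
 set (e := Cmod (phi 1 - phi 0) / 2) in *.
 apply local_to_global_Lipschitz. intros t Ht.
 assert (Ht' : Cmod (RtoC t * z) < r) by (rewrite Cmod_scal by lra; nra).
 destruct (D0 _ Ht' (e / (1 + Cmod z))) as [d [Hd X]]. { apply Rdiv_lt_0_compat; unfold e; lra. }
 exists (d / (1 + Cmod z)). split. pos_div.
 intros s Hs Hst. specialize (X (RtoC s * z)%C).
 replace (RtoC s * z - RtoC t * z)%C with (RtoC (s - t) * z)%C in X by (rewrite RtoC_minus; ring).
 rewrite Cmod_mult, Cmod_R in X.
 assert (Rabs (s - t) * Cmod z < d).
 { apply Rle_lt_trans with (Rabs (s - t) * (1 + Cmod z)).
  apply Rmult_le_compat_l. apply Rabs_pos. lra.
  apply Rmult_lt_reg_r with (/ (1 + Cmod z)). apply Rinv_0_lt_compat; lra.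
  rewrite Rmult_assoc, Rinv_r by lra. unfold Rdiv in Hst. lra. }
 specialize (X H). fold (phi s) in X. fold (phi t) in X.
 replace (phi s - phi t - 0 * (RtoC (s - t) * z))%C with (phi s - phi t)%C in X by ring.
 eapply Rle_trans; [exact X|].
 replace (e / (1 + Cmod z) * (Rabs (s - t) * Cmod z)) with (e * Rabs (s - t) * (Cmod z / (1 + Cmod z))) by (field; lra).
 assert (Cmod z / (1 + Cmod z) <= 1).
 { apply Rmult_le_reg_r with (1 + Cmod z). lra. unfold Rdiv. rewrite Rmult_assoc, Rinv_l by lra. lra. }
 assert (0 <= e * Rabs (s - t)) by (apply Rmult_le_pos; [unfold e; lra|apply Rabs_pos]).
 nra.
Qed.

Lemma circle_curve F F' r : holo F F' -> 0 <= r < 1 -> curve_on (fun t => F (polar r t)) 0 (2 * PI).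
Proof.
 intros HF Hr t _. apply curve_comp. apply polar_curve. apply (holo_cont _ _ HF).
 unfold inD. rewrite Cmod_polar; lra.
Qed.

(** [J u] integrates [F] over the circle contracted towards z by the factor u, against the fixed
    kernel zeta/(zeta - z). Its derivative in u is the integral of F' times zeta, an exact
    t-derivative over a period, so [J 1 = J 0], and [J 0] is F z times the resolvent integral.
    Continuity of F' enters through [unif_Cder]. *)
Lemma Cauchy_formula_C1 F F' r z : holo F F' -> (forall z, inD z -> Ccont F' z) -> r < 1 -> Cmod z < r ->
 CauchyK (fun t => F (polar r t) * polar r t)%C r 1 z = (RtoC (2 * PI) * F z)%C.
Proof.
 intros HF HF' Hr Hz. pose proof two_PI_pos as HP. Cnneg z as Hz0.
 assert (HC := holo_cont _ _ HF).
 assert (Hp : forall t, Cmod (polar r t) = r) by (intros; apply Cmod_polar; lra).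
 assert (Hseg : forall u t, 0 <= u <= 1 -> Cmod (seg z (polar r t) u) <= r).
 { intros u t Hu. apply seg_disc; auto. lra. rewrite Hp. lra. }
 assert (HsegD : forall u t, 0 <= u <= 1 -> inD (seg z (polar r t) u)).
 { intros u t Hu. specialize (Hseg u t Hu). unfold inD; lra. }
 assert (Cseg : forall u t, curve (fun t => seg z (polar r t) u) t).
 { intros u t. unfold seg. apply curve_plus. apply curve_const. apply curve_mult. apply curve_const.
  apply curve_minus. apply polar_curve. apply curve_const. }
 assert (Cker : forall t, curve (fun t => polar r t * / (polar r t - z))%C t).
 { intros t. apply curve_mult. apply polar_curve. apply curve_inv. apply curve_minus. apply polar_curve. apply curve_const.
  apply polar_minus_neq; auto. }
 set (J := fun u => CInt (fun t => F (seg z (polar r t) u) * (polar r t * / (polar r t - z)))%C 0 (2 * PI)).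
 assert (CJ : forall u, 0 <= u <= 1 -> curve_on (fun t => F (seg z (polar r t) u) * (polar r t * / (polar r t - z)))%C 0 (2 * PI)).
 { intros u Hu t Ht. apply curve_mult; auto. apply (curve_comp F); auto. }
 assert (J1 : J 1 = CauchyK (fun t => F (polar r t) * polar r t)%C r 1 z).
 { unfold J, CauchyK. apply CInt_ext; [lra|]. intros t _.
  replace (seg z (polar r t) 1) with (polar r t) by (unfold seg; ring). simpl. ring. }
 assert (J0 : J 0 = (RtoC (2 * PI) * F z)%C).
 { rewrite <- (CInt_resolvent r z Hz). unfold J, CauchyK.
  rewrite (CInt_ext _ (fun t => F z * (polar r t * (/ (polar r t - z)) ^ 1))%C); [|lra|].
  - rewrite CInt_scal; [ring|lra|]. apply CauchyK_curve; auto. intros t _; apply polar_curve.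
  - intros t _. replace (seg z (polar r t) 0) with z by (unfold seg; ring). simpl. ring. }
 rewrite <- J1, <- J0. apply Ceq_minus. apply Cmod_eq_0. apply Rle_antisym; [|apply Cmod_ge_0].
 apply Rnot_lt_le. intros Hc.
 assert (Cmod (J 1 - J 0) <= Cmod (J 1 - J 0) / 2); [|lra].
 set (e := Cmod (J 1 - J 0) / 2) in *.
 destruct (unif_Cder F F' r HF HF' Hr (e / (2 * PI))) as [d [Hd X]].
 { apply Rdiv_lt_0_compat; unfold e; lra. }
 assert (Hzero : forall u, 0 <= u <= 1 -> CInt (fun t => F' (seg z (polar r t) u) * polar r t)%C 0 (2 * PI) = 0).
 { intros u Hu.
  assert (CC : curve_on (fun t => F' (seg z (polar r t) u) * polar r t)%C 0 (2 * PI)).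
  { intros t _. apply curve_mult. apply (curve_comp F'); auto. apply polar_curve. }
  assert (Hi : Ci <> 0) by apply Ci_nz.
  destruct (Req_dec u 0) as [->|Hu0].
  - rewrite (CInt_ext _ (fun t => F' z * polar r t)%C); [|lra|].
   2:{ intros t _. do 2 f_equal. unfold seg; ring. }
   rewrite CInt_scal; [|lra|intros t _; apply polar_curve].
   rewrite (CInt_closed (fun t => / Ci * polar r t)%C). ring. lra. 2: intros t _; apply polar_curve.
   2: rewrite polar_2PI; auto.
   intros t _. destruct (polar_derive r t) as [H1 H2].
   replace (polar r t) with (/ Ci * (Ci * polar r t))%C by (field; auto).
   replace (Re (/ Ci * (Ci * polar r t))) with (Re ((/ Ci * 1) * (Ci * polar r t))) by (f_equal; ring).
   replace (Im (/ Ci * (Ci * polar r t))) with (Im ((/ Ci * 1) * (Ci * polar r t))) by (f_equal; ring).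
   apply (curve_Cder (polar r) (fun x => / Ci * x)%C); auto. apply (Cder_scal (/ Ci) (fun x => x)). apply Cder_id.
  - assert (Hk : (RtoC u * Ci)%C <> 0).
   { apply Cmult_neq_0; auto. intros E. apply RtoC_inj in E. auto. }
   assert (E : (RtoC u * Ci * CInt (fun t => F' (seg z (polar r t) u) * polar r t)%C 0 (2 * PI))%C = 0).
   { rewrite <- CInt_scal by (auto; lra).
    apply (CInt_closed (fun t => F (seg z (polar r t) u))).
    - lra.
    - intros t _. destruct (polar_derive r t) as [H1 H2].
     replace (RtoC u * Ci * (F' (seg z (polar r t) u) * polar r t))%C with
      (F' (seg z (polar r t) u) * (0 + RtoC u * (1 - 0)) * (Ci * polar r t))%C by ring.
     apply (curve_Cder (polar r) (fun x => F (seg z x u))); auto.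
     apply (Cder_comp (fun x => seg z x u) F). 2: apply HF; auto.
     unfold seg. apply (Cder_plus (fun _ => z) (fun x => RtoC u * (x - z))%C). apply Cder_const.
     apply (Cder_scal (RtoC u) (fun x => x - z)%C). apply (Cder_minus (fun x => x) (fun _ => z)).
     apply Cder_id. apply Cder_const.
    - intros t Ht. apply curve_mult. apply curve_const. apply CC; auto.
    - rewrite polar_2PI; auto. }
   transitivity (/ (RtoC u * Ci) * (RtoC u * Ci * CInt (fun t => F' (seg z (polar r t) u) * polar r t)%C 0 (2 * PI)))%C.
   field. split; auto. intros E'. apply RtoC_inj in E'; auto.
   rewrite E. ring. }
 apply local_to_global_Lipschitz. intros u Hu.
 exists (d / 2). split; [lra|]. intros s Hs Hsu.
 assert (CZ : curve_on (fun t => RtoC (s - u) * (F' (seg z (polar r t) u) * polar r t))%C 0 (2 * PI)).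
 { intros t _. apply curve_mult. apply curve_const. apply curve_mult. apply (curve_comp F'); auto. apply polar_curve. }
 replace (J s - J u)%C with (J s - J u - CInt (fun t => RtoC (s - u) * (F' (seg z (polar r t) u) * polar r t))%C 0 (2 * PI))%C.
 2:{ rewrite CInt_scal. rewrite (Hzero u Hu). ring. lra.
   intros t _. apply curve_mult. apply (curve_comp F'); auto. apply polar_curve. }
 unfold J. rewrite <- CInt_minus by (auto; lra).
 rewrite <- CInt_minus; auto; try lra.
 2:{ intros t Ht. apply curve_minus; apply CJ; auto. }
 replace (e * Rabs (s - u)) with (e / (2 * PI) * Rabs (s - u) * (2 * PI - 0)) by (field; lra).
 apply CInt_norm. lra.
 { intros t Ht. apply curve_minus; auto. apply curve_minus; apply CJ; auto. }
 intros t _. set (ze := polar r t). set (p := seg z ze u). set (q := seg z ze s).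
 assert (Eq : (q - p = RtoC (s - u) * (ze - z))%C) by (unfold p, q, seg; rewrite RtoC_minus; ring).
 assert (Hn : (ze - z)%C <> 0) by (apply polar_minus_neq; auto).
 replace (F q * (ze * / (ze - z)) - F p * (ze * / (ze - z)) - RtoC (s - u) * (F' p * ze))%C with
  ((F q - F p - F' p * (q - p)) * (ze * / (ze - z)))%C by (rewrite Eq; field; auto).
 assert (Hzz : 0 < Cmod (ze - z)) by (apply Cmod_gt_0; auto).
 assert (Hqp : Cmod (q - p) = Rabs (s - u) * Cmod (ze - z)) by (rewrite Eq, Cmod_mult, Cmod_R; auto).
 assert (Hze : Cmod ze = r) by apply Hp.
 rewrite !Cmod_mult, Cmod_inv, Hze by auto.
 assert (Y : Cmod (F q - F p - F' p * (q - p)) <= e / (2 * PI) * Cmod (q - p)).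
 { apply X. apply Hseg; auto. apply Hseg; auto. rewrite Hqp.
  assert (Cmod (ze - z) <= 2). { le_via Cmod_minus_le. lra. }
  pose proof (Rabs_pos (s - u)). nra. }
 rewrite Hqp in Y.
 apply Rle_trans with (e / (2 * PI) * (Rabs (s - u) * Cmod (ze - z)) * (r * / Cmod (ze - z))).
 { apply Rmult_le_compat_r; auto. apply Rmult_le_pos; [lra|]. apply Rlt_le, Rinv_0_lt_compat; auto. }
 replace (e / (2 * PI) * (Rabs (s - u) * Cmod (ze - z)) * (r * / Cmod (ze - z))) with
  (e / (2 * PI) * Rabs (s - u) * r) by (field; lra).
 assert (0 <= e / (2 * PI) * Rabs (s - u)).
 { apply Rmult_le_pos; [|apply Rabs_pos]. apply Rlt_le, Rdiv_lt_0_compat; unfold e; lra. }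
 nra.
Qed.

Lemma between_radius z : inD z -> exists r, Cmod z < r /\ r < 1.
Proof. unfold inD. intros H. exists ((Cmod z + 1) / 2). lra. Qed.

Lemma Cder_of_local_formula F K z l c :
 (exists r, Cmod z < r /\ forall w, Cmod w < r -> K w = (c * F w)%C) -> c <> 0 -> Cder K z l -> Cder F z (/ c * l).
Proof.
 intros [r [Hr E]] Hc HK.
 apply Cder_ext_loc with (fun w => / c * K w)%C.
 - exists (r - Cmod z). split; [lra|]. intros w Hw.
  assert (X := Cmod_triangle_rev w z). rewrite E by lra. field; auto.
 - apply Cder_scal; auto.
Qed.

Lemma C2PI_neq_0 : RtoC (2 * PI) <> 0.
Proof. intros E. apply RtoC_inj in E. pose proof two_PI_pos. lra. Qed.

(** The primitive [P] of [F] has the continuous derivative [F], so Cauchy's formula is available for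
    [P]. Successive derivatives of its Cauchy integral represent [F], then [F'], and one more shows
    that [F'] is differentiable. *)
Theorem holo_derivative F F' : holo F F' -> exists F'', holo F' F''.
Proof.
 intros HF. destruct (primitive_exists F F' HF) as [P [_ HP]].
 assert (HC := holo_cont _ _ HF).
 assert (H : forall z, exists l, inD z -> Cder F' z l).
 { intros z. destruct (classic (inD z)) as [Hz|Hz]; [|exists 0; tauto].
  destruct (between_radius z Hz) as [r [Hr1 Hr2]]. Cnneg z.
  set (b := fun t => (P (polar r t) * polar r t)%C).
  assert (Hb : curve_on b 0 (2 * PI)).
  { intros t Ht. apply curve_mult. apply (circle_curve P F r); auto; lra. apply polar_curve. }
  assert (E1 : forall w, Cmod w < r -> CauchyK b r 1 w = (RtoC (2 * PI) * P w)%C).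
  { intros w Hw. apply (Cauchy_formula_C1 P F); auto. }
  assert (E2 : forall w, Cmod w < r -> CauchyK b r 2 w = (RtoC (2 * PI) * F w)%C).
  { intros w Hw. assert (D1 := CauchyK_Cder b r 1 w Hb Hw).
   assert (D2 := Cder_of_local_formula P _ w _ _ (ex_intro _ r (conj Hw E1)) C2PI_neq_0 D1).
   assert (D3 := Cder_unique _ _ _ _ D2 (HP w ltac:(unfold inD; lra))).
   rewrite <- D3. simpl. field. apply C2PI_neq_0. }
  assert (E3 : forall w, Cmod w < r -> CauchyK b r 3 w = (RtoC (2 * PI) / 2 * F' w)%C).
  { intros w Hw. assert (D1 := CauchyK_Cder b r 2 w Hb Hw).
   assert (D2 := Cder_of_local_formula F _ w _ _ (ex_intro _ r (conj Hw E2)) C2PI_neq_0 D1).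
   assert (D3 := Cder_unique _ _ _ _ D2 (HF w ltac:(unfold inD; lra))).
   rewrite <- D3. simpl. rewrite RtoC_plus. field. apply C2PI_neq_0. }
  eexists. intros _. apply (Cder_of_local_formula F' (CauchyK b r 3) z (RtoC (INR 3) * CauchyK b r 4 z) (RtoC (2 * PI) / 2)).
  - exists r; auto.
  - intros E. apply C2PI_neq_0. transitivity (RtoC (2 * PI) / 2 * 2)%C. field. rewrite E. ring.
  - apply CauchyK_Cder; auto. }
 apply choice in H. destruct H as [F'' HF'']. exists F''. intros z Hz. apply HF''; auto.
Qed.

Lemma holo_deriv_cont F F' : holo F F' -> forall z, inD z -> Ccont F' z.
Proof. intros HF. destruct (holo_derivative F F' HF) as [F'' H]. apply (holo_cont _ _ H). Qed.

Theorem Cauchy_formula F F' r z : holo F F' -> r < 1 -> Cmod z < r ->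
 CauchyK (fun t => F (polar r t) * polar r t)%C r 1 z = (RtoC (2 * PI) * F z)%C.
Proof. intros HF. apply (Cauchy_formula_C1 F F'); auto. apply holo_deriv_cont with F; auto. Qed.

Theorem mean_value F F' r : holo F F' -> 0 < r < 1 ->
 CInt (fun t => F (polar r t)) 0 (2 * PI) = (RtoC (2 * PI) * F 0)%C.
Proof.
 intros HF Hr. rewrite <- (Cauchy_formula F F' r 0 HF); [|lra|rewrite Cmod_0; lra].
 pose proof two_PI_pos.
 unfold CauchyK. apply CInt_ext; [lra|]. intros t _. simpl. field.
 apply Cmod_gt_0. rewrite Cmod_polar; lra.
Qed.

(** The difference quotient is the Cauchy integral with density F(zeta) zeta/(zeta - a): by partial
    fractions away from a, and by the integral for the derivative at a itself. It is therefore
    differentiable at a as well. This removes the zero at the origin in Schwarz's lemma and in h z /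
    z. *)
Theorem divided_difference F F' a : holo F F' -> inD a ->
 exists Q Q', holo Q Q' /\ Q a = F' a /\ forall z, (F z - F a = (z - a) * Q z)%C.
Proof.
 intros HF Ha.
 set (Q := fun z => if excluded_middle_informative (z = a) then F' a else ((F z - F a) / (z - a))%C).
 assert (EQ : forall z, (F z - F a = (z - a) * Q z)%C).
 { intros z. unfold Q. destruct (excluded_middle_informative (z = a)) as [->|Hne]. ring.
  field. intros E. apply Hne, Ceq_minus; auto. }
 assert (Qa : Q a = F' a).
 { unfold Q. destruct (excluded_middle_informative (a = a)) as [_|H]; auto. elim H; auto. }
 assert (H : forall z, exists l, inD z -> Cder Q z l).
 { intros z. destruct (classic (inD z)) as [Hz|Hz]; [|exists 0; tauto].
  set (r := (Rmax (Cmod z) (Cmod a) + 1) / 2).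
  assert (Hr : Rmax (Cmod z) (Cmod a) < 1) by (apply Rmax_lub_lt; auto).
  pose proof (Rmax_l (Cmod z) (Cmod a)). pose proof (Rmax_r (Cmod z) (Cmod a)).
  assert (Hzr : Cmod z < r) by (unfold r; lra). assert (Har : Cmod a < r) by (unfold r; lra).
  assert (Hr1 : r < 1) by (unfold r; lra). Cnneg z.
  set (b := fun t => (F (polar r t) * polar r t * / (polar r t - a))%C).
  set (b0 := fun t => (F (polar r t) * polar r t)%C).
  assert (Hb0 : curve_on b0 0 (2 * PI)).
  { intros t Ht. apply curve_mult. apply (circle_curve F F' r); auto; lra. apply polar_curve. }
  assert (Hb : curve_on b 0 (2 * PI)).
  { intros t Ht. apply curve_mult. apply Hb0; auto.
   apply curve_inv. apply curve_minus. apply polar_curve. apply curve_const. apply polar_minus_neq; auto. }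
  pose proof two_PI_pos as HP.
  assert (E1 : forall w, Cmod w < r -> CauchyK b r 1 w = (RtoC (2 * PI) * Q w)%C).
  { intros w Hw. destruct (classic (w = a)) as [->|Hne].
   - rewrite Qa. assert (D1 := CauchyK_Cder b0 r 1 a Hb0 Har).
    assert (D2 : Cder F a (/ RtoC (2 * PI) * (RtoC (INR 1) * CauchyK b0 r 2 a))).
    { apply (Cder_of_local_formula F (CauchyK b0 r 1)); auto using C2PI_neq_0.
     exists r. split; auto. intros w' Hw'. apply (Cauchy_formula F F'); auto. }
    rewrite <- (Cder_unique _ _ _ _ D2 (HF a Ha)).
    replace (CauchyK b r 1 a) with (CauchyK b0 r 2 a). simpl. field. apply C2PI_neq_0.
    unfold CauchyK. apply CInt_ext; [lra|]. intros t _. unfold b, b0. simpl. ring.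
   - assert (Hwa : (w - a)%C <> 0) by (intros E; apply Hne, Ceq_minus; auto).
    assert (E : ((w - a) * CauchyK b r 1 w = CauchyK b0 r 1 w - CauchyK b0 r 1 a)%C).
    { unfold CauchyK. rewrite <- CInt_scal, <- CInt_minus; try lra; try (apply CauchyK_curve; auto).
     apply CInt_ext; [lra|]. intros t _. unfold b, b0. simpl. field.
     split; apply polar_minus_neq; auto. }
    unfold b0 in E. rewrite !(Cauchy_formula F F' r) in E by auto.
    transitivity (/ (w - a) * ((w - a) * CauchyK b r 1 w))%C. field; auto.
    rewrite E. replace (RtoC (2 * PI) * F w - RtoC (2 * PI) * F a)%C with (RtoC (2 * PI) * (F w - F a))%C by ring.
    rewrite EQ. field; auto. }
  eexists. intros _. apply (Cder_of_local_formula Q (CauchyK b r 1) z (RtoC (INR 1) * CauchyK b r 2 z) (RtoC (2 * PI))).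
  - exists r; auto.
  - apply C2PI_neq_0.
  - apply CauchyK_Cder; auto. }
 apply choice in H. destruct H as [Q' HQ']. exists Q, Q'. split; [|auto].
 intros z Hz. apply HQ'; auto.
Qed.

(** * The maximum principle *)

Lemma mean_value_local F F' z d r : (forall w, Cmod (w - z) < d -> Cder F w (F' w)) -> 0 < r < d ->
 CInt (fun t => F (z + polar r t)%C) 0 (2 * PI) = (RtoC (2 * PI) * F z)%C.
Proof.
 intros HF Hr. pose proof two_PI_pos.
 assert (HG : holo (fun x => F (z + RtoC d * x)%C) (fun x => F' (z + RtoC d * x)%C * (0 + RtoC d * 1))%C).
 { intros x Hx. apply (Cder_comp (fun x => z + RtoC d * x)%C F).
  - apply (Cder_plus (fun _ => z) (fun x => RtoC d * x)%C). apply Cder_const.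
   apply (Cder_scal (RtoC d) (fun x => x)). apply Cder_id.
  - apply HF. replace (z + RtoC d * x - z)%C with (RtoC d * x)%C by ring.
   rewrite Cmod_scal by lra. unfold inD in Hx. nra. }
 assert (Hq : 0 < r / d < 1).
 { split. pos_div. apply Rmult_lt_reg_r with d. lra.
  unfold Rdiv. rewrite Rmult_assoc, Rinv_l; lra. }
 assert (E := mean_value _ _ (r / d) HG Hq).
 cbv beta in E. replace (z + RtoC d * 0)%C with z in E by ring. rewrite <- E.
 apply CInt_ext; [lra|]. intros t _. do 2 f_equal. unfold polar. apply Ceq; unfold Re, Im; simpl; field; lra.
Qed.

Definition Vcont (v : C -> R) (z : C) : Prop :=
 forall eps, 0 < eps -> exists d, 0 < d /\ forall w, Cmod (w - z) < d -> Rabs (v w - v z) < eps.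

Definition Copen (U : C -> Prop) : Prop :=
 forall z, U z -> exists d, 0 < d /\ forall w, Cmod (w - z) < d -> U w.

Definition submean (v : C -> R) (z : C) : Prop :=
 exists d, 0 < d /\ forall r, 0 < r < d -> 2 * PI * v z <= RInt (fun t => v (z + polar r t)%C) 0 (2 * PI).

Lemma Vcont_curve v f t : curve f t -> Vcont v (f t) -> continuous (fun s => v (f s)) t.
Proof.
 intros Hf Hv. apply continuous_Reps. intros eps He. destruct (Hv eps He) as [d [Hd X]].
 apply curve_eps with (eps := d) in Hf; auto. destruct Hf as [d' [Hd' Y]]. exists d'; split; auto.
Qed.

Lemma RInt_Cmod2_circle z r :
 RInt (fun t => Cmod (z + polar r t) * Cmod (z + polar r t)) 0 (2 * PI) = 2 * PI * (Cmod z * Cmod z + r * r).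
Proof.
 rewrite (RInt_ext _ (fun t => (Cmod z * Cmod z + r * r) + 2 * r * (Re z * cos t + Im z * sin t))).
 2:{ intros t _. rewrite !Cmod_sqr. unfold polar, Re, Im; simpl.
   pose proof (sin2_cos2 t) as E. unfold Rsqr in E.
   replace (r * r) with (r * r * (sin t * sin t + cos t * cos t)) by (rewrite E; ring). ring. }
 apply is_RInt_unique.
 replace (2 * PI * (Cmod z * Cmod z + r * r)) with
  (minus ((Cmod z * Cmod z + r * r) * (2 * PI) + 2 * r * (Re z * sin (2 * PI) - Im z * cos (2 * PI)))
      ((Cmod z * Cmod z + r * r) * 0 + 2 * r * (Re z * sin 0 - Im z * cos 0))).
 - apply (is_RInt_derive (V := R_CompleteNormedModule) (fun t => (Cmod z * Cmod z + r * r) * t + 2 * r * (Re z * sin t - Im z * cos t))).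
  + intros t _. auto_derive; auto. ring.
  + intros t _. smooth.
 - rewrite sin_2PI, cos_2PI, sin_0, cos_0. unfold minus, plus, opp; simpl. ring.
Qed.

(** Adding the strictly subharmonic eta |z|^2 makes an interior maximum contradict the mean value
    inequality at once. As v may be unbounded above, the supremum is taken of the arctangent. The
    boundary condition is phrased by sequences leaving U, because in the applications v has no
    boundary values and U is not explicit. *)
Theorem maximum_principle (U : C -> Prop) (v : C -> R) M :
 Copen U -> (forall z, U z -> Cmod z <= 1) -> (forall z, U z -> Vcont v z) -> (forall z, U z -> submean v z) ->
 (forall u l M', M < M' -> (forall n, U (u n)) -> Clim u l -> ~ U l -> ~ (forall n, M' <= v (u n))) ->
 forall z, U z -> v z <= M.
Proof.
 intros HU HB Hc Hs Hbd z0 Hz0. apply Rnot_lt_le. intros Hlt.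
 (* Since |z| <= 1, the perturbation costs at most eta, so along the maximising sequence v stays
    above v z0 - eta, which still exceeds M. *)
 set (eta := (v z0 - M) / 4). assert (He : 0 < eta) by (unfold eta; lra).
 set (ve := fun z => v z + eta * (Cmod z * Cmod z)).
 set (E := fun y => exists z, U z /\ y = atan (ve z)).
 destruct (completeness E) as [s [Hub Hlub]].
 { exists (PI / 2). intros y [z [_ ->]]. pose proof (atan_bound (ve z)). lra. }
 { exists (atan (ve z0)), z0. auto. }
 assert (Hseq : forall n, exists z, U z /\ atan (ve z0) <= atan (ve z) /\ s - / INR (S n) < atan (ve z)).
 { intros n. pose proof (inv_INR_pos n).
  assert (Hex : exists z, U z /\ s - / INR (S n) < atan (ve z)).
  { apply NNPP. intros Hn. assert (s <= s - / INR (S n)); [|lra]. apply Hlub. intros y [z [Hz ->]].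
   apply Rnot_lt_le. intros Hc'. apply Hn. exists z; auto. }
  destruct Hex as [z [Hz Hz']]. destruct (Rle_lt_dec (atan (ve z0)) (atan (ve z))).
  exists z; auto. exists z0. repeat split; auto; lra. }
 apply choice in Hseq. destruct Hseq as [u Hu].
 destruct (BW_C u 1) as [x [l [Hx Hl]]]. { intros n. apply HB, Hu. }
 assert (Hmono : forall a b, atan a <= atan b -> a <= b).
 { intros a b Hab. apply Rnot_lt_le. intros Hc'. apply atan_increasing in Hc'. lra. }
 destruct (classic (U l)) as [Ul|Ul].
 - assert (Hvc : Un_cv (fun n => ve (u (x n))) (ve l)).
  { unfold ve. apply (CV_plus (fun n => v (u (x n))) (fun n => eta * (Cmod (u (x n)) * Cmod (u (x n))))).
   - intros eps Heps. destruct (Hc l Ul eps Heps) as [d [Hd X]]. destruct (Hl d Hd) as [N HN].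
    exists N. intros n Hn. apply X, HN, Hn.
   - apply (CV_mult (fun _ => eta) (fun n => Cmod (u (x n)) * Cmod (u (x n)))). apply Un_cv_const.
    apply (CV_mult (fun n => Cmod (u (x n))) (fun n => Cmod (u (x n)))); apply (Clim_Cmod (fun n => u (x n))); auto. }
  assert (Hmax : forall z, U z -> ve z <= ve l).
  { intros z Hz. apply Hmono. apply Rle_trans with s. apply Hub. exists z; auto.
   apply Rnot_lt_le. intros Hc'.
   assert (Hat : continuity_pt atan (ve l)) by (apply derivable_continuous_pt, derivable_pt_atan).
   assert (Hcv := continuity_seq atan _ _ Hat Hvc).
   destruct (Hcv ((s - atan (ve l)) / 2)) as [N1 HN1]; [lra|].
   destruct (inv_INR_small ((s - atan (ve l)) / 2)) as [N2 HN2]; [lra|].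
   set (n := (N1 + N2)%nat). specialize (HN1 n ltac:(unfold n; lia)).
   pose proof (extraction_ge x Hx n). specialize (HN2 (x n) ltac:(unfold n in *; lia)).
   destruct (Hu (x n)) as [_ [_ Q]]. unfold Rdist in HN1. apply Rabs_def2 in HN1. lra. }
  destruct (HU l Ul) as [d1 [Hd1 B1]]. destruct (Hs l Ul) as [d2 [Hd2 B2]].
  set (r := Rmin d1 d2 / 2). assert (0 < Rmin d1 d2) by (apply Rmin_pos; auto).
  pose proof (Rmin_l d1 d2). pose proof (Rmin_r d1 d2).
  assert (Hr : 0 < r < d2) by (unfold r; lra). specialize (B2 r Hr).
  assert (Hin : forall t, U (l + polar r t)%C).
  { intros t. apply B1. replace (l + polar r t - l)%C with (polar r t) by ring. rewrite Cmod_polar; unfold r; lra. }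
  assert (Cc : forall t, curve (fun t => l + polar r t)%C t).
  { intros t. apply curve_plus. apply curve_const. apply polar_curve. }
  assert (X1 : ex_RInt (fun t => v (l + polar r t)%C) 0 (2 * PI)).
  { apply ex_RInt_continuous_R. intros t _.
   apply (Vcont_curve v (fun t => l + polar r t)%C); auto. }
  assert (X2 : ex_RInt (fun t => eta * (Cmod (l + polar r t) * Cmod (l + polar r t))) 0 (2 * PI)).
  { apply ex_RInt_continuous_R. intros t _.
   apply (continuous_Rmult (fun _ => eta)). apply continuous_const.
   apply (continuous_Rmult); apply (continuous_Cmod (fun t => l + polar r t)%C); auto. }
  assert (X3 : ex_RInt (fun t => Cmod (l + polar r t) * Cmod (l + polar r t)) 0 (2 * PI)).
  { apply ex_RInt_continuous_R. intros t _.
   apply (continuous_Rmult); apply (continuous_Cmod (fun t => l + polar r t)%C); auto. }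
  pose proof two_PI_pos as HP.
  assert (Hle : RInt (fun t => v (l + polar r t)%C + eta * (Cmod (l + polar r t) * Cmod (l + polar r t))) 0 (2 * PI)
    <= RInt (fun _ => ve l) 0 (2 * PI)).
  { apply RInt_le. lra. apply ex_RInt_plus_R; auto. apply ex_RInt_const. intros t _. apply (Hmax _ (Hin t)). }
  rewrite RInt_plus_R, RInt_scal_R, RInt_Cmod2_circle, RInt_const in Hle by auto.
  unfold scal in Hle; simpl in Hle; unfold mult in Hle; simpl in Hle. unfold ve in Hle.
  assert (0 < eta * (r * r)) by (apply Rmult_lt_0_compat; nra).
  assert (Hq : 2 * PI * v l + eta * (2 * PI * (Cmod l * Cmod l + r * r)) <= (2 * PI - 0) * (v l + eta * (Cmod l * Cmod l))) by lra.
  nra.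
 - apply (Hbd (fun n => u (x n)) l (v z0 - eta)); auto.
  + unfold eta; lra.
  + intros n. apply Hu.
  + intros n. destruct (Hu (x n)) as [Hun [Q _]]. apply Hmono in Q. unfold ve in Q.
   specialize (HB _ Hun). Cnneg (u (x n)). Cnneg z0.
   assert (Cmod (u (x n)) * Cmod (u (x n)) <= 1) by nra.
   assert (0 <= eta * (Cmod z0 * Cmod z0)) by (apply Rmult_le_pos; nra).
   assert (eta * (Cmod (u (x n)) * Cmod (u (x n))) <= eta * 1) by (apply Rmult_le_compat_l; lra). lra.
Qed.

Lemma Vcont_Re F z : Ccont F z -> Vcont (fun w => Re (F w)) z.
Proof.
 intros H eps He. destruct (H eps He) as [d [Hd X]]. exists d; split; auto. intros w Hw.
 eapply Rle_lt_trans; [|apply (X w Hw)]. rewrite <- re_minus. apply re_le_Cmod.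
Qed.

Lemma Vcont_Cmod F z : Ccont F z -> Vcont (fun w => Cmod (F w)) z.
Proof.
 intros H eps He. destruct (H eps He) as [d [Hd X]]. exists d; split; auto. intros w Hw.
 specialize (X w Hw). assert (A := Cmod_triangle_rev (F w) (F z)). assert (B := Cmod_triangle_rev (F z) (F w)).
 rewrite (Cmod_minus_sym (F z)) in B. apply Rabs_def1; lra.
Qed.

Lemma Vcont_mult u v z : Vcont u z -> Vcont v z -> Vcont (fun w => u w * v w) z.
Proof.
 intros Hu Hv.
 assert (H : Ccont (fun w => RtoC (u w) * RtoC (v w))%C z).
 { apply Ccont_mult; intros eps He; [destruct (Hu eps He) as [d [Hd X]]|destruct (Hv eps He) as [d [Hd X]]];
  exists d; split; auto; intros w Hw; rewrite <- RtoC_minus, Cmod_R; auto. }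
 intros eps He. destruct (H eps He) as [d [Hd X]]. exists d; split; auto. intros w Hw.
 specialize (X w Hw). rewrite <- !RtoC_mult, <- RtoC_minus, Cmod_R in X. exact X.
Qed.

Lemma shifted_circle_curve F F' z d r : (forall w, Cmod (w - z) < d -> Cder F w (F' w)) -> 0 < r < d ->
 curve_on (fun t => F (z + polar r t)%C) 0 (2 * PI).
Proof.
 intros HF Hr t _. apply (curve_comp F (fun t => z + polar r t)%C). apply curve_plus. apply curve_const. apply polar_curve.
 apply Cder_cont with (F' (z + polar r t)%C), HF.
 replace (z + polar r t - z)%C with (polar r t) by ring. rewrite Cmod_polar; lra.
Qed.

Lemma submean_Re F F' z d : 0 < d -> (forall w, Cmod (w - z) < d -> Cder F w (F' w)) -> submean (fun w => Re (F w)) z.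
Proof.
 intros Hd HF. exists d. split; auto. intros r Hr.
 assert (E := mean_value_local F F' z d r HF Hr).
 apply (f_equal fst) in E. unfold CInt, Re in *; simpl in *. rewrite E. lra.
Qed.

(** Pointwise |F w|^2 >= 2 Re (conj (F z) F w) - |F z|^2, and the right side is harmonic in w with
    value |F z|^2 at z. The square keeps the argument free of any discussion of zeros of F. *)
Lemma submean_Cmod2 F F' z d : 0 < d -> (forall w, Cmod (w - z) < d -> Cder F w (F' w)) ->
 submean (fun w => Cmod (F w) * Cmod (F w)) z.
Proof.
 intros Hd HF. exists d. split; auto. intros r Hr. pose proof two_PI_pos.
 assert (HC := shifted_circle_curve F F' z d r HF Hr).
 assert (E := mean_value_local F F' z d r HF Hr).
 assert (E2 : RInt (fun t => Re (2 * Cconj (F z) * F (z + polar r t)%C)%C) 0 (2 * PI) = 2 * PI * (2 * (Cmod (F z) * Cmod (F z)))).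
 { assert (E3 := CInt_scal (2 * Cconj (F z))%C _ 0 (2 * PI) ltac:(lra) HC). rewrite E in E3.
  transitivity (Re (2 * Cconj (F z) * (RtoC (2 * PI) * F z))%C). exact (f_equal fst E3).
  rewrite Cmod_sqr. C_ring. }
 assert (X1 : ex_RInt (fun t => Re (2 * Cconj (F z) * F (z + polar r t)%C)%C) 0 (2 * PI)).
 { apply (curve_on_ex_re (fun t => 2 * Cconj (F z) * F (z + polar r t)%C)%C). lra.
  intros t Ht. apply curve_mult. apply curve_const. apply HC; auto. }
 apply Rle_trans with (RInt (fun t => Re (2 * Cconj (F z) * F (z + polar r t)%C)%C + - (Cmod (F z) * Cmod (F z))) 0 (2 * PI)).
 - rewrite RInt_plus_R, E2, RInt_const; auto. 2: apply ex_RInt_const.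
  unfold scal; simpl; unfold mult; simpl. lra.
 - apply RInt_le. lra. apply ex_RInt_plus_R; auto. apply ex_RInt_const.
  + apply ex_RInt_continuous_R. intros t Ht. rewrite Rmin_left, Rmax_right in Ht by lra.
   apply (continuous_Rmult); apply (continuous_Cmod (fun t => F (z + polar r t)%C)); auto.
  + intros t Ht. rewrite !Cmod_sqr. generalize (F (z + polar r t)%C). intros q. unfold Re, Im; simpl.
   pose proof (Rle_0_sqr (fst (F z) - fst q)). pose proof (Rle_0_sqr (snd (F z) - snd q)). unfold Rsqr in *. lra.
Qed.

(** The quotient F z / z is holomorphic by [divided_difference]; at the boundary |z| tends to 1, so
    the bound k for F passes to the quotient, whose value at 0 is F' 0. *)
Theorem Schwarz_disc F F' k : holo F F' -> F 0 = 0 -> (forall z, inD z -> Cmod (F z) <= k) ->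
 (forall z, inD z -> Cmod (F z) <= k * Cmod z) /\ Cmod (F' 0) <= k.
Proof.
 intros HF H0 Hk.
 destruct (divided_difference F F' 0 HF inD0) as [Q [Q' [HQ [Q0 EQ]]]].
 assert (EQ' : forall z, F z = (z * Q z)%C).
 { intros z. specialize (EQ z). rewrite H0 in EQ. replace (F z) with (F z - 0)%C by ring. rewrite EQ. ring. }
 assert (Hk0 : 0 <= k). { pose proof (Hk 0 inD0). Cnneg (F 0). lra. }
 assert (HD : Copen inD).
 { intros z Hz. exists (1 - Cmod z). unfold inD in *. split; [lra|]. intros w Hw.
  assert (X := Cmod_triangle_rev w z). lra. }
 assert (B : forall z, inD z -> Cmod (Q z) * Cmod (Q z) <= k * k).
 { apply (maximum_principle inD).
  - exact HD.
  - unfold inD; intros; lra.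
  - intros z Hz. apply Vcont_mult; apply Vcont_Cmod; apply (holo_cont _ _ HQ); auto.
  - intros z Hz. destruct (HD z Hz) as [d [Hd X]]. apply submean_Cmod2 with Q' d; auto.
  - intros u l M' HM' Hu Hl Hnl Hall.
   assert (HL : 1 <= Cmod l) by (unfold inD in Hnl; lra).
   assert (Hcv := Clim_Cmod _ _ Hl).
   assert (Hin : M' * (Cmod l * Cmod l) <= k * k).
   { apply (Un_cv_le (fun n => M' * (Cmod (u n) * Cmod (u n))) (fun _ => k * k)).
    - apply (CV_mult (fun _ => M') (fun n => Cmod (u n) * Cmod (u n))). apply Un_cv_const. apply (CV_mult _ _ _ _ Hcv Hcv).
    - apply Un_cv_const.
    - exists O. intros n _. specialize (Hall n). specialize (Hk _ (Hu n)). rewrite EQ', Cmod_mult in Hk.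
     Cnneg (u n). Cnneg (Q (u n)).
     apply Rle_trans with ((Cmod (Q (u n)) * Cmod (Q (u n))) * (Cmod (u n) * Cmod (u n))).
     + apply Rmult_le_compat_r; nra.
     + assert (0 <= Cmod (u n) * Cmod (Q (u n))) by nra.
      replace (Cmod (Q (u n)) * Cmod (Q (u n)) * (Cmod (u n) * Cmod (u n))) with
       ((Cmod (u n) * Cmod (Q (u n))) * (Cmod (u n) * Cmod (Q (u n)))) by ring.
      apply Rmult_le_compat; auto. }
   assert (0 <= k * k) by nra. assert (1 <= Cmod l * Cmod l) by nra. nra. }
 assert (B' : forall z, inD z -> Cmod (Q z) <= k).
 { intros z Hz. specialize (B z Hz). Cnneg (Q z). nra. }
 split.
 - intros z Hz. rewrite EQ', Cmod_mult, Rmult_comm. apply Rmult_le_compat_r. apply Cmod_ge_0. auto.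
 - rewrite <- Q0. apply B', inD0.
Qed.

(** * Exponential, logarithm and inverse functions *)

Definition Cexp (z : C) : C := (exp (Re z) * cos (Im z), exp (Re z) * sin (Im z)).
(** Principal logarithm on the right half-plane: the arctangent formula for the argument is
    meaningful for Re z > 0, and all uses are there. *)
Definition Clog (z : C) : C := (ln (Cmod z), atan (Im z / Re z)).

Lemma Cexp_plus z w : Cexp (z + w) = (Cexp z * Cexp w)%C.
Proof.
 unfold Cexp. apply Ceq; unfold Re, Im; simpl; rewrite exp_plus, cos_plus || rewrite exp_plus, sin_plus; ring.
Qed.

Lemma Cexp_0 : Cexp 0 = 1.
Proof. unfold Cexp, Re, Im; simpl. rewrite exp_0, cos_0, sin_0. apply Ceq; simpl; ring. Qed.

Lemma Cmod_Cexp z : Cmod (Cexp z) = exp (Re z).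
Proof.
 replace (Cexp z) with (polar (exp (Re z)) (Im z)) by reflexivity.
 apply Cmod_polar. apply Rlt_le, exp_pos.
Qed.

Lemma derivable_small (f : R -> R) l : derivable_pt_lim f 0 l -> forall e, 0 < e -> exists d, 0 < d /\
 forall x, Rabs x < d -> Rabs (f x - f 0 - l * x) <= e * Rabs x.
Proof.
 intros H e He. destruct (H e He) as [d Hd]. exists d. split. apply cond_pos.
 intros x Hx. destruct (Req_dec x 0) as [->|Hne].
 - rewrite Rminus_diag, Rmult_0_r, Rminus_0_r, !Rabs_R0. lra.
 - specialize (Hd x Hne Hx). rewrite Rplus_0_l in Hd.
  replace (f x - f 0 - l * x) with (((f x - f 0) / x - l) * x) by (field; auto).
  rewrite Rabs_mult. apply Rmult_le_compat_r. apply Rabs_pos. lra.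
Qed.

Lemma Cexp_Cder_0 : Cder Cexp 0 1.
Proof.
 intros eps He.
 set (e := Rmin 1 (eps / 8)). assert (He0 : 0 < e) by (apply Rmin_pos; lra).
 assert (e <= 1) by apply Rmin_l. assert (e <= eps / 8) by apply Rmin_r.
 destruct (derivable_small exp (exp 0) (derivable_pt_lim_exp 0) e He0) as [d1 [Hd1 X1]].
 destruct (derivable_small cos (- sin 0) (derivable_pt_lim_cos 0) e He0) as [d2 [Hd2 X2]].
 destruct (derivable_small sin (cos 0) (derivable_pt_lim_sin 0) e He0) as [d3 [Hd3 X3]].
 rewrite exp_0 in X1. rewrite sin_0, cos_0 in X2. rewrite sin_0, cos_0 in X3.
 exists (Rmin e (Rmin d1 (Rmin d2 d3))). split. apply Rmin_pos; [exact He0|repeat apply Rmin_pos; auto].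
 intros w. replace (w - 0)%C with w by ring. rewrite Cexp_0. intros Hw.
 assert (Hwe := Rlt_le_trans _ _ _ Hw (Rmin_l _ _)).
 assert (Hw0 := Rlt_le_trans _ _ _ Hw (Rmin_r _ _)).
 assert (Hw1 := Rlt_le_trans _ _ _ Hw0 (Rmin_l _ _)).
 assert (Hw2 := Rlt_le_trans _ _ _ Hw0 (Rle_trans _ _ _ (Rmin_r _ _) (Rmin_l _ _))).
 assert (Hw3 := Rlt_le_trans _ _ _ Hw0 (Rle_trans _ _ _ (Rmin_r _ _) (Rmin_r _ _))).
 pose proof (re_le_Cmod w) as Hr. pose proof (im_le_Cmod w) as Hi.
 set (x := Re w) in *. set (y := Im w) in *. set (m := Cmod w) in *.
 specialize (X1 x ltac:(lra)). specialize (X2 y ltac:(lra)). specialize (X3 y ltac:(lra)).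
 le_via Cmod_le_re_im.
 replace (Re (Cexp w - 1 - 1 * w)) with ((exp x - 1 - 1 * x) * cos y + (1 + x) * (cos y - 1 - - 0 * y)).
 2:{ unfold x, y, Cexp, Re, Im; simpl. ring. }
 replace (Im (Cexp w - 1 - 1 * w)) with ((exp x - 1) * sin y + (sin y - 0 - 1 * y)).
 2:{ unfold x, y, Cexp, Re, Im; simpl. ring. }
 assert (Hcos : Rabs (cos y) <= 1) by (apply Rabs_le; pose proof (COS_bound y); lra).
 set (A := exp x - 1 - 1 * x) in *. set (B := cos y - 1 - - 0 * y) in *. set (S := sin y - 0 - 1 * y) in *.
 assert (T1 : Rabs (A * cos y + (1 + x) * B) <= e * m + 2 * (e * m)).
 { le_via Rabs_triang. rewrite !Rabs_mult.
  assert (Rabs (1 + x) <= 2). { le_via Rabs_triang. rewrite Rabs_R1. lra. }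
  pose proof (Rabs_pos A). pose proof (Rabs_pos B). pose proof (Rabs_pos x). pose proof (Rabs_pos (cos y)).
  assert (Rabs A <= e * m) by nra. assert (Rabs B <= e * m) by nra. nra. }
 assert (T2 : Rabs ((exp x - 1) * sin y + S) <= 4 * e * m + e * m).
 { le_via Rabs_triang. rewrite Rabs_mult.
  assert (Rabs (exp x - 1) <= 2 * m).
  { replace (exp x - 1) with (A + x) by (unfold A; ring). le_via Rabs_triang.
   pose proof (Rabs_pos x). nra. }
  assert (Rabs (sin y) <= 2 * m).
  { replace (sin y) with (S + y) by (unfold S; ring). le_via Rabs_triang.
   pose proof (Rabs_pos y). nra. }
  pose proof (Rabs_pos (exp x - 1)). pose proof (Rabs_pos (sin y)).
  assert (Rabs (exp x - 1) * Rabs (sin y) <= (2 * m) * (2 * m)) by (apply Rmult_le_compat; auto).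
  assert (0 <= m) by apply Cmod_ge_0. pose proof (Rabs_pos y). nra. }
 assert (0 <= m) by apply Cmod_ge_0. nra.
Qed.

Lemma Cexp_Cder z : Cder Cexp z (Cexp z).
Proof.
 apply Cder_ext with (fun w => Cexp z * Cexp (w - z))%C.
 { intros w. rewrite <- Cexp_plus. f_equal. ring. }
 cut (Cder (fun w => Cexp z * Cexp (w - z))%C z (Cexp z * (1 * (1 - 0)))).
 { replace (Cexp z * (1 * (1 - 0)))%C with (Cexp z) by ring. auto. }
 apply (Cder_scal (Cexp z) (fun w => Cexp (w - z))).
 apply (Cder_comp (fun w => w - z)%C Cexp).
 apply (Cder_minus (fun w => w) (fun _ => z)). apply Cder_id. apply Cder_const.
 replace (z - z)%C with (RtoC 0) by ring. apply Cexp_Cder_0.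
Qed.

(** Continuity of the inverse being given, the expansion of [F] at [G w] forces |G x - G w| <= 2 |x
    - w| / |l| near w, and solving it for G x - G w gives the expansion of [G]. *)
Lemma Cder_inverse (F G : C -> C) (w l : C) : Cder F (G w) l -> l <> 0 -> Ccont G w ->
 (exists d, 0 < d /\ forall x, Cmod (x - w) < d -> F (G x) = x) -> Cder G w (/ l).
Proof.
 intros HF Hl HG [d0 [Hd0 E]] eps He.
 assert (Hlp : 0 < Cmod l) by (apply Cmod_gt_0; auto).
 set (e := Rmin (Cmod l / 2) (eps * (Cmod l * Cmod l) / 2)).
 assert (He0 : 0 < e) by (apply Rmin_pos; [lra|]; assert (0 < Cmod l * Cmod l) by nra; nra).
 destruct (HF e He0) as [d1 [Hd1 X]]. destruct (HG d1 Hd1) as [d2 [Hd2 Y]].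
 exists (Rmin d0 d2). split. apply Rmin_pos; auto. intros x Hx.
 specialize (Y x (lt_min_r Hx)).
 specialize (X _ Y).
 assert (Ex := E x (lt_min_l Hx)).
 assert (Ew : F (G w) = w). { apply E. rewrite Cmod_diag; auto. }
 rewrite Ex, Ew in X. set (D := (G x - G w)%C) in *. set (dx := (x - w)%C) in *.
 replace (D - / l * dx)%C with (- (/ l * (dx - l * D)))%C by (field; auto).
 rewrite Cmod_opp, Cmod_mult, Cmod_inv by auto.
 assert (HD : Cmod l * Cmod D <= 2 * Cmod dx).
 { assert (A := Cmod_triangle_rev (l * D) dx). rewrite Cmod_minus_sym, Cmod_mult in A.
  assert (e <= Cmod l / 2) by apply Rmin_l. Cnneg D. nra. }
 assert (e <= eps * (Cmod l * Cmod l) / 2) by apply Rmin_r.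
 apply Rmult_le_reg_l with (Cmod l * Cmod l). nra.
 replace (Cmod l * Cmod l * (/ Cmod l * Cmod (dx - l * D))) with (Cmod l * Cmod (dx - l * D)) by (field; lra).
 apply Rle_trans with (Cmod l * (e * Cmod D)). apply Rmult_le_compat_l; lra.
 Cnneg D. Cnneg dx.
 apply Rle_trans with (e * (2 * Cmod dx)). nra.
 apply Rle_trans with (eps * (Cmod l * Cmod l) / 2 * (2 * Cmod dx)). apply Rmult_le_compat_r; lra.
 right. field.
Qed.

Lemma Cexp_Clog z : 0 < Re z -> Cexp (Clog z) = z.
Proof.
 intros Hz. unfold Cexp. change (Re (Clog z)) with (ln (Cmod z)). change (Im (Clog z)) with (atan (Im z / Re z)).
 assert (Hm : 0 < Cmod z). { eapply Rlt_le_trans; [exact Hz|]. eapply Rle_trans; [apply Rle_abs|apply re_le_Cmod]. }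
 rewrite exp_ln by auto. rewrite cos_atan, sin_atan.
 assert (Hs : sqrt (1 + Rsqr (Im z / Re z)) = Cmod z / Re z).
 { apply Rsqr_inj. apply sqrt_pos. apply Rlt_le, Rdiv_lt_0_compat; auto.
  rewrite Rsqr_sqrt. unfold Rsqr.
  replace (Cmod z / Re z * (Cmod z / Re z)) with ((Cmod z * Cmod z) / (Re z * Re z)) by (field; lra).
  rewrite Cmod_sqr. field; lra. pose proof (Rle_0_sqr (Im z / Re z)). lra. }
 rewrite Hs. apply Ceq; unfold Re, Im in *; simpl; field; lra.
Qed.

Lemma continuity_pt_Reps (u : R -> R) t : continuity_pt u t -> forall eps, 0 < eps ->
 exists d, 0 < d /\ forall s, Rabs (s - t) < d -> Rabs (u s - u t) < eps.
Proof. intros H. apply continuity_pt_filterlim in H. apply continuous_Reps. exact H. Qed.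

Lemma Clog_cont z : 0 < Re z -> Ccont Clog z.
Proof.
 intros Hz.
 assert (Hm : 0 < Cmod z). { eapply Rlt_le_trans; [exact Hz|]. eapply Rle_trans; [apply Rle_abs|apply re_le_Cmod]. }
 assert (H1 : Vcont (fun w => ln (Cmod w)) z).
 { intros eps He. assert (Hc : continuity_pt ln (Cmod z)) by (apply derivable_continuous_pt; exists (/ Cmod z); apply derivable_pt_lim_ln; auto).
  destruct (continuity_pt_Reps _ _ Hc eps He) as [d [Hd X]].
  destruct (Vcont_Cmod (fun w => w) z (Ccont_id z) d Hd) as [d' [Hd' Y]]. exists d'; split; auto. }
 assert (H2 : Vcont (fun w => atan (Im w / Re w)) z).
 { intros eps He. assert (Hc : continuity_pt atan (Im z / Re z)) by (apply derivable_continuous_pt, derivable_pt_atan).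
  destruct (continuity_pt_Reps _ _ Hc eps He) as [d [Hd X]].
  assert (Hq : Vcont (fun w => Im w * / Re w) z).
  { apply Vcont_mult.
   - intros e0 He0. exists e0; split; auto. intros w Hw. rewrite <- im_minus. eapply Rle_lt_trans; [apply im_le_Cmod|auto].
   - intros e0 He0. assert (Hci : continuity_pt Rinv (Re z)).
    { apply (continuity_pt_inv id). apply derivable_continuous_pt, derivable_pt_id. unfold id; lra. }
    destruct (continuity_pt_Reps _ _ Hci e0 He0) as [d0 [Hd0 X0]].
    exists d0; split; auto. intros w Hw. apply X0. rewrite <- re_minus. eapply Rle_lt_trans; [apply re_le_Cmod|auto]. }
  destruct (Hq d Hd) as [d' [Hd' Y]]. exists d'; split; auto. intros w Hw. apply X. exact (Y w Hw). }
 intros eps He. destruct (H1 (eps / 2)) as [d1 [Hd1 X1]]; [lra|]. destruct (H2 (eps / 2)) as [d2 [Hd2 X2]]; [lra|].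
 exists (Rmin d1 d2). split. apply Rmin_pos; auto. intros w Hw.
 specialize (X1 w (lt_min_l Hw)). specialize (X2 w (lt_min_r Hw)).
 lt_via Cmod_le_re_im. rewrite re_minus, im_minus. simpl. lra.
Qed.

Lemma Clog_Cder z : 0 < Re z -> Cder Clog z (/ z).
Proof.
 intros Hz. apply (Cder_inverse Cexp).
 - rewrite <- (Cexp_Clog z Hz) at 2. apply Cexp_Cder.
 - intros E. rewrite E in Hz. simpl in Hz. lra.
 - apply Clog_cont; auto.
 - exists (Re z). split; auto. intros x Hx. apply Cexp_Clog.
  assert (A := re_le_Cmod (x - z)). rewrite re_minus in A. apply Rabs_le_between in A. lra.
Qed.

Lemma zero_derivative_constant F : holo F (fun _ => 0) -> forall z, inD z -> F z = F 0.
Proof.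
 intros HF z Hz.
 assert (E := SInt_primitive F (fun _ => RtoC 0) 0 z HF (fun w _ => Ccont_const 0 w) inD0 Hz).
 unfold SInt in E. rewrite CInt_const in E. apply Ceq_minus. rewrite <- E. ring.
Qed.

(** L is the primitive of F'/F vanishing at 0; the product F exp(-L) has zero derivative, hence is
    1. *)
Theorem holo_logarithm F F' : holo F F' -> (forall z, inD z -> F z <> 0) -> F 0 = 1 ->
 exists L L', holo L L' /\ L 0 = 0 /\ forall z, inD z -> Cexp (L z) = F z.
Proof.
 intros HF Hnz H0. destruct (holo_derivative F F' HF) as [F'' HF''].
 destruct (primitive_exists (fun z => F' z / F z)%C (fun z => (F'' z * F z - F' z * F' z) / (F z * F z))%C) as [L [L0 HL]].
 { intros z Hz. apply (Cder_div F' F); auto. }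
 exists L, (fun z => F' z / F z)%C. repeat split; auto.
 set (Q := fun z => (F z * Cexp (- L z))%C).
 assert (HQ : holo Q (fun _ => 0)).
 { intros z Hz. replace (RtoC 0) with (F' z * Cexp (- L z) + F z * (Cexp (- L z) * - (F' z / F z)))%C.
  - apply (Cder_mult F (fun z => Cexp (- L z))); auto.
   apply (Cder_comp (fun z => - L z)%C Cexp). apply Cder_opp; auto. apply Cexp_Cder.
  - field. auto. }
 intros z Hz. assert (E := zero_derivative_constant Q HQ z Hz). unfold Q in E.
 rewrite H0, L0 in E. replace (- 0)%C with (RtoC 0) in E by ring. rewrite Cexp_0 in E.
 assert (E2 : (Cexp (L z) * Cexp (- L z))%C = 1) by (rewrite <- Cexp_plus, <- Cexp_0; f_equal; ring).
 transitivity (Cexp (L z) * (F z * Cexp (- L z)))%C. rewrite E. ring.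
 transitivity (F z * (Cexp (L z) * Cexp (- L z)))%C. ring. rewrite E2. ring.
Qed.

(** * Arguments and crossing curves *)

(** A relation and not a choice: every determination is allowed, and 0 has all arguments. Continuous
    determinations are built where they are wanted. *)
Definition isarg (z : C) (th : R) : Prop := z = polar (Cmod z) th.

Lemma polar_mult r a s b : (polar r a * polar s b)%C = polar (r * s) (a + b).
Proof. unfold polar. apply Ceq; unfold Re, Im; simpl; rewrite ?cos_plus, ?sin_plus; ring. Qed.

Lemma isarg_mult z w a b : isarg z a -> isarg w b -> isarg (z * w) (a + b).
Proof. unfold isarg. intros Hz Hw. rewrite Cmod_mult, <- polar_mult, <- Hz, <- Hw. reflexivity. Qed.

Lemma isarg_polar r a : 0 <= r -> isarg (polar r a) a.
Proof. intros Hr. unfold isarg. rewrite Cmod_polar; auto. Qed.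

Lemma isarg_Re z a : isarg z a -> Re z = Cmod z * cos a.
Proof. intros H. unfold isarg in H. rewrite H at 1. reflexivity. Qed.

Lemma isarg_Im z a : isarg z a -> Im z = Cmod z * sin a.
Proof. intros H. unfold isarg in H. rewrite H at 1. reflexivity. Qed.

Lemma isarg_Clog z : 0 < Re z -> isarg z (Im (Clog z)).
Proof.
 intros Hz. unfold isarg. rewrite <- (Cexp_Clog z Hz) at 1.
 assert (0 < Cmod z). { eapply Rlt_le_trans; [exact Hz|]. eapply Rle_trans; [apply Rle_abs|apply re_le_Cmod]. }
 unfold Cexp, polar. change (Re (Clog z)) with (ln (Cmod z)). rewrite exp_ln; auto.
Qed.

Lemma isarg_scal c z a : 0 <= c -> isarg z a -> isarg (RtoC c * z) a.
Proof.
 intros Hc Hz. replace a with (0 + a) by ring. apply isarg_mult; auto.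
 unfold isarg, polar. rewrite cos_0, sin_0, Cmod_R, Rabs_right by lra. C_eq.
Qed.

Lemma isarg_2PI z a : isarg z a -> isarg z (a + 2 * PI).
Proof. unfold isarg, polar. rewrite cos_plus, sin_plus, cos_2PI, sin_2PI. intros H. rewrite H at 1.
 C_eq. Qed.

Lemma isarg_2PI_minus z a : isarg z a -> isarg z (a - 2 * PI).
Proof. unfold isarg, polar. rewrite cos_minus, sin_minus, cos_2PI, sin_2PI. intros H. rewrite H at 1.
 C_eq. Qed.

Fixpoint Rsum (f : nat -> R) (n : nat) : R :=
 match n with O => 0 | S k => Rsum f k + f k end.

Lemma Rsum_continuous (f : nat -> R -> R) n t : (forall i, (i < n)%nat -> continuous (f i) t) ->
 continuous (fun s => Rsum (fun i => f i s) n) t.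
Proof.
 intros H. induction n; simpl. apply continuous_const.
 apply (continuous_plus (fun s => Rsum (fun i => f i s) n) (f n)); auto.
Qed.

Lemma curve_reparam (f : R -> C) (u : R -> R) t : curve f (u t) -> continuous u t -> curve (fun s => f (u s)) t.
Proof.
 rewrite !curve_eps, continuous_Reps. intros Hf Hu eps He. destruct (Hf eps He) as [d [Hd X]].
 destruct (Hu d Hd) as [d' [Hd' Y]]. exists d'; split; auto.
Qed.

Lemma curve_on_uniform A : curve_on A 0 1 -> forall eps, 0 < eps -> exists d, 0 < d /\
 forall s t, 0 <= s <= 1 -> 0 <= t <= 1 -> Rabs (s - t) < d -> Cmod (A s - A t) < eps.
Proof.
 intros HA eps He. apply NNPP. intros Hn.
 assert (H : forall n, exists p : R * R, 0 <= fst p <= 1 /\ 0 <= snd p <= 1 /\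
   Rabs (fst p - snd p) < / INR (S n) /\ eps <= Cmod (A (fst p) - A (snd p))).
 { intros n. apply NNPP. intros H. apply Hn. exists (/ INR (S n)). split. apply inv_INR_pos.
  intros s t Hs Ht Hst. apply Rnot_le_lt. intros Hc. apply H. exists (s, t). simpl. auto. }
 apply choice in H. destruct H as [p Hp].
 destruct (BW_R (fun n => fst (p n)) 0 1) as [x [l [Hx [Hl Hl01]]]]. { intros n. apply Hp. }
 specialize (HA l Hl01). rewrite curve_eps in HA. destruct (HA (eps / 2)) as [d [Hd X]]; [lra|].
 destruct (Hl (d / 2)) as [N1 HN1]; [lra|].
 destruct (inv_INR_small (d / 2)) as [N2 HN2]; [lra|].
 set (n := (N1 + N2)%nat). specialize (HN1 n ltac:(unfold n; lia)). unfold Rdist in HN1.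
 pose proof (extraction_ge x Hx n). specialize (HN2 (x n) ltac:(unfold n in *; lia)).
 destruct (Hp (x n)) as [_ [_ [H1 H2]]].
 set (a := fst (p (x n))) in *. set (b := snd (p (x n))) in *.
 assert (Xa := X a ltac:(lra)).
 assert (Xb := X b). assert (Rabs (b - l) < d).
 { replace (b - l) with (- (a - b) + (a - l)) by ring. lt_via Rabs_triang. rewrite Rabs_Ropp. lra. }
 specialize (Xb H0). assert (Y := Cmod_triangle3 (A a) (A l) (A b)). rewrite (Cmod_minus_sym (A l)) in Y. lra.
Qed.

Lemma disjoint_curves_distance A B : curve_on A 0 1 -> curve_on B 0 1 ->
 (forall s t, 0 <= s <= 1 -> 0 <= t <= 1 -> A s <> B t) ->
 exists m, 0 < m /\ forall s t, 0 <= s <= 1 -> 0 <= t <= 1 -> m <= Cmod (A s - B t).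
Proof.
 intros HA HB Hd. apply NNPP. intros Hn.
 assert (H : forall n, exists p : R * R, 0 <= fst p <= 1 /\ 0 <= snd p <= 1 /\
   Cmod (A (fst p) - B (snd p)) < / INR (S n)).
 { intros n. apply NNPP. intros H. apply Hn. exists (/ INR (S n)). split. apply inv_INR_pos.
  intros s t Hs Ht. apply Rnot_lt_le. intros Hc. apply H. exists (s, t). simpl. auto. }
 apply choice in H. destruct H as [p Hp].
 destruct (BW_R (fun n => fst (p n)) 0 1) as [x [a [Hx [Ha Ha01]]]]. { intros n. apply Hp. }
 destruct (BW_R (fun n => snd (p (x n))) 0 1) as [y [b [Hy [Hb Hb01]]]]. { intros n. apply Hp. }
 apply (Hd a b Ha01 Hb01). apply Ceq_minus. apply Cmod_eq_0.
 apply Rle_antisym; [|apply Cmod_ge_0]. apply Rnot_lt_le. intros Hc. set (e := Cmod (A a - B b)) in *.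
 destruct (proj1 (curve_eps A a) (HA a Ha01) (e / 4)) as [d1 [Hd1 X1]]; [lra|].
 destruct (proj1 (curve_eps B b) (HB b Hb01) (e / 4)) as [d2 [Hd2 X2]]; [lra|].
 apply (Un_cv_ext_sub _ _ y Hy) in Ha.
 destruct (Ha d1 Hd1) as [N1 HN1]. destruct (Hb d2 Hd2) as [N2 HN2].
 destruct (inv_INR_small (e / 4)) as [N3 HN3]; [lra|].
 set (n := (N1 + N2 + N3)%nat). specialize (HN1 n ltac:(unfold n; lia)). specialize (HN2 n ltac:(unfold n; lia)).
 assert (Hxy := extraction_comp x y Hx Hy). pose proof (extraction_ge _ Hxy n).
 specialize (HN3 (x (y n)) ltac:(unfold n in *; lia)). destruct (Hp (x (y n))) as [_ [_ H1]].
 unfold Rdist in *. specialize (X1 _ HN1). specialize (X2 _ HN2).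
 set (u := A (fst (p (x (y n))))) in *. set (v := B (snd (p (x (y n))))) in *.
 assert (e <= Cmod (A a - u) + (Cmod (u - v) + Cmod (v - B b))).
 { unfold e. le_via (Cmod_triangle3 _ u _). apply Rplus_le_compat_l, Cmod_triangle3. }
 rewrite (Cmod_minus_sym (A a)) in H0. lra.
Qed.

Lemma Re_near_1 q : Cmod (q - 1) < 1 -> 0 < Re q.
Proof.
 intros H. assert (A := re_le_Cmod (q - 1)). rewrite re_minus in A. simpl in A.
 apply Rabs_le_between in A. lra.
Qed.

(** The argument is followed along the straight path from (0,0) to (s,t), cut into n steps. For n
    large, successive values of A - B have quotients in the right half-plane, and the lift is th0
    plus the sum of the n principal arguments, each continuous in s and in t. *)
Lemma lift_difference A B th0 : (forall t, curve A t) -> (forall t, curve B t) ->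
 (forall s t, 0 <= s <= 1 -> 0 <= t <= 1 -> A s <> B t) -> isarg (A 0 - B 0) th0 ->
 exists psi : R -> R -> R, psi 0 0 = th0 /\ forall s t, 0 <= s <= 1 -> 0 <= t <= 1 ->
  isarg (A s - B t) (psi s t) /\ continuous (fun s => psi s t) s /\ continuous (fun t => psi s t) t.
Proof.
 intros HA HB Hd Hth.
 assert (HA' : curve_on A 0 1) by (intros t _; auto). assert (HB' : curve_on B 0 1) by (intros t _; auto).
 destruct (disjoint_curves_distance A B HA' HB' Hd) as [m [Hm Hlow]].
 destruct (curve_on_uniform A HA' (m / 2)) as [d1 [Hd1 U1]]; [lra|].
 destruct (curve_on_uniform B HB' (m / 2)) as [d2 [Hd2 U2]]; [lra|].
 destruct (inv_INR_small (Rmin d1 d2)) as [N HN]. apply Rmin_pos; auto.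
 specialize (HN N (Nat.le_refl _)). set (n := S N) in *.
 assert (Hn0 : 0 < INR n) by (apply lt_0_INR; unfold n; lia).
 set (H := fun s t i => (A (INR i * s / INR n)%R - B (INR i * t / INR n)%R)%C).
 set (q := fun s t i => (H s t (S i) / H s t i)%C).
 assert (Hin : forall i s, (i <= n)%nat -> 0 <= s <= 1 -> 0 <= INR i * s / INR n <= 1).
 { intros i s Hi Hs. assert (0 <= INR i <= INR n) by (split; [apply pos_INR|apply le_INR; auto]).
  split. apply Rmult_le_pos. nra. apply Rlt_le, Rinv_0_lt_compat; auto.
  apply Rmult_le_reg_r with (INR n); auto. unfold Rdiv. rewrite Rmult_assoc, Rinv_l by lra. nra. }
 assert (Hstep : forall i s, (i < n)%nat -> 0 <= s <= 1 -> Rabs (INR (S i) * s / INR n - INR i * s / INR n) < Rmin d1 d2).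
 { intros i s Hi Hs. rewrite S_INR. replace ((INR i + 1) * s / INR n - INR i * s / INR n) with (s * / INR n) by (field; lra).
  assert (0 < / INR n) by (apply Rinv_0_lt_compat; auto).
  rewrite Rabs_right by nra. nra. }
 assert (HH : forall i s t, (i <= n)%nat -> 0 <= s <= 1 -> 0 <= t <= 1 -> m <= Cmod (H s t i)).
 { intros i s t Hi Hs Ht. apply Hlow; apply Hin; auto. }
 assert (Hq : forall i s t, (i < n)%nat -> 0 <= s <= 1 -> 0 <= t <= 1 -> 0 < Re (q s t i)).
 { intros i s t Hi Hs Ht. apply Re_near_1.
  assert (Hp := HH i s t ltac:(lia) Hs Ht).
  assert (Hnz : H s t i <> 0) by (apply Cmod_gt_0; lra).
  replace (q s t i - 1)%C with ((H s t (S i) - H s t i) / H s t i)%C by (unfold q; field; auto).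
  rewrite Cmod_div by auto. apply Rmult_lt_reg_r with (Cmod (H s t i)). lra.
  unfold Rdiv. rewrite Rmult_assoc, Rinv_l, Rmult_1_r, Rmult_1_l by lra.
  apply Rlt_le_trans with m; auto.
  replace (H s t (S i) - H s t i)%C with ((A (INR (S i) * s / INR n)%R - A (INR i * s / INR n)%R) - (B (INR (S i) * t / INR n)%R - B (INR i * t / INR n)%R))%C by (unfold H; ring).
  lt_via Cmod_minus_le.
  assert (Cmod (A (INR (S i) * s / INR n)%R - A (INR i * s / INR n)%R) < m / 2).
  { apply U1; try (apply Hin; auto; lia). eapply Rlt_le_trans; [apply Hstep; auto|apply Rmin_l]. }
  assert (Cmod (B (INR (S i) * t / INR n)%R - B (INR i * t / INR n)%R) < m / 2).
  { apply U2; try (apply Hin; auto; lia). eapply Rlt_le_trans; [apply Hstep; auto|apply Rmin_r]. }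
  lra. }
 set (psi := fun s t => th0 + Rsum (fun i => Im (Clog (q s t i))) n).
 assert (Hlin : forall i t, continuous (fun s => INR i * s / INR n) t).
 { intros i t. smooth. }
 assert (HAc : forall i t, curve (fun s => A (INR i * s / INR n)%R) t).
 { intros i t. apply (curve_reparam A (fun s => INR i * s / INR n)); auto. }
 assert (HBc : forall i t, curve (fun s => B (INR i * s / INR n)%R) t).
 { intros i t. apply (curve_reparam B (fun s => INR i * s / INR n)); auto. }
 exists psi. split.
 - unfold psi. assert (Z : forall k, (k <= n)%nat -> Rsum (fun i => Im (Clog (q 0 0 i))) k = 0).
  { induction k; intros Hk; cbn [Rsum]; auto. rewrite IHk by lia.
   assert (E : q 0 0 k = 1).
   { unfold q, H. rewrite !Rmult_0_r. unfold Rdiv. rewrite Rmult_0_l.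
    field. intros E. apply (Hd 0 0); try lra. apply Ceq_minus; auto. }
   rewrite E. unfold Clog; simpl. unfold Rdiv. rewrite Rmult_0_l, atan_0. ring. }
  rewrite Z by lia. ring.
 - intros s t Hs Ht. split; [|split].
  + assert (Z : forall k, (k <= n)%nat -> isarg (H s t k) (th0 + Rsum (fun i => Im (Clog (q s t i))) k)).
   { induction k; intros Hk.
    - cbn [Rsum]. rewrite Rplus_0_r. unfold H. simpl INR. unfold Rdiv. rewrite !Rmult_0_l. exact Hth.
    - cbn [Rsum]. rewrite <- Rplus_assoc.
     replace (H s t (S k)) with (H s t k * q s t k)%C.
     + apply isarg_mult. apply IHk; lia. apply isarg_Clog. apply Hq; auto.
     + unfold q. field. apply Cmod_gt_0. pose proof (HH k s t ltac:(lia) Hs Ht). lra. }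
   specialize (Z n (Nat.le_refl _)). unfold H in Z.
   replace (INR n * s / INR n) with s in Z by (field; lra). replace (INR n * t / INR n) with t in Z by (field; lra).
   exact Z.
  + apply (continuous_plus (fun _ => th0)). apply continuous_const.
   apply (Rsum_continuous (fun i s => Im (Clog (q s t i)))). intros i Hi.
   apply (curve_comp Clog (fun s => q s t i)).
   * apply curve_mult. apply curve_minus; auto. apply curve_const.
    apply (curve_inv (fun s => H s t i)). apply curve_minus; auto. apply curve_const.
    apply Cmod_gt_0. pose proof (HH i s t ltac:(lia) Hs Ht). lra.
   * apply Clog_cont, Hq; auto.
  + apply (continuous_plus (fun _ => th0)). apply continuous_const.
   apply (Rsum_continuous (fun i t => Im (Clog (q s t i)))). intros i Hi.
   apply (curve_comp Clog (fun t => q s t i)).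
   * apply curve_mult. apply curve_minus; auto. apply curve_const.
    apply (curve_inv (fun t => H s t i)). apply curve_minus; auto. apply curve_const.
    apply Cmod_gt_0. pose proof (HH i s t ltac:(lia) Hs Ht). lra.
   * apply Clog_cont, Hq; auto.
Qed.

Lemma IVT_value (f : R -> R) a b y : a < b -> (forall t, a <= t <= b -> continuous f t) -> f a <= y <= f b ->
 exists t, a <= t <= b /\ f t = y.
Proof.
 intros Hab Hf Hy.
 destruct (Req_dec (f a) y) as [E|E]. exists a; split; [lra|auto].
 destruct (Req_dec (f b) y) as [E'|E']. exists b; split; [lra|auto].
 destruct (IVT_interv (fun t => f t - y) a b) as [t [Ht E2]]; try lra.
 - intros t Ht. apply continuity_pt_filterlim. apply (continuous_minus f (fun _ => y)); auto. apply continuous_const.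
 - exists t; split; auto; lra.
Qed.

(** To leave the interval of half-width pi/2 around c, the angle would have to take values just
    beyond its ends, where the cosine is negative. *)
Lemma half_plane_angle (psi : R -> R) a b c : a < b -> (forall t, a <= t <= b -> continuous psi t) ->
 (forall t, a <= t <= b -> 0 <= cos (psi t - c)) -> Rabs (psi a - c) <= PI / 2 -> Rabs (psi b - c) <= PI / 2.
Proof.
 assert (Key : forall (f : R -> R), a < b -> (forall t, a <= t <= b -> continuous f t) ->
  (forall t, a <= t <= b -> 0 <= cos (f t)) -> f a <= PI / 2 -> f b <= PI / 2).
 { intros f Hab Hf Hcos H0. apply Rnot_lt_le. intros Hc. pose proof PI_RGT_0 as HPI.
  set (y := Rmin (f b) PI). assert (y <= f b) by apply Rmin_l. assert (y <= PI) by apply Rmin_r.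
  assert (PI / 2 < y) by (apply Rmin_glb_lt; lra).
  destruct (IVT_value f a b y Hab Hf) as [t [Ht E]]; [lra|].
  specialize (Hcos t Ht). rewrite E in Hcos. assert (cos y < 0) by (apply cos_lt_0; lra). lra. }
 intros Hab Hf Hcos H0. apply Rabs_le_between in H0. apply Rabs_le. split.
 - assert (- (psi b - c) <= PI / 2); [|lra].
  apply (Key (fun t => - (psi t - c))); auto; try lra.
  + intros t Ht. apply (continuous_opp (fun t => psi t - c)). apply (continuous_minus psi (fun _ => c)); auto. apply continuous_const.
  + intros t Ht. rewrite cos_neg. auto.
 - apply (Key (fun t => psi t - c)); auto; try lra.
  intros t Ht. apply (continuous_minus psi (fun _ => c)); auto. apply continuous_const.
Qed.

Lemma isarg_cos_shift z a c : isarg z a -> z <> 0 -> 0 <= Re z * cos c + Im z * sin c -> 0 <= cos (a - c).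
Proof.
 intros H Hz Hc. rewrite (isarg_Re _ _ H), (isarg_Im _ _ H) in Hc.
 replace (Cmod z * cos a * cos c + Cmod z * sin a * sin c) with (Cmod z * cos (a - c)) in Hc by (rewrite cos_minus; ring).
 assert (0 < Cmod z) by (apply Cmod_gt_0; auto). nra.
Qed.

Lemma minus_neq_0 (a b : C) : a <> b -> (a - b)%C <> 0.
Proof. intros H E. apply H, Ceq_minus; auto. Qed.

Lemma exists_arg z : exists th, isarg z th.
Proof.
 assert (Up : forall z, 0 <= Im z -> exists th, isarg z th).
 { intros w Hw. destruct (Req_dec (Cmod w) 0) as [E|E].
  - exists 0. rewrite (Cmod_eq_0 w E). unfold isarg, polar. rewrite Cmod_0. C_eq.
  - Cnneg w. set (c := Re w / Cmod w).
   assert (Ec : Cmod w * c = Re w) by (unfold c; field; lra).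
   assert (Hc : -1 <= c <= 1). { pose proof (re_le_Cmod w) as X. apply Rabs_le_between in X. split; nra. }
   exists (acos c). pose proof (acos_bound c).
   assert (Hcos : cos (acos c) = c) by (apply cos_acos; lra).
   assert (0 <= sin (acos c)) by (apply sin_ge_0; lra).
   unfold isarg, polar. rewrite Hcos, Ec. apply Ceq; [reflexivity|].
   change (Im w = Cmod w * sin (acos c)). apply Rsqr_inj; auto. apply Rmult_le_pos; lra.
   pose proof (sin2_cos2 (acos c)) as S. pose proof (Cmod_sqr w) as Q. rewrite Hcos in S. unfold Rsqr in *.
   replace (Cmod w * sin (acos c) * (Cmod w * sin (acos c))) with (Cmod w * Cmod w * (1 - c * c)) by (rewrite <- S; ring).
   replace (Cmod w * Cmod w * (1 - c * c)) with (Cmod w * Cmod w - (Cmod w * c) * (Cmod w * c)) by ring.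
   rewrite Ec, Q. ring. }
 destruct (Rle_lt_dec 0 (Im z)) as [H|H]; auto.
 destruct (Up (- z)%C) as [th Hth]. { simpl. unfold Im in H. lra. }
 exists (PI + th). replace z with ((- (1)) * (- z))%C by ring. apply isarg_mult; auto.
 unfold isarg, polar. rewrite Cmod_m1, cos_PI, sin_PI. C_eq.
Qed.

Lemma exists_arg_from (z : C) x : exists t, isarg z t /\ x <= t <= x + 2 * PI.
Proof.
 pose proof PI_RGT_0 as HPI. destruct (exists_arg z) as [t0 Ht0].
 assert (Hn : forall n : nat, isarg z (t0 + 2 * PI * INR n) /\ isarg z (t0 - 2 * PI * INR n)).
 { induction n as [|n [IH1 IH2]].
  - simpl. replace (t0 + 2 * PI * 0) with t0 by ring. replace (t0 - 2 * PI * 0) with t0 by ring. auto.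
  - rewrite S_INR. split. replace (t0 + 2 * PI * (INR n + 1)) with (t0 + 2 * PI * INR n + 2 * PI) by ring. apply isarg_2PI; auto.
   replace (t0 - 2 * PI * (INR n + 1)) with (t0 - 2 * PI * INR n - 2 * PI) by ring. apply isarg_2PI_minus; auto. }
 set (y := (x - t0) / (2 * PI)). assert (Ey : 2 * PI * y = x - t0) by (unfold y; field; lra).
 destruct (archimed y) as [A1 A2].
 destruct (Z.le_gt_cases 0 (up y)) as [Hz|Hz].
 - exists (t0 + 2 * PI * INR (Z.to_nat (up y))). split. apply Hn. rewrite INR_IZR_INZ, Z2Nat.id by auto. nra.
 - exists (t0 - 2 * PI * INR (Z.to_nat (- up y))). split. apply Hn. rewrite INR_IZR_INZ, Z2Nat.id, opp_IZR by lia. nra.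
Qed.

Lemma lift_half_planes A B th0 : (forall t, curve A t) -> (forall t, curve B t) ->
 (forall s t, 0 <= s <= 1 -> 0 <= t <= 1 -> A s <> B t) -> isarg (A 0 - B 0) th0 ->
 exists psi : R -> R -> R, psi 0 0 = th0 /\ (forall s t, 0 <= s <= 1 -> 0 <= t <= 1 -> isarg (A s - B t) (psi s t)) /\
  (forall s c, 0 <= s <= 1 -> (forall t, 0 <= t <= 1 -> 0 <= (Re (A s) - Re (B t)) * cos c + (Im (A s) - Im (B t)) * sin c) ->
   Rabs (psi s 0 - c) <= PI / 2 -> Rabs (psi s 1 - c) <= PI / 2) /\
  (forall t c, 0 <= t <= 1 -> (forall s, 0 <= s <= 1 -> 0 <= (Re (A s) - Re (B t)) * cos c + (Im (A s) - Im (B t)) * sin c) ->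
   Rabs (psi 0 t - c) <= PI / 2 -> Rabs (psi 1 t - c) <= PI / 2).
Proof.
 intros HA HB Hd Hth. destruct (lift_difference A B th0 HA HB Hd Hth) as [psi [E0 Hpsi]].
 exists psi. split; auto. split. intros s t Hs Ht. apply Hpsi; auto.
 split; intros x c Hx Hc; [apply (half_plane_angle (fun t => psi x t))|apply (half_plane_angle (fun s => psi s x))]; try lra;
  intros y Hy; try (apply Hpsi; auto).
 - apply (isarg_cos_shift (A x - B y)%C). apply Hpsi; auto. apply minus_neq_0, Hd; auto. rewrite re_minus, im_minus. auto.
 - apply (isarg_cos_shift (A y - B x)%C). apply Hpsi; auto. apply minus_neq_0, Hd; auto. rewrite re_minus, im_minus. auto.
Qed.

(** If the curves were disjoint, the direction of A s - B t would lift continuously to the parameter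
    square. Along each side of the square the difference stays in a half-plane, so the lift can be
    followed to the corner (1,1) in two ways, and the two values obtained there are incompatible. *)
Lemma crossing_rectangle A B : (forall t, curve A t) -> (forall t, curve B t) ->
 (forall t, 0 <= t <= 1 -> Re (A 0) <= Re (B t) <= Re (A 1)) ->
 (forall s, 0 <= s <= 1 -> Im (B 0) <= Im (A s) <= Im (B 1)) ->
 exists s t, 0 <= s <= 1 /\ 0 <= t <= 1 /\ A s = B t.
Proof.
 intros HA HB Hx Hy. apply NNPP. intros Hn. pose proof PI_RGT_0 as HPI.
 assert (Hd : forall s t, 0 <= s <= 1 -> 0 <= t <= 1 -> A s <> B t) by (intros s t Hs Ht E; apply Hn; exists s, t; auto).
 assert (Hm : forall s t, 0 <= s <= 1 -> 0 <= t <= 1 -> 0 < Cmod (A s - B t)) by (intros; apply Cmod_gt_0, minus_neq_0; auto).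
 assert (I0 : 0 <= 0 <= 1) by lra. assert (I1 : 0 <= 1 <= 1) by lra.
 pose proof (Hx 0 I0). pose proof (Hx 1 I1). pose proof (Hy 0 I0). pose proof (Hy 1 I1).
 destruct (exists_arg_from (A 0 - B 0) 0) as [th0 [Hth Hb]].
 pose proof (isarg_Re _ _ Hth) as R0. pose proof (isarg_Im _ _ Hth) as J0. rewrite re_minus in R0. rewrite im_minus in J0.
 pose proof (Hm 0 0 I0 I0).
 assert (Hth0 : PI / 2 <= th0 <= PI).
 { split; apply Rnot_lt_le; intros Hc.
  - assert (0 < cos th0) by (apply cos_gt_0; lra). nra.
  - destruct (Req_dec th0 (2 * PI)) as [->|]. rewrite cos_2PI in R0. lra.
   assert (sin th0 < 0) by (apply sin_lt_0; lra). nra. }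
 destruct (lift_half_planes A B th0 HA HB Hd Hth) as [psi [E0 [Hpsi [St Ss]]]].
 assert (S1 : Rabs (psi 0 1 - PI) <= PI / 2).
 { apply St; auto. intros t Ht. rewrite cos_PI, sin_PI. specialize (Hx t Ht). lra. rewrite E0. apply Rabs_le; lra. }
 apply Rabs_le_between in S1. pose proof (isarg_Im _ _ (Hpsi 0 1 I0 I1)) as J1. rewrite im_minus in J1. pose proof (Hm 0 1 I0 I1).
 assert (S1' : PI <= psi 0 1).
 { apply Rnot_lt_le. intros Hc. assert (0 < sin (psi 0 1)) by (apply sin_gt_0; lra). nra. }
 assert (S2 : Rabs (psi 1 1 - 3 * (PI / 2)) <= PI / 2).
 { apply Ss; auto. intros s Hs. rewrite cos_3PI2, sin_3PI2. specialize (Hy s Hs). lra. apply Rabs_le; lra. }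
 assert (T1 : Rabs (psi 1 0 - PI / 2) <= PI / 2).
 { apply Ss; auto. intros s Hs. rewrite cos_PI2, sin_PI2. specialize (Hy s Hs). lra. rewrite E0. apply Rabs_le; lra. }
 apply Rabs_le_between in T1. pose proof (isarg_Re _ _ (Hpsi 1 0 I1 I0)) as R1. rewrite re_minus in R1. pose proof (Hm 1 0 I1 I0).
 assert (T1' : psi 1 0 <= PI / 2).
 { apply Rnot_lt_le. intros Hc. assert (cos (psi 1 0) < 0) by (apply cos_lt_0; lra). nra. }
 assert (T2 : Rabs (psi 1 1 - 0) <= PI / 2).
 { apply St; auto. intros t Ht. rewrite cos_0, sin_0. specialize (Hx t Ht). lra. apply Rabs_le; lra. }
 apply Rabs_le_between in S2, T2. lra.
Qed.

(** Both curves lead from one vertical line to another, with exchanged order. For disjoint curves,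
    the two ways round the parameter square place the angle at (1,1) within pi/2 of pi and within
    pi/2 of 0. It is therefore pi/2, that is, A still ends above B. *)
Lemma crossing_fan A B : (forall t, curve A t) -> (forall t, curve B t) ->
 (forall t, 0 <= t <= 1 -> Re (A 0) <= Re (B t) <= Re (A 1)) ->
 (forall s, 0 <= s <= 1 -> Re (B 0) <= Re (A s) <= Re (B 1)) ->
 Im (B 0) < Im (A 0) -> Im (A 1) < Im (B 1) ->
 exists s t, 0 <= s <= 1 /\ 0 <= t <= 1 /\ A s = B t.
Proof.
 intros HA HB Hx Hy H0 H1. apply NNPP. intros Hn. pose proof PI_RGT_0 as HPI.
 assert (Hd : forall s t, 0 <= s <= 1 -> 0 <= t <= 1 -> A s <> B t) by (intros s t Hs Ht E; apply Hn; exists s, t; auto).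
 assert (I0 : 0 <= 0 <= 1) by lra. assert (I1 : 0 <= 1 <= 1) by lra.
 assert (Hth : isarg (A 0 - B 0) (PI / 2)).
 { unfold isarg, polar. rewrite cos_PI2, sin_PI2.
  assert (E : Re (A 0 - B 0) = 0) by (rewrite re_minus; pose proof (Hx 0 I0); pose proof (Hy 0 I0); lra).
  assert (E2 : Cmod (A 0 - B 0) = Im (A 0 - B 0)).
  { pose proof (Cmod_sqr (A 0 - B 0)) as Q. rewrite E in Q. Cnneg (A 0 - B 0)%C.
   assert (0 <= Im (A 0 - B 0)) by (rewrite im_minus; lra). nra. }
  rewrite E2. apply Ceq. rewrite E. simpl; ring. simpl; ring. }
 destruct (lift_half_planes A B _ HA HB Hd Hth) as [psi [E0 [Hpsi [St Ss]]]].
 assert (S2 : Rabs (psi 1 1 - PI) <= PI / 2).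
 { apply Ss; auto. intros s Hs. rewrite cos_PI, sin_PI. specialize (Hy s Hs). lra.
  apply St; auto. intros t Ht. rewrite cos_PI, sin_PI. specialize (Hx t Ht). lra. rewrite E0. apply Rabs_le; lra. }
 assert (T2 : Rabs (psi 1 1 - 0) <= PI / 2).
 { apply St; auto. intros t Ht. rewrite cos_0, sin_0. specialize (Hx t Ht). lra.
  apply Ss; auto. intros s Hs. rewrite cos_0, sin_0. specialize (Hy s Hs). lra. rewrite E0. apply Rabs_le; lra. }
 apply Rabs_le_between in S2, T2. assert (E1 : psi 1 1 = PI / 2) by lra.
 pose proof (isarg_Im _ _ (Hpsi 1 1 I1 I1)) as J. rewrite E1, sin_PI2, im_minus in J. Cnneg (A 1 - B 1)%C. lra.
Qed.

(** * Convex quasiconformal harmonic maps: elementary distortion *)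

(** Curves are used on [0,1] but must be continuous on the whole line; this reparametrisation
    extends them by constants. *)
Definition clamp (t : R) : R := Rmax 0 (Rmin 1 t).

Lemma clamp_01 t : 0 <= clamp t <= 1.
Proof. unfold clamp. split. apply Rmax_l. apply Rmax_lub. lra. apply Rmin_l. Qed.

Lemma clamp_id t : 0 <= t <= 1 -> clamp t = t.
Proof. intros H. unfold clamp. rewrite Rmin_right, Rmax_right; lra. Qed.

Lemma clamp_continuous t : continuous clamp t.
Proof.
 apply continuous_Reps. intros eps He. exists eps; split; auto. intros s Hs.
 apply Rabs_def2 in Hs. unfold clamp.
 apply Rabs_def1; unfold Rmax, Rmin; repeat destruct (Rle_dec _ _); lra.
Qed.

Definition cross (u v : C) : R := Re u * Im v - Im u * Re v.

Lemma cross_le u v : Rabs (cross u v) <= Cmod u * Cmod v.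
Proof.
 replace (cross u v) with (Im (Cconj u * v)) by (unfold cross, Re, Im; simpl; ring).
 le_via im_le_Cmod. rewrite Cmod_mult, Cmod_conj. lra.
Qed.

Lemma cross_perturb u v du dv A e : Cmod u <= A -> Cmod v <= A -> Cmod du <= e -> Cmod dv <= e ->
 cross u v - (2 * A * e + e * e) <= cross (u + du) (v + dv).
Proof.
 intros Hu Hv Hdu Hdv.
 replace (cross (u + du) (v + dv)) with (cross u v + cross u dv + cross du v + cross du dv)
  by (unfold cross, Re, Im; simpl; ring).
 pose proof (cross_le u dv) as X1. pose proof (cross_le du v) as X2. pose proof (cross_le du dv) as X3.
 apply Rabs_le_between in X1, X2, X3.
 Cnneg u. Cnneg v. Cnneg du. Cnneg dv.
 assert (Cmod u * Cmod dv <= A * e) by (apply Rmult_le_compat; auto).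
 assert (Cmod du * Cmod v <= e * A) by (apply Rmult_le_compat; auto).
 assert (Cmod du * Cmod dv <= e * e) by (apply Rmult_le_compat; auto). lra.
Qed.

(** * Koebe's lemma on arcs *)

Lemma polar_pow r t n : ((polar r t) ^ n)%C = polar (r ^ n) (INR n * t).
Proof.
 induction n.
 - simpl. unfold polar. rewrite Rmult_0_l, cos_0, sin_0. C_eq.
 - rewrite S_INR. simpl. rewrite IHn, polar_mult. f_equal. ring.
Qed.

Lemma Cder_pow (n : nat) z : Cder (fun w => w ^ n)%C z (RtoC (INR n) * z ^ pred n).
Proof.
 induction n.
 - simpl. replace (RtoC 0 * 1)%C with (RtoC 0) by ring. apply Cder_const.
 - replace (RtoC (INR (S n)) * z ^ pred (S n))%C with (1 * z ^ n + z * (RtoC (INR n) * z ^ pred n))%C.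
  + apply (Cder_mult (fun w => w) (fun w => w ^ n)%C); auto. apply Cder_id.
  + rewrite S_INR, RtoC_plus. destruct n. simpl. ring. simpl Nat.pred. simpl Cpow. ring.
Qed.

Lemma inD_open : Copen inD.
Proof.
 intros z Hz. exists (1 - Cmod z). unfold inD in *. split; [lra|]. intros w Hw.
 assert (X := Cmod_triangle_rev w z). lra.
Qed.

Lemma Clim_polar (r th : nat -> R) r0 th0 : Un_cv r r0 -> Un_cv th th0 ->
 Clim (fun n => polar (r n) (th n)) (polar r0 th0).
Proof.
 intros Hr Ht. apply Clim_re_im; unfold polar, Re, Im; simpl.
 - apply (CV_mult r (fun n => cos (th n))); auto. apply (continuity_seq cos); auto. apply continuity_cos.
 - apply (CV_mult r (fun n => sin (th n))); auto. apply (continuity_seq sin); auto. apply continuity_sin.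
Qed.

Lemma continuous_bounded_above (u : R -> R) a b : a <= b -> (forall t, a <= t <= b -> continuous u t) ->
 exists x, a <= x <= b /\ forall t, a <= t <= b -> u t <= u x.
Proof.
 intros Hab Hu. destruct (continuity_ab_maj u a b Hab) as [x [Hx Hx']].
 - intros c Hc. apply continuity_pt_filterlim. apply Hu; auto.
 - exists x; auto.
Qed.

(** A choice of argument at all points that is continuous at the single point z; this suffices to
    read small discs around z in polar coordinates. *)
Lemma local_argument (z : C) a : z <> 0 -> isarg z a ->
 exists A : C -> R, (forall w, isarg w (A w)) /\ A z = a /\ Vcont A z.
Proof.
 intros Hz Ha. set (q := fun w => (w * / z)%C).
 assert (H : forall w, exists t, isarg w t /\ (0 < Re (q w) -> t = a + Im (Clog (q w)))).
 { intros w. destruct (Rlt_dec 0 (Re (q w))) as [Hr|Hr].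
  - exists (a + Im (Clog (q w))). split; auto. replace w with (z * q w)%C at 1 by (unfold q; field; auto).
   apply isarg_mult; auto. apply isarg_Clog; auto.
  - destruct (exists_arg w) as [t Ht]. exists t. split; auto. intros; contradiction. }
 apply choice in H. destruct H as [A HA]. exists A. split. apply HA.
 assert (E1 : q z = 1) by (unfold q; field; auto).
 assert (L1 : Im (Clog 1) = 0) by (unfold Clog, Re, Im; simpl; unfold Rdiv; rewrite Rmult_0_l; apply atan_0).
 assert (Az : A z = a) by (rewrite (proj2 (HA z)); rewrite E1; [rewrite L1; ring|simpl; lra]).
 split; auto. intros e He.
 assert (HC : Ccont q z) by (apply Ccont_mult; [apply Ccont_id|apply Ccont_const]).
 assert (HC2 : Ccont (fun w => Clog (q w)) z) by (apply (Ccont_comp q Clog); auto; apply Clog_cont; rewrite E1; simpl; lra).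
 destruct (HC 1) as [d1 [Hd1 X1]]; [lra|]. destruct (HC2 e He) as [d2 [Hd2 X2]].
 exists (Rmin d1 d2). split. apply Rmin_pos; auto. intros w Hw.
 specialize (X1 w (lt_min_l Hw)). specialize (X2 w (lt_min_r Hw)).
 rewrite E1 in X1, X2. rewrite Az, (proj2 (HA w)) by (apply Re_near_1; auto).
 replace (a + Im (Clog (q w)) - a) with (Im (Clog (q w) - Clog 1)) by (rewrite im_minus, L1; ring).
 eapply Rle_lt_trans; [apply im_le_Cmod|exact X2].
Qed.

(** A two-constants estimate in a sector of opening pi/m. The curve [Gam] is a cross-cut in the
    coordinates (angle, radius). The function r^m sin(m (angle - th1)) is the real part of [gg]; it
    vanishes on the sides and at 0 and is at most 1. With the weight ln(2/d) in the exponent, both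
    the bound |B - b| <= 2 near the sides and the bound |B - b| <= d on the cross-cut become |W| <=
    1. *)
Lemma Koebe_arc_estimate (B B' : C -> C) (m : nat) (th1 R0 d phi0 r0 : R) (Gam : R -> C) (b : C) :
 holo B B' -> (forall z, inD z -> Cmod (B z) <= 1) -> Cmod b <= 1 -> 0 < d -> (1 <= m)%nat ->
 (forall s, curve Gam s) ->
 Re (Gam 0) = th1 -> Re (Gam 1) = th1 + PI / INR m ->
 (forall s, 0 <= s <= 1 -> th1 <= Re (Gam s) <= th1 + PI / INR m /\ R0 <= Im (Gam s) < 1 /\
   Cmod (B (polar (Im (Gam s)) (Re (Gam s))) - b) <= d) ->
 th1 < phi0 < th1 + PI / INR m -> 0 < r0 < R0 ->
 Cmod (B (polar r0 phi0) - b) <= 2 * exp (- ln (2 / d) * (r0 ^ m * sin (INR m * (phi0 - th1)))).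
Proof.
 intros HB HB1 Hb1 Hd Hm HGc HG0 HG1 HG Hphi Hr0.
 set (th2 := th1 + PI / INR m) in *.
 assert (Hm0 : 0 < INR m) by (apply lt_0_INR; lia).
 set (N := ln (2 / d)).
 set (gg := fun z => (- Ci * (cis (- th1) * z) ^ m)%C).
 assert (Hgg : forall r th, Re (gg (polar r th)) = r ^ m * sin (INR m * (th - th1))).
 { intros r th. unfold gg. rewrite polar_mult, polar_pow. rewrite Rmult_1_l.
  replace (- th1 + th) with (th - th1) by ring. unfold polar, Ci, Re, Im; simpl. ring. }
 assert (Hang : forall th, th1 <= th <= th2 -> 0 <= INR m * (th - th1) <= PI).
 { intros th Hth. unfold th2 in Hth. split. apply Rmult_le_pos; lra.
  replace PI with (INR m * (PI / INR m)) by (field; lra). apply Rmult_le_compat_l; lra. }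
 set (W := fun z => ((B z - b) * / 2 * Cexp (RtoC N * gg z))%C).
 assert (HWd : forall z, exists l, inD z -> Cder W z l).
 { intros z. eexists. intros Hz.
  apply (Cder_mult (fun z => (B z - b) * / 2)%C (fun z => Cexp (RtoC N * gg z))).
  - apply (Cder_mult (fun z => B z - b)%C (fun _ => / 2)%C); [|apply Cder_const].
   apply (Cder_minus B (fun _ => b)); [apply HB; auto|apply Cder_const].
  - apply (Cder_comp (fun z => RtoC N * gg z)%C Cexp); [|apply Cexp_Cder].
   apply Cder_scal. apply (Cder_scal (- Ci) (fun z => (cis (- th1) * z) ^ m)%C).
   apply (Cder_comp (fun z => cis (- th1) * z)%C (fun w => w ^ m)%C); [|apply Cder_pow].
   apply (Cder_scal (cis (- th1)) (fun z => z)). apply Cder_id. }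
 apply choice in HWd. destruct HWd as [W' HW].
 assert (HWc : forall z, inD z -> Ccont W z) by (intros z Hz; exact (Cder_cont _ _ _ (HW z Hz))).
 assert (HWn : forall z, Cmod (W z) = Cmod (B z - b) / 2 * exp (N * Re (gg z))).
 { intros z. unfold W. rewrite !Cmod_mult, Cmod_Cexp, Cmod_inv by apply C2_neq_0.
  rewrite Cmod_R, Rabs_right by lra. unfold Rdiv. do 2 f_equal. unfold Re; simpl. ring. }
 assert (HA1 : forall z, inD z -> Cmod (B z - b) / 2 <= 1).
 { intros z Hz. assert (Cmod (B z - b) <= Cmod (B z) + Cmod b) by apply Cmod_minus_le. specialize (HB1 z Hz). lra. }
 set (box := fun p : C => th1 < Re p < th2 /\ 0 < Im p < 1).
 set (p0 := (phi0, r0) : C).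
 (* The component of p0 in the complement of the cross-cut, by paths in the polar rectangle. Its
    image [U] in the disc is the domain of the maximum principle. *)
 set (Up := fun p : C => exists c : R -> C, (forall t, curve c t) /\ c 0 = p0 /\ c 1 = p /\
   forall t, 0 <= t <= 1 -> box (c t) /\ forall s, 0 <= s <= 1 -> Gam s <> c t).
 set (U := fun z : C => exists p, Up p /\ z = polar (Im p) (Re p)).
 assert (HGd : forall p, (forall s, 0 <= s <= 1 -> Gam s <> p) -> exists e, 0 < e /\ forall q, Cmod (q - p) < e -> forall s, 0 <= s <= 1 -> Gam s <> q).
 { intros p Hp. destruct (disjoint_curves_distance Gam (fun _ => p)) as [e [He X]].
  - intros s _; auto. - intros s _. apply curve_const. - intros s _ Hs _. auto.
  - exists e. split; auto. intros q Hq s Hs E. specialize (X s 0 Hs ltac:(lra)). rewrite E in X. lra. }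
 assert (Hbox : forall p, box p -> exists e, 0 < e /\ forall q, Cmod (q - p) < e -> box q).
 { intros p [Hp1 Hp2].
  exists (Rmin (Rmin (Re p - th1) (th2 - Re p)) (Rmin (Im p) (1 - Im p))). split. repeat apply Rmin_pos; lra.
  intros q Hq. assert (Q1 := Rlt_le_trans _ _ _ Hq (Rmin_l _ _)). assert (Q2 := Rlt_le_trans _ _ _ Hq (Rmin_r _ _)).
  pose proof (Rmin_l (Re p - th1) (th2 - Re p)). pose proof (Rmin_r (Re p - th1) (th2 - Re p)).
  pose proof (Rmin_l (Im p) (1 - Im p)). pose proof (Rmin_r (Im p) (1 - Im p)).
  pose proof (re_le_Cmod (q - p)) as Z1. pose proof (im_le_Cmod (q - p)) as Z2.
  rewrite re_minus in Z1. rewrite im_minus in Z2. apply Rabs_le_between in Z1, Z2. unfold box. lra. }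
 assert (Hext : forall p q, Up p -> (forall t, 0 <= t <= 1 -> box (seg p q t) /\ forall s, 0 <= s <= 1 -> Gam s <> seg p q t) -> Up q).
 { intros p q [c [Hc [Hc0 [Hc1 Hca]]]] Hs.
  exists (fun t => c (clamp (2 * t)) + RtoC (clamp (2 * t - 1)) * (q - p))%C.
  split; [|split; [|split]].
  - intros t. apply (curve_plus (fun t => c (clamp (2 * t))) (fun t => RtoC (clamp (2 * t - 1)) * (q - p))%C).
   + apply (curve_reparam c (fun t => clamp (2 * t))); auto.
    apply (continuous_comp (fun t => 2 * t) clamp); [|apply clamp_continuous].
    smooth.
   + apply curve_mult; [|apply curve_const]. apply curve_RtoC.
    apply (continuous_comp (fun t => 2 * t - 1) clamp); [|apply clamp_continuous].
    smooth.
  - rewrite Rmult_0_r. rewrite (clamp_id 0) by lra. rewrite Hc0.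
   replace (clamp (0 - 1)) with 0. ring. unfold clamp. rewrite Rmin_right, Rmax_left; lra.
  - replace (2 * 1 - 1) with 1 by ring. rewrite (clamp_id 1) by lra.
   replace (clamp (2 * 1)) with 1. rewrite Hc1. ring. unfold clamp. rewrite Rmin_left, Rmax_right; lra.
  - intros t Ht01. destruct (Rle_lt_dec (2 * t) 1) as [Ht|Ht].
   + replace (clamp (2 * t - 1)) with 0. 2:{ unfold clamp. rewrite Rmin_right, Rmax_left; lra. }
    rewrite clamp_id by lra. replace (c (2 * t)%R + 0 * (q - p))%C with (c (2 * t)%R) by ring. apply Hca; lra.
   + replace (clamp (2 * t)) with 1. 2:{ unfold clamp. rewrite Rmin_left, Rmax_right; lra. }
    rewrite clamp_id by lra. rewrite Hc1. apply (Hs (2 * t - 1)); lra. }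
 assert (Hnear : forall p, box p -> (forall s, 0 <= s <= 1 -> Gam s <> p) -> exists e, 0 < e /\
   forall q q', Cmod (q - p) < e -> Cmod (q' - p) < e -> Up q -> Up q').
 { intros p Hp1 Hp2. destruct (HGd p Hp2) as [e1 [He1 X1]]. destruct (Hbox p Hp1) as [e2 [He2 X2]].
  exists (Rmin e1 e2). split. apply Rmin_pos; auto. intros q q' Hq Hq' HU. apply (Hext q q' HU).
  intros t Ht. assert (Hs : Cmod (seg q q' t - p) < Rmin e1 e2).
  { replace (seg q q' t - p)%C with (seg (q - p) (q' - p) t) by (unfold seg; ring).
   apply Rle_lt_trans with (Rmax (Cmod (q - p)) (Cmod (q' - p))). apply seg_disc; auto. apply Rmax_l. apply Rmax_r.
   apply Rmax_lub_lt; auto. }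
  split. apply X2. eapply Rlt_le_trans; [exact Hs|apply Rmin_r].
  apply X1. eapply Rlt_le_trans; [exact Hs|apply Rmin_l]. }
 destruct (continuous_bounded_above (fun s => Im (Gam s)) 0 1) as [sm [Hsm Hrm]]; [lra|intros; apply HGc|].
 set (rm := Im (Gam sm)) in *.
 assert (Hrm1 : rm < 1) by (apply HG; auto).
 (* A path from p0 reaching the height [rm] of the cross-cut would meet it by the crossing lemma.
    Hence [U] stays away from the unit circle, where nothing is known about B. *)
 assert (HUp : forall p, Up p -> box p /\ (forall s, 0 <= s <= 1 -> Gam s <> p) /\ Im p < rm).
 { intros p [c [Hc [Hc0 [Hc1 Hca]]]]. destruct (Hca 1 ltac:(lra)) as [Q1 Q2]. rewrite Hc1 in Q1, Q2.
  split; [auto|split; auto]. apply Rnot_le_lt. intros Hle.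
  destruct (crossing_rectangle Gam c HGc Hc) as [s [t [Hs [Ht E]]]].
  - intros t Ht. rewrite HG0, HG1. destruct (Hca t Ht) as [[Z _] _]. lra.
  - intros s Hs. rewrite Hc0, Hc1. simpl. specialize (Hrm s Hs). destruct (HG s Hs) as [_ [Z _]]. simpl in Hrm. lra.
  - destruct (Hca t Ht) as [_ Z]. apply (Z s Hs E). }
 assert (Hmod : forall r th, 0 <= r -> Cmod (polar r th) = r) by (intros; apply Cmod_polar; auto).
 assert (Hfin : Cmod (W (polar r0 phi0)) * Cmod (W (polar r0 phi0)) <= 1).
 { apply (maximum_principle U (fun z => Cmod (W z) * Cmod (W z))).
  - intros z [p [Hp ->]]. destruct (HUp p Hp) as [[B1 B2] [Hpg _]].
   destruct (Hnear p (conj B1 B2) Hpg) as [e [He X]].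
   set (z := polar (Im p) (Re p)).
   assert (Nz : z <> 0). { apply Cmod_gt_0. unfold z. rewrite Hmod; lra. }
   assert (HC1 : Vcont (fun w => Cmod w) z) by (apply (Vcont_Cmod (fun w => w)); apply Ccont_id).
   destruct (local_argument z (Re p) Nz) as [A [HA [Az HC2]]]. { unfold z. apply isarg_polar. lra. }
   destruct (HC1 (e / 2)) as [d1 [Hd1 Y1]]; [lra|]. destruct (HC2 (e / 2)) as [d2 [Hd2 Y2]]; [lra|].
   exists (Rmin d1 d2). split. apply Rmin_pos; auto. intros w Hw.
   specialize (Y1 w (lt_min_l Hw)). specialize (Y2 w (lt_min_r Hw)).
   exists (A w, Cmod w). split; [|exact (HA w)].
   apply (X p); auto. rewrite Cmod_diag; auto.
   lt_via Cmod_le_re_im.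
   change (Rabs (A w - Re p) + Rabs (Cmod w - Im p) < e). rewrite Az in Y2.
   replace (Cmod z) with (Im p) in Y1 by (unfold z; rewrite Hmod; lra). lra.
  - intros z [p [Hp ->]]. destruct (HUp p Hp) as [[B1 B2] _]. rewrite Hmod; lra.
  - intros z [p [Hp ->]]. destruct (HUp p Hp) as [[B1 B2] _].
   apply Vcont_mult; apply Vcont_Cmod; apply HWc; unfold inD; rewrite Hmod; lra.
  - intros z [p [Hp ->]]. destruct (HUp p Hp) as [[B1 B2] _].
   destruct (inD_open (polar (Im p) (Re p))) as [e [He X]]. unfold inD; rewrite Hmod; lra.
   apply submean_Cmod2 with W' e; auto.
  - intros u l M' HM' Hu Hl Hnl Hall.
   apply choice in Hu. destruct Hu as [p Hp].
   destruct (BW_R (fun n => Re (p n)) th1 th2) as [s1 [thl [Hs1 [Hth Hthl]]]].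
   { intros n. destruct (Hp n) as [Q _]. destruct (HUp _ Q) as [[B1 _] _]. lra. }
   destruct (BW_R (fun n => Im (p (s1 n))) 0 rm) as [s2 [rl [Hs2 [Hrl Hrll]]]].
   { intros n. destruct (Hp (s1 n)) as [Q _]. destruct (HUp _ Q) as [[_ B2] [_ B3]]. lra. }
   apply (Un_cv_ext_sub _ _ s2 Hs2) in Hth.
   assert (Es := extraction_comp s1 s2 Hs1 Hs2).
   assert (Hl2 : Clim (fun n => u (s1 (s2 n))) (polar rl thl)).
   { intros eps He. destruct (Clim_polar _ _ _ _ Hrl Hth eps He) as [N0 HN]. exists N0. intros n Hn.
    destruct (Hp (s1 (s2 n))) as [_ E]. rewrite E. apply HN; auto. }
   assert (El := Clim_unique _ _ _ (Clim_ext_sub u l _ Es Hl) Hl2).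
   assert (Il : inD l) by (rewrite El; unfold inD; rewrite Hmod; lra).
   assert (Hge : M' <= Cmod (W l) * Cmod (W l)).
   { assert (L1 := Clim_Cmod _ _ (Clim_cont W u l (HWc l Il) Hl)).
    apply (Un_cv_le (fun _ => M') (fun n => Cmod (W (u n)) * Cmod (W (u n)))). apply Un_cv_const.
    apply (CV_mult _ _ _ _ L1 L1). exists O. intros n _. apply Hall. }
   assert (Hgt : 1 < Cmod (W l)). { Cnneg (W l). nra. }
   rewrite HWn in Hgt. assert (Hreg : Re (gg l) = rl ^ m * sin (INR m * (thl - th1))) by (rewrite El; apply Hgg).
   specialize (HA1 l Il). Cnneg (B l - b)%C.
   (* At the origin and on the sides the exponent vanishes and |W| <= 1. The limit point thus lies
      in the open polar rectangle: either on the cross-cut, where the bound d applies, or in [U],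
      which was excluded. *)
   assert (Hg0 : Re (gg l) <> 0).
   { intros E. rewrite E, Rmult_0_r, exp_0 in Hgt. lra. }
   assert (Hrl0 : 0 < rl).
   { destruct (Req_dec rl 0) as [E|E]; [|lra]. exfalso. apply Hg0. rewrite Hreg, E. destruct m; [lia|]. simpl. ring. }
   assert (Hth1 : thl <> th1).
   { intros E. apply Hg0. rewrite Hreg, E. replace (INR m * (th1 - th1)) with 0 by ring. rewrite sin_0; ring. }
   assert (Hth2 : thl <> th2).
   { intros E. apply Hg0. rewrite Hreg, E. unfold th2. replace (INR m * (th1 + PI / INR m - th1)) with PI by (field; lra).
    rewrite sin_PI; ring. }
   set (pl := (thl, rl) : C).
   assert (Hplb : box pl) by (unfold box, pl, Re, Im; simpl; lra).
   destruct (classic (exists s, 0 <= s <= 1 /\ Gam s = pl)) as [[s [Hs E]]|Hno].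
   + destruct (HG s Hs) as [_ [_ Z]]. rewrite E in Z. unfold pl, Re, Im in Z; simpl in Z. rewrite <- El in Z.
    assert (Hg1 : Re (gg l) <= 1).
    { rewrite Hreg. pose proof (SIN_bound (INR m * (thl - th1))).
     assert (0 <= rl ^ m <= 1). { split. apply pow_le; lra. rewrite <- (pow1 m). apply pow_incr; lra. } nra. }
    assert (Hg2 : 0 <= Re (gg l)).
    { rewrite Hreg. apply Rmult_le_pos. apply pow_le; lra. destruct (Hang thl Hthl). apply sin_ge_0; auto. }
    destruct (Rle_lt_dec N 0) as [HN|HN].
    * assert (exp (N * Re (gg l)) <= exp 0) by (apply exp_le_equiv || (destruct (Req_dec (N * Re (gg l)) 0) as [->|]; [lra|left; apply exp_increasing; nra])).
     rewrite exp_0 in H0. pose proof (exp_pos (N * Re (gg l))). nra.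
    * assert (exp (N * Re (gg l)) <= exp N).
     { destruct (Req_dec (N * Re (gg l)) N) as [->|]; [lra|left; apply exp_increasing; nra]. }
     unfold N in H0 at 2. rewrite exp_ln in H0 by pos_div.
     assert (Cmod (B l - b) / 2 * exp (N * Re (gg l)) <= d / 2 * (2 / d)).
     { apply Rmult_le_compat; try lra. apply Rlt_le, exp_pos. }
     replace (d / 2 * (2 / d)) with 1 in H1 by (field; lra). lra.
   + assert (Hplg : forall s, 0 <= s <= 1 -> Gam s <> pl) by (intros s Hs E; apply Hno; exists s; auto).
    destruct (Hnear pl Hplb Hplg) as [e [He X]].
    assert (HC : Clim (fun n => p (s1 (s2 n))) pl) by (apply Clim_re_im; auto).
    destruct (HC e He) as [N0 HN]. specialize (HN N0 (Nat.le_refl _)).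
    apply Hnl. exists pl. split. apply (X (p (s1 (s2 N0)))); auto.
    rewrite Cmod_diag; auto. apply Hp. rewrite El. reflexivity.
  - exists p0. split; [|reflexivity]. exists (fun _ => p0). split. intros; apply curve_const. split; auto. split; auto.
   intros t _. split. unfold box, p0, Re, Im; simpl. destruct (HG 0 ltac:(lra)) as [_ [Z _]]. lra.
   intros s Hs E. destruct (HG s Hs) as [_ [Z _]]. rewrite E in Z. unfold p0, Im in Z; simpl in Z. lra. }
 assert (Hle : Cmod (W (polar r0 phi0)) <= 1). { Cnneg (W (polar r0 phi0)). nra. }
 rewrite HWn, Hgg in Hle. fold N. set (om := r0 ^ m * sin (INR m * (phi0 - th1))) in *.
 replace (- N * om) with (- (N * om)) by ring. rewrite exp_Ropp. pose proof (exp_pos (N * om)).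
 apply Rmult_le_reg_r with (exp (N * om)); auto. rewrite Rmult_assoc, Rinv_l by lra. lra.
Qed.

Lemma last_time (u : R -> R) a b y : a < b -> (forall t, a <= t <= b -> continuous u t) -> u a <= y <= u b ->
 exists s, a <= s <= b /\ u s = y /\ forall t, s <= t <= b -> y <= u t.
Proof.
 intros Hab Hu Hy.
 destruct (completeness (fun s => a <= s <= b /\ u s <= y)) as [s [Hub Hlub]].
 { exists b. intros s [Hs _]; lra. } { exists a. lra. }
 assert (Hs : a <= s <= b). { split. apply Hub; lra. apply Hlub. intros t [Ht _]; lra. }
 assert (Habove : forall t, s < t <= b -> y < u t).
 { intros t Ht. apply Rnot_le_lt. intros Hc. assert (t <= s); [|lra]. apply Hub. lra. }
 assert (Hcont := Hu s Hs). rewrite continuous_Reps in Hcont.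
 assert (Hle : u s <= y).
 { apply Rnot_lt_le. intros Hc. destruct (Hcont (u s - y)) as [d [Hd X]]; [lra|].
  assert (s <= s - Rmin d (s - a + 1) / 2 \/ s = a \/ exists t, s - d < t <= s /\ a <= t <= b /\ u t <= y).
  { right. right. apply NNPP. intros Hn. assert (s <= s - d); [|lra]. apply Hlub. intros t Ht.
   apply Rnot_lt_le. intros Hlt. apply Hn. exists t. assert (t <= s) by (apply Hub; auto). lra. }
  assert (0 < Rmin d (s - a + 1)) by (apply Rmin_pos; lra).
  destruct H as [H|[H|[t [H1 [H2 H3]]]]]; [lra| |].
  - subst s. lra.
  - specialize (X t). rewrite Rabs_left1 in X by lra. specialize (X ltac:(lra)). apply Rabs_def2 in X. lra. }
 assert (Hge : y <= u s).
 { apply Rnot_lt_le. intros Hc. destruct (Req_dec s b) as [->|Hne]; [lra|].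
  destruct (Hcont (y - u s)) as [d [Hd X]]; [lra|].
  set (t := Rmin b (s + d / 2)). assert (s < t) by (apply Rmin_glb_lt; lra).
  assert (t <= b) by apply Rmin_l. assert (t <= s + d / 2) by apply Rmin_r.
  specialize (X t). rewrite Rabs_right in X by lra. specialize (X ltac:(lra)). apply Rabs_def2 in X.
  specialize (Habove t ltac:(lra)). lra. }
 exists s. split; auto. split. lra. intros t Ht. destruct (Req_dec t s) as [->|]; auto.
 apply Rlt_le, Habove. lra.
Qed.

Lemma first_time (u : R -> R) a b y : a < b -> (forall t, a <= t <= b -> continuous u t) -> u a <= y <= u b ->
 exists s, a <= s <= b /\ u s = y /\ forall t, a <= t <= s -> u t <= y.
Proof.
 intros Hab Hu Hy.
 destruct (last_time (fun t => - u (- t)) (- b) (- a) (- y)) as [s [Hs [E X]]].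
 - lra.
 - intros t Ht. apply (continuous_opp (fun t => u (- t))). apply (continuous_comp Ropp u).
  smooth. apply Hu; lra.
 - rewrite !Ropp_involutive. lra.
 - exists (- s). split. lra. split. lra. intros t Ht. specialize (X (- t) ltac:(lra)). rewrite Ropp_involutive in X. lra.
Qed.

(** Last passage at the level y1, followed by the next passage at the level y2. *)
Lemma upcrossing (u : R -> R) y1 y2 : y1 < y2 -> (forall t, 0 <= t <= 1 -> continuous u t) -> u 0 <= y1 -> y2 <= u 1 ->
 exists s1 s2, 0 <= s1 <= 1 /\ s1 <= s2 <= 1 /\ u s1 = y1 /\ u s2 = y2 /\
  forall t, s1 <= t <= s2 -> y1 <= u t <= y2.
Proof.
 intros Hy Hu H0 H1.
 destruct (last_time u 0 1 y1) as [s1 [Hs1 [E1 X1]]]; auto; try lra.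
 assert (s1 < 1). { destruct (Req_dec s1 1) as [E|E]; [rewrite E in E1; lra|lra]. }
 destruct (first_time u s1 1 y2) as [s2 [Hs2 [E2 X2]]]; try lra.
 { intros t Ht. apply Hu; lra. }
 exists s1, s2. repeat split; auto; try lra.
 apply X1; lra.
Qed.

(** Two fixed points z1 and z2 of modulus 1/4 in the sector have images at a distance D > 0 by
    injectivity. A crossing arc on which B stays within a small d of b would bring both images
    within D/4 of b. *)
Lemma Koebe_sector (B B' : C -> C) m th1 : holo B B' -> (forall z, inD z -> Cmod (B z) <= 1) ->
 (forall z w, inD z -> inD w -> B z = B w -> z = w) -> (1 <= m)%nat ->
 exists d, 0 < d /\ forall (gam : R -> C) (th : R -> R) (b : C), (forall s, curve gam s) ->
  (forall s, 0 <= s <= 1 -> continuous th s /\ isarg (gam s) (th s) /\ 1/2 <= Cmod (gam s) < 1 /\ Cmod (B (gam s) - b) <= d) ->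
  Cmod b <= 1 -> th 0 <= th1 -> th1 + PI / INR m <= th 1 -> False.
Proof.
 intros HB HB1 Hinj Hm. pose proof PI_RGT_0 as HPI.
 assert (Hm0 : 0 < INR m) by (apply lt_0_INR; lia).
 assert (Hq : 0 < PI / INR m) by pos_div.
 set (z1 := polar (1/4) (th1 + PI / INR m / 2)). set (z2 := polar (1/4) (th1 + PI / INR m / 4)).
 assert (I1 : inD z1) by (unfold inD, z1; rewrite Cmod_polar; lra).
 assert (I2 : inD z2) by (unfold inD, z2; rewrite Cmod_polar; lra).
 set (w1 := (1/4) ^ m * sin (INR m * (th1 + PI / INR m / 2 - th1))).
 set (w2 := (1/4) ^ m * sin (INR m * (th1 + PI / INR m / 4 - th1))).
 assert (H4 : 0 < (1/4) ^ m) by (apply pow_lt; lra).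
 assert (W1 : 0 < w1).
 { unfold w1. replace (INR m * (th1 + PI / INR m / 2 - th1)) with (PI / 2) by (field; lra). rewrite sin_PI2; lra. }
 assert (W2 : 0 < w2).
 { unfold w2. replace (INR m * (th1 + PI / INR m / 4 - th1)) with (PI / 4) by (field; lra).
  apply Rmult_lt_0_compat; auto. apply sin_gt_0; lra. }
 set (D := Cmod (B z1 - B z2)).
 assert (HD : 0 < D).
 { apply Cmod_gt_0. intros E. assert (E2 : z1 = z2) by (apply Hinj; auto; apply Ceq_minus; auto).
  unfold z1, z2, polar in E2. injection E2 as E3 E4.
  assert (E5 : sin (PI / INR m / 4) = 0).
  { replace (PI / INR m / 4) with ((th1 + PI / INR m / 2) - (th1 + PI / INR m / 4)) by (field; lra).
   rewrite sin_minus. assert (cos (th1 + PI / INR m / 2) = cos (th1 + PI / INR m / 4)) as -> by lra.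
   assert (sin (th1 + PI / INR m / 2) = sin (th1 + PI / INR m / 4)) as -> by lra. ring. }
  assert (0 < sin (PI / INR m / 4)); [|lra]. apply sin_gt_0; [lra|].
  assert (PI / INR m <= PI); [|lra]. apply Rmult_le_reg_r with (INR m); auto. unfold Rdiv.
  rewrite Rmult_assoc, Rinv_l by lra. assert (1 <= INR m) by (apply (le_INR 1); auto). nra. }
 set (w := Rmin w1 w2). assert (Hw : 0 < w) by (apply Rmin_pos; auto).
 (* Chosen to give exp(-N w) <= D/8, where w bounds the two sine factors from below. With d = 2
    exp(-N) the weight ln(2/d) is N. *)
 set (N := Rmax 0 (ln (8 / D)) / w).
 assert (HN : 0 <= N). { apply Rmult_le_pos. apply Rmax_l. apply Rlt_le, Rinv_0_lt_compat; auto. }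
 assert (HNw : exp (- N * w) <= D / 8).
 { replace (- N * w) with (- (N * w)) by ring. unfold N. replace (Rmax 0 (ln (8 / D)) / w * w) with (Rmax 0 (ln (8 / D))) by (field; lra).
  replace (D / 8) with (exp (- ln (8 / D))).
  2:{ rewrite exp_Ropp, exp_ln by pos_div. field; lra. }
  assert (- Rmax 0 (ln (8 / D)) <= - ln (8 / D)) by (apply Ropp_le_contravar, Rmax_r).
  destruct H as [H|H]. apply Rlt_le, exp_increasing; auto. rewrite H; lra. }
 exists (2 * exp (- N)). split. pose proof (exp_pos (- N)); lra.
 intros gam th b Hg Hs Hb H0 H1.
 destruct (upcrossing th th1 (th1 + PI / INR m)) as [s1 [s2 [Hs1 [Hs2 [E1 [E2 X]]]]]]; auto; try lra.
 { intros t Ht. apply Hs; auto. }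
 assert (Hin : forall s, 0 <= s1 + (s2 - s1) * clamp s <= 1).
 { intros s. pose proof (clamp_01 s). nra. }
 assert (Hcl : forall s, continuous (fun s => s1 + (s2 - s1) * clamp s) s).
 { intros s. apply (continuous_plus (fun _ => s1)). apply continuous_const.
  apply (continuous_Rmult (fun _ => s2 - s1)). apply continuous_const. apply clamp_continuous. }
 set (Gam := fun s => (th (s1 + (s2 - s1) * clamp s), Cmod (gam (s1 + (s2 - s1) * clamp s))) : C).
 assert (HGc : forall s, curve Gam s).
 { intros s. split; unfold Gam, Re, Im; simpl.
  - apply (continuous_comp (fun s => s1 + (s2 - s1) * clamp s) th); auto. apply Hs; auto.
  - apply (continuous_Cmod (fun s => gam (s1 + (s2 - s1) * clamp s))). apply (curve_reparam gam (fun s => s1 + (s2 - s1) * clamp s)); auto. }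
 assert (HGp : forall s, polar (Im (Gam s)) (Re (Gam s)) = gam (s1 + (s2 - s1) * clamp s)).
 { intros s. unfold Gam, Re, Im; simpl. destruct (Hs _ (Hin s)) as [_ [Q _]]. symmetry. exact Q. }
 assert (Hln : ln (2 / (2 * exp (- N))) = N).
 { replace (2 / (2 * exp (- N))) with (exp N). apply ln_exp. rewrite exp_Ropp. pose proof (exp_pos N). field; lra. }
 assert (Main : forall phi0, th1 < phi0 < th1 + PI / INR m ->
  Cmod (B (polar (1/4) phi0) - b) <= 2 * exp (- N * ((1/4) ^ m * sin (INR m * (phi0 - th1))))).
 { intros phi0 Hphi. rewrite <- Hln at 1.
  apply (Koebe_arc_estimate B B' m th1 (1/2) (2 * exp (- N)) phi0 (1/4) Gam b); auto; try lra.
  - pose proof (exp_pos (- N)); lra.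
  - unfold Gam, Re; simpl. rewrite clamp_id by lra. rewrite <- E1. f_equal; ring.
  - unfold Gam, Re; simpl. rewrite clamp_id by lra. rewrite <- E2. f_equal; ring.
  - intros s Hs01. rewrite HGp. split.
   + unfold Gam, Re; simpl. apply X. pose proof (clamp_01 s). nra.
   + destruct (Hs _ (Hin s)) as [_ [_ [Q1 Q2]]]. unfold Gam, Im; simpl. lra. }
 assert (M1 := Main (th1 + PI / INR m / 2) ltac:(lra)). assert (M2 := Main (th1 + PI / INR m / 4) ltac:(lra)).
 fold z1 w1 in M1. fold z2 w2 in M2.
 assert (Hexp : forall x, w <= x -> exp (- N * x) <= D / 8).
 { intros x Hx. eapply Rle_trans; [|exact HNw]. assert (Hl : - N * x <= - N * w) by nra.
  destruct Hl as [Hl|Hl]. apply Rlt_le, exp_increasing; auto. rewrite Hl; lra. }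
 assert (Y1 := Hexp w1 (Rmin_l _ _)). assert (Y2 := Hexp w2 (Rmin_r _ _)).
 assert (Ht : D <= Cmod (B z1 - b) + Cmod (b - B z2)) by apply Cmod_triangle3.
 rewrite (Cmod_minus_sym b) in Ht. lra.
Qed.

Lemma sin_abs_le x : Rabs (sin x) <= Rabs x.
Proof.
 assert (P : forall y, 0 <= y -> Rabs (sin y) <= y).
 { intros y Hy. destruct (Req_dec y 0) as [->|]. rewrite sin_0, Rabs_R0; lra.
  assert (sin y < y) by (apply sin_lt_x; lra).
  apply Rabs_le. split; [|lra].
  destruct (Rle_lt_dec y PI). assert (0 <= sin y) by (apply sin_ge_0; lra). lra.
  pose proof (SIN_bound y). pose proof PI2_1. lra. }
 destruct (Rle_lt_dec 0 x). rewrite (Rabs_right x) by lra. auto.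
 rewrite (Rabs_left x) by lra. rewrite <- Rabs_Ropp, <- sin_neg. apply P; lra.
Qed.

Lemma polar_Lipschitz a b : Cmod (cis a - cis b) <= Rabs (a - b).
Proof.
 assert (E : Cmod (cis a - cis b) * Cmod (cis a - cis b) = (2 * sin ((a - b) / 2)) * (2 * sin ((a - b) / 2))).
 { rewrite Cmod_sqr. unfold polar, Re, Im; simpl.
  pose proof (sin2_cos2 a) as A. pose proof (sin2_cos2 b) as B. unfold Rsqr in *.
  assert (C1 : cos (a - b) = 1 - 2 * sin ((a - b) / 2) * sin ((a - b) / 2)).
  { replace (a - b) with (2 * ((a - b) / 2)) at 1 by field. rewrite cos_2a_sin. ring. }
  rewrite cos_minus in C1.
  replace ((1 * cos a + - (1 * cos b)) * (1 * cos a + - (1 * cos b)) + (1 * sin a + - (1 * sin b)) * (1 * sin a + - (1 * sin b)))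
   with ((sin a * sin a + cos a * cos a) + (sin b * sin b + cos b * cos b) - 2 * (cos a * cos b + sin a * sin b)) by ring.
  rewrite A, B, C1. ring. }
 pose proof (sin_abs_le ((a - b) / 2)) as S.
 assert (S2 : Rabs (2 * sin ((a - b) / 2)) <= Rabs (a - b)).
 { rewrite Rabs_mult, (Rabs_right 2) by lra. unfold Rdiv in S at 2. rewrite Rabs_mult, (Rabs_right (/ 2)) in S by lra. lra. }
 assert (E3 : Rabs (2 * sin ((a - b) / 2)) * Rabs (2 * sin ((a - b) / 2)) = 2 * sin ((a - b) / 2) * (2 * sin ((a - b) / 2))).
 { rewrite <- Rabs_mult. apply Rabs_right. apply Rle_ge, Rle_0_sqr. }
 Cnneg (cis a - cis b)%C. pose proof (Rabs_pos (2 * sin ((a - b) / 2))). nra.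
Qed.

(** Arcs approaching the circle with endpoints tending to distinct points have to sweep, on one side
    of ze, a sector of fixed opening pi/m. By [Koebe_sector] the values of B on them cannot then be
    arbitrarily close to a constant. *)
Theorem no_Koebe_arcs (B B' : C -> C) (gam : nat -> R -> C) (ze ze' : C) :
 holo B B' -> (forall z, inD z -> Cmod (B z) <= 1) -> (forall z w, inD z -> inD w -> B z = B w -> z = w) ->
 (forall n s, curve (gam n) s) -> (forall n s, 0 <= s <= 1 -> inD (gam n s)) ->
 (forall eps, 0 < eps -> exists N, forall n, (N <= n)%nat -> forall s, 0 <= s <= 1 -> 1 - eps <= Cmod (gam n s)) ->
 (forall eps, 0 < eps -> exists N, forall n, (N <= n)%nat -> exists b, Cmod b <= 1 /\ forall s, 0 <= s <= 1 -> Cmod (B (gam n s) - b) <= eps) ->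
 Clim (fun n => gam n 0) ze -> Clim (fun n => gam n 1) ze' -> Cmod ze = 1 -> ze = ze'.
Proof.
 intros HB HB1 Hinj Hc HD Hexit Hosc H0 H1 Hze. apply NNPP. intros Hne. pose proof PI_RGT_0 as HPI.
 set (D0 := Cmod (ze' - ze)). assert (HD0 : 0 < D0). { apply Cmod_gt_0, minus_neq_0. auto. }
 set (eta := D0 / 2). assert (Heta : 0 < eta) by (unfold eta; lra).
 destruct (exists_arg ze) as [be Hbe].
 destruct (archimed_cor1 (eta / (2 * PI))) as [m [Hm1 Hm2]]. { pos_div. }
 assert (Hm0 : 0 < INR m) by (apply lt_0_INR; lia).
 assert (Hpm : PI / INR m <= eta / 2).
 { unfold Rdiv. apply Rmult_lt_compat_l with (r := PI) in Hm1; [|lra].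
  replace (PI * (eta / (2 * PI))) with (eta / 2) in Hm1 by (field; lra). unfold Rdiv in Hm1. lra. }
 assert (Hpm0 : 0 < PI / INR m) by pos_div.
 (* Two candidate sectors, just after and just before the argument of ze. The arc crosses the one
    or, with time reversed, the other, according to the side on which its lifted argument ends. *)
 destruct (Koebe_sector B B' m (be + eta / 4) HB HB1 Hinj ltac:(lia)) as [d1 [Hd1 K1]].
 destruct (Koebe_sector B B' m (be - eta / 4 - PI / INR m) HB HB1 Hinj ltac:(lia)) as [d2 [Hd2 K2]].
 assert (Nze : ze <> 0) by (apply Cmod_gt_0; lra).
 destruct (local_argument ze be Nze Hbe) as [A [HA [Aze HC]]].
 destruct (HC (eta / 4)) as [d [Hd X1']]; [lra|]. destruct (H0 d Hd) as [N1 X1].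
 destruct (H1 (D0 / 8)) as [N3 X3]; [lra|].
 destruct (Hexit (Rmin (1/2) (D0 / 8))) as [N4 X4]. { apply Rmin_pos; lra. }
 destruct (Hosc (Rmin d1 d2)) as [N5 X5]. { apply Rmin_pos; lra. }
 set (n := (N1 + N3 + N4 + N5)%nat).
 specialize (X1 n ltac:(unfold n; lia)). specialize (X3 n ltac:(unfold n; lia)).
 specialize (X4 n ltac:(unfold n; lia)). destruct (X5 n ltac:(unfold n; lia)) as [b [Hb X6]]. clear X5.
 set (th0 := A (gam n 0)).
 assert (Hth0 : isarg (gam n 0 - 0) th0) by (replace (gam n 0 - 0)%C with (gam n 0) by ring; apply HA).
 assert (Hth0b : Rabs (th0 - be) < eta / 4) by (rewrite <- Aze; apply X1', X1).
 pose proof (Rmin_l (1/2) (D0 / 8)) as M1. pose proof (Rmin_r (1/2) (D0 / 8)) as M2.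
 destruct (lift_difference (gam n) (fun _ => RtoC 0) th0) as [psi [E0 Hpsi]]; auto.
 { intros t; apply curve_const. }
 { intros s t Hs _. apply Cmod_gt_0. specialize (X4 s Hs). lra. }
 set (th := fun s => psi s 0).
 assert (Hth : forall s, 0 <= s <= 1 -> continuous th s /\ isarg (gam n s) (th s)).
 { intros s Hs. destruct (Hpsi s 0 Hs ltac:(lra)) as [P1 [P2 _]]. split; auto.
  replace (gam n s - 0)%C with (gam n s) in P1 by ring. exact P1. }
 assert (Hth1 : eta <= Rabs (th 1 - be)).
 { assert (Y : D0 <= Cmod (ze' - gam n 1) + Cmod (gam n 1 - cis (th 1)) + Cmod (cis (th 1) - ze)).
  { unfold D0. le_via (Cmod_triangle3 _ (gam n 1) _).
   rewrite Rplus_assoc. apply Rplus_le_compat_l, Cmod_triangle3. }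
  rewrite (Cmod_minus_sym ze') in Y.
  assert (Y2 : Cmod (gam n 1 - cis (th 1)) <= D0 / 8).
  { destruct (Hth 1 ltac:(lra)) as [_ Q]. unfold isarg in Q. rewrite Q at 1.
   replace (polar (Cmod (gam n 1)) (th 1) - cis (th 1))%C with (RtoC (Cmod (gam n 1) - 1) * cis (th 1))%C.
   2:{ unfold polar; C_eq. }
   rewrite Cmod_mult, Cmod_polar, Cmod_R, Rmult_1_r by lra.
   specialize (X4 1 ltac:(lra)). specialize (HD n 1 ltac:(lra)). unfold inD in HD. rewrite Rabs_left by lra. lra. }
  assert (Y3 : Cmod (cis (th 1) - ze) <= Rabs (th 1 - be)).
  { unfold isarg in Hbe. rewrite Hbe, Hze. apply polar_Lipschitz. }
  unfold eta. lra. }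
 apply Rabs_def2 in Hth0b. assert (Eth0 : th 0 = th0) by exact E0.
 pose proof (Rmin_l d1 d2) as M3. pose proof (Rmin_r d1 d2) as M4.
 destruct (Rle_lt_dec be (th 1)) as [Hpos|Hneg].
 - rewrite Rabs_right in Hth1 by lra. apply (K1 (gam n) th b); auto; try lra.
  intros s Hs. destruct (Hth s Hs) as [P1 P2]. specialize (X4 s Hs). specialize (X6 s Hs). specialize (HD n s Hs). unfold inD in HD.
  repeat split; auto; lra.
 - rewrite Rabs_left in Hth1 by lra. apply (K2 (fun s => gam n (1 - s)) (fun s => th (1 - s)) b); auto.
  + intros s. apply (curve_reparam (gam n) (fun s => 1 - s)); auto.
   smooth.
  + intros s Hs. destruct (Hth (1 - s) ltac:(lra)) as [P1 P2]. specialize (X4 (1 - s) ltac:(lra)).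
   specialize (X6 (1 - s) ltac:(lra)). specialize (HD n (1 - s) ltac:(lra)). unfold inD in HD.
   repeat split; auto; try lra. apply (continuous_comp (fun s => 1 - s) th); auto.
   smooth.
  + rewrite Rminus_0_r. lra.
  + rewrite Rminus_diag. lra.
Qed.

(** * Convex quasiconformal harmonic maps: the image, the shears and their inverses *)

Section ConvexQC.
Variables (h g h' g' : C -> C) (k : R).
Hypothesis Hk : 0 <= k < 1.
Hypothesis Hh : holo h h'.
Hypothesis Hg : holo g g'.
Hypothesis h_0 : h 0 = 0.
Hypothesis g_0 : g 0 = 0.
Hypothesis h'_0 : h' 0 = 1.
Hypothesis g'_0 : g' 0 = 0.
Hypothesis dil : forall z, inD z -> Cmod (g' z) <= k * Cmod (h' z).
Hypothesis h'_nz : forall z, inD z -> h' z <> 0.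
Hypothesis f_conv : convex_image (harm h g).
Hypothesis f_inj : forall z w, inD z -> inD w -> harm h g z = harm h g w -> z = w.
Hypothesis f_inv : forall w, inD w -> forall eps, 0 < eps -> exists delta, 0 < delta /\
   forall z, inD z -> Cmod (harm h g z - harm h g w) < delta -> Cmod (z - w) < eps.

Local Notation f := (harm h g).

Definition Om (w : C) : Prop := exists z, inD z /\ f z = w.
Definition Ef (w : C) : C := epsilon (inhabits (RtoC 0)) (fun z => inD z /\ f z = w).

Lemma Ef_spec w : Om w -> inD (Ef w) /\ f (Ef w) = w.
Proof. intros H. unfold Ef. apply epsilon_spec. exact H. Qed.

Lemma Ef_f z : inD z -> Ef (f z) = z.
Proof.
 intros Hz. destruct (Ef_spec (f z)) as [H1 H2]. exists z; auto. apply f_inj; auto.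
Qed.

Lemma Om_f z : inD z -> Om (f z).
Proof. intros Hz; exists z; auto. Qed.

Lemma f_0 : f 0 = 0.
Proof. unfold harm. rewrite h_0, g_0. apply Ceq; simpl; ring. Qed.

Lemma Om_0 : Om 0.
Proof. exists 0. split. apply inD0. apply f_0. Qed.

Lemma Om_seg a b t : Om a -> Om b -> 0 <= t <= 1 -> Om (seg a b t).
Proof.
 intros [z1 [H1 <-]] [z2 [H2 <-]] Ht. destruct (f_conv z1 z2 H1 H2 t Ht) as [z [Hz E]].
 exists z; split; auto. rewrite E. unfold seg. rewrite RtoC_minus. ring.
Qed.

Lemma f_cont z : inD z -> Ccont f z.
Proof.
 intros Hz. apply Ccont_plus. apply (holo_cont _ _ Hh); auto.
 apply (Ccont_comp g Cconj). apply (holo_cont _ _ Hg); auto. apply Ccont_conj.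
Qed.

Lemma f_first_order z : inD z -> forall eps, 0 < eps -> exists d, 0 < d /\ forall w, Cmod (w - z) < d ->
 Cmod (f w - f z - (h' z * (w - z) + Cconj (g' z * (w - z)))) <= eps * Cmod (w - z).
Proof.
 intros Hz eps He. destruct (Hh z Hz (eps / 2)) as [d1 [Hd1 X1]]; [lra|].
 destruct (Hg z Hz (eps / 2)) as [d2 [Hd2 X2]]; [lra|].
 exists (Rmin d1 d2). split. apply Rmin_pos; auto. intros w Hw.
 specialize (X1 w (lt_min_l Hw)). specialize (X2 w (lt_min_r Hw)).
 replace (f w - f z - (h' z * (w - z) + Cconj (g' z * (w - z))))%C with
  ((h w - h z - h' z * (w - z)) + Cconj (g w - g z - g' z * (w - z)))%C.
 2:{ unfold harm. rewrite !Cminus_conj. ring. }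
 le_via Cmod_triangle. rewrite Cmod_conj. lra.
Qed.

(** The three cross products are, up to normalisation, the barycentric coordinates of x, and x is
    reached by two nested segments. *)
Lemma Om_triangle p1 p2 p3 x : Om p1 -> Om p2 -> Om p3 ->
 0 < cross (p2 - x) (p3 - x) -> 0 < cross (p3 - x) (p1 - x) -> 0 < cross (p1 - x) (p2 - x) -> Om x.
Proof.
 intros H1 H2 H3.
 set (c1 := cross (p2 - x) (p3 - x)). set (c2 := cross (p3 - x) (p1 - x)). set (c3 := cross (p1 - x) (p2 - x)).
 intros P1 P2 P3.
 assert (E : x = seg p3 (seg p2 p1 (c1 / (c1 + c2))) ((c1 + c2) / (c1 + c2 + c3))).
 { assert (I : (RtoC c1 * (p1 - x) + RtoC c2 * (p2 - x) + RtoC c3 * (p3 - x))%C = 0).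
  { unfold c1, c2, c3, cross. C_eq. }
  assert (N1 : RtoC (c1 + c2) <> 0) by (intros Q; apply RtoC_inj in Q; lra).
  assert (N2 : RtoC (c1 + c2 + c3) <> 0) by (intros Q; apply RtoC_inj in Q; lra).
  assert (I2 : (RtoC (c1 + c2 + c3) * x = RtoC c1 * p1 + RtoC c2 * p2 + RtoC c3 * p3)%C).
  { rewrite !RtoC_plus. transitivity (RtoC c1 * p1 + RtoC c2 * p2 + RtoC c3 * p3 - (RtoC c1 * (p1 - x) + RtoC c2 * (p2 - x) + RtoC c3 * (p3 - x)))%C.
   ring. rewrite I. ring. }
  transitivity ((RtoC c1 * p1 + RtoC c2 * p2 + RtoC c3 * p3) / RtoC (c1 + c2 + c3))%C.
  rewrite <- I2. field; auto. unfold seg. rewrite !RtoC_div by lra.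
  rewrite !RtoC_plus in *. field. auto. }
 rewrite E. apply Om_seg; auto.
 - apply Om_seg; auto. split. apply Rlt_le, Rdiv_lt_0_compat; lra.
  apply Rmult_le_reg_r with (c1 + c2). lra. unfold Rdiv. rewrite Rmult_assoc, Rinv_l by lra. lra.
 - split. apply Rlt_le, Rdiv_lt_0_compat; lra.
  apply Rmult_le_reg_r with (c1 + c2 + c3). lra. unfold Rdiv. rewrite Rmult_assoc, Rinv_l by lra. lra.
Qed.

(** Openness comes from convexity: the images of three points around z0 form a triangle that is
    positively oriented around every point close to f z0, since the differential multiplies cross
    products by |h'|^2 - |g'|^2 > 0. *)
Theorem Om_open : Copen Om.
Proof.
 intros w0 [z0 [Hz0 <-]].
 assert (Ha : 0 < Cmod (h' z0)) by (apply Cmod_gt_0, h'_nz; auto). set (a := Cmod (h' z0)) in *.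
 set (L := fun v => (h' z0 * v + Cconj (g' z0 * v))%C).
 set (dt := Cmod (h' z0) * Cmod (h' z0) - Cmod (g' z0) * Cmod (g' z0)).
 assert (Hdt : 0 < dt).
 { unfold dt. pose proof (dil z0 Hz0) as Q. fold a in Q. fold a. Cnneg (g' z0).
  assert (Cmod (g' z0) < a) by nra. nra. }
 assert (LL : forall u v, cross (L u) (L v) = dt * cross u v).
 { intros u v. unfold L, cross, dt. rewrite !Cmod_sqr. C_ring. }
 assert (LB : forall v, Cmod v <= 2 -> Cmod (L v) <= 4 * a).
 { intros v Hv. unfold L. le_via Cmod_triangle. rewrite Cmod_conj, !Cmod_mult.
  pose proof (dil z0 Hz0) as Q. fold a in Q. fold a. Cnneg (g' z0). Cnneg v.
  assert (Cmod (g' z0) * Cmod v <= a * 2) by (apply Rmult_le_compat; nra). nra. }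
 (* By [cross_perturb], errors of size eta in vectors of length at most 4 a change a cross product
    by at most 8 a eta + eta^2, which is kept below dt. *)
 set (eta := Rmin 1 (dt / (2 * (1 + 8 * a)))).
 assert (Heta : 0 < eta) by (apply Rmin_pos; [lra|pos_div]).
 assert (He1 : eta <= 1) by apply Rmin_l.
 assert (He2 : 2 * (4 * a) * eta + eta * eta < dt).
 { assert (X : eta <= dt / (2 * (1 + 8 * a))) by apply Rmin_r.
  assert (Y : dt / (2 * (1 + 8 * a)) * (1 + 8 * a) = dt / 2) by (field; lra). nra. }
 destruct (f_first_order z0 Hz0 (eta / 4)) as [d [Hd X]]; [lra|].
 unfold inD in Hz0. set (e := Rmin d (1 - Cmod z0) / 3).
 assert (HM : 0 < Rmin d (1 - Cmod z0)) by (apply Rmin_pos; lra).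
 assert (He : 0 < e) by (unfold e; lra).
 pose proof (Rmin_l d (1 - Cmod z0)). pose proof (Rmin_r d (1 - Cmod z0)).
 assert (Hpt : forall v, Cmod v <= 2 -> inD (z0 + RtoC e * v)%C /\
   Cmod (f (z0 + RtoC e * v)%C - f z0 - RtoC e * L v) <= e * (eta / 2)).
 { intros v Hv.
  assert (E1 : Cmod (RtoC e * v) <= 2 * e). { rewrite Cmod_scal by lra. nra. }
  split. { unfold inD. lt_via Cmod_triangle. unfold e in *. lra. }
  specialize (X (z0 + RtoC e * v)%C). replace (z0 + RtoC e * v - z0)%C with (RtoC e * v)%C in X by ring.
  replace (RtoC e * L v)%C with (h' z0 * (RtoC e * v) + Cconj (g' z0 * (RtoC e * v)))%C.
  2:{ unfold L. rewrite !Cmult_conj. replace (Cconj (RtoC e)) with (RtoC e) by (C_eq). ring. }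
  le_via X. unfold e in *; lra. nra. }
 exists (e * (eta / 2)). split. nra. intros x Hx.
 assert (Hc : forall u v, Cmod u <= 2 -> Cmod v <= 2 -> cross u v = 1 ->
   0 < cross (f (z0 + RtoC e * u)%C - x) (f (z0 + RtoC e * v)%C - x)).
 { intros u v Hu Hv Huv.
  assert (Q : forall w, Cmod w <= 2 -> exists dw, Cmod dw <= eta /\ (f (z0 + RtoC e * w) - x)%C = (RtoC e * (L w + dw))%C).
  { intros w Hw. exists ((f (z0 + RtoC e * w) - x - RtoC e * L w) / RtoC e)%C.
   assert (Ne : RtoC e <> 0) by (intros Q; apply RtoC_inj in Q; lra). split.
   - rewrite Cmod_div, Cmod_R, Rabs_right by (auto; lra).
    apply Rmult_le_reg_r with e. lra. unfold Rdiv. rewrite Rmult_assoc, Rinv_l by lra.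
    replace (f (z0 + RtoC e * w) - x - RtoC e * L w)%C with
     ((f (z0 + RtoC e * w) - f z0 - RtoC e * L w) - (x - f z0))%C by ring.
    rewrite Rmult_1_r. le_via Cmod_minus_le. destruct (Hpt w Hw) as [_ Y]. nra.
   - field; auto. }
  destruct (Q u Hu) as [du [Hdu Eu]]. destruct (Q v Hv) as [dv [Hdv Ev]]. rewrite Eu, Ev.
  replace (cross (RtoC e * (L u + du)) (RtoC e * (L v + dv))) with (e * e * cross (L u + du) (L v + dv))
   by (unfold cross, Re, Im; simpl; ring).
  pose proof (cross_perturb (L u) (L v) du dv (4 * a) eta (LB u Hu) (LB v Hv) Hdu Hdv) as Z.
  rewrite LL, Huv in Z. apply Rmult_lt_0_compat; nra. }
 assert (B1 : Cmod 1 <= 2) by (rewrite Cmod_1; lra).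
 assert (B2 : Cmod Ci <= 2) by (rewrite Cmod_Ci; lra).
 assert (B3 : Cmod (- (1) - Ci) <= 2) by (eapply Rle_trans; [apply Cmod_minus_le|rewrite Cmod_m1, Cmod_Ci; lra]).
 apply (Om_triangle (f (z0 + RtoC e * 1)%C) (f (z0 + RtoC e * Ci)%C) (f (z0 + RtoC e * (- (1) - Ci))%C)).
 - exact (Om_f _ (proj1 (Hpt _ B1))).
 - exact (Om_f _ (proj1 (Hpt _ B2))).
 - exact (Om_f _ (proj1 (Hpt _ B3))).
 - apply Hc; auto. unfold cross, Re, Im, Ci; simpl; ring.
 - apply Hc; auto. unfold cross, Re, Im, Ci; simpl; ring.
 - apply Hc; auto. unfold cross, Re, Im, Ci; simpl; ring.
Qed.

Lemma Ef_cont w : Om w -> Ccont Ef w.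
Proof.
 intros Hw eps He. destruct (Ef_spec w Hw) as [H1 H2].
 destruct (f_inv (Ef w) H1 eps He) as [d [Hd X]]. destruct (Om_open w Hw) as [d' [Hd' Y]].
 exists (Rmin d d'). split. apply Rmin_pos; auto. intros x Hx.
 destruct (Ef_spec x (Y x (lt_min_r Hx))) as [H3 H4].
 apply X; auto. rewrite H2, H4. eapply Rlt_le_trans; [exact Hx|apply Rmin_l].
Qed.

(** The gap between k and k' absorbs the first-order errors of h and g, because h' z is not zero. *)
Lemma local_dilatation z k' : inD z -> k < k' < 1 -> exists d, 0 < d /\ forall w, Cmod (w - z) < d ->
 Cmod (g w - g z) <= k' * Cmod (h w - h z).
Proof.
 intros Hz Hk'. assert (Ha : 0 < Cmod (h' z)) by (apply Cmod_gt_0, h'_nz; auto). set (a := Cmod (h' z)) in *.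
 set (e := (k' - k) * a / 2). assert (He : 0 < e) by (unfold e; nra).
 destruct (Hh z Hz e He) as [d1 [Hd1 X1]]. destruct (Hg z Hz e He) as [d2 [Hd2 X2]].
 exists (Rmin d1 d2). split. apply Rmin_pos; auto. intros w Hw.
 specialize (X1 w (lt_min_l Hw)). specialize (X2 w (lt_min_r Hw)).
 set (dz := (w - z)%C) in *. Cnneg dz.
 assert (A1 : a * Cmod dz - e * Cmod dz <= Cmod (h w - h z)).
 { assert (Q := Cmod_triangle_rev (h' z * dz) (- (h w - h z - h' z * dz))).
  replace (h' z * dz - - (h w - h z - h' z * dz))%C with (h w - h z)%C in Q by ring.
  rewrite Cmod_opp, Cmod_mult in Q. fold a in Q. lra. }
 assert (A2 : Cmod (g w - g z) <= k * a * Cmod dz + e * Cmod dz).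
 { replace (g w - g z)%C with ((g w - g z - g' z * dz) + g' z * dz)%C by ring.
  le_via Cmod_triangle. rewrite Cmod_mult. pose proof (dil z Hz) as Q. fold a in Q. nra. }
 assert (k' * (a * Cmod dz - e * Cmod dz) <= k' * Cmod (h w - h z)) by (apply Rmult_le_compat_l; lra).
 assert (E : k' * a = k * a + 2 * e) by (unfold e; field).
 assert (k' * e <= e) by nra.
 assert (k * a * Cmod dz + e * Cmod dz <= k' * (a * Cmod dz - e * Cmod dz)).
 { replace (k' * (a * Cmod dz - e * Cmod dz)) with ((k' * a - k' * e) * Cmod dz) by ring. rewrite E.
  replace (k * a * Cmod dz + e * Cmod dz) with ((k * a + e) * Cmod dz) by ring.
  apply Rmult_le_compat_r; lra. }
 lra.
Qed.

(** Circle of Apollonius. The gain is that a comparison of two moduli becomes a condition that is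
    visibly convex in x and homogeneous in w. *)
Lemma disc_condition (w x : C) kk : 0 <= kk < 1 ->
 (Cmod (w - x) <= kk * Cmod x <->
  Cmod (x - RtoC (/ (1 - kk * kk)) * w) <= kk / (1 - kk * kk) * Cmod w).
Proof.
 intros Hkk. assert (Hq : 0 < 1 - kk * kk) by nra. set (q := 1 - kk * kk) in *.
 assert (Sq : forall a b, 0 <= a -> 0 <= b -> (a <= b <-> a * a <= b * b)) by (intros; split; nra).
 assert (0 <= kk / q) by (apply Rmult_le_pos; [lra|apply Rlt_le, Rinv_0_lt_compat; auto]).
 Cnneg x. Cnneg w.
 rewrite Sq by (try apply Cmod_ge_0; apply Rmult_le_pos; lra).
 rewrite (Sq (Cmod (x - _))) by (try apply Cmod_ge_0; apply Rmult_le_pos; lra).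
 replace (kk * Cmod x * (kk * Cmod x)) with (kk * kk * (Cmod x * Cmod x)) by ring.
 replace (kk / q * Cmod w * (kk / q * Cmod w)) with (kk * kk / (q * q) * (Cmod w * Cmod w)) by (field; lra).
 rewrite !Cmod_sqr.
 set (a := Re x). set (b := Im x). set (c := Re w). set (e := Im w).
 replace (Re (w - x)) with (c - a) by reflexivity. replace (Im (w - x)) with (e - b) by reflexivity.
 replace (Re (x - RtoC (/ q) * w)) with (a - c / q) by (unfold a, c, Re; simpl; field; lra).
 replace (Im (x - RtoC (/ q) * w)) with (b - e / q) by (unfold b, e, Im; simpl; field; lra).
 assert (E : (a - c / q) * (a - c / q) + (b - e / q) * (b - e / q) - kk * kk / (q * q) * (c * c + e * e) =
  ((c - a) * (c - a) + (e - b) * (e - b) - kk * kk * (a * a + b * b)) / q).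
 { unfold q in *. field. lra. }
 split; intros H2.
 - assert (((c - a) * (c - a) + (e - b) * (e - b) - kk * kk * (a * a + b * b)) / q <= 0); [|lra].
  apply Rmult_le_reg_r with q; auto. unfold Rdiv. rewrite Rmult_assoc, Rinv_l by lra. lra.
 - assert (H3 : ((c - a) * (c - a) + (e - b) * (e - b) - kk * kk * (a * a + b * b)) / q <= 0) by lra.
  apply Rmult_le_compat_r with (r := q) in H3; [|lra]. unfold Rdiv in H3. rewrite Rmult_assoc, Rinv_l in H3 by lra. lra.
Qed.

(* Along the preimage of a segment, [dh] stays in a fixed Apollonius disc determined by the direction of the segment; discs being convex, the whole increment of [h] lies in it. *)
Theorem chord_dilatation z w : inD z -> inD w -> Cmod (g w - g z) <= k * Cmod (h w - h z).
Proof.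
 intros Hz Hw.
 assert (Main : forall k', k < k' < 1 -> Cmod (g w - g z) <= k' * Cmod (h w - h z)).
 { intros k' Hk'. set (W := (f w - f z)%C).
  assert (EW : forall u v, (f v - f u - (h v - h u) = Cconj (g v - g u))%C) by (intros u v; unfold harm; rewrite Cminus_conj; ring).
  set (P := fun t => Ef (seg (f z) (f w) t)).
  assert (HO : forall t, 0 <= t <= 1 -> Om (seg (f z) (f w) t)) by (intros; apply Om_seg; auto; apply Om_f; auto).
  assert (HP : forall t, 0 <= t <= 1 -> inD (P t) /\ f (P t) = seg (f z) (f w) t) by (intros t Ht; apply Ef_spec; auto).
  assert (P1 : P 1 = w). { unfold P, seg. replace (f z + 1 * (f w - f z))%C with (f w) by ring. apply Ef_f; auto. }
  assert (P0 : P 0 = z). { unfold P, seg. replace (f z + 0 * (f w - f z))%C with (f z) by ring. apply Ef_f; auto. }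
  set (c := RtoC (/ (1 - k' * k'))). set (phi := fun t => (h (P t) - RtoC t * (c * W))%C).
  assert (HL : Cmod (phi 1 - phi 0) <= k' / (1 - k' * k') * Cmod W).
  { apply local_to_global_Lipschitz. intros t Ht.
   destruct (HP t Ht) as [D1 F1]. destruct (local_dilatation (P t) k' D1 Hk') as [d [Hd X]].
   assert (HC : curve P t). { apply (curve_comp Ef (seg (f z) (f w))). apply seg_curve. apply Ef_cont; auto. }
   rewrite curve_eps in HC. destruct (HC d Hd) as [d' [Hd' Y]]. exists d'; split; auto.
   intros s Hs Hst. specialize (X _ (Y s Hst)). destruct (HP s Hs) as [D2 F2].
   rewrite <- Cmod_conj, <- EW, F1, F2 in X.
   replace (seg (f z) (f w) s - seg (f z) (f w) t)%C with (RtoC (s - t) * W)%C in X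
    by (unfold seg, W; rewrite RtoC_minus; ring).
   apply disc_condition in X; [|lra].
   replace (phi s - phi t)%C with (h (P s) - h (P t) - RtoC (/ (1 - k' * k')) * (RtoC (s - t) * W))%C
    by (unfold phi, c; rewrite RtoC_minus; ring).
   rewrite Cmod_mult, Cmod_R in X. rewrite Rmult_assoc, (Rmult_comm (Cmod W)). exact X. }
  unfold phi in HL. rewrite P0, P1 in HL.
  replace (h w - 1 * (c * W) - (h z - 0 * (c * W)))%C with (h w - h z - c * W)%C in HL by ring.
  unfold c in HL. apply disc_condition in HL; [|lra]. unfold W in HL. rewrite EW, Cmod_conj in HL. exact HL. }
 apply Rnot_lt_le. intros Hc. Cnneg (h w - h z)%C as Hp. set (H := Cmod (h w - h z)) in *.
 set (G := Cmod (g w - g z)) in *.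
 set (k' := k + Rmin ((1 - k) / 2) ((G - k * H) / (2 * (1 + H)))).
 assert (0 < Rmin ((1 - k) / 2) ((G - k * H) / (2 * (1 + H)))) by (apply Rmin_pos; [lra|pos_div]).
 pose proof (Rmin_l ((1 - k) / 2) ((G - k * H) / (2 * (1 + H)))).
 pose proof (Rmin_r ((1 - k) / 2) ((G - k * H) / (2 * (1 + H)))) as Q.
 specialize (Main k' ltac:(unfold k'; lra)).
 assert ((G - k * H) / (2 * (1 + H)) * (1 + H) = (G - k * H) / 2) by (field; lra).
 unfold k' in Main. nra.
Qed.

Lemma h_le_f z w : inD z -> inD w -> (1 - k) * Cmod (h w - h z) <= Cmod (f w - f z).
Proof.
 intros Hz Hw. pose proof (chord_dilatation z w Hz Hw).
 replace (f w - f z)%C with ((h w - h z) - - Cconj (g w - g z))%C by (unfold harm; rewrite Cminus_conj; ring).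
 assert (Q := Cmod_triangle_rev (h w - h z) (- Cconj (g w - g z))). rewrite Cmod_opp, Cmod_conj in Q. lra.
Qed.

Lemma f_le_h z w : inD z -> inD w -> Cmod (f w - f z) <= (1 + k) * Cmod (h w - h z).
Proof.
 intros Hz Hw. pose proof (chord_dilatation z w Hz Hw).
 replace (f w - f z)%C with ((h w - h z) + Cconj (g w - g z))%C by (unfold harm; rewrite Cminus_conj; ring).
 le_via Cmod_triangle. rewrite Cmod_conj. lra.
Qed.

(* The analytic shear whose real part is that of [e^(i al) f]. *)
Definition Fa (al : R) (z : C) : C := (cis al * h z + cis (- al) * g z)%C.
Definition Fa' (al : R) (z : C) : C := (cis al * h' z + cis (- al) * g' z)%C.

Lemma Fa_holo al : holo (Fa al) (Fa' al).
Proof.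
 intros z Hz. apply (Cder_plus (fun z => cis al * h z)%C (fun z => cis (- al) * g z)%C);
 apply Cder_scal; auto.
Qed.

Lemma Fa_0 al : Fa al 0 = 0.
Proof. unfold Fa. rewrite h_0, g_0. ring. Qed.

Lemma Cmod_polar1 t : Cmod (cis t) = 1.
Proof. apply Cmod_polar; lra. Qed.

Lemma Fa_re al z : Re (Fa al z) = Re (cis al * f z).
Proof. unfold Fa, harm, polar, Re, Im; simpl. rewrite cos_neg, sin_neg. ring. Qed.

Lemma Fa_diff al z w : (Fa al w - Fa al z = cis al * (h w - h z) + cis (- al) * (g w - g z))%C.
Proof. unfold Fa. ring. Qed.

Lemma Fa_le_h al z w : inD z -> inD w -> Cmod (Fa al w - Fa al z) <= (1 + k) * Cmod (h w - h z).
Proof.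
 intros Hz Hw. pose proof (chord_dilatation z w Hz Hw). rewrite Fa_diff.
 le_via Cmod_triangle. rewrite !Cmod_mult, !Cmod_polar1. lra.
Qed.

Lemma h_le_Fa al z w : inD z -> inD w -> (1 - k) * Cmod (h w - h z) <= Cmod (Fa al w - Fa al z).
Proof.
 intros Hz Hw. pose proof (chord_dilatation z w Hz Hw). rewrite Fa_diff.
 assert (Q := Cmod_triangle_rev (cis al * (h w - h z)) (- (cis (- al) * (g w - g z)))).
 replace (cis al * (h w - h z) - - (cis (- al) * (g w - g z)))%C with
  (cis al * (h w - h z) + cis (- al) * (g w - g z))%C in Q by ring.
 rewrite Cmod_opp, !Cmod_mult, !Cmod_polar1 in Q. lra.
Qed.

Lemma Fa_le_f al z w : inD z -> inD w -> (1 - k) * Cmod (Fa al w - Fa al z) <= (1 + k) * Cmod (f w - f z).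
Proof.
 intros Hz Hw. pose proof (Fa_le_h al z w Hz Hw). pose proof (h_le_f z w Hz Hw). nra.
Qed.

Lemma f_le_Fa al z w : inD z -> inD w -> (1 - k) * Cmod (f w - f z) <= (1 + k) * Cmod (Fa al w - Fa al z).
Proof.
 intros Hz Hw. pose proof (h_le_Fa al z w Hz Hw). pose proof (f_le_h z w Hz Hw). nra.
Qed.

Lemma Fa_inj al z w : inD z -> inD w -> Fa al z = Fa al w -> z = w.
Proof.
 intros Hz Hw E. apply f_inj; auto. symmetry. apply Ceq_minus. apply Cmod_eq_0.
 pose proof (f_le_Fa al z w Hz Hw) as Q. rewrite E in Q.
 replace (Fa al w - Fa al w)%C with (RtoC 0) in Q by ring. rewrite Cmod_0 in Q.
 Cnneg (f w - f z)%C. nra.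
Qed.

Lemma Fa_inv_cont al w : inD w -> forall eps, 0 < eps -> exists delta, 0 < delta /\
 forall z, inD z -> Cmod (Fa al z - Fa al w) < delta -> Cmod (z - w) < eps.
Proof.
 intros Hw eps He. destruct (f_inv w Hw eps He) as [d [Hd X]].
 exists ((1 - k) / (1 + k) * d). assert (0 < (1 - k) / (1 + k)) by pos_div.
 split. nra. intros z Hz Hlt. apply X; auto. pose proof (f_le_Fa al w z Hw Hz).
 apply Rmult_lt_compat_l with (r := 1 + k) in Hlt; [|lra].
 replace ((1 + k) * ((1 - k) / (1 + k) * d)) with ((1 - k) * d) in Hlt by (field; lra). nra.
Qed.

Lemma Fa'_nz al z : inD z -> Fa' al z <> 0.
Proof.
 intros Hz. apply Cmod_gt_0. unfold Fa'.
 assert (Q := Cmod_triangle_rev (cis al * h' z) (- (cis (- al) * g' z))).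
 replace (cis al * h' z - - (cis (- al) * g' z))%C with (cis al * h' z + cis (- al) * g' z)%C in Q by ring.
 rewrite Cmod_opp, !Cmod_mult, !Cmod_polar1 in Q. pose proof (dil z Hz).
 assert (0 < Cmod (h' z)) by (apply Cmod_gt_0, h'_nz; auto). nra.
Qed.

Definition FOm (al : R) (y : C) : Prop := exists z, inD z /\ Fa al z = y.
Definition Gf (al : R) (y : C) : C := epsilon (inhabits (RtoC 0)) (fun z => inD z /\ Fa al z = y).

Lemma Gf_spec al y : FOm al y -> inD (Gf al y) /\ Fa al (Gf al y) = y.
Proof. intros H. unfold Gf. apply epsilon_spec. exact H. Qed.

Lemma Gf_Fa al z : inD z -> Gf al (Fa al z) = z.
Proof.
 intros Hz. destruct (Gf_spec al (Fa al z)) as [H1 H2]. exists z; auto. apply (Fa_inj al); auto.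
Qed.

(** If w near Fa al z0 were omitted, 1/(Fa al - w) would be holomorphic on a small disc around z0,
    at most 2/m on its boundary circle and larger at the centre, against the maximum principle. *)
Theorem FOm_open al : Copen (FOm al).
Proof.
 intros w0 [z0 [Hz0 <-]]. set (rho := (1 - Cmod z0) / 2).
 assert (Hrho : 0 < rho) by (unfold rho; unfold inD in Hz0; lra).
 destruct (Fa_inv_cont al z0 Hz0 rho Hrho) as [m [Hm X]].
 exists (m / 2). split. lra. intros w Hw. apply NNPP. intros Hn.
 assert (Hnz : forall z, inD z -> (Fa al z - w)%C <> 0).
 { intros z Hz E. apply Hn. exists z. split; auto. apply Ceq_minus; auto. }
 set (Phi := fun z => (/ (Fa al z - w))%C).
 assert (HPhi : holo Phi (fun z => - / ((Fa al z - w) * (Fa al z - w)) * (Fa' al z - 0))%C).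
 { intros z Hz. apply (Cder_comp (fun z => Fa al z - w)%C (fun x => / x)%C).
  apply (Cder_minus (Fa al) (fun _ => w)). apply Fa_holo; auto. apply Cder_const. apply Cder_inv; auto. }
 assert (HU : forall z, Cmod (z - z0) <= rho -> inD z).
 { intros z Hz. unfold inD in *. assert (Q := Cmod_triangle_rev z z0). unfold rho in *. lra. }
 assert (B : Cmod (Phi z0) * Cmod (Phi z0) <= (2 / m) * (2 / m)).
 { apply (maximum_principle (fun z => Cmod (z - z0) < rho) (fun z => Cmod (Phi z) * Cmod (Phi z))).
  - intros z Hz. exists (rho - Cmod (z - z0)). split. lra. intros y Hy.
   lt_via (Cmod_triangle3 y z z0). lra.
  - intros z Hz. apply Rlt_le, HU. lra.
  - intros z Hz. apply Vcont_mult; apply Vcont_Cmod; apply (holo_cont _ _ HPhi); apply HU; lra.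
  - intros z Hz. apply submean_Cmod2 with (fun z => - / ((Fa al z - w) * (Fa al z - w)) * (Fa' al z - 0))%C (rho - Cmod (z - z0)).
   lra. intros y Hy. apply HPhi, HU. le_via (Cmod_triangle3 y z z0). lra.
  - intros u l M' HM' Hu Hl Hnl Hall.
   assert (Hcl : Cmod (l - z0) <= rho).
   { apply (Un_cv_le (fun n => Cmod (u n - z0)) (fun _ => rho)).
    apply (Clim_Cmod (fun n => u n - z0)%C). apply (Clim_cont (fun z => z - z0)%C); auto.
    apply Ccont_plus. apply Ccont_id. apply Ccont_const. apply Un_cv_const. exists O. intros n _. apply Rlt_le, Hu. }
   assert (Il : inD l) by (apply HU; auto).
   assert (HPl : M' <= Cmod (Phi l) * Cmod (Phi l)).
   { assert (L1 := Clim_Cmod _ _ (Clim_cont Phi u l (holo_cont _ _ HPhi l Il) Hl)).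
    apply (Un_cv_le (fun _ => M') (fun n => Cmod (Phi (u n)) * Cmod (Phi (u n)))). apply Un_cv_const.
    apply (CV_mult _ _ _ _ L1 L1). exists O. intros n _. apply Hall. }
   assert (Hge : m / 2 <= Cmod (Fa al l - w)).
   { apply Rnot_lt_le. intros Hc. apply Hnl. apply X; auto.
    lt_via (Cmod_triangle3 _ w _). lra. }
   assert (Hle : Cmod (Phi l) <= 2 / m).
   { unfold Phi. rewrite Cmod_inv by auto. replace (2 / m) with (/ (m / 2)) by (field; lra).
    apply Rinv_le_contravar; lra. }
   Cnneg (Phi l). assert (0 < 2 / m) by pos_div. nra.
  - rewrite Cmod_diag. auto. }
 assert (Hlt : 2 / m < Cmod (Phi z0)).
 { unfold Phi. rewrite Cmod_inv by auto. rewrite Cmod_minus_sym.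
  replace (2 / m) with (/ (m / 2)) by (field; lra). apply Rinv_lt_contravar; auto.
  apply Rmult_lt_0_compat. rewrite Cmod_minus_sym. apply Cmod_gt_0; auto. lra. }
 assert (0 < 2 / m) by pos_div. nra.
Qed.

Lemma Gf_cont al y : FOm al y -> Ccont (Gf al) y.
Proof.
 intros Hw eps He. destruct (Gf_spec al y Hw) as [H1 H2].
 destruct (Fa_inv_cont al (Gf al y) H1 eps He) as [d [Hd X]]. destruct (FOm_open al y Hw) as [d' [Hd' Y]].
 exists (Rmin d d'). split. apply Rmin_pos; auto. intros x Hx.
 destruct (Gf_spec al x (Y x (lt_min_r Hx))) as [H3 H4].
 apply X; auto. rewrite H2, H4. eapply Rlt_le_trans; [exact Hx|apply Rmin_l].
Qed.

Lemma Gf_Cder al y : FOm al y -> Cder (Gf al) y (/ Fa' al (Gf al y)).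
Proof.
 intros Hy. destruct (Gf_spec al y Hy) as [H1 H2].
 apply (Cder_inverse (Fa al)). apply Fa_holo; auto. apply Fa'_nz; auto. apply Gf_cont; auto.
 destruct (FOm_open al y Hy) as [d [Hd X]]. exists d; split; auto. intros x Hx. apply Gf_spec; auto.
Qed.

(* Moving in the direction [i e^(-i al)] in the image of [f] means moving vertically upwards in the image of [Fa al]. *)
Lemma vertical_monotone al z w s t : inD z -> inD w ->
 (cis al * f w - cis al * f z = Ci * RtoC s)%C -> (Fa al w - Fa al z = Ci * RtoC t)%C ->
 0 <= s * t /\ (1 - k) * Rabs s <= (1 + k) * Rabs t /\ (1 - k) * Rabs t <= (1 + k) * Rabs s.
Proof.
 intros Hz Hw Es Et.
 assert (Ns : Cmod (f w - f z) = Rabs s).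
 { replace (Cmod (f w - f z)) with (Cmod (cis al * f w - cis al * f z)).
  rewrite Es, Cmod_mult, Cmod_Ci, Cmod_R; ring.
  replace (cis al * f w - cis al * f z)%C with (cis al * (f w - f z))%C by ring.
  rewrite Cmod_mult, Cmod_polar1. ring. }
 assert (Nt : Cmod (Fa al w - Fa al z) = Rabs t) by (rewrite Et, Cmod_mult, Cmod_Ci, Cmod_R; ring).
 split; [|split].
 - set (a := (cis al * (h w - h z))%C). set (b := (cis (- al) * (g w - g z))%C).
  assert (Hb : Cmod b <= Cmod a).
  { unfold a, b. rewrite !Cmod_mult, !Cmod_polar1. pose proof (chord_dilatation z w Hz Hw).
   Cnneg (h w - h z)%C. nra. }
  assert (E1 : (a + Cconj b = Ci * RtoC s)%C).
  { rewrite <- Es. unfold a, b, harm, polar. rewrite Cmult_conj, Cminus_conj.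
   rewrite cos_neg, sin_neg. C_eq. }
  assert (E2 : (a + b = Ci * RtoC t)%C) by (rewrite <- Et, Fa_diff; reflexivity).
  assert (A1 : Re a + Re b = 0) by (apply (f_equal Re) in E2; unfold Re, Im, Ci in *; simpl in *; lra).
  assert (A2 : Im a - Im b = s) by (apply (f_equal Im) in E1; unfold Re, Im, Ci in *; simpl in *; lra).
  assert (A3 : Im a + Im b = t) by (apply (f_equal Im) in E2; unfold Re, Im, Ci in *; simpl in *; lra).
  assert (Cmod b * Cmod b <= Cmod a * Cmod a) by (Cnneg b; nra).
  rewrite !Cmod_sqr in H. nra.
 - rewrite <- Ns, <- Nt. apply f_le_Fa; auto.
 - rewrite <- Ns, <- Nt. apply Fa_le_f; auto.
Qed.


(** If Om were the whole plane, the shear would map the preimage of each vertical line into that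
    line by a function increasing at the rate (1 - k)/(1 + k) at least, and so would be onto. Then z
    -> Gf 0 (2 Fa 0 z) would be a self-map of the disc fixing 0 with derivative 2, against Schwarz's
    lemma. *)
Lemma Om_proper : exists w, ~ Om w.
Proof.
 apply NNPP. intros Hn. assert (HO : forall w, Om w). { intros w. apply NNPP. intros H. apply Hn. exists w. auto. } clear Hn.
 assert (HF : forall y, FOm 0 y).
 { intros y. set (q := (1 - k) / (1 + k)). assert (Hq : 0 < q) by pos_div.
  set (Z := fun s : R => Ef (Re y, s)). set (T := fun s => Im (Fa 0 (Z s))).
  assert (HZ : forall s, inD (Z s) /\ f (Z s) = (Re y, s)) by (intros s; apply Ef_spec; auto).
  assert (HR : forall s, Re (Fa 0 (Z s)) = Re y).
  { intros s. rewrite Fa_re. destruct (HZ s) as [_ E]. rewrite E. unfold polar. rewrite cos_0, sin_0. C_ring. }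
  assert (HT : forall s, continuous T s).
  { intros s. assert (Hc : curve (fun s => Fa 0 (Z s)) s).
   { apply (curve_comp (Fa 0) Z). 2: apply (holo_cont _ _ (Fa_holo 0)); apply HZ.
    unfold Z. apply (curve_comp Ef (fun s => (Re y, s) : C)); [|apply Ef_cont; auto].
    split; unfold Re, Im; simpl. apply continuous_const. apply continuous_id. }
   apply Hc. }
  assert (HM : forall s s', s <= s' -> q * (s' - s) <= T s' - T s).
  { intros s s' Hs. destruct (Req_dec s s') as [->|Hne]; [lra|].
   destruct (vertical_monotone 0 (Z s) (Z s') (s' - s) (T s' - T s)) as [V1 [V2 _]].
   - apply HZ.
   - apply HZ.
   - destruct (HZ s) as [_ ->]. destruct (HZ s') as [_ ->]. unfold polar. rewrite cos_0, sin_0.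
    C_eq.
   - apply Ceq.
    + rewrite re_minus, !HR. C_ring.
    + rewrite im_minus. fold (T s) (T s'). C_ring.
   - assert (0 <= T s' - T s) by nra. rewrite !Rabs_right in V2 by lra.
    unfold q. apply Rmult_le_reg_l with (1 + k). lra.
    replace ((1 + k) * ((1 - k) / (1 + k) * (s' - s))) with ((1 - k) * (s' - s)) by (field; lra). lra. }
  set (S := (Rabs (Im y - T 0) + 1) / q). assert (HS : q * S = Rabs (Im y - T 0) + 1) by (unfold S; field; lra).
  assert (HS0 : 0 < S) by (apply Rdiv_lt_0_compat; [pose proof (Rabs_pos (Im y - T 0)); lra|auto]).
  pose proof (HM 0 S ltac:(lra)). pose proof (HM (- S) 0 ltac:(lra)).
  pose proof (Rle_abs (Im y - T 0)). pose proof (Rle_abs (- (Im y - T 0))). rewrite Rabs_Ropp in *.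
  destruct (IVT_value T (- S) S (Im y)) as [s [_ E]]; auto; try nra.
  exists (Z s). split. apply HZ. apply Ceq; auto. }
 assert (HS : holo (fun z => Gf 0 (RtoC 2 * Fa 0 z)) (fun z => / Fa' 0 (Gf 0 (RtoC 2 * Fa 0 z)) * (RtoC 2 * Fa' 0 z))%C).
 { intros z Hz. apply (Cder_comp (fun z => RtoC 2 * Fa 0 z)%C (Gf 0)). apply Cder_scal, Fa_holo; auto. apply Gf_Cder; auto. }
 assert (HG0 : Gf 0 (RtoC 0) = 0) by (rewrite <- (Fa_0 0) at 1; apply Gf_Fa, inD0).
 destruct (Schwarz_disc _ _ 1 HS) as [_ Q].
 - rewrite Fa_0. replace (RtoC 2 * 0)%C with (RtoC 0) by ring. exact HG0.
 - intros z Hz. apply Rlt_le. apply Gf_spec. auto.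
 - cbv beta in Q. rewrite Fa_0 in Q. replace (RtoC 2 * 0)%C with (RtoC 0) in Q by ring.
  rewrite HG0 in Q.
  replace (/ Fa' 0 0 * (RtoC 2 * Fa' 0 0))%C with (RtoC 2) in Q by (field; apply Fa'_nz, inD0).
  rewrite Cmod_R, Rabs_right in Q; lra.
Qed.

Definition adh (p : C) : Prop := forall d, 0 < d -> exists w, Om w /\ Cmod (w - p) < d.

(** The point is a convex combination of some w of Om near p and of a multiple of the error p - w,
    which lies in a ball around 0 contained in Om. *)
Lemma Om_adh_seg p s : adh p -> 0 < s <= 1 -> Om (RtoC (1 - s) * p).
Proof.
 intros Hp Hs. destruct (Om_open 0 Om_0) as [r [Hr X]].
 destruct (Hp (s * r)) as [w [Hw Hwp]]. nra.
 replace (RtoC (1 - s) * p)%C with (seg w (RtoC ((1 - s) / s) * (p - w)) s).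
 - apply Om_seg; auto; try lra. apply X. replace (RtoC ((1 - s) / s) * (p - w) - 0)%C with (RtoC ((1 - s) / s) * (p - w))%C by ring.
  rewrite Cmod_mult, Cmod_R, Rabs_right, Cmod_minus_sym.
  2:{ apply Rle_ge. apply Rmult_le_pos. lra. apply Rlt_le, Rinv_0_lt_compat; lra. }
  apply Rle_lt_trans with (/ s * Cmod (w - p)).
  { apply Rmult_le_compat_r. apply Cmod_ge_0. unfold Rdiv. rewrite <- (Rmult_1_l (/ s)) at 2. apply Rmult_le_compat_r; [|lra].
   apply Rlt_le, Rinv_0_lt_compat; lra. }
  apply Rmult_lt_reg_l with s. lra. rewrite <- Rmult_assoc, Rinv_r, Rmult_1_l by lra. auto.
 - assert (RtoC s <> 0) by (intros E; apply RtoC_inj in E; lra).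
  unfold seg. rewrite RtoC_div, RtoC_minus by lra. field; auto.
Qed.

(** The nearest point p of the closure is the limit of a minimising sequence; comparing distances
    along the segment from p to w gives the obtuse angle inequality. *)
Lemma Om_projection q : exists p, adh p /\ forall w, Om w -> Re ((w - p) * Cconj (q - p)) <= 0.
Proof.
 destruct (completeness (fun x => exists w, Om w /\ x = - Cmod (w - q))) as [m [Hub Hlub]].
 { exists 0. intros x [w [_ ->]]. Cnneg (w - q)%C. lra. }
 { exists (- Cmod (0 - q)). exists 0. split; auto. apply Om_0. }
 set (d := - m).
 assert (Hd : forall w, Om w -> d <= Cmod (w - q)).
 { intros w Hw. unfold d. assert (- Cmod (w - q) <= m); [|lra]. apply Hub. exists w. auto. }
 assert (Hn : forall n, exists w, Om w /\ Cmod (w - q) < d + / INR (S n)).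
 { intros n. apply NNPP. intros Hc. pose proof (inv_INR_pos n). assert (m <= m - / INR (S n)); [|lra].
  apply Hlub. intros x [w [Hw ->]]. apply Rnot_lt_le. intros Hlt. apply Hc. exists w. split; auto. unfold d. lra. }
 apply choice in Hn. destruct Hn as [u Hu].
 destruct (BW_C u (Cmod q + d + 1)) as [s [p [Hs Hlim]]].
 { intros n. replace (u n) with ((u n - q) + q)%C by ring. le_via Cmod_triangle.
  assert (/ INR (S n) <= 1). { rewrite <- Rinv_1. apply Rinv_le_contravar. lra. apply (le_INR 1). lia. }
  pose proof (proj2 (Hu n)). lra. }
 exists p. split.
 { intros e He. destruct (Hlim e He) as [N X]. exists (u (s N)). split. apply Hu. apply X; lia. }
 assert (Hpq : Cmod (p - q) <= d).
 { apply Rnot_lt_le. intros Hlt. set (e := (Cmod (p - q) - d) / 2). assert (He : 0 < e) by (unfold e; lra).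
  destruct (Hlim e He) as [N1 X1]. destruct (inv_INR_small e He) as [N2 X2].
  specialize (X1 (N1 + N2)%nat ltac:(lia)). specialize (X2 (s (N1 + N2)%nat)).
  pose proof (extraction_ge s Hs (N1 + N2)). specialize (X2 ltac:(lia)).
  pose proof (proj2 (Hu (s (N1 + N2)%nat))). pose proof (Cmod_triangle3 p (u (s (N1 + N2)%nat)) q).
  rewrite Cmod_minus_sym in X1. unfold e in *. lra. }
 intros w Hw.
 assert (Hseg : forall t, 0 <= t <= 1 -> d <= Cmod (seg p w t - q)).
 { intros t Ht. apply Rnot_lt_le. intros Hlt. destruct (Hlim (d - Cmod (seg p w t - q))) as [N X]. lra.
  specialize (X N ltac:(lia)). assert (Q := Hd (seg (u (s N)) w t) ltac:(apply Om_seg; auto; apply Hu)).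
  replace (seg (u (s N)) w t - q)%C with ((RtoC (1 - t) * (u (s N) - p)) + (seg p w t - q))%C in Q
   by (unfold seg; rewrite RtoC_minus; ring).
  pose proof (Cmod_triangle (RtoC (1 - t) * (u (s N) - p)) (seg p w t - q)) as T.
  rewrite Cmod_mult, Cmod_R, Rabs_right in T by lra. Cnneg (u (s N) - p)%C. nra. }
 assert (H0 : 0 <= d). { rewrite <- (Rmult_1_l 0). pose proof (Hseg 0 ltac:(lra)). Cnneg (p - q)%C.
  destruct (Rle_lt_dec 0 d); lra. }
 set (x := Re ((w - p) * Cconj (q - p))). set (y := Cmod (w - p) * Cmod (w - p)).
 assert (Hy : 0 <= y) by (unfold y; Cnneg (w - p)%C; nra).
 assert (Hquad : forall t, 0 <= t <= 1 -> 0 <= t * t * y - 2 * t * x).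
 { intros t Ht. assert (A := Hseg t Ht). Cnneg (p - q)%C.
  assert (E : Cmod (seg p w t - q) * Cmod (seg p w t - q) = Cmod (p - q) * Cmod (p - q) + t * t * y - 2 * t * x).
  { unfold y, x. rewrite !Cmod_sqr. destruct p, w, q. unfold seg, Re, Im; simpl; ring. }
  assert (d * d <= Cmod (seg p w t - q) * Cmod (seg p w t - q)) by (apply Rmult_le_compat; auto).
  assert (Cmod (p - q) * Cmod (p - q) <= d * d) by (apply Rmult_le_compat; auto). lra. }
 apply Rnot_lt_le. intros Hx.
 destruct (Rle_lt_dec y x).
 - specialize (Hquad 1 ltac:(lra)). lra.
 - specialize (Hquad (x / y)). assert (0 < x / y) by pos_div.
  assert (x / y < 1). { apply Rmult_lt_reg_r with y. lra. unfold Rdiv. rewrite Rmult_assoc, Rinv_l; lra. }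
  specialize (Hquad ltac:(lra)). replace (x / y * (x / y) * y - 2 * (x / y) * x) with (- (x / y) * x) in Hquad by (field; lra). nra.
Qed.

(** The point projected is 2 w0 and not w0, which may be adherent to Om: were 2 w0 adherent, its
    half w0 would belong to Om. So 2 w0 differs from its projection, and the difference is the
    normal of the half-plane. *)
Lemma Om_half_plane : exists al S, 0 <= S /\ forall w, Om w -> Re (cis al * w) <= S.
Proof.
 destruct Om_proper as [w0 Hw0]. destruct (Om_projection (RtoC 2 * w0)) as [p [Hp X]].
 assert (Hne : (RtoC 2 * w0 - p)%C <> 0).
 { intros E. apply Hw0. replace w0 with (RtoC (1 - 1/2) * p)%C. apply Om_adh_seg; auto; lra.
  replace p with (RtoC 2 * w0 - (RtoC 2 * w0 - p))%C by ring. rewrite E. rewrite RtoC_minus, RtoC_div by lra. field. }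
 destruct (exists_arg (Cconj (RtoC 2 * w0 - p))) as [al Hal]. set (c := Cconj (RtoC 2 * w0 - p)) in *.
 assert (Hc : 0 < Cmod c). { apply Cmod_gt_0. intros E. apply Hne. rewrite <- (Cconj_conj (RtoC 2 * w0 - p)). fold c. rewrite E.
  C_eq. }
 assert (Hpol : forall w, Cmod c * Re (cis al * w) = Re (w * c)).
 { intros w. unfold isarg in Hal. rewrite Hal at 2. destruct w. unfold polar, Re, Im; simpl. ring. }
 exists al, (Re (p * c) / Cmod c).
 assert (Q : forall w, Om w -> Re (cis al * w) <= Re (p * c) / Cmod c).
 { intros w Hw. apply Rmult_le_reg_l with (Cmod c); auto. rewrite Hpol.
  replace (Cmod c * (Re (p * c) / Cmod c)) with (Re (p * c)) by (field; lra).
  specialize (X w Hw). replace ((w - p) * c)%C with (w * c - p * c)%C in X by ring. rewrite re_minus in X. lra. }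
 split; auto. eapply Rle_trans; [|apply (Q 0 Om_0)]. replace (cis al * 0)%C with (RtoC 0) by ring. simpl; lra.
Qed.

Lemma Om_ball : exists r, 0 < r /\ forall w, Cmod w < r -> Om w.
Proof.
 destruct (Om_open 0 Om_0) as [r [Hr X]]. exists r. split; auto. intros w Hw. apply X.
 replace (w - 0)%C with w by ring. auto.
Qed.

Lemma Om_shrink w t : Om w -> 0 <= t <= 1 -> Om (RtoC t * w).
Proof.
 intros Hw Ht. replace (RtoC t * w)%C with (seg 0 w t) by (unfold seg; ring). apply Om_seg; auto. apply Om_0.
Qed.

Lemma Ef_Clim (u : nat -> C) w : (forall n, inD (u n)) -> Clim (fun n => f (u n)) w -> Om w -> Clim u (Ef w).
Proof.
 intros Hu Hl Hw e He. destruct (Clim_cont Ef _ _ (Ef_cont w Hw) Hl e He) as [N X].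
 exists N. intros n Hn. specialize (X n Hn). cbv beta in X. rewrite Ef_f in X; auto.
Qed.

(** * Directions of escape and limits on the circle *)

(** Convergence of x n / |x n| to the unit vector e, written without division so that zero terms are
    harmless. *)
Definition dir_lim (x : nat -> C) (e : C) : Prop :=
 forall d, 0 < d -> exists N, forall n, (N <= n)%nat -> Cmod (x n - RtoC (Cmod (x n)) * e) <= d * Cmod (x n).

Lemma dir_lim_sub x e s : extraction s -> dir_lim x e -> dir_lim (fun n => x (s n)) e.
Proof.
 intros Hs Hx d Hd. destruct (Hx d Hd) as [N X]. exists N. intros n Hn. apply X.
 pose proof (extraction_ge s Hs n). lia.
Qed.

(** A point of Om further out than T + c in almost the direction e could be shrunk to modulus T + c
    and combined with a short vector of the ball around 0 to give T e. The constant d makes this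
    vector shorter than the radius r of the ball. *)
Lemma dir_upper T e c : ~ Om (RtoC T * e) -> 0 <= T -> 0 < c -> Cmod e = 1 -> exists d, 0 < d /\ forall x, Om x ->
 Cmod (x - RtoC (Cmod x) * e) <= d * Cmod x -> Cmod x <= T + c.
Proof.
 intros HT HT0 Hc He. destruct Om_ball as [r [Hr X]].
 set (d := r * c / (2 * ((T + 1) * (T + c)))).
 assert (Hd : 0 < d) by (apply Rdiv_lt_0_compat; nra).
 exists d. split; auto. intros x Hx Hxd. apply Rnot_lt_le. intros Hlt. apply HT.
 assert (Nx : RtoC (Cmod x) <> 0) by (intros E; apply RtoC_inj in E; lra).
 assert (Nc : RtoC c <> 0) by (intros E; apply RtoC_inj in E; lra).
 assert (NT : RtoC (T + c) <> 0) by (intros E; apply RtoC_inj in E; lra).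
 set (y := (RtoC ((T + c) / Cmod x) * x)%C).
 assert (Hy : Om y). { apply Om_shrink; auto. split. apply Rlt_le, Rdiv_lt_0_compat; lra.
  apply Rdiv_le_1; lra. }
 set (v := (RtoC (T / c) * (RtoC (T + c) * e - y))%C).
 assert (Hv : Om v).
 { apply X. unfold v. rewrite Cmod_mult, Cmod_R, Rabs_right.
  2:{ apply Rle_ge. apply Rmult_le_pos. lra. apply Rlt_le, Rinv_0_lt_compat; lra. }
  replace (RtoC (T + c) * e - y)%C with (- (RtoC ((T + c) / Cmod x) * (x - RtoC (Cmod x) * e)))%C.
  2:{ unfold y. rewrite RtoC_div by lra. field; auto. }
  rewrite Cmod_opp, Cmod_mult, Cmod_R, Rabs_right by (apply Rle_ge, Rlt_le, Rdiv_lt_0_compat; lra).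
  apply Rle_lt_trans with (T / c * ((T + c) / Cmod x * (d * Cmod x))).
  { apply Rmult_le_compat_l. apply Rmult_le_pos. lra. apply Rlt_le, Rinv_0_lt_compat; lra.
   apply Rmult_le_compat_l; auto. apply Rlt_le, Rdiv_lt_0_compat; lra. }
  replace (T / c * ((T + c) / Cmod x * (d * Cmod x))) with (r / 2 * (T / (T + 1))) by (unfold d; field; lra).
  assert (T / (T + 1) <= 1). { apply Rdiv_le_1; lra. }
  nra. }
 replace (RtoC T * e)%C with (seg v y (T / (T + c))).
 - apply Om_seg; auto. apply Rdiv_01; lra.
 - unfold seg, v. rewrite !RtoC_div by lra. rewrite RtoC_plus in *. field; auto.
Qed.

(** Otherwise the f (m n) would accumulate at a point T' e with T' <= T, which belongs to Om, and
    the m n at its preimage in the open disc. *)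
Lemma dir_lower T e (m : nat -> C) : Om (RtoC T * e) -> 0 <= T -> Cmod e = 1 -> (forall n, inD (m n)) ->
 Un_cv (fun n => Cmod (m n)) 1 -> dir_lim (fun n => f (m n)) e -> exists N, forall n, (N <= n)%nat -> T < Cmod (f (m n)).
Proof.
 intros HT HT0 He Hm Hm1 Hdir. apply NNPP. intros Hn.
 destruct (infinitely_often_extraction (fun n => Cmod (f (m n)) <= T)) as [s [Hs Hs2]].
 { intros N. apply NNPP. intros Hc. apply Hn. exists N. intros n Hle. apply Rnot_le_lt. intros H. apply Hc. exists n; auto. }
 destruct (BW_R (fun n => Cmod (f (m (s n)))) 0 T) as [s2 [T' [Hs3 [HT' HT'b]]]].
 { intros n. split. apply Cmod_ge_0. auto. }
 assert (Hlim : Clim (fun n => f (m (s (s2 n)))) (RtoC T' * e)).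
 { intros eps Heps. destruct (HT' (eps / 4)) as [N1 X1]; [lra|].
  destruct (dir_lim_sub _ _ _ (extraction_comp _ _ Hs Hs3) Hdir (eps / (4 * (T + 1)))) as [N2 X2].
  { pos_div. }
  exists (N1 + N2)%nat. intros n Hnn. at_rank n. cbv beta in X2.
  set (w := f (m (s (s2 n)))) in *.
  replace (w - RtoC T' * e)%C with ((w - RtoC (Cmod w) * e) + RtoC (Cmod w - T') * e)%C by (rewrite RtoC_minus; ring).
  lt_via Cmod_triangle. rewrite (Cmod_mult _ e), Cmod_R, He, Rmult_1_r.
  unfold Rdist in X1. cbv beta in X1. fold w in X1.
  assert (Hw : Cmod w <= T) by (apply Hs2). Cnneg w.
  assert (eps / (4 * (T + 1)) * Cmod w <= eps / 4); [|lra].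
  replace (eps / (4 * (T + 1)) * Cmod w) with (eps / 4 * (Cmod w / (T + 1))) by (field; lra).
  assert (Cmod w / (T + 1) <= 1). { apply Rdiv_le_1; lra. }
  nra. }
 assert (HO : Om (RtoC T' * e)).
 { destruct (Req_dec T 0) as [E|E].
  - replace T' with 0 by lra. replace (0 * e)%C with (RtoC 0) by ring. apply Om_0.
  - replace (RtoC T' * e)%C with (RtoC (T' / T) * (RtoC T * e))%C.
   + apply Om_shrink; auto. apply Rdiv_01; lra.
   + rewrite RtoC_div by auto. field. intros E2; apply RtoC_inj in E2; lra. }
 assert (Hl := Ef_Clim (fun n => m (s (s2 n))) _ (fun n => Hm _) Hlim HO).
 apply Clim_Cmod in Hl.
 assert (Hl1 := Un_cv_ext_sub _ _ _ (extraction_comp _ _ Hs Hs3) Hm1). cbv beta in Hl1.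
 pose proof (UL_sequence _ _ _ Hl Hl1) as E. pose proof (proj1 (Ef_spec _ HO)) as F. unfold inD in F. lra.
Qed.

(** The segment is compared with rho e, where rho interpolates the two moduli. The error relative to
    rho is averaged; replacing rho by the true modulus costs the factor 4. *)
Lemma seg_direction x y e d t : Cmod e = 1 -> 0 <= d <= 1/2 -> Cmod (x - RtoC (Cmod x) * e) <= d * Cmod x ->
 Cmod (y - RtoC (Cmod y) * e) <= d * Cmod y -> 0 <= t <= 1 ->
 Cmod (seg x y t - RtoC (Cmod (seg x y t)) * e) <= 4 * d * Cmod (seg x y t) /\ (1 - d) * Rmin (Cmod x) (Cmod y) <= Cmod (seg x y t).
Proof.
 intros He Hd Hx Hy Ht. set (w := seg x y t). set (rho := (1 - t) * Cmod x + t * Cmod y).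
 Cnneg x. Cnneg y.
 assert (Hr : Rmin (Cmod x) (Cmod y) <= rho).
 { pose proof (Rmin_l (Cmod x) (Cmod y)). pose proof (Rmin_r (Cmod x) (Cmod y)). unfold rho. nra. }
 assert (Hr0 : 0 <= rho) by (unfold rho; nra).
 assert (Hw : Cmod (w - RtoC rho * e) <= d * rho).
 { replace (w - RtoC rho * e)%C with (RtoC (1 - t) * (x - RtoC (Cmod x) * e) + RtoC t * (y - RtoC (Cmod y) * e))%C
   by (unfold w, seg, rho; rewrite RtoC_plus, !RtoC_mult, RtoC_minus; ring).
  le_via Cmod_triangle. rewrite !Cmod_mult, !Cmod_R, !Rabs_right by lra. unfold rho. nra. }
 assert (Hre : Cmod (RtoC rho * e) = rho) by (rewrite Cmod_mult, Cmod_R, He, Rabs_right; lra).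
 pose proof (Cmod_triangle_rev w (RtoC rho * e)) as R1. pose proof (Cmod_triangle_rev (RtoC rho * e) w) as R2.
 rewrite Cmod_minus_sym in R2. rewrite Hre in R1, R2.
 assert (R3 : rho <= 2 * Cmod w) by nra.
 split; [|nra].
 replace (w - RtoC (Cmod w) * e)%C with ((w - RtoC rho * e) + RtoC (rho - Cmod w) * e)%C by (rewrite RtoC_minus; ring).
 le_via Cmod_triangle. rewrite (Cmod_mult _ e), Cmod_R, He, Rmult_1_r.
 assert (Rabs (rho - Cmod w) <= d * rho) by (apply Rabs_le; lra). nra.
Qed.

(** By contradiction: if some preimage points accumulated at l inside the disc, f l would be a point
    T e of the ray, because directions are preserved along the segments. *)
Lemma segment_exit (u v : nat -> C) e : Cmod e = 1 -> (forall n, inD (u n)) -> (forall n, inD (v n)) ->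
 Un_cv (fun n => Cmod (u n)) 1 -> Un_cv (fun n => Cmod (v n)) 1 ->
 dir_lim (fun n => f (u n)) e -> dir_lim (fun n => f (v n)) e ->
 forall eps, 0 < eps -> exists N, forall n, (N <= n)%nat -> forall t, 0 <= t <= 1 -> 1 - eps <= Cmod (Ef (seg (f (u n)) (f (v n)) t)).
Proof.
 intros He Hu Hv Hu1 Hv1 Du Dv eps Heps. apply NNPP. intros Hn.
 destruct (infinitely_often_extraction (fun n => exists t, 0 <= t <= 1 /\ Cmod (Ef (seg (f (u n)) (f (v n)) t)) < 1 - eps)) as [s [Hs Hs2]].
 { intros N. apply NNPP. intros Hc. apply Hn. exists N. intros n Hle t Ht. apply Rnot_lt_le. intros H. apply Hc. exists n; eauto. }
 apply choice in Hs2. destruct Hs2 as [t Hts].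
 set (w := fun n => seg (f (u (s n))) (f (v (s n))) (t n)).
 assert (HwO : forall n, Om (w n)) by (intros n; apply Om_seg; try apply Om_f; auto; apply Hts).
 set (z := fun n => Ef (w n)).
 assert (Hz : forall n, inD (z n) /\ f (z n) = w n) by (intros n; apply Ef_spec; auto).
 assert (Hzb : forall n, Cmod (z n) < 1 - eps) by (intros n; apply Hts).
 destruct (BW_C z 1) as [s2 [l [Hs3 Hl]]]. { intros n. specialize (Hzb n). lra. }
 assert (Hlb : Cmod l <= 1 - eps).
 { apply (Un_cv_le _ _ _ _ (Clim_Cmod _ _ Hl) (Un_cv_const (1 - eps))). exists 0%nat. intros n _. apply Rlt_le; auto. }
 assert (Hlin : inD l) by (unfold inD; lra).
 assert (Hfl : Clim (fun n => w (s2 n)) (f l)).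
 { intros e' He'. destruct (Clim_cont f _ _ (f_cont l Hlin) Hl e' He') as [N X]. exists N. intros n Hnn.
  specialize (X n Hnn). cbv beta in X. rewrite (proj2 (Hz (s2 n))) in X. exact X. }
 set (T := Cmod (f l)).
 assert (Hdir : dir_lim (fun n => w (s2 n)) e).
 { intros d Hd. set (d' := Rmin (1/2) (d / 4)). assert (Hd' : 0 < d') by (apply Rmin_pos; lra).
  assert (d' <= d / 4) by apply Rmin_r. assert (d' <= 1/2) by apply Rmin_l.
  destruct (dir_lim_sub _ _ _ (extraction_comp _ _ Hs Hs3) Du d' Hd') as [N1 X1].
  destruct (dir_lim_sub _ _ _ (extraction_comp _ _ Hs Hs3) Dv d' Hd') as [N2 X2].
  exists (N1 + N2)%nat. intros n Hnn. at_rank n. cbv beta in X1, X2.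
  destruct (seg_direction _ _ e d' (t (s2 n)) He ltac:(lra) X1 X2 ltac:(apply Hts)) as [Y _].
  eapply Rle_trans; [exact Y|]. apply Rmult_le_compat_r. apply Cmod_ge_0. lra. }
 assert (HT : f l = (RtoC T * e)%C).
 { apply Ceq_minus. apply NNPP. intros Hc. assert (Hpos : 0 < Cmod (f l - RtoC T * e)) by (apply Cmod_gt_0; auto).
  set (q := Cmod (f l - RtoC T * e)) in *.
  destruct (Hfl (Rmin 1 (q / 4))) as [N1 X1]. apply Rmin_pos; lra.
  destruct (Hdir (q / (4 * (T + 1)))) as [N2 X2]. apply Rdiv_lt_0_compat; auto. unfold T. Cnneg (f l); lra.
  at_rank (N1 + N2)%nat. cbv beta in X1, X2.
  set (x := w (s2 (N1 + N2)%nat)) in *.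
  pose proof (Rmin_l 1 (q / 4)). pose proof (Rmin_r 1 (q / 4)).
  pose proof (Cmod_triangle_rev x (f l)) as R1. pose proof (Cmod_triangle_rev (f l) x) as R2.
  rewrite (Cmod_minus_sym (f l) x) in R2. fold T in R1, R2.
  assert (0 <= T) by apply Cmod_ge_0.
  assert (X3 : q / (4 * (T + 1)) * Cmod x <= q / 4).
  { replace (q / 4) with (q / (4 * (T + 1)) * (T + 1)) by (field; lra). apply Rmult_le_compat_l; [|lra].
   apply Rlt_le, Rdiv_lt_0_compat; lra. }
  assert (q <= Cmod (f l - x) + (Cmod (x - RtoC (Cmod x) * e) + Cmod (RtoC (Cmod x - T) * e))).
  { unfold q. replace (f l - RtoC T * e)%C with ((f l - x) + ((x - RtoC (Cmod x) * e) + RtoC (Cmod x - T) * e))%C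
    by (rewrite RtoC_minus; ring). le_via Cmod_triangle. apply Rplus_le_compat_l, Cmod_triangle. }
  rewrite (Cmod_mult _ e), Cmod_R, He, Rmult_1_r, (Cmod_minus_sym (f l)) in H2.
  assert (Rabs (Cmod x - T) < q / 4) by (apply Rabs_def1; lra). lra. }
 (* the ray meets [Om] beyond [T e], so both endpoints, hence the whole segment, eventually lie further out than [T e] *)
 destruct (Om_open (f l) (Om_f l Hlin)) as [c [Hc X]].
 assert (HO : Om (RtoC (T + c / 2) * e)).
 { apply X. rewrite HT. replace (RtoC (T + c / 2) * e - RtoC T * e)%C with (RtoC (c / 2) * e)%C by (rewrite RtoC_plus; ring).
  rewrite Cmod_mult, Cmod_R, He, Rabs_right; lra. }
 assert (HT0 : 0 <= T) by apply Cmod_ge_0.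
 destruct (dir_lower _ _ _ HO ltac:(lra) He Hu Hu1 Du) as [N1 X1].
 destruct (dir_lower _ _ _ HO ltac:(lra) He Hv Hv1 Dv) as [N2 X2].
 set (dd := Rmin (1/2) (c / (8 * (T + c)))).
 assert (Hdd : 0 < dd) by (apply Rmin_pos; [lra|pos_div]).
 destruct (Du dd Hdd) as [N3 X3]. destruct (Dv dd Hdd) as [N4 X4].
 destruct (Hfl (c / 8)) as [N5 X5]; [lra|].
 set (n := (N1 + N2 + N3 + N4 + N5)%nat).
 pose proof (extraction_ge _ (extraction_comp _ _ Hs Hs3) n) as Hge. cbv beta in Hge.
 specialize (X1 (s (s2 n)) ltac:(unfold n in *; lia)). specialize (X2 (s (s2 n)) ltac:(unfold n in *; lia)).
 specialize (X3 (s (s2 n)) ltac:(unfold n in *; lia)). specialize (X4 (s (s2 n)) ltac:(unfold n in *; lia)).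
 specialize (X5 n ltac:(unfold n; lia)). cbv beta in X3, X4, X5.
 set (a := f (u (s (s2 n)))) in *. set (b := f (v (s (s2 n)))) in *.
 assert (Ew : w (s2 n) = seg a b (t (s2 n))) by reflexivity. rewrite Ew in X5.
 destruct (Hts (s2 n)) as [Ht _]. set (tt := t (s2 n)) in *.
 destruct (seg_direction a b e dd tt He ltac:(split; [lra|apply Rmin_l]) X3 X4 Ht) as [_ P].
 assert (M : T + c / 2 < Rmin (Cmod a) (Cmod b)) by (apply Rmin_glb_lt; auto).
 pose proof (Cmod_triangle_rev (seg a b tt) (f l)) as R1. fold T in R1.
 assert (dd * (T + c) <= c / 8).
 { replace (c / 8) with (c / (8 * (T + c)) * (T + c)) by (field; lra). apply Rmult_le_compat_r. lra. apply Rmin_r. }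
 assert (dd <= 1/2) by apply Rmin_l.
 assert ((1 - dd) * (T + c / 2) <= (1 - dd) * Rmin (Cmod a) (Cmod b)) by (apply Rmult_le_compat_l; lra). nra.
Qed.

(** The image lies in a half-plane, and the shear has the same real part as the rotated f, so S + 1
    - Fa al has real part at least 1 and its reciprocal is bounded and univalent. The Lipschitz
    bound serves sequences with bounded images, the decay bound those with images going to
    infinity. *)
Lemma bounded_coordinate : exists B B' M, holo B B' /\ (forall z, inD z -> Cmod (B z) <= 1) /\
 (forall z w, inD z -> inD w -> B z = B w -> z = w) /\
 (forall z w, inD z -> inD w -> Cmod (B z - B w) <= (1 + k) / (1 - k) * Cmod (f z - f w)) /\
 (forall z, inD z -> Cmod (B z) * ((1 - k) / (1 + k) * Cmod (f z) - M) <= 1).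
Proof.
 destruct Om_half_plane as [al [S [HS0 HS]]]. set (D := fun z => (RtoC (S + 1) - Fa al z)%C).
 assert (HD : forall z, inD z -> 1 <= Cmod (D z)).
 { intros z Hz. pose proof (HS _ (Om_f z Hz)) as Q. rewrite <- Fa_re in Q.
  pose proof (re_le_Cmod (D z)) as R. unfold D in *. rewrite re_minus in R. change (Re (RtoC (S + 1))) with (S + 1) in R.
  apply Rabs_le_between in R. lra. }
 assert (HDn : forall z, inD z -> D z <> 0). { intros z Hz. apply Cmod_gt_0. specialize (HD z Hz). lra. }
 assert (HDc : forall z, inD z -> Cder D z (0 - Fa' al z)).
 { intros z Hz. apply Cder_minus. apply Cder_const. apply Fa_holo; auto. }
 exists (fun z => / D z)%C, (fun z => - / (D z * D z) * (0 - Fa' al z))%C, (S + 1).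
 split; [|split; [|split; [|split]]].
 - intros z Hz. apply (Cder_comp D (fun w => / w)%C). auto. apply Cder_inv; auto.
 - intros z Hz. rewrite Cmod_inv by auto. rewrite <- Rinv_1. apply Rinv_le_contravar; auto. lra.
 - intros z w Hz Hw E. apply (Fa_inj al); auto. assert (E2 : D z = D w).
  { replace (D z) with (/ / D z)%C by (field; auto). rewrite E. field; auto. }
  unfold D in E2. replace (Fa al z) with (RtoC (S + 1) - (RtoC (S + 1) - Fa al z))%C by ring. rewrite E2. ring.
 - intros z w Hz Hw. replace (/ D z - / D w)%C with ((D w - D z) * (/ D z * / D w))%C by (field; auto).
  replace (D w - D z)%C with (Fa al z - Fa al w)%C by (unfold D; ring).
  rewrite !Cmod_mult, !Cmod_inv by auto.
  pose proof (Fa_le_f al w z Hw Hz) as Q. Cnneg (Fa al z - Fa al w)%C.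
  assert (0 < / Cmod (D z) <= 1). { specialize (HD z Hz). split. apply Rinv_0_lt_compat; lra. rewrite <- Rinv_1. apply Rinv_le_contravar; lra. }
  assert (0 < / Cmod (D w) <= 1). { specialize (HD w Hw). split. apply Rinv_0_lt_compat; lra. rewrite <- Rinv_1. apply Rinv_le_contravar; lra. }
  apply Rle_trans with (Cmod (Fa al z - Fa al w) * 1). apply Rmult_le_compat_l; auto. nra.
  rewrite Rmult_1_r. apply Rmult_le_reg_l with (1 - k). lra.
  replace ((1 - k) * ((1 + k) / (1 - k) * Cmod (f z - f w))) with ((1 + k) * Cmod (f z - f w)) by (field; lra). auto.
 - intros z Hz. rewrite Cmod_inv by auto. specialize (HD z Hz).
  apply Rmult_le_reg_l with (Cmod (D z)). lra. rewrite <- Rmult_assoc, Rinv_r, Rmult_1_l, Rmult_1_r by lra.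
  pose proof (f_le_Fa al 0 z inD0 Hz) as Q. rewrite f_0, Fa_0 in Q.
  replace (f z - 0)%C with (f z) in Q by ring. replace (Fa al z - 0)%C with (Fa al z) in Q by ring.
  assert (Q2 : (1 - k) / (1 + k) * Cmod (f z) <= Cmod (Fa al z)).
  { apply Rmult_le_reg_l with (1 + k). lra. replace ((1 + k) * ((1 - k) / (1 + k) * Cmod (f z))) with ((1 - k) * Cmod (f z)) by (field; lra). auto. }
  pose proof (Cmod_triangle_rev (Fa al z) (RtoC (S + 1))) as R. rewrite Cmod_R, Rabs_right in R by lra.
  rewrite Cmod_minus_sym in R. unfold D. lra.
Qed.

(* The preimages of the segments joining the images would form Koebe arcs for a bounded univalent function. *)
Theorem same_direction_same_limit (u v : nat -> C) ze ze' e : Cmod e = 1 -> (forall n, inD (u n)) -> (forall n, inD (v n)) ->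
 Clim u ze -> Clim v ze' -> Cmod ze = 1 -> Cmod ze' = 1 ->
 dir_lim (fun n => f (u n)) e -> dir_lim (fun n => f (v n)) e -> ze = ze'.
Proof.
 intros He Hu Hv Lu Lv Hze Hze' Du Dv.
 assert (Hu1 : Un_cv (fun n => Cmod (u n)) 1) by (rewrite <- Hze; apply Clim_Cmod; auto).
 assert (Hv1 : Un_cv (fun n => Cmod (v n)) 1) by (rewrite <- Hze'; apply Clim_Cmod; auto).
 destruct bounded_coordinate as [B [B' [M [HB [HB1 [Binj [BLip Bdec]]]]]]].
 set (gam := fun n s => Ef (seg (f (u n)) (f (v n)) (clamp s))).
 assert (HO : forall n t, 0 <= t <= 1 -> Om (seg (f (u n)) (f (v n)) t)) by (intros; apply Om_seg; auto; apply Om_f; auto).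
 assert (Hgam : forall n s, inD (gam n s) /\ f (gam n s) = seg (f (u n)) (f (v n)) (clamp s)).
 { intros n s. apply Ef_spec, HO, clamp_01. }
 assert (HK : 0 < (1 + k) / (1 - k)) by pos_div. set (K := (1 + k) / (1 - k)) in *.
 assert (Hq : 0 < (1 - k) / (1 + k)) by pos_div. set (q := (1 - k) / (1 + k)) in *.
 apply (no_Koebe_arcs B B' gam); auto.
 - intros n s. apply (curve_comp Ef (fun s => seg (f (u n)) (f (v n)) (clamp s))).
  + apply (curve_reparam (seg (f (u n)) (f (v n))) clamp). apply seg_curve. apply clamp_continuous.
  + apply Ef_cont, HO, clamp_01.
 - intros n s _. apply Hgam.
 - intros eps Heps. destruct (segment_exit u v e He Hu Hv Hu1 Hv1 Du Dv eps Heps) as [N X]. exists N.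
  intros n Hn s Hs. apply X; auto. apply clamp_01.
 - intros eps Heps. destruct (classic (forall T, 0 <= T -> Om (RtoC T * e))) as [Hall|Hnot].
  (* The whole ray lies in Om: the images go to infinity, and [B] tends to 0 on the arcs. *)
  + set (T := 2 * ((Rabs M + / eps) / q) + 1).
   pose proof (Rinv_0_lt_compat _ Heps). pose proof (Rabs_pos M).
   assert (HT : 0 <= T). { unfold T. assert (0 <= (Rabs M + / eps) / q); [|lra]. apply Rlt_le, Rdiv_lt_0_compat; lra. }
   destruct (dir_lower _ _ _ (Hall T HT) HT He Hu Hu1 Du) as [N1 X1].
   destruct (dir_lower _ _ _ (Hall T HT) HT He Hv Hv1 Dv) as [N2 X2].
   destruct (Du (1/2)) as [N3 X3]; [lra|]. destruct (Dv (1/2)) as [N4 X4]; [lra|].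
   exists (N1 + N2 + N3 + N4)%nat. intros n Hn. exists 0. split. rewrite Cmod_0; lra.
   intros s _. destruct (Hgam n s) as [G1 G2]. replace (B (gam n s) - 0)%C with (B (gam n s)) by ring.
   at_rank n.
   destruct (seg_direction _ _ e (1/2) (clamp s) He ltac:(lra) X3 X4 (clamp_01 s)) as [_ Y]. rewrite <- G2 in Y.
   assert (T < Rmin (Cmod (f (u n))) (Cmod (f (v n)))) by (apply Rmin_glb_lt; auto).
   specialize (Bdec _ G1).
   assert (/ eps <= q * Cmod (f (gam n s)) - M).
   { assert (Rabs M + / eps <= q * Cmod (f (gam n s))).
    { replace (Rabs M + / eps) with (q * ((Rabs M + / eps) / q)) by (field; lra). apply Rmult_le_compat_l; unfold T in *; lra. }
    pose proof (Rle_abs M). lra. }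
   Cnneg (B (gam n s)).
   apply Rmult_le_reg_r with (/ eps); auto. rewrite Rinv_r by lra. nra.
  (* The ray leaves Om at the distance [Ts]. Both ends of the segment are then close to Ts e, so the
     segment is short and the Lipschitz bound controls [B] on the arc. *)
  + assert (Hex : exists T0, 0 <= T0 /\ ~ Om (RtoC T0 * e)).
   { apply NNPP. intros Hc. apply Hnot. intros T HT. apply NNPP. intros H. apply Hc. exists T; auto. }
   destruct Hex as [T0 [HT0 HnT0]].
   destruct (completeness (fun T => 0 <= T /\ Om (RtoC T * e))) as [Ts [Hub Hlub]].
   { exists T0. intros T [HT1 HT2]. apply Rnot_lt_le. intros Hlt. apply HnT0.
    replace (RtoC T0 * e)%C with (RtoC (T0 / T) * (RtoC T * e))%C.
    - apply Om_shrink; auto. apply Rdiv_01; lra.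
    - rewrite RtoC_div by lra. field. intros E; apply RtoC_inj in E; lra. }
   { exists 0. split. lra. replace (0 * e)%C with (RtoC 0) by ring. apply Om_0. }
   assert (HTs : 0 <= Ts). { apply Hub. split. lra. replace (0 * e)%C with (RtoC 0) by ring. apply Om_0. }
   set (c := eps / (8 * K)). assert (Hc : 0 < c) by pos_div.
   assert (HT : exists T, 0 <= T /\ Om (RtoC T * e) /\ Ts - c < T).
   { apply NNPP. intros Hn. assert (Ts <= Ts - c); [|lra]. apply Hlub. intros T [HT1 HT2]. apply Rnot_lt_le. intros Hlt.
    apply Hn. exists T; auto. }
   destruct HT as [T [HT1 [HT2 HT3]]].
   destruct (dir_lower _ _ _ HT2 HT1 He Hu Hu1 Du) as [N1 X1].
   destruct (dir_lower _ _ _ HT2 HT1 He Hv Hv1 Dv) as [N2 X2].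
   destruct (dir_upper (Ts + c) e c) as [d0 [Hd0 U]]; auto; try lra.
   { intros HO'. assert (Ts + c <= Ts); [|lra]. apply Hub. split; auto; lra. }
   set (d := Rmin d0 (c / (Ts + 2 * c))).
   assert (Hd : 0 < d) by (apply Rmin_pos; [auto|pos_div]).
   assert (Hdd : d <= d0) by apply Rmin_l.
   assert (Hdc : d * (Ts + 2 * c) <= c).
   { replace c with (c / (Ts + 2 * c) * (Ts + 2 * c)) at 2 by (field; lra). apply Rmult_le_compat_r. lra. apply Rmin_r. }
   destruct (Du d Hd) as [N3 X3]. destruct (Dv d Hd) as [N4 X4].
   exists (N1 + N2 + N3 + N4)%nat. intros n Hn. exists (B (u n)). split; auto. intros s _.
   at_rank n.
   cbv beta in X3, X4. destruct (Hgam n s) as [G1 G2].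
   Cnneg (f (u n)). Cnneg (f (v n)).
   assert (Ua := U _ (Om_f _ (Hu n)) ltac:(nra)). assert (Ub := U _ (Om_f _ (Hv n)) ltac:(nra)).
   eapply Rle_trans; [apply BLip; auto|]. rewrite G2.
   replace (seg (f (u n)) (f (v n)) (clamp s) - f (u n))%C with (RtoC (clamp s) * (f (v n) - f (u n)))%C by (unfold seg; ring).
   rewrite Cmod_mult, Cmod_R. pose proof (clamp_01 s). rewrite Rabs_right by lra.
   assert (Dst : Cmod (f (v n) - f (u n)) <= 5 * c).
   { replace (f (v n) - f (u n))%C with ((f (v n) - RtoC (Cmod (f (v n))) * e) + ((RtoC (Cmod (f (u n))) * e - f (u n))
     + RtoC (Cmod (f (v n)) - Cmod (f (u n))) * e))%C by (rewrite RtoC_minus; ring).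
    le_via Cmod_triangle. le_via Rplus_le_compat_l, Cmod_triangle.
    rewrite (Cmod_mult _ e), Cmod_R, He, Rmult_1_r, (Cmod_minus_sym _ (f (u n))).
    assert (Rabs (Cmod (f (v n)) - Cmod (f (u n))) <= 3 * c) by (apply Rabs_le; lra).
    assert (d * Cmod (f (v n)) <= c) by nra. assert (d * Cmod (f (u n)) <= c) by nra. lra. }
   Cnneg (f (v n) - f (u n))%C.
   apply Rle_trans with (K * (5 * c)). apply Rmult_le_compat_l. lra. nra.
   unfold c. replace (K * (5 * (eps / (8 * K)))) with (5 / 8 * eps) by (field; lra). lra.
 - intros e' He'. destruct (Lu e' He') as [N X]. exists N. intros n Hn. unfold gam. rewrite clamp_id by lra.
  replace (seg (f (u n)) (f (v n)) 0) with (f (u n)) by (unfold seg; ring). rewrite Ef_f; auto.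
 - intros e' He'. destruct (Lv e' He') as [N X]. exists N. intros n Hn. unfold gam. rewrite clamp_id by lra.
  replace (seg (f (u n)) (f (v n)) 1) with (f (v n)) by (unfold seg; ring). rewrite Ef_f; auto.
Qed.

(** * The continuous argument of f z / z and the order of boundary points *)

Lemma isarg_0 t : isarg 0 t.
Proof. unfold isarg. rewrite Cmod_0. unfold polar; C_eq. Qed.

Lemma isarg_RtoC_polar (z : C) a : isarg z a -> z = (RtoC (Cmod z) * cis a)%C.
Proof. intros H. unfold isarg in H. rewrite H at 1. unfold polar; C_eq. Qed.

Lemma RtoC_polar_isarg (z : C) a : z = (RtoC (Cmod z) * cis a)%C -> isarg z a.
Proof. intros H. unfold isarg. rewrite H at 1. unfold polar; C_eq. Qed.

Lemma isarg_polar_eq (z : C) a b : z <> 0 -> isarg z a -> isarg z b -> cis a = cis b.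
Proof.
 intros Hz Ha Hb. apply isarg_RtoC_polar in Ha, Hb.
 assert (N : RtoC (Cmod z) <> 0) by (intros E; apply RtoC_inj in E; apply Cmod_gt_0 in Hz; lra).
 assert (E : (RtoC (Cmod z) * cis a)%C = (RtoC (Cmod z) * cis b)%C) by congruence.
 replace (cis a) with (/ RtoC (Cmod z) * (RtoC (Cmod z) * cis a))%C by (field; auto). rewrite E. field; auto.
Qed.

(** f z = z Q q, where Q = h z / z has no zero and hence a logarithm, and where |q - 1| < 1 by the
    dilatation of the chord from 0 to z, so that q has a principal argument. The normalisations of
    h' and g' at 0 make [lam] vanish there. *)
Lemma argument_lift : exists lam : C -> R, lam 0 = 0 /\ (forall z, inD z -> Vcont lam z) /\
 forall z t, inD z -> isarg z t -> isarg (f z) (t + lam z).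
Proof.
 destruct (divided_difference h h' 0 Hh inD0) as [Q [Q' [HQ [Q0 HQe]]]].
 destruct (divided_difference g g' 0 Hg inD0) as [G [G' [HG [G0 HGe]]]].
 rewrite h'_0 in Q0. rewrite g'_0 in G0.
 assert (Eh : forall z, h z = (z * Q z)%C). { intros z. specialize (HQe z). rewrite h_0 in HQe. replace (h z) with (h z - 0)%C by ring. rewrite HQe. ring. }
 assert (Eg : forall z, g z = (z * G z)%C). { intros z. specialize (HGe z). rewrite g_0 in HGe. replace (g z) with (g z - 0)%C by ring. rewrite HGe. ring. }
 assert (HQn : forall z, inD z -> Q z <> 0).
 { intros z Hz E. destruct (classic (z = 0)) as [->|Hne]. rewrite Q0 in E. apply RtoC_inj in E; lra.
  apply Hne. apply (f_inj z 0); auto. apply inD0. rewrite f_0. pose proof (f_le_h 0 z inD0 Hz) as X.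
  rewrite Eh, E, h_0, f_0 in X. replace (z * 0 - 0)%C with (RtoC 0) in X by ring. rewrite Cmod_0, Rmult_0_r in X.
  replace (f z - 0)%C with (f z) in X by ring. apply Cmod_eq_0. Cnneg (f z). lra. }
 assert (HGQ : forall z, inD z -> z <> 0 -> Cmod (G z) <= k * Cmod (Q z)).
 { intros z Hz Hne. pose proof (chord_dilatation 0 z inD0 Hz) as X. rewrite g_0, h_0, Eh, Eg in X.
  replace (z * G z - 0)%C with (z * G z)%C in X by ring. replace (z * Q z - 0)%C with (z * Q z)%C in X by ring.
  rewrite !Cmod_mult in X. apply Cmod_gt_0 in Hne. apply Rmult_le_reg_l with (Cmod z); auto. lra. }
 destruct (holo_logarithm Q Q' HQ HQn Q0) as [L [L' [HL [L0 HLe]]]].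
 set (q := fun z => (1 + Cconj (G z) * Cconj z * / (z * Q z))%C).
 assert (q0 : q 0 = 1). { unfold q. rewrite G0. replace (Cconj 0) with (RtoC 0) by (C_eq). ring. }
 assert (qb : forall z, inD z -> Cmod (q z - 1) <= Cmod (G z * / Q z)).
 { intros z Hz. destruct (classic (z = 0)) as [->|Hne].
  - rewrite q0. rewrite Cmod_diag. apply Cmod_ge_0.
  - replace (q z - 1)%C with (Cconj (G z) * Cconj z * / (z * Q z))%C by (unfold q; ring).
   specialize (HQn z Hz). rewrite !Cmod_mult, !Cmod_inv, Cmod_mult, !Cmod_conj by (try apply Cmult_neq_0; auto).
   apply Cmod_gt_0 in Hne. apply Cmod_gt_0 in HQn. right. field. lra. }
 assert (qR : forall z, inD z -> 0 < Re (q z)).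
 { intros z Hz. apply Re_near_1. destruct (classic (z = 0)) as [->|Hne].
  - rewrite q0. rewrite Cmod_diag. lra.
  - eapply Rle_lt_trans; [apply qb; auto|]. rewrite Cmod_mult, Cmod_inv by auto.
   specialize (HGQ z Hz Hne). specialize (HQn z Hz). apply Cmod_gt_0 in HQn.
   apply Rmult_lt_reg_r with (Cmod (Q z)); auto. rewrite Rmult_assoc, Rinv_l by lra. nra. }
 assert (qc : forall z, inD z -> Ccont q z).
 { intros z Hz. destruct (classic (z = 0)) as [->|Hne].
  - intros eps Heps. assert (HC : Ccont (fun w => G w * / Q w)%C 0).
   { apply Ccont_mult. apply (holo_cont _ _ HG); apply inD0. apply (Ccont_comp Q (fun w => / w)%C).
    apply (holo_cont _ _ HQ); apply inD0. apply Ccont_inv. apply HQn, inD0. }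
   destruct (HC eps Heps) as [d [Hd X]]. exists (Rmin d 1). split. apply Rmin_pos; lra.
   intros w Hw. pose proof (Rmin_l d 1). pose proof (Rmin_r d 1). specialize (X w ltac:(lra)).
   rewrite G0 in X. replace (G w * / Q w - 0 * / Q 0)%C with (G w * / Q w)%C in X by ring.
   rewrite q0. eapply Rle_lt_trans; [apply qb|exact X]. replace (w - 0)%C with w in Hw by ring. unfold inD; lra.
  - unfold q. apply Ccont_plus. apply Ccont_const. apply Ccont_mult.
   + apply Ccont_mult. apply (Ccont_comp G Cconj). apply (holo_cont _ _ HG); auto. apply Ccont_conj. apply Ccont_conj.
   + apply (Ccont_comp (fun z => z * Q z)%C (fun w => / w)%C). apply Ccont_mult. apply Ccont_id. apply (holo_cont _ _ HQ); auto.
    apply Ccont_inv. apply Cmult_neq_0; auto. }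
 exists (fun z => Im (L z) + Im (Clog (q z))). split; [|split].
 - rewrite L0, q0. unfold Clog, Re, Im; simpl. unfold Rdiv. rewrite Rmult_0_l, atan_0. ring.
 - intros z Hz. assert (HC : Ccont (fun w => L w + Clog (q w))%C z).
  { apply Ccont_plus. apply (holo_cont _ _ HL); auto. apply (Ccont_comp q Clog); auto. apply Clog_cont; auto. }
  intros eps Heps. destruct (HC eps Heps) as [d [Hd X]]. exists d. split; auto. intros w Hw. specialize (X w Hw).
  eapply Rle_lt_trans; [|exact X]. eapply Rle_trans; [|apply im_le_Cmod]. rewrite im_minus. right. reflexivity.
 - intros z t Hz Ht. destruct (classic (z = 0)) as [->|Hne]. rewrite f_0. apply isarg_0.
  replace (f z) with (z * (Q z * q z))%C.
  + replace (t + (Im (L z) + Im (Clog (q z)))) with (t + (Im (L z) + Im (Clog (q z)))) by ring.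
   apply isarg_mult; auto. apply isarg_mult.
   * rewrite <- HLe by auto. replace (Cexp (L z)) with (polar (exp (Re (L z))) (Im (L z))) by reflexivity.
    apply isarg_polar. left; apply exp_pos.
   * apply isarg_Clog; auto.
  + unfold harm. rewrite Eh, Eg, Cmult_conj. unfold q. field. auto.
Qed.

Lemma dir_extract (x : nat -> C) : exists s e, extraction s /\ Cmod e = 1 /\ dir_lim (fun n => x (s n)) e.
Proof.
 assert (H := fun n => exists_arg (x n)). apply choice in H. destruct H as [th Hth].
 destruct (BW_C (fun n => cis (th n)) 1) as [s [e [Hs He]]]. { intros n. rewrite Cmod_polar1. lra. }
 exists s, e. split; [|split]; auto.
 - apply Clim_Cmod in He. apply (UL_sequence _ _ _ He). intros eps Heps. exists 0%nat. intros n _.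
  rewrite Cmod_polar1. unfold Rdist. rewrite Rminus_diag, Rabs_R0. auto.
 - intros d Hd. destruct (He d Hd) as [N X]. exists N. intros n Hn. specialize (X n Hn). cbv beta in X.
  set (y := x (s n)). rewrite (isarg_RtoC_polar y _ (Hth (s n))) at 1.
  replace (RtoC (Cmod y) * cis (th (s n)) - RtoC (Cmod y) * e)%C with (RtoC (Cmod y) * (cis (th (s n)) - e))%C by ring.
  rewrite Cmod_scal by (apply Cmod_ge_0). Cnneg y. nra.
Qed.

Lemma dir_lim_scal (x : nat -> C) (c : nat -> R) e : (forall n, 0 <= c n) -> dir_lim x e -> dir_lim (fun n => RtoC (c n) * x n)%C e.
Proof.
 intros Hc Hx d Hd. destruct (Hx d Hd) as [N X]. exists N. intros n Hn. specialize (X n Hn). specialize (Hc n).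
 rewrite Cmod_scal by lra.
 replace (RtoC (c n) * x n - RtoC (c n * Cmod (x n)) * e)%C with (RtoC (c n) * (x n - RtoC (Cmod (x n)) * e))%C by (rewrite RtoC_mult; ring).
 rewrite Cmod_scal by lra. nra.
Qed.

Section ArgumentLift.
Variable lam : C -> R.
Hypothesis lam_0 : lam 0 = 0.
Hypothesis lam_cont : forall z, inD z -> Vcont lam z.
Hypothesis lam_arg : forall z t, inD z -> isarg z t -> isarg (f z) (t + lam z).

Lemma f_neq_0 z : inD z -> z <> 0 -> f z <> 0.
Proof. intros Hz Hne E. apply Hne. apply f_inj; auto. apply inD0. rewrite f_0; auto. Qed.

Lemma arg_preimage z phi : inD z -> isarg (f z) phi -> isarg z (phi - lam z).
Proof.
 intros Hz Hp. destruct (classic (z = 0)) as [->|Hne]. apply isarg_0.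
 destruct (exists_arg z) as [t Ht]. assert (E := isarg_polar_eq _ _ _ (f_neq_0 z Hz Hne) Hp (lam_arg z t Hz Ht)).
 apply RtoC_polar_isarg. rewrite (isarg_RtoC_polar z t Ht) at 1. f_equal.
 replace (cis (phi - lam z)) with (cis phi * cis (- lam z))%C by (rewrite polar_mult; f_equal; ring).
 rewrite E, polar_mult. f_equal; ring.
Qed.

(** Preimage of the segment from 0 to f z. The image argument is constant along it, so the argument
    of the point itself varies only through [lam]. *)
Definition ray (z : C) (t : R) : C := Ef (RtoC (clamp t) * f z).

Lemma ray_spec z t : inD z -> inD (ray z t) /\ f (ray z t) = (RtoC (clamp t) * f z)%C.
Proof. intros Hz. apply Ef_spec, Om_shrink. apply Om_f; auto. apply clamp_01. Qed.

Lemma ray_curve z t : inD z -> curve (ray z) t.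
Proof.
 intros Hz. unfold ray. apply (curve_comp Ef (fun t => RtoC (clamp t) * f z)%C).
 - apply curve_mult. apply curve_RtoC, clamp_continuous. apply curve_const.
 - apply Ef_cont, Om_shrink. apply Om_f; auto. apply clamp_01.
Qed.

Lemma ray_0 z : inD z -> ray z 0 = 0.
Proof.
 intros Hz. unfold ray. rewrite clamp_id by lra. replace (0 * f z)%C with (f 0) by (rewrite f_0; ring). apply Ef_f, inD0.
Qed.

Lemma ray_1 z : inD z -> ray z 1 = z.
Proof. intros Hz. unfold ray. rewrite clamp_id by lra. rewrite Cmult_1_l. apply Ef_f; auto. Qed.

Lemma ray_arg z t phi : inD z -> isarg (f z) phi -> isarg (ray z t) (phi - lam (ray z t)).
Proof.
 intros Hz Hp. destruct (ray_spec z t Hz) as [H1 H2]. apply arg_preimage; auto. rewrite H2. apply isarg_scal; auto. apply clamp_01.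
Qed.

(** In the coordinates (modulus, argument) the two rays are curves over the same interval of moduli.
    A common value would be a common point of the disc, where [lam] is the same and the image
    arguments would agree. So they do not cross, and the order at small modulus persists up to the
    modulus R. *)
Lemma first_hit_order R z1 z2 phi1 phi2 : 0 < R < 1 -> inD z1 -> inD z2 -> R <= Cmod z1 -> R <= Cmod z2 ->
 isarg (f z1) phi1 -> isarg (f z2) phi2 -> phi1 < phi2 ->
 exists t1 t2, 0 <= t1 <= 1 /\ 0 <= t2 <= 1 /\ Cmod (ray z1 t1) = R /\ Cmod (ray z2 t2) = R /\
  phi1 - lam (ray z1 t1) <= phi2 - lam (ray z2 t2).
Proof.
 intros HR Hz1 Hz2 HR1 HR2 Hp1 Hp2 Hlt.
 destruct (lam_cont 0 inD0 ((phi2 - phi1) / 2)) as [d [Hd Hlam]]; [lra|].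
 (* At this modulus [lam] is less than half of phi2 - phi1, so the curves start in the order of phi1
    and phi2. *)
 set (r0 := Rmin (d / 2) (R / 2)). assert (Hr0 : 0 < r0) by (apply Rmin_pos; lra).
 assert (Hr0d : r0 <= d / 2) by apply Rmin_l. assert (Hr0R : r0 <= R / 2) by apply Rmin_r.
 assert (Hsub : forall z, inD z -> R <= Cmod z -> exists s T, 0 <= s <= T /\ T <= 1 /\ Cmod (ray z s) = r0 /\ Cmod (ray z T) = R /\
  forall t, s <= t <= T -> r0 <= Cmod (ray z t) <= R).
 { intros z Hz HRz. assert (Hc : forall t, continuous (fun t => Cmod (ray z t)) t) by (intros t; apply continuous_Cmod, ray_curve; auto).
  destruct (first_time (fun t => Cmod (ray z t)) 0 1 R) as [T [HT [ET XT]]]; auto. lra.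
  { rewrite ray_0, ray_1, Cmod_0 by auto. lra. }
  assert (T <> 0). { intros E. rewrite E, ray_0, Cmod_0 in ET by auto. lra. }
  destruct (last_time (fun t => Cmod (ray z t)) 0 T r0) as [s [Hs [Es Xs]]]; auto. lra.
  { rewrite ray_0, ET, Cmod_0 by auto. lra. }
  exists s, T. split. lra. split. lra. split; auto. split; auto. intros t Ht. split. apply Xs; lra. apply XT; lra. }
 destruct (Hsub z1 Hz1 HR1) as [s1 [T1 [Hs1 [HT1 [Es1 [ET1 X1]]]]]].
 destruct (Hsub z2 Hz2 HR2) as [s2 [T2 [Hs2 [HT2 [Es2 [ET2 X2]]]]]].
 exists T1, T2. split. lra. split. lra. split; auto. split; auto.
 apply Rnot_lt_le. intros Hc.
 set (cv := fun z phi s T x => (Cmod (ray z (s + (T - s) * clamp x)), phi - lam (ray z (s + (T - s) * clamp x))) : C).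
 assert (Hcv : forall z phi s T, inD z -> forall x, curve (cv z phi s T) x).
 { intros z phi s T Hz x.
  assert (Hcu : continuous (fun x => s + (T - s) * clamp x) x).
  { apply (continuous_plus (fun _ => s)). apply continuous_const.
   apply (continuous_Rmult (fun _ => T - s)). apply continuous_const. apply clamp_continuous. }
  assert (Hcr : curve (fun x => ray z (s + (T - s) * clamp x)) x).
  { apply (curve_reparam (ray z) (fun x => s + (T - s) * clamp x)). apply ray_curve; auto. auto. }
  split; unfold cv, Re, Im; simpl.
  - apply (continuous_Cmod (fun x => ray z (s + (T - s) * clamp x))). auto.
  - apply (continuous_minus (fun _ => phi)). apply continuous_const.
   apply (Vcont_curve lam (fun x => ray z (s + (T - s) * clamp x))); auto. apply lam_cont, ray_spec; auto. }
 assert (Hin : forall s T x, s <= T -> s <= s + (T - s) * clamp x <= T). { intros s T x H. pose proof (clamp_01 x). nra. }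
 assert (E0 : forall s T, s + (T - s) * clamp 0 = s) by (intros; rewrite clamp_id by lra; ring).
 assert (E1 : forall s T, s + (T - s) * clamp 1 = T) by (intros; rewrite clamp_id by lra; ring).
 assert (Hsmall : forall z s, inD z -> Cmod (ray z s) = r0 -> Rabs (lam (ray z s)) < (phi2 - phi1) / 2).
 { intros z s Hz E. specialize (Hlam (ray z s)). rewrite lam_0, Rminus_0_r in Hlam. apply Hlam.
  replace (ray z s - 0)%C with (ray z s) by ring. lra. }
 destruct (crossing_fan (cv z2 phi2 s2 T2) (cv z1 phi1 s1 T1)) as [x [y [Hx [Hy E]]]].
 - apply Hcv; auto.
 - apply Hcv; auto.
 - intros t _. unfold cv, Re; simpl. rewrite E0, E1, Es2, ET2. apply X1, Hin; lra.
 - intros t _. unfold cv, Re; simpl. rewrite E0, E1, Es1, ET1. apply X2, Hin; lra.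
 - unfold cv, Im; simpl. rewrite !E0. pose proof (Hsmall z1 s1 Hz1 Es1) as A. pose proof (Hsmall z2 s2 Hz2 Es2) as B.
  apply Rabs_def2 in A, B. lra.
 - unfold cv, Im; simpl. rewrite !E1. lra.
 - unfold cv in E. injection E as E2 E3.
  set (u := s2 + (T2 - s2) * clamp x) in *. set (v := s1 + (T1 - s1) * clamp y) in *.
  assert (Q1 := ray_arg z1 v phi1 Hz1 Hp1). assert (Q2 := ray_arg z2 u phi2 Hz2 Hp2).
  unfold isarg in Q1, Q2. rewrite E2, E3, <- Q1 in Q2. rewrite Q2 in E3. lra.
Qed.

(** Otherwise, along some ray close to the circle, the argument changes by a fixed amount [et]
    between two points [a n] and [c n], obtained by the intermediate value theorem. Both sequences
    tend to the circle and their images have the same limit direction, so they have the same limit,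
    whereas their arguments differ by [et]. *)
Lemma ray_angle_close eta : 0 < eta -> exists R0, 0 < R0 < 1 /\ forall b t, inD b -> 0 <= t <= 1 ->
 R0 <= Cmod b -> R0 <= Cmod (ray b t) -> Rabs (lam b - lam (ray b t)) <= eta.
Proof.
 intros Heta. apply NNPP. intros Hn.
 assert (Hseq : forall n : nat, exists p : C * R, inD (fst p) /\ 0 <= snd p <= 1 /\ 1 - / INR (S (S n)) <= Cmod (fst p) /\
   1 - / INR (S (S n)) <= Cmod (ray (fst p) (snd p)) /\ eta < Rabs (lam (fst p) - lam (ray (fst p) (snd p)))).
 { intros n. apply NNPP. intros Hc. apply Hn. exists (1 - / INR (S (S n))).
  assert (0 < / INR (S (S n))) by apply inv_INR_pos.
  assert (/ INR (S (S n)) < 1). { rewrite <- Rinv_1. apply Rinv_lt_contravar. rewrite Rmult_1_l. apply lt_0_INR; lia. apply (lt_INR 1). lia. }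
  split. lra. intros b t Hb Ht H1 H2. apply Rnot_lt_le. intros H3. apply Hc. exists (b, t). simpl. auto. }
 apply choice in Hseq. destruct Hseq as [p Hp].
 assert (Hto1 : forall m : nat -> C, (forall n, inD (m n)) -> (forall n, 1 - / INR (S (S n)) <= Cmod (m n)) -> Un_cv (fun n => Cmod (m n)) 1).
 { intros m Hm1 Hm2 e He. destruct (inv_INR_small e He) as [N X]. exists N. intros n Hnn. specialize (X (S n) ltac:(lia)).
  specialize (Hm1 n). specialize (Hm2 n). unfold inD in Hm1. unfold Rdist. apply Rabs_def1; lra. }
 set (b0 := fun n => fst (p n)). set (a0 := fun n => ray (fst (p n)) (snd (p n))).
 assert (Hb01 : Un_cv (fun n => Cmod (b0 n)) 1) by (apply Hto1; intros; apply Hp).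
 assert (Ha01 : Un_cv (fun n => Cmod (a0 n)) 1) by (apply Hto1; intros; [apply ray_spec|]; apply Hp).
 destruct (dir_extract (fun n => f (b0 n))) as [s1 [e [Hs1 [He De]]]].
 destruct (BW_C (fun n => a0 (s1 n)) 1) as [s2 [ze [Hs2 Hze]]].
 { intros n. apply Rlt_le. apply ray_spec, Hp. }
 assert (Hs12 := extraction_comp _ _ Hs1 Hs2). cbv beta in Hs12.
 set (b := fun n => b0 (s1 (s2 n))). set (a := fun n => a0 (s1 (s2 n))). set (t := fun n => clamp (snd (p (s1 (s2 n))))).
 assert (Hb : forall n, inD (b n)) by (intros; apply Hp).
 assert (Ha : forall n, inD (a n)) by (intros; apply ray_spec, Hp).
 assert (Hb1 : Un_cv (fun n => Cmod (b n)) 1) by (apply (Un_cv_ext_sub _ _ _ Hs12 Hb01)).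
 assert (Ha1 : Un_cv (fun n => Cmod (a n)) 1) by (apply (Un_cv_ext_sub _ _ _ Hs12 Ha01)).
 assert (Db : dir_lim (fun n => f (b n)) e) by (apply (dir_lim_sub _ _ s2 Hs2 De)).
 assert (Hfa : forall n, f (a n) = (RtoC (t n) * f (b n))%C) by (intros n; apply ray_spec, Hp).
 assert (Ht : forall n, 0 <= t n <= 1) by (intros n; apply clamp_01).
 assert (Da : dir_lim (fun n => f (a n)) e).
 { intros d Hd. destruct (dir_lim_scal _ t e ltac:(intros; apply Ht) Db d Hd) as [N X]. exists N. intros n Hnn. rewrite Hfa. apply X; auto. }
 assert (Hexit := segment_exit a b e He Ha Hb Ha1 Hb1 Da Db).
 set (gam := fun n x => Ef (seg (f (a n)) (f (b n)) (clamp x))).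
 assert (HO : forall n x, Om (seg (f (a n)) (f (b n)) (clamp x))) by (intros; apply Om_seg; try apply Om_f; auto; apply clamp_01).
 assert (Hgam : forall n x, inD (gam n x) /\ f (gam n x) = seg (f (a n)) (f (b n)) (clamp x)) by (intros; apply Ef_spec; auto).
 (* Capped at 1 so that cos et < 1; a difference of a full turn would not separate the limits. *)
 set (et := Rmin eta 1). assert (Het : 0 < et <= 1) by (split; [apply Rmin_pos; lra|apply Rmin_r]).
 assert (Heteta : et <= eta) by apply Rmin_l.
 assert (HIVT : forall n, exists x, 0 <= x <= 1 /\ Rabs (lam (gam n x) - lam (a n)) = et).
 { intros n. destruct (IVT_value (fun x => Rabs (lam (gam n x) - lam (a n))) 0 1 et) as [x Hx]; try lra.
  - intros x _. apply (continuous_comp (fun x => lam (gam n x) - lam (a n)) Rabs).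
   + apply (continuous_minus (fun x => lam (gam n x))). 2: apply continuous_const.
    apply (Vcont_curve lam (gam n)). 2: apply lam_cont, Hgam.
    unfold gam. apply (curve_comp Ef (fun x => seg (f (a n)) (f (b n)) (clamp x))). 2: apply Ef_cont; auto.
    apply (curve_reparam (seg (f (a n)) (f (b n))) clamp). apply seg_curve. apply clamp_continuous.
   + apply continuous_Rabs.
  - unfold gam. rewrite !clamp_id by lra. replace (seg (f (a n)) (f (b n)) 0) with (f (a n)) by (unfold seg; ring).
   replace (seg (f (a n)) (f (b n)) 1) with (f (b n)) by (unfold seg; ring). rewrite !Ef_f by auto.
   rewrite Rminus_diag, Rabs_R0. destruct (Hp (s1 (s2 n))) as [_ [_ [_ [_ Q]]]]. fold (b0 (s1 (s2 n))) (a0 (s1 (s2 n))) (a n) (b n) in Q.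
   change (eta < Rabs (lam (b n) - lam (a n))) in Q. lra.
  - exists x. auto. }
 apply choice in HIVT. destruct HIVT as [x Hx].
 set (c := fun n => gam n (x n)).
 assert (Hc : forall n, inD (c n)) by (intros; apply Hgam).
 destruct (BW_C c 1) as [s3 [ze' [Hs3 Hze']]]. { intros n. apply Rlt_le, Hc. }
 assert (Hc1 : Un_cv (fun n => Cmod (c n)) 1).
 { intros eps Heps. destruct (Hexit (eps / 2)) as [N X]; [lra|]. exists N. intros n Hnn.
  specialize (X n Hnn (clamp (x n)) (clamp_01 _)). specialize (Hc n). unfold inD in Hc. fold (gam n (x n)) in X. fold (c n) in X.
  unfold Rdist. apply Rabs_def1; lra. }
 assert (Mze : Cmod ze = 1) by (apply (UL_sequence _ _ _ (Clim_Cmod _ _ Hze)); exact Ha1).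
 assert (Mze' : Cmod ze' = 1) by (apply (UL_sequence _ _ _ (Clim_Cmod _ _ Hze')); apply (Un_cv_ext_sub _ _ _ Hs3 Hc1)).
 set (tc := fun n => t n + clamp (x n) * (1 - t n)).
 assert (Htc : forall n, 0 <= tc n). { intros n. specialize (Ht n). pose proof (clamp_01 (x n)). unfold tc. nra. }
 assert (Hfc : forall n, f (c n) = (RtoC (tc n) * f (b n))%C).
 { intros n. unfold c. rewrite (proj2 (Hgam n (x n))), Hfa. unfold seg, tc. rewrite RtoC_plus, RtoC_mult, RtoC_minus. ring. }
 assert (Dc : dir_lim (fun n => f (c n)) e).
 { intros d Hd. destruct (dir_lim_scal _ tc e Htc Db d Hd) as [N X]. exists N. intros n Hnn. rewrite Hfc. apply X; auto. }
 assert (Eze : ze = ze').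
 { apply (same_direction_same_limit (fun n => a (s3 n)) (fun n => c (s3 n)) ze ze' e); auto.
  - apply (Clim_ext_sub _ _ _ Hs3 Hze).
  - apply (dir_lim_sub _ _ s3 Hs3 Da).
  - apply (dir_lim_sub _ _ s3 Hs3 Dc). }
 assert (Hdot : forall n, Re (Cconj (a (s3 n)) * c (s3 n)) = Cmod (a (s3 n)) * Cmod (c (s3 n)) * cos et).
 { intros n. set (m := s3 n). destruct (exists_arg (f (b m))) as [phi Hphi].
  assert (A1 : isarg (a m) (phi - lam (a m))). { apply arg_preimage; auto. rewrite Hfa. apply isarg_scal; auto. apply Ht. }
  assert (A2 : isarg (c m) (phi - lam (c m))). { apply arg_preimage; auto. rewrite Hfc. apply isarg_scal; auto. }
  replace (cos et) with (cos ((phi - lam (a m)) - (phi - lam (c m)))).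
  - rewrite cos_minus. pose proof (isarg_Re _ _ A1). pose proof (isarg_Im _ _ A1). pose proof (isarg_Re _ _ A2). pose proof (isarg_Im _ _ A2).
   replace (Re (Cconj (a m) * c m)) with (Re (a m) * Re (c m) + Im (a m) * Im (c m)) by C_ring.
   rewrite H, H0, H1, H2. ring.
  - destruct (Hx m) as [_ Q]. fold (c m) in Q. rewrite <- Q. replace (phi - lam (a m) - (phi - lam (c m))) with (lam (c m) - lam (a m)) by ring.
   unfold Rabs. destruct (Rcase_abs _). symmetry; apply cos_neg. reflexivity. }
 assert (L1 : Un_cv (fun n => Re (Cconj (a (s3 n)) * c (s3 n))) (Re (Cconj ze * ze'))).
 { apply Clim_Re. apply (Clim_mult (fun n => Cconj (a (s3 n)))); auto. apply (Clim_cont Cconj). apply Ccont_conj. apply (Clim_ext_sub _ _ _ Hs3 Hze). }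
 assert (L2 : Un_cv (fun n => Cmod (a (s3 n)) * Cmod (c (s3 n)) * cos et) (1 * 1 * cos et)).
 { apply CV_mult. apply CV_mult. apply (Un_cv_ext_sub _ _ _ Hs3 Ha1). apply (Un_cv_ext_sub _ _ _ Hs3 Hc1). apply Un_cv_const. }
 assert (L3 : Un_cv (fun n => Re (Cconj (a (s3 n)) * c (s3 n))) (1 * 1 * cos et)).
 { intros eps Heps. destruct (L2 eps Heps) as [N X]. exists N. intros n Hnn. rewrite Hdot. apply X; auto. }
 assert (E := UL_sequence _ _ _ L1 L3). rewrite <- Eze in E.
 replace (Re (Cconj ze * ze)) with (Cmod ze * Cmod ze) in E by (rewrite Cmod_sqr; C_ring).
 rewrite Mze in E. assert (cos et < 1); [|lra].
 rewrite <- cos_0. apply cos_decreasing_1; pose proof PI_RGT_0; pose proof PI2_1; lra.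
Qed.

(** The order is exact where the rays first reach the modulus R0, and from there on the arguments
    vary by at most eta/2 each. *)
Lemma boundary_order eta : 0 < eta -> exists R0, 0 < R0 < 1 /\ forall z1 z2 phi1 phi2, inD z1 -> inD z2 ->
 R0 <= Cmod z1 -> R0 <= Cmod z2 -> isarg (f z1) phi1 -> isarg (f z2) phi2 -> phi1 < phi2 ->
 phi1 - lam z1 <= phi2 - lam z2 + eta.
Proof.
 intros Heta. destruct (ray_angle_close (eta / 2)) as [R0 [HR0 X]]; [lra|]. exists R0. split; auto.
 intros z1 z2 phi1 phi2 H1 H2 HR1 HR2 Hp1 Hp2 Hlt.
 destruct (first_hit_order R0 z1 z2 phi1 phi2) as [t1 [t2 [Ht1 [Ht2 [E1 [E2 Q]]]]]]; auto.
 pose proof (X z1 t1 H1 Ht1 HR1 ltac:(lra)) as A. pose proof (X z2 t2 H2 Ht2 HR2 ltac:(lra)) as B.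
 apply Rabs_le_between in A, B. lra.
Qed.

(** * Extremal sequences ending at antipodal points *)

Lemma polar_plus_PI t : cis (t + PI) = (- cis t)%C.
Proof. unfold polar. rewrite neg_cos, neg_sin. C_eq. Qed.

Lemma polar_plus_2PI t : cis (t + 2 * PI) = cis t.
Proof. unfold polar. rewrite cos_2PI_plus, sin_2PI_plus || (rewrite cos_plus, sin_plus, cos_2PI, sin_2PI). C_eq. Qed.

Lemma polar_curve1 t : curve cis t.
Proof. split; unfold polar, Re, Im; simpl; smooth. Qed.

(** Asymptotic maximality of a linear form, tested against one competitor w at a time because the
    supremum over an unbounded Om may be infinite. *)
Definition support (al : nat -> R) (m : nat -> C) : Prop :=
 forall w e, Om w -> 0 < e -> exists N, forall n, (N <= n)%nat ->
  Re (cis (al n) * w) - e <= Re (cis (al n) * f (m n)).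

(** The images of b n and a n are asymptotically extremal for Re (e^(i al) w), maximal and minimal
    respectively, while the points themselves tend to antipodal points of the circle. [pb] and [pa]
    are arguments of the images, which after the rotation by al lie in the right and in the left
    half-plane. [ap_opp] says that the points are exactly opposite in argument at every rank. *)
Record antipodal (al : nat -> R) (al0 be : R) (b a : nat -> C) (pb pa : nat -> R) (pb0 pa0 : R) : Prop := {
 ap_al : Un_cv al al0;
 ap_b : forall n, inD (b n);
 ap_a : forall n, inD (a n);
 ap_b_lim : Clim b (cis be);
 ap_a_lim : Clim a (cis (be + PI));
 ap_pb : forall n, isarg (f (b n)) (pb n);
 ap_pa : forall n, isarg (f (a n)) (pa n);
 ap_pb_lim : Un_cv pb pb0;
 ap_pa_lim : Un_cv pa pa0;
 ap_pb_bd : forall n, - (PI / 2) <= pb n + al n <= PI / 2;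
 ap_pa_bd : forall n, PI / 2 <= pa n + al n <= 3 * (PI / 2);
 ap_opp : forall n, pa n - lam (a n) = pb n - lam (b n) + PI;
 ap_sb : support al b;
 ap_sa : support (fun n => al n + PI) a
}.

(** A half turn exchanges the two sequences. It carries each statement about one arc of the circle
    to the other arc. *)
Lemma antipodal_swap al al0 be b a pb pa pb0 pa0 : antipodal al al0 be b a pb pa pb0 pa0 ->
 antipodal (fun n => al n + PI) (al0 + PI) (be + PI) a b (fun n => pa n - 2 * PI) pb (pa0 - 2 * PI) pb0.
Proof.
 intros [H1 H2 H3 H4 H5 H6 H7 H8 H9 H10 H11 H12 H13 H14]. split; auto.
 - apply CV_plus; auto. apply Un_cv_const.
 - replace (be + PI + PI) with (be + 2 * PI) by ring. rewrite polar_plus_2PI. auto.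
 - intros n. apply isarg_2PI_minus; auto.
 - apply CV_minus; auto. apply Un_cv_const.
 - intros n. specialize (H11 n). lra.
 - intros n. specialize (H10 n). lra.
 - intros n. specialize (H12 n). lra.
 - intros w e Hw He. destruct (H13 w e Hw He) as [N X]. exists N. intros n Hn. specialize (X n Hn).
  replace (al n + PI + PI) with (al n + 2 * PI) by ring. rewrite polar_plus_2PI. auto.
Qed.

(** A limit point inside the disc would be mapped to a point of the open set Om at which a nonzero
    linear form is maximal. *)
Lemma support_escape al al0 m : Un_cv al al0 -> (forall n, inD (m n)) -> support al m -> Un_cv (fun n => Cmod (m n)) 1.
Proof.
 intros Hal Hm Hs e He. apply NNPP. intros Hn.
 destruct (infinitely_often_extraction (fun n => Cmod (m n) <= 1 - e)) as [s [Hs1 Hs2]].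
 { intros N. apply NNPP. intros Hc. apply Hn. exists N. intros n Hle. unfold Rdist.
  specialize (Hm n). unfold inD in Hm. rewrite Rabs_left by lra. apply Rnot_le_lt. intros H. apply Hc. exists n. split; auto. lra. }
 destruct (BW_C (fun n => m (s n)) 1) as [s2 [l [Hs3 Hl]]]. { intros n. apply Rlt_le, Hm. }
 assert (Hlb : Cmod l <= 1 - e).
 { apply (Un_cv_le _ _ _ _ (Clim_Cmod _ _ Hl) (Un_cv_const (1 - e))). exists 0%nat. intros n _. auto. }
 assert (Hlin : inD l) by (unfold inD; lra).
 destruct (Om_open (f l) (Om_f l Hlin)) as [d [Hd X]].
 set (w := (f l + RtoC (d / 2) * cis (- al0))%C).
 assert (Hw : Om w). { apply X. unfold w. replace (f l + RtoC (d / 2) * cis (- al0) - f l)%C with (RtoC (d / 2) * cis (- al0))%C by ring.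
  rewrite Cmod_mult, Cmod_R, Cmod_polar1, Rabs_right; lra. }
 destruct (Hs w (d / 4) Hw ltac:(lra)) as [N Y].
 assert (Hex := extraction_comp _ _ Hs1 Hs3). cbv beta in Hex.
 assert (La : Un_cv (fun n => al (s (s2 n))) al0) by (apply (Un_cv_ext_sub _ _ _ Hex Hal)).
 assert (Lp : Clim (fun n => cis (al (s (s2 n)))) (cis al0)) by (apply (Clim_polar (fun _ => 1) _ 1 al0 (Un_cv_const 1) La)).
 assert (L1 : Un_cv (fun n => Re (cis (al (s (s2 n))) * w) - d / 4) (Re (cis al0 * w) - d / 4)).
 { apply CV_minus. 2: apply Un_cv_const. apply Clim_Re. apply Clim_mult; auto. apply Clim_const. }
 assert (L2 : Un_cv (fun n => Re (cis (al (s (s2 n))) * f (m (s (s2 n))))) (Re (cis al0 * f l))).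
 { apply Clim_Re. apply (Clim_mult (fun n => cis (al (s (s2 n))))); auto. apply (Clim_cont f). apply f_cont; auto. exact Hl. }
 assert (Q : Re (cis al0 * w) - d / 4 <= Re (cis al0 * f l)).
 { apply (Un_cv_le _ _ _ _ L1 L2). exists N. intros n Hnn. apply Y. pose proof (extraction_ge _ Hex n). cbv beta in *. lia. }
 unfold w in Q. replace (cis al0 * (f l + RtoC (d / 2) * cis (- al0)))%C with
  (cis al0 * f l + RtoC (d / 2) * (cis al0 * cis (- al0)))%C in Q by ring.
 rewrite polar_mult, Rplus_opp_r in Q. replace (polar (1 * 1) 0) with (RtoC 1) in Q.
 2:{ unfold polar. rewrite cos_0, sin_0. C_eq. }
 rewrite Cmult_1_r in Q.
 replace (Re (cis al0 * f l + RtoC (d / 2))) with (Re (cis al0 * f l) + d / 2) in Q by reflexivity. lra.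
Qed.

(** Om may have no support points, so the maximiser is replaced by the projection of the distant
    point N e^(-i al), pulled inside Om by the factor 1 - s. This point depends continuously on al,
    and so does the argument -al + mu al of its preimage. Since [mu] has period 2 pi, it takes equal
    values at some al and al + pi. *)
Lemma antipodal_step (N s : R) : 0 < N -> 0 < s < 1 -> exists al b a pb pa,
 0 <= al <= PI /\ inD b /\ inD a /\ isarg (f b) pb /\ isarg (f a) pa /\
 - (PI / 2) <= pb + al <= PI / 2 /\ PI / 2 <= pa + al <= 3 * (PI / 2) /\ pa - lam a = pb - lam b + PI /\
 (forall w, Om w -> (1 - s) * (Re (cis al * w) - Cmod w * Cmod w / (4 * N)) <= Re (cis al * f b)) /\
 (forall w, Om w -> (1 - s) * (Re (cis (al + PI) * w) - Cmod w * Cmod w / (4 * N)) <= Re (cis (al + PI) * f a)).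
Proof.
 intros HN Hs. pose proof PI_RGT_0 as HPI.
 destruct (choice _ Om_projection) as [P HP].
 (* Projection onto a convex set does not increase distances: the two obtuse angle inequalities are
    extended to the closure and added. *)
 assert (HLip : forall q q', Cmod (P q - P q') <= Cmod (q - q')).
 { intros q q'. destruct (HP q) as [A1 A2]. destruct (HP q') as [B1 B2].
  assert (Hcl : forall p c x, adh p -> (forall w, Om w -> Re ((w - c) * x) <= 0) -> Re ((p - c) * x) <= 0).
  { intros p c x Hp Hx. apply Rnot_lt_le. intros Hlt. destruct (Hp (Re ((p - c) * x) / (Cmod x + 1))) as [w [Hw Hwp]].
   { apply Rdiv_lt_0_compat; auto. Cnneg x; lra. }
   specialize (Hx w Hw). replace ((p - c) * x)%C with ((w - c) * x + (p - w) * x)%C in Hlt, Hwp by ring.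
   pose proof (re_le_Cmod ((p - w) * x)) as Q. rewrite Cmod_mult, (Cmod_minus_sym p) in Q. apply Rabs_le_between in Q.
   Cnneg x. Cnneg (w - p)%C.
   apply Rmult_lt_compat_r with (r := Cmod x + 1) in Hwp; [|lra]. unfold Rdiv in Hwp. rewrite Rmult_assoc, Rinv_l, Rmult_1_r in Hwp by lra.
   change (Re ((w - c) * x + (p - w) * x)) with (Re ((w - c) * x) + Re ((p - w) * x)) in *. nra. }
  assert (C1 := Hcl _ _ _ B1 A2). assert (C2 := Hcl _ _ _ A1 B2).
  assert (E : Cmod (P q - P q') * Cmod (P q - P q') <= Re ((P q - P q') * Cconj (q - q'))).
  { rewrite Cmod_sqr. destruct (P q), (P q'), q, q'. unfold Re, Im in *; simpl in *. lra. }
  pose proof (re_le_Cmod ((P q - P q') * Cconj (q - q'))) as Q. rewrite Cmod_mult, Cmod_conj in Q. apply Rabs_le_between in Q.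
  Cnneg (P q - P q')%C. Cnneg (q - q')%C. nra. }
 (* A ball around 0 lies in Om, so the projection has a positive component towards q. The rotated
    boundary point thus stays in the right half-plane, where [Clog] gives a continuous argument. *)
 assert (Hpos : forall q : C, q <> 0 -> 0 < Re (P q * Cconj q)).
 { intros q Hq. destruct (HP q) as [A1 A2]. destruct Om_ball as [r [Hr X]].
  set (c := (q - P q)%C). Cnneg c. set (t := r / (Cmod c + 1)).
  assert (Ht : 0 < t) by pos_div.
  assert (Hw : Om (RtoC t * c)). { apply X. rewrite Cmod_scal by lra. unfold t.
   apply Rmult_lt_reg_r with (Cmod c + 1). lra. replace (r / (Cmod c + 1) * Cmod c * (Cmod c + 1)) with (r * Cmod c) by (field; lra). nra. }
  specialize (A2 _ Hw). fold c in A2.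
  assert (E : Re (P q * Cconj q) = Cmod (P q) * Cmod (P q) + t * (Cmod c * Cmod c) - Re ((RtoC t * c - P q) * Cconj c)).
  { rewrite !Cmod_sqr. unfold c. C_ring. }
  destruct (classic (P q = 0)) as [E0|E0].
  - assert (0 < Cmod c). { apply Cmod_gt_0. unfold c. rewrite E0. intros E1. apply Hq. rewrite <- E1. ring. }
   assert (0 < t * (Cmod c * Cmod c)) by (apply Rmult_lt_0_compat; nra).
   pose proof (Rle_0_sqr (Cmod (P q))). unfold Rsqr in *. lra.
  - apply Cmod_gt_0 in E0. assert (0 <= t * (Cmod c * Cmod c)) by (apply Rmult_le_pos; nra).
   assert (0 < Cmod (P q) * Cmod (P q)) by nra. lra. }
 (* The loss |w|^2/4 comes from |P q - w/2|^2 >= 0; for |q| = N it is divided by N and disappears in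
    the limit. *)
 assert (Hmax : forall q w, Om w -> Re (w * Cconj q) - Cmod w * Cmod w / 4 <= Re (P q * Cconj q)).
 { intros q w Hw. destruct (HP q) as [_ A2]. specialize (A2 w Hw).
  assert (0 <= Cmod (P q - RtoC (1/2) * w) * Cmod (P q - RtoC (1/2) * w)) by apply Rle_0_sqr.
  rewrite Cmod_sqr in H. rewrite Cmod_sqr. destruct (P q), q, w. unfold Re, Im in *; simpl in *. lra. }
 set (q := fun al => (RtoC N * cis (- al))%C).
 assert (Hqd : forall al w, Re (w * Cconj (q al)) = N * Re (cis al * w)).
 { intros al w. unfold q, polar. rewrite cos_neg, sin_neg. destruct w; C_ring. }
 assert (Hq0 : forall al, q al <> 0).
 { intros al. apply Cmod_gt_0. unfold q. rewrite Cmod_mult, Cmod_R, Cmod_polar1, Rabs_right; lra. }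
 set (B := fun al => (RtoC (1 - s) * P (q al))%C).
 assert (HBO : forall al, Om (B al)). { intros al. apply Om_adh_seg. apply HP. lra. }
 assert (Hre : forall al w, Re (cis al * (RtoC (1 - s) * w)) = (1 - s) * Re (cis al * w)).
 { intros al w. destruct w; C_ring. }
 assert (HBpos : forall al, 0 < Re (cis al * B al)).
 { intros al. unfold B. rewrite Hre. specialize (Hpos (q al) (Hq0 al)). rewrite Hqd in Hpos. apply Rmult_lt_0_compat; nra. }
 assert (HBmax : forall al w, Om w -> (1 - s) * (Re (cis al * w) - Cmod w * Cmod w / (4 * N)) <= Re (cis al * B al)).
 { intros al w Hw. unfold B. rewrite Hre. apply Rmult_le_compat_l. lra. specialize (Hmax (q al) w Hw). rewrite !Hqd in Hmax.
  apply Rmult_le_reg_l with N; auto. replace (N * (Re (cis al * w) - Cmod w * Cmod w / (4 * N)))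
   with (N * Re (cis al * w) - Cmod w * Cmod w / 4) by (field; lra). auto. }
 assert (HBc : forall al, curve B al).
 { intros al. unfold B. apply curve_mult. apply curve_const. apply (curve_comp P q).
  - unfold q. apply curve_mult. apply curve_const. apply (curve_reparam cis Ropp). apply polar_curve1.
   smooth.
  - intros e He. exists e. split; auto. intros w Hw. eapply Rle_lt_trans; [apply HLip|]; auto. }
 assert (HBper : forall al, B (al + 2 * PI) = B al).
 { intros al. unfold B, q. replace (cis (- (al + 2 * PI))) with (cis (- al)); auto.
  rewrite <- (polar_plus_2PI (- (al + 2 * PI))). f_equal; ring. }
 set (L := fun al => Im (Clog (cis al * B al))). set (mu := fun al => L al - lam (Ef (B al))).
 assert (Hmuc : forall al, continuous mu al).
 { intros al. apply (continuous_minus L).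
  - apply (curve_comp Clog (fun al => cis al * B al)%C). apply curve_mult; auto. apply polar_curve1. apply Clog_cont; auto.
  - apply (Vcont_curve lam (fun al => Ef (B al))). apply (curve_comp Ef B); auto. apply Ef_cont; auto. apply lam_cont, Ef_spec; auto. }
 assert (Hmuper : forall al, mu (al + 2 * PI) = mu al).
 { intros al. unfold mu, L. rewrite HBper, polar_plus_2PI. auto. }
 assert (HIVT : exists al, 0 <= al <= PI /\ mu (al + PI) = mu al).
 { set (D := fun x => mu (x + PI) - mu x).
  assert (HD : forall x, continuous D x).
  { intros x. apply (continuous_minus (fun x => mu (x + PI))); auto. apply (continuous_comp (fun x => x + PI) mu); auto.
   smooth. }
  assert (DPI : D PI = - D 0). { unfold D. replace (PI + PI) with (0 + 2 * PI) by ring. rewrite Hmuper, Rplus_0_l. ring. }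
  destruct (Rle_lt_dec (D 0) 0).
  - destruct (IVT_value D 0 PI 0) as [x [Hx E]]; auto. lra. exists x. split; auto. unfold D in E. lra.
  - destruct (IVT_value (fun x => - D x) 0 PI 0) as [x [Hx E]]; auto.
   { intros t _. apply (continuous_opp D); auto. } lra. exists x. split; auto. unfold D in E. lra. }
 destruct HIVT as [al [Hal Emu]].
 assert (HL : forall x, - (PI / 2) < L x < PI / 2). { intros x. unfold L, Clog, Im; simpl. pose proof (atan_bound (Im (cis x * B x) / Re (cis x * B x))) as Q. unfold Im, Re in Q. simpl in Q. lra. }
 assert (Harg : forall x, isarg (B x) (- x + L x)).
 { intros x. replace (B x) with (cis (- x) * (cis x * B x))%C.
  - apply isarg_mult. apply isarg_polar; lra. apply isarg_Clog; auto.
  - rewrite Cmult_assoc, polar_mult. replace (- x + x) with 0 by ring. unfold polar. rewrite cos_0, sin_0.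
   destruct (B x). C_eq. }
 exists al, (Ef (B al)), (Ef (B (al + PI))), (- al + L al), (- (al + PI) + L (al + PI) + 2 * PI).
 destruct (Ef_spec (B al) (HBO al)) as [I1 F1]. destruct (Ef_spec (B (al + PI)) (HBO (al + PI))) as [I2 F2].
 rewrite F1, F2. pose proof (HL al). pose proof (HL (al + PI)).
 split; auto. split; auto. split; auto. split; auto. split. apply isarg_2PI; auto.
 split. lra. split. lra. split. unfold mu in Emu. lra. split; auto.
Qed.

(** The parameters N = n + 1 and s = 1/(n + 2) make both sequences asymptotically extremal; by
    compactness the direction, the image arguments and the points b n converge along a
    subsequence. *)
Lemma antipodal_exists : exists al al0 be b a pb pa pb0 pa0, antipodal al al0 be b a pb pa pb0 pa0.
Proof.
 pose proof PI_RGT_0 as HPI.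
 assert (H : forall n : nat, exists p : R * C * C * R * R, let '(al, b, a, pb, pa) := p in
  0 <= al <= PI /\ inD b /\ inD a /\ isarg (f b) pb /\ isarg (f a) pa /\
  - (PI / 2) <= pb + al <= PI / 2 /\ PI / 2 <= pa + al <= 3 * (PI / 2) /\ pa - lam a = pb - lam b + PI /\
  (forall w, Om w -> (1 - / INR (S (S n))) * (Re (cis al * w) - Cmod w * Cmod w / (4 * INR (S n))) <= Re (cis al * f b)) /\
  (forall w, Om w -> (1 - / INR (S (S n))) * (Re (cis (al + PI) * w) - Cmod w * Cmod w / (4 * INR (S n))) <= Re (cis (al + PI) * f a))).
 { intros n. destruct (antipodal_step (INR (S n)) (/ INR (S (S n)))) as [al [b [a [pb [pa Q]]]]].
  - apply lt_0_INR; lia.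
  - split. apply inv_INR_pos. rewrite <- Rinv_1. apply Rinv_lt_contravar. rewrite Rmult_1_l. apply lt_0_INR; lia. apply (lt_INR 1). lia.
  - exists (al, b, a, pb, pa). exact Q. }
 apply choice in H. destruct H as [p Hp].
 set (al0 := fun n => fst (fst (fst (fst (p n))))). set (b0 := fun n => snd (fst (fst (fst (p n))))).
 set (a0 := fun n => snd (fst (fst (p n)))). set (pb0 := fun n => snd (fst (p n))). set (pa0 := fun n => snd (p n)).
 assert (HP : forall n, 0 <= al0 n <= PI /\ inD (b0 n) /\ inD (a0 n) /\ isarg (f (b0 n)) (pb0 n) /\ isarg (f (a0 n)) (pa0 n) /\
  - (PI / 2) <= pb0 n + al0 n <= PI / 2 /\ PI / 2 <= pa0 n + al0 n <= 3 * (PI / 2) /\ pa0 n - lam (a0 n) = pb0 n - lam (b0 n) + PI /\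
  (forall w, Om w -> (1 - / INR (S (S n))) * (Re (cis (al0 n) * w) - Cmod w * Cmod w / (4 * INR (S n))) <= Re (cis (al0 n) * f (b0 n))) /\
  (forall w, Om w -> (1 - / INR (S (S n))) * (Re (cis (al0 n + PI) * w) - Cmod w * Cmod w / (4 * INR (S n))) <= Re (cis (al0 n + PI) * f (a0 n)))).
 { intros n. specialize (Hp n). unfold al0, b0, a0, pb0, pa0. destruct (p n) as [[[[? ?] ?] ?] ?]. exact Hp. }
 clear Hp. clearbody al0 b0 a0 pb0 pa0. clear p.
 assert (HSup : forall (x : nat -> R) (m : nat -> C),
  (forall n w, Om w -> (1 - / INR (S (S n))) * (Re (cis (x n) * w) - Cmod w * Cmod w / (4 * INR (S n))) <= Re (cis (x n) * f (m n))) ->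
  support x m).
 { intros x m Hxm w e Hw He. set (M := Cmod w + Cmod w * Cmod w + 1). Cnneg w.
  destruct (inv_INR_small (e / M)) as [N X]. { apply Rdiv_lt_0_compat; unfold M; nra. }
  exists N. intros n Hn. specialize (Hxm n w Hw). eapply Rle_trans; [|exact Hxm].
  assert (X1 := X n Hn). assert (X2 := X (S n) ltac:(lia)). pose proof (inv_INR_pos n). pose proof (inv_INR_pos (S n)).
  assert (HM : 0 < M) by (unfold M; nra).
  assert (Y : forall y, y < e / M -> y * M < e). { intros y Hy. apply Rmult_lt_compat_r with (r := M) in Hy; auto. unfold Rdiv in Hy. rewrite Rmult_assoc, Rinv_l in Hy; lra. }
  apply Y in X1, X2. pose proof (re_le_Cmod (cis (x n) * w)) as Q. rewrite Cmod_mult, Cmod_polar1, Rmult_1_l in Q. apply Rabs_le_between in Q.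
  replace (Cmod w * Cmod w / (4 * INR (S n))) with (/ 4 * (Cmod w * Cmod w) * / INR (S n)) by (field; apply not_0_INR; lia).
  assert (/ INR (S (S n)) <= 1). { rewrite <- Rinv_1. apply Rinv_le_contravar. lra. apply (le_INR 1). lia. }
  set (i1 := / INR (S n)) in *. set (i2 := / INR (S (S n))) in *. unfold M in *.
  assert (i2 * Re (cis (x n) * w) <= i2 * Cmod w) by (apply Rmult_le_compat_l; lra).
  assert (0 <= i2 * (Cmod w * Cmod w * i1)) by (apply Rmult_le_pos; nra).
  assert (i2 * M <= e) by (unfold M; lra). assert (0 <= i1 * Cmod w) by nra. assert (0 <= i2 * (Cmod w * Cmod w)) by nra.
  assert (i2 <= i1). { unfold i1, i2. apply Rinv_le_contravar. apply lt_0_INR; lia. apply le_INR; lia. }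
  assert (i2 * (Cmod w * Cmod w) <= i1 * (Cmod w * Cmod w)) by (apply Rmult_le_compat_r; nra).
  assert (i2 * Cmod w <= i1 * Cmod w) by (apply Rmult_le_compat_r; lra). nra. }
 assert (Sb0 : support al0 b0) by (apply HSup; apply HP).
 assert (Sa0 : support (fun n => al0 n + PI) a0) by (apply HSup; apply HP).
 assert (Ssub : forall x m s, extraction s -> support x m -> support (fun n => x (s n)) (fun n => m (s n))).
 { intros x m s Hs Hx w e Hw He. destruct (Hx w e Hw He) as [N X]. exists N. intros n Hn. apply X. pose proof (extraction_ge s Hs n). lia. }
 destruct (BW_R al0 0 PI) as [s1 [al1 [Hs1 [Lal Bal]]]]; [apply HP|].
 destruct (BW_R (fun n => pb0 (s1 n)) (- (3 * PI)) (3 * PI)) as [s2 [pb1 [Hs2 [Lpb _]]]].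
 { intros n. destruct (HP (s1 n)) as [? [_ [_ [_ [_ [? _]]]]]]. lra. }
 destruct (BW_R (fun n => pa0 (s1 (s2 n))) (- (3 * PI)) (3 * PI)) as [s3 [pa1 [Hs3 [Lpa _]]]].
 { intros n. destruct (HP (s1 (s2 n))) as [? [_ [_ [_ [_ [_ [? _]]]]]]]. lra. }
 destruct (BW_C (fun n => b0 (s1 (s2 (s3 n)))) 1) as [s4 [ze [Hs4 Lb]]]. { intros n. apply Rlt_le, HP. }
 set (s := fun n => s1 (s2 (s3 (s4 n)))).
 assert (Hs34 := extraction_comp _ _ Hs3 Hs4). assert (Hs234 := extraction_comp _ _ Hs2 Hs34).
 assert (Hs : extraction s) by (apply (extraction_comp _ _ Hs1 Hs234)).
 assert (Lals : Un_cv (fun n => al0 (s n)) al1) by (apply (Un_cv_ext_sub _ _ _ Hs234 Lal)).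
 assert (Sb := Ssub _ _ _ Hs Sb0). assert (Sa := Ssub _ _ _ Hs Sa0). cbv beta in Sa.
 assert (Mb := support_escape _ _ _ Lals (fun n => proj1 (proj2 (HP (s n)))) Sb).
 assert (Lals' : Un_cv (fun n => al0 (s n) + PI) (al1 + PI)) by (apply CV_plus; auto; apply Un_cv_const).
 assert (Ma := support_escape (fun n => al0 (s n) + PI) (al1 + PI) (fun n => a0 (s n)) Lals' (fun n => proj1 (proj2 (proj2 (HP (s n))))) Sa).
 assert (Mze : Cmod ze = 1) by (apply (UL_sequence _ _ _ (Clim_Cmod _ _ Lb)); exact Mb).
 destruct (exists_arg ze) as [be Hbe].
 assert (Ebe : ze = cis be) by (unfold isarg in Hbe; rewrite Mze in Hbe; exact Hbe).
 exists (fun n => al0 (s n)), al1, be, (fun n => b0 (s n)), (fun n => a0 (s n)), (fun n => pb0 (s n)), (fun n => pa0 (s n)), pb1, pa1.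
 split; auto; try (intros n; apply HP).
 - rewrite <- Ebe. exact Lb.
 - rewrite polar_plus_PI, <- Ebe.
  (* The arguments of the two points differ by exactly pi and their moduli tend to 1, so the limit
     of one sequence determines that of the other. *)
  assert (Hrel : forall n, (RtoC (Cmod (b0 (s n))) * a0 (s n) = - (RtoC (Cmod (a0 (s n))) * b0 (s n)))%C).
  { intros n. destruct (HP (s n)) as [_ [I1 [I2 [P1 [P2 [_ [_ [E _]]]]]]]]. apply arg_preimage in P1, P2; auto. rewrite E in P2.
   apply isarg_RtoC_polar in P1, P2. rewrite polar_plus_PI in P2. rewrite P1 at 2. rewrite P2 at 1. ring. }
  assert (L1 : Clim (fun n => RtoC (Cmod (b0 (s n))) * a0 (s n) - RtoC (Cmod (b0 (s n)) - 1) * a0 (s n))%C (- ze)).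
  { intros e He. destruct (Lb (e / 2)) as [N1 X1]; [lra|]. destruct (Ma (e / 4)) as [N2 X2]; [lra|]. destruct (Mb (e / 4)) as [N3 X3]; [lra|].
   exists (N1 + N2 + N3)%nat. intros n Hn. at_rank n.
   unfold Rdist in X2, X3. cbv beta in X1. fold (s n) in X1. rewrite Hrel.
   set (x := b0 (s n)) in *. set (y := a0 (s n)) in *.
   assert (Ix : Cmod x < 1) by (apply HP). assert (Iy : Cmod y < 1) by (apply HP).
   replace (- (RtoC (Cmod y) * x) - RtoC (Cmod x - 1) * y - - ze)%C with (- ((x - ze) + (RtoC (Cmod y - 1) * x + RtoC (Cmod x - 1) * y)))%C
    by (rewrite !RtoC_minus; ring).
   rewrite Cmod_opp. lt_via Cmod_triangle. eapply Rle_lt_trans; [apply Rplus_le_compat_l, Cmod_triangle|].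
   rewrite !Cmod_mult, !Cmod_R. Cnneg x. Cnneg y.
   pose proof (Rabs_pos (Cmod y - 1)). pose proof (Rabs_pos (Cmod x - 1)). nra. }
  intros e He. destruct (L1 e He) as [N X]. exists N. intros n Hn. specialize (X n Hn). cbv beta in X.
  replace (RtoC (Cmod (b0 (s n))) * a0 (s n) - RtoC (Cmod (b0 (s n)) - 1) * a0 (s n))%C with (a0 (s n)) in X
   by (rewrite RtoC_minus; ring). exact X.
 - apply (Un_cv_ext_sub _ _ _ Hs34 Lpb).
 - apply (Un_cv_ext_sub _ _ _ Hs4 Lpa).
Qed.

(** * Upward translation and the two boundary arcs *)

Lemma Im_mult_conj (z w : C) a b : isarg z a -> isarg w b -> Im (z * Cconj w) = Cmod z * Cmod w * sin (a - b).
Proof.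
 intros Ha Hb. replace (Im (z * Cconj w)) with (Im z * Re w - Re z * Im w) by C_ring.
 rewrite (isarg_Re _ _ Ha), (isarg_Im _ _ Ha), (isarg_Re _ _ Hb), (isarg_Im _ _ Hb), sin_minus. ring.
Qed.

Lemma Cconj_polar1 t : Cconj (cis t) = cis (- t).
Proof. unfold polar. rewrite cos_neg, sin_neg. C_eq. Qed.

Lemma polar1_inv t : (cis (- t) * cis t)%C = 1.
Proof. rewrite polar_mult. replace (- t + t) with 0 by ring. unfold polar. rewrite cos_0, sin_0. C_eq. Qed.

Lemma dir_lim_args (x : nat -> C) (ph : nat -> R) ph0 : (forall n, isarg (x n) (ph n)) -> Un_cv ph ph0 -> dir_lim x (cis ph0).
Proof.
 intros Hx Hp d Hd. assert (L := Clim_polar (fun _ => 1) ph 1 ph0 (Un_cv_const 1) Hp). destruct (L d Hd) as [N X].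
 exists N. intros n Hn. specialize (X n Hn). cbv beta in X. rewrite (isarg_RtoC_polar _ _ (Hx n)) at 1.
 replace (RtoC (Cmod (x n)) * cis (ph n) - RtoC (Cmod (x n)) * cis ph0)%C with (RtoC (Cmod (x n)) * (cis (ph n) - cis ph0))%C by ring.
 rewrite Cmod_scal by (apply Cmod_ge_0). Cnneg (x n). nra.
Qed.

Lemma args_converge (x : nat -> C) (Q : C) ph : Clim x Q -> Q <> 0 -> isarg Q ph ->
 exists p, (forall n, isarg (x n) (p n)) /\ Un_cv p ph.
Proof.
 intros Hx HQ Hph. destruct (local_argument Q ph HQ Hph) as [A [HA [AQ HC]]]. exists (fun n => A (x n)). split. intros; apply HA.
 intros e He. destruct (HC e He) as [d [Hd X]]. destruct (Hx d Hd) as [N Y]. exists N. intros n Hn. rewrite <- AQ. apply X, Y; auto.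
Qed.

Lemma Un_cv_lt u l m : Un_cv u l -> l < m -> exists N, forall n, (N <= n)%nat -> u n < m.
Proof.
 intros Hu Hl. destruct (Hu (m - l)) as [N X]; [lra|]. exists N. intros n Hn. specialize (X n Hn).
 unfold Rdist in X. apply Rabs_def2 in X. lra.
Qed.

Lemma Un_cv_gt u l m : Un_cv u l -> m < l -> exists N, forall n, (N <= n)%nat -> m < u n.
Proof.
 intros Hu Hl. destruct (Hu (l - m)) as [N X]; [lra|]. exists N. intros n Hn. specialize (X n Hn).
 unfold Rdist in X. apply Rabs_def2 in X. lra.
Qed.

Lemma sin_near_half_turn d eta : 0 < eta < PI / 2 -> - eta <= d <= PI + eta -> - eta <= sin d.
Proof.
 intros He Hd. pose proof PI_RGT_0. destruct (Rle_lt_dec d 0); [|destruct (Rle_lt_dec d PI)].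
 - pose proof (sin_abs_le d) as Q. rewrite (Rabs_left1 d) in Q by lra. apply Rabs_le_between in Q. lra.
 - pose proof (sin_ge_0 d). lra.
 - pose proof (sin_abs_le (d - PI)) as Q. rewrite (Rabs_right (d - PI)) in Q by lra. apply Rabs_le_between in Q.
  replace (sin d) with (- sin (d - PI)) by (rewrite sin_minus, cos_PI, sin_PI; ring). lra.
Qed.

Lemma cos_neg_arc t : PI / 2 <= t <= 3 * (PI / 2) -> cos t <= 0.
Proof. intros H. apply cos_le_0; lra. Qed.

(** The sine of the change of argument has the sign of Re P, so an upward move brings the argument
    closer to pi/2, which separates pb from pa. *)
Lemma upward_stays_in_sector (P : C) psi pb pa s : P <> 0 -> isarg P psi -> - (PI / 2) <= pb -> pb <= PI / 2 ->
 PI / 2 <= pa -> pa <= 3 * (PI / 2) -> pb < psi < pa -> 0 < s ->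
 exists psi', isarg (P + Ci * RtoC s) psi' /\ pb < psi' < pa.
Proof.
 intros HP Hp H1 H2 H3 H4 Hpsi Hs. pose proof PI_RGT_0 as HPI. apply Cmod_gt_0 in HP.
 pose proof (isarg_Re _ _ Hp) as ER. pose proof (isarg_Im _ _ Hp) as EI. set (Q := (P + Ci * RtoC s)%C).
 assert (QR : Re Q = Re P) by (unfold Q, Re, Im; simpl; ring). assert (QI : Im Q = Im P + s) by (unfold Q, Re, Im; simpl; ring).
 assert (Ecr : forall t, isarg Q t -> Cmod Q * Cmod P * sin (t - psi) = s * Re P).
 { intros t Ht. rewrite <- (Im_mult_conj _ _ _ _ Ht Hp).
  replace (Im (Q * Cconj P)) with (Im Q * Re P - Re Q * Im P) by C_ring. rewrite QR, QI. ring. }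
 Cnneg Q as HQ.
 destruct (Rtotal_order (Re P) 0) as [Hx|[Hx|Hx]].
 - assert (Hpsi2 : PI / 2 < psi). { apply Rnot_le_lt. intros Hc. assert (0 <= cos psi) by (apply cos_ge_0; lra). nra. }
  assert (HQn : 0 < Re (- Q)). { replace (Re (- Q)) with (- Re Q) by reflexivity. lra. }
  set (t := Im (Clog (- Q)) + PI).
  assert (Ht : isarg Q t). { apply RtoC_polar_isarg. unfold t. rewrite polar_plus_PI. rewrite <- Cmod_opp.
   assert (E := isarg_RtoC_polar _ _ (isarg_Clog _ HQn)). replace Q with (- - Q)%C at 1 by ring. rewrite E at 1. ring. }
  assert (Hb : PI / 2 < t < 3 * (PI / 2)). { unfold t, Clog, Im; simpl. pose proof (atan_bound (snd (- Q)%C / Re (- Q))). simpl in *. lra. }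
  exists t. split; auto. split; [lra|]. apply Rlt_trans with psi; [|lra]. apply Rnot_le_lt. intros Hc.
  assert (0 <= sin (t - psi)) by (apply sin_ge_0; lra). specialize (Ecr t Ht).
  assert (0 <= Cmod Q * Cmod P * sin (t - psi)) by (apply Rmult_le_pos; [apply Rmult_le_pos; lra|auto]). nra.
 - exists (PI / 2). assert (Hcos : cos psi = 0) by nra. assert (Epsi : psi = PI / 2).
  { destruct (Rtotal_order psi (PI / 2)) as [Hc|[Hc|Hc]]; auto.
   assert (0 < cos psi) by (apply cos_gt_0; lra). lra.
   assert (cos psi < 0) by (apply cos_lt_0; lra). lra. }
  rewrite Epsi in *. split; auto. rewrite sin_PI2 in EI.
  unfold isarg. assert (EQ : Q = (Ci * RtoC (Cmod P + s))%C). { apply Ceq. rewrite QR, Hx. C_ring. rewrite QI, EI. C_ring. }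
  assert (MQ : Cmod Q = Cmod P + s).
  { rewrite EQ, Cmod_mult, Cmod_R, Rabs_right by lra. replace (Cmod Ci) with 1. ring.
   unfold Cmod, Ci; simpl. replace (0 * (0 * 1) + 1 * (1 * 1)) with 1 by ring. rewrite sqrt_1; auto. }
  rewrite MQ, EQ. unfold polar. rewrite cos_PI2, sin_PI2. C_eq.
 - assert (Hpsi2 : psi < PI / 2). { apply Rnot_le_lt. intros Hc. assert (cos psi <= 0) by (apply cos_neg_arc; lra). nra. }
  assert (HQn : 0 < Re Q) by lra.
  set (t := Im (Clog Q)). assert (Ht : isarg Q t) by (apply isarg_Clog; auto).
  assert (Hb : - (PI / 2) < t < PI / 2). { unfold t, Clog, Im; simpl. pose proof (atan_bound (snd Q / Re Q)). simpl in *. lra. }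
  exists t. split; auto. split; [|lra]. apply Rlt_trans with psi; [lra|]. apply Rnot_le_lt. intros Hc.
  assert (0 <= sin (psi - t)) by (apply sin_ge_0; lra). specialize (Ecr t Ht).
  replace (sin (t - psi)) with (- sin (psi - t)) in Ecr by (rewrite <- sin_neg; f_equal; ring).
  assert (0 <= Cmod Q * Cmod P * sin (psi - t)) by (apply Rmult_le_pos; [apply Rmult_le_pos; lra|auto]). nra.
Qed.

(** The vertical line through P meets the broken line B-0-A on the leg that lies on the side of P.
    The bounds on real parts keep the intersection on this leg, and the order of the arguments puts
    it below P. *)
Lemma point_below (P B A : C) psi pb pa : P <> 0 -> isarg P psi -> isarg B pb -> isarg A pa ->
 - (PI / 2) <= pb <= PI / 2 -> PI / 2 <= pa <= 3 * (PI / 2) -> pb < psi < pa -> Re A <= Re P <= Re B ->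
 exists t, 0 <= t <= 1 /\ ((Re P = t * Re B /\ t * Im B <= Im P) \/ (Re P = t * Re A /\ t * Im A <= Im P)).
Proof.
 intros HP Hp Hb Ha Hpb Hpa Hpsi Hre. pose proof PI_RGT_0 as HPI. apply Cmod_gt_0 in HP.
 pose proof (isarg_Re _ _ Hp) as ER. pose proof (isarg_Im _ _ Hp) as EI.
 destruct (Rtotal_order (Re P) 0) as [Hx|[Hx|Hx]].
 - assert (Hpsi2 : PI / 2 < psi). { apply Rnot_le_lt. intros Hc. assert (0 <= cos psi) by (apply cos_ge_0; lra). nra. }
  assert (Q := Im_mult_conj _ _ _ _ Ha Hp). assert (0 <= sin (pa - psi)) by (apply sin_ge_0; lra).
  assert (0 <= Im (A * Cconj P)). { rewrite Q. apply Rmult_le_pos; auto. apply Rmult_le_pos; apply Cmod_ge_0. }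
  replace (Im (A * Cconj P)) with (Im A * Re P - Re A * Im P) in H0 by C_ring.
  exists (Re P / Re A). split; [|right; split].
  + replace (Re P / Re A) with ((- Re P) / (- Re A)) by (field; lra). split. apply Rlt_le, Rdiv_lt_0_compat; lra.
   apply Rdiv_le_1; lra.
  + field; lra.
  + apply Rmult_le_reg_r with (- Re A). lra. replace (Re P / Re A * Im A * - Re A) with (- (Im A * Re P)) by (field; lra). lra.
 - exists 0. split. lra. left. split. lra. assert (Hcos : cos psi = 0) by nra. assert (Epsi : psi = PI / 2).
  { destruct (Rtotal_order psi (PI / 2)) as [Hc|[Hc|Hc]]; auto.
   assert (0 < cos psi) by (apply cos_gt_0; lra). lra.
   assert (cos psi < 0) by (apply cos_lt_0; lra). lra. }
  rewrite Epsi, sin_PI2 in EI. lra.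
 - assert (Hpsi2 : psi < PI / 2). { apply Rnot_le_lt. intros Hc. assert (cos psi <= 0) by (apply cos_neg_arc; lra). nra. }
  assert (Q := Im_mult_conj _ _ _ _ Hp Hb). assert (0 <= sin (psi - pb)) by (apply sin_ge_0; lra).
  assert (0 <= Im (P * Cconj B)). { rewrite Q. apply Rmult_le_pos; auto. apply Rmult_le_pos; apply Cmod_ge_0. }
  replace (Im (P * Cconj B)) with (Im P * Re B - Re P * Im B) in H0 by C_ring.
  exists (Re P / Re B). split; [|left; split].
  + split. apply Rlt_le, Rdiv_lt_0_compat; lra. apply Rdiv_le_1; lra.
  + field; lra.
  + apply Rmult_le_reg_r with (Re B). lra. replace (Re P / Re B * Im B * Re B) with (Re P * Im B) by (field; lra). lra.
Qed.

Section Antipodal.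
Variables (al : nat -> R) (al0 be : R) (b a : nat -> C) (pb pa : nat -> R) (pb0 pa0 : R).
Hypothesis AP : antipodal al al0 be b a pb pa pb0 pa0.

(** By [boundary_order] the arguments of the z n lie, up to eta, between those of b n and a n, and
    these are exactly pi apart; so Im (z n conj (b n)) >= -eta. *)
Lemma between_upper_arc (z : nat -> C) (ph : nat -> R) ze : (forall n, inD (z n)) -> Clim z ze -> Cmod ze = 1 ->
 (forall n, isarg (f (z n)) (ph n)) -> (exists N, forall n, (N <= n)%nat -> pb n < ph n < pa n) ->
 0 <= Im (ze * cis (- be)).
Proof.
 intros Hz Lz Mze Hph [N0 HN0]. destruct AP as [H1 H2 H3 H4 H5 H6 H7 H8 H9 H10 H11 H12 H13 H14].
 pose proof PI_RGT_0 as HPI. pose proof PI2_1 as HPI2.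
 apply Rnot_lt_le. intros Hneg. set (x := Im (ze * cis (- be))) in *. set (eta := Rmin (1/2) (- x / 2)).
 assert (He : 0 < eta) by (apply Rmin_pos; lra). assert (He1 : eta <= 1/2) by apply Rmin_l. assert (He2 : eta <= - x / 2) by apply Rmin_r.
 destruct (boundary_order eta He) as [R0 [HR0 HO]].
 assert (M1 : forall (u : nat -> C) l, Clim u l -> Cmod l = 1 -> exists N, forall n, (N <= n)%nat -> R0 <= Cmod (u n)).
 { intros u l Hu Hl. destruct (Un_cv_gt (fun n => Cmod (u n)) 1 R0) as [N X]. rewrite <- Hl. apply Clim_Cmod; auto. lra.
  exists N. intros n Hn. apply Rlt_le, X; auto. }
 destruct (M1 _ _ Lz Mze) as [N1 X1]. destruct (M1 _ _ H4 (Cmod_polar1 _)) as [N2 X2]. destruct (M1 _ _ H5 (Cmod_polar1 _)) as [N3 X3].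
 assert (Q : forall n, (N0 + N1 + N2 + N3 <= n)%nat -> - eta <= Im (z n * Cconj (b n))).
 { intros n Hn. at_rank n.
  assert (O1 := HO (b n) (z n) (pb n) (ph n) (H2 n) (Hz n) X2 X1 (H6 n) (Hph n) ltac:(lra)).
  assert (O2 := HO (z n) (a n) (ph n) (pa n) (Hz n) (H3 n) X1 X3 (Hph n) (H7 n) ltac:(lra)).
  assert (A1 := arg_preimage _ _ (Hz n) (Hph n)). assert (A2 := arg_preimage _ _ (H2 n) (H6 n)).
  rewrite (Im_mult_conj _ _ _ _ A1 A2). specialize (H12 n).
  assert (S := sin_near_half_turn (ph n - lam (z n) - (pb n - lam (b n))) eta ltac:(lra) ltac:(lra)).
  pose proof (Hz n) as I1. pose proof (H2 n) as I2. unfold inD in I1, I2. Cnneg (z n). Cnneg (b n).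
  assert (0 <= Cmod (z n) * Cmod (b n) <= 1) by nra.
  set (S0 := sin (ph n - lam (z n) - (pb n - lam (b n)))) in *. destruct (Rle_lt_dec 0 S0); nra. }
 assert (L : Un_cv (fun n => Im (z n * Cconj (b n))) x).
 { unfold x. rewrite <- Cconj_polar1. apply Clim_Im. apply (Clim_mult z); auto. apply (Clim_cont Cconj). apply Ccont_conj. auto. }
 assert (- eta <= x); [|lra]. apply (Un_cv_le _ _ _ _ (Un_cv_const (- eta)) L). eauto.
Qed.
End Antipodal.

(** The complementary interval of image arguments becomes the interval of [between_upper_arc] after
    [antipodal_swap]. *)
Lemma between_lower_arc al al0 be b a pb pa pb0 pa0 (z : nat -> C) (ph : nat -> R) ze :
 antipodal al al0 be b a pb pa pb0 pa0 -> (forall n, inD (z n)) -> Clim z ze -> Cmod ze = 1 ->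
 (forall n, isarg (f (z n)) (ph n)) -> (exists N, forall n, (N <= n)%nat -> pa n < ph n < pb n + 2 * PI) ->
 Im (ze * cis (- be)) <= 0.
Proof.
 intros AP Hz Lz Mze Hph [N HN].
 assert (Q := between_upper_arc _ _ _ _ _ _ _ _ _ (antipodal_swap _ _ _ _ _ _ _ _ _ AP) z (fun n => ph n - 2 * PI) ze Hz Lz Mze).
 assert (E : cis (- (be + PI)) = (- cis (- be))%C).
 { rewrite <- polar_plus_PI, <- (polar_plus_2PI (- (be + PI))). f_equal; ring. }
 rewrite E in Q. replace (Im (ze * - cis (- be))) with (- Im (ze * cis (- be))) in Q by C_ring.
 assert (0 <= - Im (ze * cis (- be))); [|lra]. apply Q.
 - intros n. apply isarg_2PI_minus; auto.
 - exists N. intros n Hn. specialize (HN n Hn). lra.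
Qed.

Lemma Un_cv_order u v l m : Un_cv u l -> Un_cv v m -> l < m -> exists N, forall n, (N <= n)%nat -> u n < v n.
Proof.
 intros Hu Hv Hl. destruct (Un_cv_lt u l ((l + m) / 2)) as [N1 X1]; auto. lra.
 destruct (Un_cv_gt v m ((l + m) / 2)) as [N2 X2]; auto. lra.
 exists (N1 + N2)%nat. intros n Hn. at_rank n. lra.
Qed.

Lemma Clim_inD_le (w : nat -> C) l : (forall n, inD (w n)) -> Clim w l -> Cmod l <= 1.
Proof.
 intros Hw Hl. apply (Un_cv_le _ _ _ _ (Clim_Cmod _ _ Hl) (Un_cv_const 1)). exists 0%nat. intros n _. apply Rlt_le, Hw.
Qed.

Lemma limit_not_in_Om (z : nat -> C) ze P : (forall n, inD (z n)) -> Clim z ze -> Cmod ze = 1 -> Clim (fun n => f (z n)) P -> ~ Om P.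
Proof.
 intros Hz Lz Mze Lf HO. assert (E := Clim_unique _ _ _ Lz (Ef_Clim z P Hz Lf HO)).
 pose proof (proj1 (Ef_spec P HO)) as Q. unfold inD in Q. rewrite <- E in Q. lra.
Qed.

Lemma isarg_rotate (z : C) t x : isarg z t -> isarg (cis x * z) (t + x).
Proof. intros H. rewrite Rplus_comm. apply isarg_mult; auto. apply isarg_polar; lra. Qed.

Lemma Clim_args_isarg (x : nat -> C) (ph : nat -> R) P ph0 : (forall n, isarg (x n) (ph n)) -> Un_cv ph ph0 -> Clim x P -> isarg P ph0.
Proof.
 intros Hx Hp HP. unfold isarg. apply (Clim_unique x); auto.
 assert (L := Clim_polar (fun n => Cmod (x n)) ph _ _ (Clim_Cmod _ _ HP) Hp).
 intros e He. destruct (L e He) as [N X]. exists N. intros n Hn. rewrite (Hx n). apply X; auto.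
Qed.

(* A boundary point cannot lie strictly between the broken line B-0-A and an interior point straight above it. *)
Lemma no_boundary_point_below al al0 be b a pb pa pb0 pa0 (P Q : C) ph0 s0 :
 antipodal al al0 be b a pb pa pb0 pa0 -> P <> 0 -> isarg P ph0 -> pb0 < ph0 < pa0 -> 0 < s0 ->
 Om Q -> (cis al0 * Q = cis al0 * P + Ci * RtoC s0)%C -> Om P.
Proof.
 intros AP HP Hph Hb Hs0 HQ E. destruct AP as [H1 H2 H3 H4 H5 H6 H7 H8 H9 H10 H11 H12 H13 H14].
 destruct (Om_open Q HQ) as [d [Hd X]].
 (* Q + v and Q - v lie in Om, and their rotated real parts enclose that of P strictly. By the
    support property the rotated real parts of f (b n) and f (a n) then enclose it as well, as
    [point_below] demands. *)
 set (v := (RtoC (d / 2) * cis (- al0))%C).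
 assert (Mv : Cmod v = d / 2) by (unfold v; rewrite Cmod_mult, Cmod_R, Cmod_polar1, Rabs_right; lra).
 assert (Hw1 : Om (Q + v)). { apply X. replace (Q + v - Q)%C with v by ring. lra. }
 assert (Hw2 : Om (Q - v)). { apply X. replace (Q - v - Q)%C with (- v)%C by ring. rewrite Cmod_opp. lra. }
 destruct (H13 _ (d / 8) Hw1 ltac:(lra)) as [N1 X1]. destruct (H14 _ (d / 8) Hw2 ltac:(lra)) as [N2 X2].
 assert (Lp : Clim (fun n => cis (al n)) (cis al0)) by (apply (Clim_polar (fun _ => 1) _ 1 al0 (Un_cv_const 1) H1)).
 assert (Lpm : Clim (fun n => cis (- al n)) (cis (- al0))).
 { apply (Clim_polar (fun _ => 1) (fun n => - al n) 1 (- al0) (Un_cv_const 1)). apply CV_opp; auto. }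
 assert (Hrot : (cis al0 * v = RtoC (d / 2))%C).
 { unfold v. replace (cis al0 * (RtoC (d / 2) * cis (- al0)))%C with (RtoC (d / 2) * (cis (- al0) * cis al0))%C by ring.
  rewrite polar1_inv. ring. }
 assert (Hre : forall x, Re (cis al0 * (Q + RtoC x * v)) = Re (cis al0 * P) + x * (d / 2)).
 { intros x. replace (cis al0 * (Q + RtoC x * v))%C with (cis al0 * Q + RtoC x * (cis al0 * v))%C by ring.
  rewrite E, Hrot. C_ring. }
 assert (LR : forall w, Un_cv (fun n => Re (cis (al n) * w)) (Re (cis al0 * w))).
 { intros w. apply Clim_Re. apply Clim_mult; auto. apply Clim_const. }
 pose proof (Hre 1) as R1. pose proof (Hre (-1)) as R2.
 replace (Q + 1 * v)%C with (Q + v)%C in R1 by ring.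
 replace (Q + (-1) * v)%C with (Q - v)%C in R2 by ring.
 destruct (LR (Q + v)%C (d / 8) ltac:(lra)) as [N3 X3]. destruct (LR (Q - v)%C (d / 8) ltac:(lra)) as [N4 X4].
 destruct (LR P (d / 8) ltac:(lra)) as [N5 X5].
 assert (LQ : Clim (fun n => P + RtoC s0 * Ci * cis (- al n))%C Q).
 { replace Q with (P + RtoC s0 * Ci * cis (- al0))%C.
  - apply Clim_plus. apply Clim_const. apply (Clim_mult (fun _ => RtoC s0 * Ci)%C). apply Clim_const. auto.
  - replace (P + RtoC s0 * Ci * cis (- al0))%C with (cis (- al0) * (cis al0 * P + Ci * RtoC s0) + (P - (cis (- al0) * cis al0) * P))%C by ring.
   rewrite <- E, polar1_inv. rewrite Cmult_assoc, polar1_inv. ring. }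
 destruct (LQ d Hd) as [N6 X6].
 destruct (Un_cv_lt pb pb0 ph0 H8 ltac:(lra)) as [N7 X7]. destruct (Un_cv_gt pa pa0 ph0 H9 ltac:(lra)) as [N8 X8].
 set (n := (N1 + N2 + N3 + N4 + N5 + N6 + N7 + N8)%nat).
 at_rank n. cbv beta in X6.
 unfold Rdist in X3, X4, X5. apply Rabs_def2 in X3, X4, X5.
 rewrite polar_plus_PI in X2.
 replace (Re (- cis (al n) * (Q - v))) with (- Re (cis (al n) * (Q - v))) in X2 by C_ring.
 replace (Re (- cis (al n) * f (a n))) with (- Re (cis (al n) * f (a n))) in X2 by C_ring.
 assert (HQn : Om (P + RtoC s0 * Ci * cis (- al n))) by (apply X; auto).
 assert (HPn : (cis (al n) * P)%C <> 0). { apply Cmult_neq_0; auto. apply Cmod_gt_0. rewrite Cmod_polar1. lra. }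
 destruct (point_below (cis (al n) * P) (cis (al n) * f (b n)) (cis (al n) * f (a n))
  (ph0 + al n) (pb n + al n) (pa n + al n)) as [t [Ht HD]]; auto; try (apply isarg_rotate; auto); try lra.
 assert (HDO : exists D, Om D /\ Re (cis (al n) * P) = Re (cis (al n) * D) /\ Im (cis (al n) * D) <= Im (cis (al n) * P)).
 { assert (S : forall y, (cis (al n) * (RtoC t * y) = RtoC t * (cis (al n) * y))%C) by (intros; ring).
  assert (SR : forall y, Re (RtoC t * y) = t * Re y) by (intros y; destruct y; C_ring).
  assert (SI : forall y, Im (RtoC t * y) = t * Im y) by (intros y; destruct y; C_ring).
  destruct HD as [[D1 D2]|[D1 D2]].
  - exists (RtoC t * f (b n))%C. split. apply Om_shrink; auto. apply Om_f; auto. rewrite S, SR, SI. auto.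
  - exists (RtoC t * f (a n))%C. split. apply Om_shrink; auto. apply Om_f; auto. rewrite S, SR, SI. auto. }
 destruct HDO as [D [HD1 [HD2 HD3]]].
 set (y := Im (cis (al n) * P) - Im (cis (al n) * D)). assert (Hy : 0 <= y) by (unfold y; lra).
 assert (EPD : (P - D = RtoC y * Ci * cis (- al n))%C).
 { replace (P - D)%C with ((cis (- al n) * cis (al n)) * (P - D))%C by (rewrite polar1_inv; ring).
  replace (cis (- al n) * cis (al n) * (P - D))%C with (cis (- al n) * (cis (al n) * P - cis (al n) * D))%C by ring.
  replace (cis (al n) * P - cis (al n) * D)%C with (RtoC y * Ci)%C. ring.
  apply Ceq. rewrite re_minus, HD2. C_ring. rewrite im_minus. fold y. C_ring. }
 (* P is on the segment from D, straight below it, to its own upward translate; both ends belong to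
    Om. *)
 replace P with (seg D (P + RtoC s0 * Ci * cis (- al n)) (y / (y + s0))).
 - apply Om_seg; auto. apply Rdiv_01; lra.
 - unfold seg. replace (P + RtoC s0 * Ci * cis (- al n) - D)%C with ((P - D) + RtoC s0 * Ci * cis (- al n))%C by ring.
  rewrite EPD. replace (RtoC y * Ci * cis (- al n) + RtoC s0 * Ci * cis (- al n))%C with (RtoC (y + s0) * Ci * cis (- al n))%C
   by (rewrite RtoC_plus; ring).
  replace (D + RtoC (y / (y + s0)) * (RtoC (y + s0) * Ci * cis (- al n)))%C with (D + RtoC (y / (y + s0) * (y + s0)) * Ci * cis (- al n))%C
   by (rewrite RtoC_mult; ring).
  replace (y / (y + s0) * (y + s0)) with y by (field; lra). rewrite <- EPD. ring.
Qed.

(** The limit direction of the f (z n) lies strictly between pb0 and pa0: equality would identify ze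
    with one of the antipodal points, and the complementary directions belong to the lower arc. An
    upward shift preserves this sector, and it cannot lead into Om from a boundary point seen in
    it. *)
Theorem upper_arc_goes_up al al0 be b a pb pa pb0 pa0 (z w : nat -> C) (s : nat -> R) ze ze' c C0 :
 antipodal al al0 be b a pb pa pb0 pa0 -> (forall n, inD (z n)) -> (forall n, inD (w n)) ->
 Clim z ze -> Cmod ze = 1 -> 0 < Im (ze * cis (- be)) -> Clim w ze' -> 0 < c -> (forall n, c <= s n <= C0) ->
 (forall n, cis al0 * f (w n) = cis al0 * f (z n) + Ci * RtoC (s n))%C ->
 Cmod ze' = 1 /\ 0 <= Im (ze' * cis (- be)).
Proof.
 intros AP Hz Hw Lz Mze Hup Lw Hc Hs Hzw. pose proof PI_RGT_0 as HPI.
 destruct (choice _ (fun n => exists_arg_from (f (z n)) pb0)) as [ph Hph].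
 destruct (BW_R ph pb0 (pb0 + 2 * PI)) as [s1 [ph0 [Hs1 [Lph Bph]]]]; [apply Hph|].
 revert Lz Lw Hs Hzw Hz Hw. intros Lz0 Lw0 Hs0 Hzw0 Hz0 Hw0.
 assert (Lz := Clim_ext_sub _ _ _ Hs1 Lz0). assert (Lw := Clim_ext_sub _ _ _ Hs1 Lw0).
 assert (Hs := fun n => Hs0 (s1 n)). assert (Hzw := fun n => Hzw0 (s1 n)). assert (Hz := fun n => Hz0 (s1 n)). assert (Hw := fun n => Hw0 (s1 n)).
 assert (Hpz := fun n => proj1 (Hph (s1 n))). cbv beta in *.
 set (z1 := fun n => z (s1 n)) in *. set (w1 := fun n => w (s1 n)) in *. set (q1 := fun n => s (s1 n)) in *. set (p1 := fun n => ph (s1 n)) in *.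
 change (forall n, inD (z1 n)) in Hz. change (forall n, inD (w1 n)) in Hw. change (forall n, isarg (f (z1 n)) (p1 n)) in Hpz.
 change (forall n, c <= q1 n <= C0) in Hs. change (forall n, cis al0 * f (w1 n) = cis al0 * f (z1 n) + Ci * RtoC (q1 n))%C in Hzw.
 clearbody z1 w1 q1 p1. clear z w s ph s1 Hs1 Hph Lz0 Lw0 Hs0 Hzw0 Hz0 Hw0.
 rename z1 into z. rename w1 into w. rename q1 into s. rename p1 into ph.
 pose proof AP as [H1 H2 H3 H4 H5 H6 H7 H8 H9 H10 H11 H12 H13 H14].
 assert (Dz := dir_lim_args _ _ _ Hpz Lph). assert (Db := dir_lim_args _ _ _ H6 H8). assert (Da := dir_lim_args _ _ _ H7 H9).
 assert (Hnb : cis ph0 <> cis pb0).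
 { intros E. rewrite E in Dz. assert (E2 := same_direction_same_limit z b ze (cis be) _ (Cmod_polar1 _) Hz H2 Lz H4 Mze (Cmod_polar1 _) Dz Db).
  rewrite E2, Cmult_comm, polar1_inv in Hup. simpl in Hup. lra. }
 assert (Hna : cis ph0 <> cis pa0).
 { intros E. rewrite E in Dz. assert (E2 := same_direction_same_limit z a ze _ _ (Cmod_polar1 _) Hz H3 Lz H5 Mze (Cmod_polar1 _) Dz Da).
  rewrite E2, polar_plus_PI in Hup. replace (- cis be * cis (- be))%C with (- (cis (- be) * cis be))%C in Hup by ring.
  rewrite polar1_inv in Hup. simpl in Hup. lra. }
 assert (Hlt : pb0 < ph0 < pb0 + 2 * PI).
 { split. destruct (Req_dec pb0 ph0) as [E|E]; [|lra]. exfalso. apply Hnb. rewrite E; auto.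
  destruct (Req_dec ph0 (pb0 + 2 * PI)) as [E|E]; [|lra]. exfalso. apply Hnb. rewrite E. apply polar_plus_2PI. }
 assert (Hsec : pb0 < ph0 < pa0).
 { split. lra. destruct (Rtotal_order ph0 pa0) as [E|[E|E]]; auto. exfalso; apply Hna; rewrite E; auto.
  exfalso. assert (Im (ze * cis (- be)) <= 0); [|lra].
  apply (between_lower_arc _ _ _ _ _ _ _ _ _ z ph ze AP Hz Lz Mze Hpz).
  destruct (Un_cv_order _ _ _ _ H9 Lph E) as [N1 X1].
  destruct (Un_cv_order ph (fun n => pb n + 2 * PI) ph0 (pb0 + 2 * PI) Lph) as [N2 X2].
  { apply CV_plus; auto. apply Un_cv_const. } lra.
  exists (N1 + N2)%nat. intros n Hn. split; [apply X1|apply X2]; lia. }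
 assert (Hpb0 : - (PI / 2) <= pb0 + al0 <= PI / 2).
 { assert (L : Un_cv (fun n => pb n + al n) (pb0 + al0)) by (apply CV_plus; auto). split.
  - apply (Un_cv_le _ _ _ _ (Un_cv_const _) L). exists 0%nat. intros n _. apply H10.
  - apply (Un_cv_le _ _ _ _ L (Un_cv_const _)). exists 0%nat. intros n _. apply H10. }
 assert (Hpa0 : PI / 2 <= pa0 + al0 <= 3 * (PI / 2)).
 { assert (L : Un_cv (fun n => pa n + al n) (pa0 + al0)) by (apply CV_plus; auto). split.
  - apply (Un_cv_le _ _ _ _ (Un_cv_const _) L). exists 0%nat. intros n _. apply H11.
  - apply (Un_cv_le _ _ _ _ L (Un_cv_const _)). exists 0%nat. intros n _. apply H11. }
 assert (Hfw : forall n, f (w n) = (f (z n) + RtoC (s n) * Ci * cis (- al0))%C).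
 { intros n. replace (f (w n)) with ((cis (- al0) * cis al0) * f (w n))%C by (rewrite polar1_inv; ring).
  rewrite <- Cmult_assoc, Hzw. replace (cis (- al0) * (cis al0 * f (z n) + Ci * RtoC (s n)))%C with
   ((cis (- al0) * cis al0) * f (z n) + RtoC (s n) * Ci * cis (- al0))%C by ring. rewrite polar1_inv. ring. }
 assert (Mze'1 := Clim_inD_le w ze' Hw Lw).
 assert (MCi : Cmod Ci = 1). { unfold Cmod, Ci; simpl. replace (0 * (0 * 1) + 1 * (1 * 1)) with 1 by ring. apply sqrt_1. }
 destruct (classic (exists M, forall N, exists n, (N <= n)%nat /\ Cmod (f (z n)) <= M)) as [[M HM]|Hunb].
 - destruct (infinitely_often_extraction _ HM) as [s1 [Hs1 Hs2]].
  destruct (BW_C (fun n => f (z (s1 n))) M Hs2) as [s2 [P [Hs3 LP]]].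
  destruct (BW_R (fun n => s (s1 (s2 n))) c C0) as [s3 [s0 [Hs4 [Ls0 Bs0]]]]; [intros; apply Hs|].
  assert (Hx := extraction_comp _ _ Hs1 (extraction_comp _ _ Hs3 Hs4)). cbv beta in Hx.
  set (x := fun n => s1 (s2 (s3 n))) in *.
  assert (LP' : Clim (fun n => f (z (x n))) P) by (apply (Clim_ext_sub _ _ _ Hs4 LP)).
  assert (Lzx := Clim_ext_sub _ _ _ Hx Lz). assert (Lwx := Clim_ext_sub _ _ _ Hx Lw). cbv beta in Lzx, Lwx.
  set (Q := (P + RtoC s0 * Ci * cis (- al0))%C).
  assert (LQ : Clim (fun n => f (w (x n))) Q).
  { assert (L : Clim (fun n => f (z (x n)) + RtoC (s (x n)) * Ci * cis (- al0))%C Q).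
   { apply (Clim_plus (fun n => f (z (x n)))); auto. apply (Clim_mult (fun n => RtoC (s (x n)) * Ci)%C). 2: apply Clim_const.
    apply (Clim_mult (fun n => RtoC (s (x n)))). 2: apply Clim_const.
    apply Clim_re_im. exact Ls0. unfold Im; simpl. apply Un_cv_const. }
   intros e He. destruct (L e He) as [N X]. exists N. intros n Hn. rewrite Hfw. apply X; auto. }
  assert (HPO : ~ Om P) by (apply (limit_not_in_Om _ _ _ (fun n => Hz (x n)) Lzx Mze LP')).
  assert (HP0 : P <> 0) by (intros E; apply HPO; rewrite E; apply Om_0).
  assert (HPph : isarg P ph0) by (apply (Clim_args_isarg _ _ _ _ (fun n => Hpz (x n)) (Un_cv_ext_sub _ _ _ Hx Lph) LP')).
  assert (EQ : (cis al0 * Q = cis al0 * P + Ci * RtoC s0)%C).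
  { unfold Q. replace (cis al0 * (P + RtoC s0 * Ci * cis (- al0)))%C with
    (cis al0 * P + (cis (- al0) * cis al0) * (RtoC s0 * Ci))%C by ring. rewrite polar1_inv. ring. }
  assert (Mze' : Cmod ze' = 1).
  { destruct (Req_dec (Cmod ze') 1) as [E|E]; auto. exfalso. apply HPO.
   assert (Hin : inD ze') by (unfold inD; lra).
   apply (no_boundary_point_below _ _ _ _ _ _ _ _ _ P Q ph0 s0 AP HP0 HPph Hsec); auto; try lra.
   rewrite (Clim_unique _ _ _ LQ (Clim_cont f _ _ (f_cont ze' Hin) Lwx)). apply Om_f; auto. }
  split; auto.
  assert (HQO : ~ Om Q) by (apply (limit_not_in_Om _ _ _ (fun n => Hw (x n)) Lwx Mze' LQ)).
  assert (HQ0 : Q <> 0) by (intros E; apply HQO; rewrite E; apply Om_0).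
  destruct (upward_stays_in_sector (cis al0 * P) (ph0 + al0) (pb0 + al0) (pa0 + al0) s0) as [psi [Hpsi1 Hpsi2]]; try lra.
  { apply Cmult_neq_0; auto. apply Cmod_gt_0. rewrite Cmod_polar1; lra. }
  { apply isarg_rotate; auto. }
  rewrite <- EQ in Hpsi1.
  assert (HQarg : isarg Q (psi - al0)).
  { replace Q with (cis (- al0) * (cis al0 * Q))%C by (rewrite Cmult_assoc, polar1_inv; ring).
   apply (isarg_rotate _ _ (- al0)); auto. }
  destruct (args_converge _ _ _ LQ HQ0 HQarg) as [pw [Hpw1 Hpw2]].
  apply (between_upper_arc _ _ _ _ _ _ _ _ _ AP (fun n => w (x n)) pw ze' (fun n => Hw (x n)) Lwx Mze' Hpw1).
  destruct (Un_cv_order _ _ _ _ H8 Hpw2) as [N1 X1]. lra. destruct (Un_cv_order _ _ _ _ Hpw2 H9) as [N2 X2]. lra.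
  exists (N1 + N2)%nat. intros n Hn. split; [apply X1|apply X2]; lia.
 - assert (Hinf : forall M, exists N, forall n, (N <= n)%nat -> M < Cmod (f (z n))).
  { intros M. apply NNPP. intros Hn. apply Hunb. exists M. intros N. apply NNPP. intros Hcc. apply Hn. exists N.
   intros n Hle. apply Rnot_le_lt. intros H. apply Hcc. exists n; auto. }
  assert (HC0 : 0 < C0) by (specialize (Hs 0%nat); lra).
  assert (Hdist : forall n, Cmod (f (w n) - f (z n)) <= C0).
  { intros n. rewrite Hfw. replace (f (z n) + RtoC (s n) * Ci * cis (- al0) - f (z n))%C with (RtoC (s n) * Ci * cis (- al0))%C by ring.
   rewrite !Cmod_mult, Cmod_R, MCi, Cmod_polar1. specialize (Hs n). rewrite Rabs_right; lra. }
  assert (Mze' : Cmod ze' = 1).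
  { destruct (Req_dec (Cmod ze') 1) as [E|E]; auto. exfalso. assert (Hin : inD ze') by (unfold inD; lra).
   destruct (Clim_cont f _ _ (f_cont ze' Hin) Lw 1) as [N1 X1]; [lra|].
   destruct (Hinf (C0 + Cmod (f ze') + 1)) as [N2 X2]. at_rank (N1 + N2)%nat.
   cbv beta in X1. pose proof (Cmod_triangle_rev (f (w (N1 + N2)%nat)) (f ze')).
   pose proof (Cmod_triangle_rev (f (z (N1 + N2)%nat)) (f (w (N1 + N2)%nat))). rewrite Cmod_minus_sym in H0. specialize (Hdist (N1 + N2)%nat). lra. }
  split; auto.
  assert (E : ze = ze').
  { apply (same_direction_same_limit z w ze ze' (cis ph0)); auto. apply Cmod_polar1.
   intros d Hd. destruct (Dz (d / 4)) as [N1 X1]; [lra|]. destruct (Hinf (4 * C0 / d + 2 * C0)) as [N2 X2].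
   exists (N1 + N2)%nat. intros n Hn. at_rank n. specialize (Hdist n). cbv beta in X1.
   set (u := f (w n)) in *. set (v := f (z n)) in *.
   replace (u - RtoC (Cmod u) * cis ph0)%C with ((u - v) + ((v - RtoC (Cmod v) * cis ph0) + RtoC (Cmod v - Cmod u) * cis ph0))%C
    by (rewrite RtoC_minus; ring).
   le_via Cmod_triangle. le_via Rplus_le_compat_l, Cmod_triangle.
   rewrite (Cmod_mult _ (cis ph0)), Cmod_R, Cmod_polar1, Rmult_1_r.
   pose proof (Cmod_triangle_rev u v) as R1. pose proof (Cmod_triangle_rev v u) as R2. rewrite (Cmod_minus_sym v) in R2.
   assert (Rabs (Cmod v - Cmod u) <= C0) by (apply Rabs_le; lra).
   assert (4 * C0 / d * d = 4 * C0) by (field; lra). assert (0 < 4 * C0 / d) by pos_div.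
   assert (4 * C0 + 2 * C0 * d <= d * Cmod v) by nra. nra. }
  rewrite <- E. lra.
Qed.

(** [upper_arc_goes_up] after a half turn: up becomes down, the lower arc becomes the upper one, and
    z and w exchange their roles. *)
Theorem lower_arc_goes_down al al0 be b a pb pa pb0 pa0 (z w : nat -> C) (s : nat -> R) ze ze' c C0 :
 antipodal al al0 be b a pb pa pb0 pa0 -> (forall n, inD (z n)) -> (forall n, inD (w n)) ->
 Clim z ze -> Clim w ze' -> Cmod ze' = 1 -> Im (ze' * cis (- be)) < 0 -> 0 < c -> (forall n, c <= s n <= C0) ->
 (forall n, cis al0 * f (w n) = cis al0 * f (z n) + Ci * RtoC (s n))%C ->
 Cmod ze = 1 /\ Im (ze * cis (- be)) <= 0.
Proof.
 intros AP Hz Hw Lz Lw Mze' Hdn Hc Hs Hzw.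
 assert (E : cis (- (be + PI)) = (- cis (- be))%C).
 { rewrite <- polar_plus_PI, <- (polar_plus_2PI (- (be + PI))). f_equal; ring. }
 assert (EI : forall x, Im (x * cis (- (be + PI))) = - Im (x * cis (- be))).
 { intros x. rewrite E. C_ring. }
 destruct (upper_arc_goes_up _ _ _ _ _ _ _ _ _ w z s ze' ze c C0 (antipodal_swap _ _ _ _ _ _ _ _ _ AP)) as [Q1 Q2]; auto.
 - rewrite EI. lra.
 - intros n. rewrite polar_plus_PI. replace (- cis al0 * f (z n))%C with (- (cis al0 * f (z n)))%C by ring.
  replace (- cis al0 * f (w n))%C with (- (cis al0 * f (w n)))%C by ring. rewrite Hzw. ring.
 - rewrite EI in Q2. split; auto. lra.
Qed.

(** * Comparison with vertical translates in the strip coordinate *)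

(** Imaginary part of log ((1 + x)/(1 - x)), the map of the disc onto the strip of width pi: it
    tends to pi/2 at the open upper half-circle and to -pi/2 at the lower one. *)
Definition strip_arg (x : C) : R := Im (Clog (1 + x)) - Im (Clog (1 - x)).

Lemma strip_arg_atan x : strip_arg x = atan (Im x / (1 + Re x)) + atan (Im x / (1 - Re x)).
Proof.
 unfold strip_arg, Clog, Im; simpl. destruct x as [x y]; simpl.
 replace (0 + y) with y by ring. replace (0 + - y) with (- y) by ring. replace (1 + - x) with (1 - x) by ring.
 replace (- y / (1 - x)) with (- (y / (1 - x))) by (unfold Rdiv; ring). rewrite atan_opp. ring.
Qed.

Lemma closed_disc_re (x : C) : Cmod x <= 1 -> x <> 1 -> x <> - (1) -> 0 < Re (1 + x) /\ 0 < Re (1 - x) /\ Im x * Im x <= (1 + Re x) * (1 - Re x).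
Proof.
 intros Hx H1 H2. assert (Q := Cmod_sqr x). Cnneg x. assert (Cmod x * Cmod x <= 1) by nra.
 assert (R1 : Re x <> 1). { intros E. apply H1. apply Ceq; auto. assert (Im x = 0) by nra. rewrite H3. reflexivity. }
 assert (R2 : Re x <> - (1)). { intros E. apply H2. apply Ceq; simpl; auto. assert (Im x = 0) by nra. unfold Im in *; simpl; lra. }
 replace (Re (1 + x)) with (1 + Re x) by reflexivity. replace (Re (1 - x)) with (1 - Re x) by reflexivity.
 pose proof (Rle_0_sqr (Im x)). unfold Rsqr in *. assert (-1 <= Re x <= 1) by nra. repeat split; lra.
Qed.

(** For positive numbers with product at most 1 the arctangents add up to at most pi/2; for y/p and
    y/q this is the condition of lying in the closed disc. *)
Lemma strip_arg_bound x : 0 < Re (1 + x) -> 0 < Re (1 - x) -> Im x * Im x <= (1 + Re x) * (1 - Re x) ->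
 - (PI / 2) <= strip_arg x <= PI / 2.
Proof.
 intros H1 H2 Hq. replace (Re (1 + x)) with (1 + Re x) in H1 by reflexivity. replace (Re (1 - x)) with (1 - Re x) in H2 by reflexivity.
 rewrite strip_arg_atan. set (p := 1 + Re x) in *. set (q := 1 - Re x) in *. pose proof PI_RGT_0.
 assert (P : forall y, 0 <= y -> y * y <= p * q -> 0 <= atan (y / p) + atan (y / q) <= PI / 2).
 { intros y Hy Hyq. destruct (Req_dec y 0) as [->|Hne].
  - unfold Rdiv. rewrite !Rmult_0_l, atan_0. lra.
  - assert (A : 0 < y / p) by pos_div. assert (B : 0 < y / q) by pos_div.
   assert (atan 0 < atan (y / p)) by (apply atan_increasing; auto). assert (atan 0 < atan (y / q)) by (apply atan_increasing; auto).
   rewrite atan_0 in *. split. lra.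
   assert (C1 : y / q <= / (y / p)). { replace (/ (y / p)) with (p / y) by (field; lra). apply Rmult_le_reg_r with (q * y). nra.
    replace (y / q * (q * y)) with (y * y) by (field; lra). replace (p / y * (q * y)) with (p * q) by (field; lra). auto. }
   assert (C2 := atan_inv (y / p) A). assert (atan (y / q) <= atan (/ (y / p))); [|lra].
   destruct C1 as [C1| ->]; [left; apply atan_increasing; auto|lra]. }
 destruct (Rle_lt_dec 0 (Im x)). specialize (P (Im x) r Hq). lra.
 specialize (P (- Im x) ltac:(lra) ltac:(lra)).
 replace (- Im x / p) with (- (Im x / p)) in P by (unfold Rdiv; ring). replace (- Im x / q) with (- (Im x / q)) in P by (unfold Rdiv; ring).
 rewrite !atan_opp in P. lra.
Qed.

Lemma strip_arg_circle x : 0 < Re (1 + x) -> 0 < Re (1 - x) -> Cmod x = 1 ->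
 (0 < Im x -> strip_arg x = PI / 2) /\ (Im x < 0 -> strip_arg x = - (PI / 2)).
Proof.
 intros H1 H2 Hm. replace (Re (1 + x)) with (1 + Re x) in H1 by reflexivity. replace (Re (1 - x)) with (1 - Re x) in H2 by reflexivity.
 rewrite strip_arg_atan. assert (Q := Cmod_sqr x). rewrite Hm in Q.
 assert (P : forall y, 0 < y -> y * y = (1 + Re x) * (1 - Re x) -> atan (y / (1 + Re x)) + atan (y / (1 - Re x)) = PI / 2).
 { intros y Hy E. assert (A : 0 < y / (1 + Re x)) by pos_div.
  replace (y / (1 - Re x)) with (/ (y / (1 + Re x))).
  rewrite atan_inv by auto. ring.
  apply Rmult_eq_reg_r with (y * (1 - Re x)); [|nra]. replace (/ (y / (1 + Re x)) * (y * (1 - Re x))) with ((1 + Re x) * (1 - Re x)) by (field; lra).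
  rewrite <- E. field. lra. }
 split; intros Hy. apply P; auto; lra.
 assert (E := P (- Im x) ltac:(lra) ltac:(lra)).
 replace (- Im x / (1 + Re x)) with (- (Im x / (1 + Re x))) in E by (unfold Rdiv; ring).
 replace (- Im x / (1 - Re x)) with (- (Im x / (1 - Re x))) in E by (unfold Rdiv; ring).
 rewrite !atan_opp in E. lra.
Qed.

(** The rotated f and the shear have equal real parts, so a vertical step of the one is a vertical
    step of the other, of comparable length by [vertical_monotone]. *)
Lemma vertical_shift_bounds al z w t : inD z -> inD w -> 0 < t -> (Fa al w = Fa al z + Ci * RtoC t)%C ->
 exists s, (1 - k) / (1 + k) * t <= s <= (1 + k) / (1 - k) * t /\ (cis al * f w = cis al * f z + Ci * RtoC s)%C.
Proof.
 intros Hz Hw Ht E. set (s := Im (cis al * f w) - Im (cis al * f z)).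
 assert (Es : (cis al * f w = cis al * f z + Ci * RtoC s)%C).
 { apply Ceq.
  - pose proof (Fa_re al w) as A. pose proof (Fa_re al z) as B. rewrite E in A.
   replace (Re (Fa al z + Ci * RtoC t)) with (Re (Fa al z)) in A by C_ring.
   replace (Re (cis al * f z + Ci * RtoC s)) with (Re (cis al * f z)) by C_ring. lra.
  - replace (Im (cis al * f z + Ci * RtoC s)) with (Im (cis al * f z) + s) by C_ring. unfold s. ring. }
 exists s. split; auto.
 destruct (vertical_monotone al z w s t Hz Hw) as [V1 [V2 V3]].
 - rewrite Es. ring.
 - rewrite E. ring.
 - assert (Hs0 : 0 <= s) by nra. rewrite (Rabs_right t) in * by lra. rewrite (Rabs_right s) in * by lra. split.
  + apply Rmult_le_reg_l with (1 + k). lra. replace ((1 + k) * ((1 - k) / (1 + k) * t)) with ((1 - k) * t) by (field; lra). lra.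
  + apply Rmult_le_reg_l with (1 - k). lra. replace ((1 - k) * ((1 + k) / (1 - k) * t)) with ((1 + k) * t) by (field; lra). lra.
Qed.

Section Monotone.
Variables (aln : nat -> R) (al be : R) (b a : nat -> C) (pb pa : nat -> R) (pb0 pa0 : R).
Hypothesis AP : antipodal aln al be b a pb pa pb0 pa0.

Definition rot (z : C) : C := (cis (- be) * z)%C.

Lemma Cmod_rot z : Cmod (rot z) = Cmod z.
Proof. unfold rot. rewrite Cmod_mult, Cmod_polar1. ring. Qed.

Lemma disc_re z : inD z -> 0 < Re (1 + rot z) /\ 0 < Re (1 - rot z).
Proof.
 intros Hz. unfold inD in Hz. pose proof (re_le_Cmod (rot z)) as Q. rewrite Cmod_rot in Q. apply Rabs_le_between in Q.
 replace (Re (1 + rot z)) with (1 + Re (rot z)) by reflexivity. replace (Re (1 - rot z)) with (1 - Re (rot z)) by reflexivity. lra.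
Qed.

(** Conformal map of the disc onto a horizontal strip, with the two antipodal points at the ends of
    the strip. *)
Definition slit (z : C) : C := (Clog (1 + rot z) - Clog (1 - rot z))%C.
Definition slit' (z : C) : C := (RtoC 2 * cis (- be) / ((1 - rot z) * (1 + rot z)))%C.
(** Its real part ln |1 - rot z^2| tends to minus infinity at the two antipodal points. A small
    multiple of it is the barrier that hides these points from the maximum principle. *)
Definition pole (z : C) : C := (Clog (1 + rot z) + Clog (1 - rot z))%C.
Definition pole' (z : C) : C := (/ (1 + rot z) * (0 + cis (- be) * 1) + / (1 - rot z) * (0 - cis (- be) * 1))%C.

Lemma Re_pos_neq_0 (x : C) : 0 < Re x -> x <> 0.
Proof. intros H E. rewrite E in H. simpl in H. lra. Qed.

Lemma slit_holo : holo slit slit'.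
Proof.
 intros z Hz. destruct (disc_re z Hz) as [R1 R2]. assert (N1 := Re_pos_neq_0 _ R1). assert (N2 := Re_pos_neq_0 _ R2).
 replace (slit' z) with (/ (1 + rot z) * (0 + cis (- be) * 1) - / (1 - rot z) * (0 - cis (- be) * 1))%C.
 - apply Cder_minus. apply (Cder_comp (fun z => 1 + rot z)%C Clog). 2: apply Clog_Cder; auto.
  apply Cder_plus. apply Cder_const. apply Cder_scal, Cder_id.
  apply (Cder_comp (fun z => 1 - rot z)%C Clog). apply Cder_minus. apply Cder_const. apply Cder_scal, Cder_id. apply Clog_Cder; auto.
 - unfold slit'. field. auto.
Qed.

Lemma pole_holo : holo pole pole'.
Proof.
 intros z Hz. destruct (disc_re z Hz) as [R1 R2].
 apply Cder_plus. apply (Cder_comp (fun z => 1 + rot z)%C Clog). 2: apply Clog_Cder; auto.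
 apply Cder_plus. apply Cder_const. apply Cder_scal, Cder_id.
 apply (Cder_comp (fun z => 1 - rot z)%C Clog). apply Cder_minus. apply Cder_const. apply Cder_scal, Cder_id. apply Clog_Cder; auto.
Qed.

Lemma slit_Im z : Im (slit z) = strip_arg (rot z).
Proof. unfold slit, strip_arg. rewrite im_minus. reflexivity. Qed.

Lemma pole_Re z : Re (pole z) = ln (Cmod (1 + rot z)) + ln (Cmod (1 - rot z)).
Proof. reflexivity. Qed.

Lemma pole_le z : inD z -> Re (pole z) <= 2 * ln 2.
Proof.
 intros Hz. rewrite pole_Re. destruct (disc_re z Hz) as [R1 R2].
 assert (Q : forall x, 0 < Re x -> Cmod x <= 2 -> ln (Cmod x) <= ln 2).
 { intros x Hx Hx2. assert (0 < Cmod x) by (apply Cmod_gt_0, Re_pos_neq_0; auto).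
  destruct Hx2 as [Hx2| ->]; [left; apply ln_increasing; auto|lra]. }
 unfold inD in Hz. rewrite <- Cmod_rot in Hz.
 assert (ln (Cmod (1 + rot z)) <= ln 2). { apply Q; auto. le_via Cmod_triangle. rewrite Cmod_1. lra. }
 assert (ln (Cmod (1 - rot z)) <= ln 2). { apply Q; auto. le_via Cmod_minus_le. rewrite Cmod_1. lra. }
 lra.
Qed.

(** Each of the two logarithms has real part at most ln 2, so a lower bound on their sum keeps both
    1 + rot and 1 - rot away from 0. *)
Lemma pole_escape (u : nat -> C) l M : (forall n, inD (u n)) -> Clim u l -> (forall n, - M <= Re (pole (u n))) ->
 rot l <> 1 /\ rot l <> - (1).
Proof.
 intros Hu Hl HM.
 assert (Lr : Clim (fun n => rot (u n)) (rot l)) by (apply (Clim_mult (fun _ => cis (- be)) u); auto; apply Clim_const).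
 assert (Key : forall (c : C), Cmod c = 1 -> (forall n, - (M + ln 2) <= ln (Cmod (1 + c * rot (u n)))) -> (1 + c * rot l)%C <> 0).
 { intros c Hc Hcn E. set (d := exp (- (M + ln 2))). assert (Hd : 0 < d) by apply exp_pos.
  destruct (Lr d Hd) as [N X]. specialize (X N ltac:(lia)). cbv beta in X. specialize (Hcn N).
  assert (E2 : (1 + c * rot (u N))%C = (c * (rot (u N) - rot l))%C).
  { replace (c * (rot (u N) - rot l))%C with ((1 + c * rot (u N)) - (1 + c * rot l))%C by ring. rewrite E. ring. }
  rewrite E2, Cmod_mult, Hc, Rmult_1_l in Hcn.
  destruct (Req_dec (Cmod (rot (u N) - rot l)) 0) as [E0|E0].
  - assert (E3 : rot (u N) = rot l) by (apply Ceq_minus, Cmod_eq_0; auto).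
   assert (Cmod (c * rot l) = 1). { replace (c * rot l)%C with (- (1) + (1 + c * rot l))%C by ring. rewrite E. replace (- (1) + 0)%C with (- (1))%C by ring. rewrite Cmod_opp, Cmod_1. auto. }
   rewrite Cmod_mult, Hc, Rmult_1_l, <- E3, Cmod_rot in H. specialize (Hu N). unfold inD in Hu. lra.
  - Cnneg (rot (u N) - rot l)%C. assert (ln (Cmod (rot (u N) - rot l)) < ln d) by (apply ln_increasing; lra).
   unfold d in H0. rewrite ln_exp in H0. lra. }
 assert (Hup : forall n x, inD (u n) -> Cmod x = 1 -> 0 < Re (1 + x * rot (u n)) -> ln (Cmod (1 + x * rot (u n))) <= ln 2).
 { intros n x Hn Hx Hre. assert (0 < Cmod (1 + x * rot (u n))) by (apply Cmod_gt_0, Re_pos_neq_0; auto).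
  assert (Cmod (1 + x * rot (u n)) <= 2). { le_via Cmod_triangle. rewrite Cmod_1, Cmod_mult, Hx, Cmod_rot. unfold inD in Hn. lra. }
  destruct H0 as [H0| ->]; [left; apply ln_increasing; auto|lra]. }
 assert (E1 : forall z, (1 + 1 * rot z = 1 + rot z)%C) by (intros; ring).
 assert (E2 : forall z, (1 + - (1) * rot z = 1 - rot z)%C) by (intros; ring).
 assert (M1 : Cmod (- (1)) = 1) by (rewrite Cmod_opp; apply Cmod_1).
 assert (K1 : forall n, - (M + ln 2) <= ln (Cmod (1 + 1 * rot (u n)))).
 { intros n. specialize (HM n). rewrite pole_Re in HM. destruct (disc_re _ (Hu n)) as [R1 R2].
  assert (Q := Hup n (- (1))%C (Hu n) M1). rewrite E1. rewrite E2 in Q. specialize (Q R2). lra. }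
 assert (K2 : forall n, - (M + ln 2) <= ln (Cmod (1 + - (1) * rot (u n)))).
 { intros n. specialize (HM n). rewrite pole_Re in HM. destruct (disc_re _ (Hu n)) as [R1 R2].
  assert (Q := Hup n 1 (Hu n) Cmod_1). rewrite E2. rewrite E1 in Q. specialize (Q R1). lra. }
 split; intros E.
 - apply (Key _ M1 K2). rewrite E. ring.
 - apply (Key _ Cmod_1 K1). rewrite E, RtoC_opp. ring.
Qed.

Lemma strip_arg_Clim (u : nat -> C) l : Clim u l -> 0 < Re (1 + rot l) -> 0 < Re (1 - rot l) ->
 Un_cv (fun n => strip_arg (rot (u n))) (strip_arg (rot l)).
Proof.
 intros Hl H1 H2. assert (HC : Ccont slit l).
 { unfold slit, Cminus. apply Ccont_plus.
  - apply (Ccont_comp (fun z => 1 + rot z)%C Clog). apply Ccont_plus. apply Ccont_const. apply Ccont_mult; [apply Ccont_const|apply Ccont_id]. apply Clog_cont; auto.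
  - apply (Ccont_comp (fun z => Clog (1 + - rot z)) Copp). apply (Ccont_comp (fun z => 1 + - rot z)%C Clog).
   apply Ccont_plus. apply Ccont_const. apply (Ccont_comp rot Copp). apply Ccont_mult; [apply Ccont_const|apply Ccont_id].
   intros e He. exists e. split; auto. intros w Hw. replace (- w - - rot l)%C with (- (w - rot l))%C by ring. rewrite Cmod_opp. auto.
   apply Clog_cont; auto.
   intros e He. exists e. split; auto. intros w Hw. replace (- w - - Clog (1 + - rot l))%C with (- (w - Clog (1 + - rot l)))%C by ring. rewrite Cmod_opp. auto. }
 assert (L := Clim_Im _ _ (Clim_cont slit u l HC Hl)). rewrite slit_Im in L.
 intros e He. destruct (L e He) as [N X]. exists N. intros n Hn. specialize (X n Hn). rewrite slit_Im in X. exact X.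
Qed.

(** Maximum principle for the difference of the strip coordinates of z and of its translate, on the
    set where the translate stays in the image. At a boundary point l of modulus 1 on the lower arc
    the coordinate of l is minimal; on the upper arc the translates tend to the upper arc too, and
    both coordinates are pi/2. If |l| < 1, the translates tend to the circle, and not to the lower
    arc, so their coordinate is maximal in the limit. *)
Theorem strip_arg_increasing tau z : 0 < tau -> inD z -> FOm al (Fa al z + Ci * RtoC tau) ->
 strip_arg (rot z) <= strip_arg (rot (Gf al (Fa al z + Ci * RtoC tau))).
Proof.
 intros Htau Hz0 HF0. set (T := fun z => Gf al (Fa al z + Ci * RtoC tau)). fold (T z).
 set (U := fun z => inD z /\ FOm al (Fa al z + Ci * RtoC tau)).
 assert (HT : forall z, U z -> inD (T z) /\ (Fa al (T z) = Fa al z + Ci * RtoC tau)%C) by (intros y [Hy1 Hy2]; apply Gf_spec; auto).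
 assert (HTd : forall y, U y -> Cder T y (/ Fa' al (T y) * (Fa' al y + 0))).
 { intros y [Hy1 Hy2]. apply (Cder_comp (fun y => Fa al y + Ci * RtoC tau)%C (Gf al)).
  apply Cder_plus. apply Fa_holo; auto. apply Cder_const. apply Gf_Cder; auto. }
 assert (HUo : Copen U).
 { intros y [Hy1 Hy2]. destruct (inD_open y Hy1) as [d1 [Hd1 X1]]. destruct (FOm_open al _ Hy2) as [d2 [Hd2 X2]].
  destruct (holo_cont _ _ (Fa_holo al) y Hy1 d2 Hd2) as [d3 [Hd3 X3]].
  exists (Rmin d1 d3). split. apply Rmin_pos; auto. intros w Hw. pose proof (Rmin_l d1 d3). pose proof (Rmin_r d1 d3).
  split. apply X1; lra. apply X2. replace (Fa al w + Ci * RtoC tau - (Fa al y + Ci * RtoC tau))%C with (Fa al w - Fa al y)%C by ring. apply X3; lra. }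
 (* The barrier enters at z and at its translate, each time with a real part at most 2 ln 2; this is
    the origin of 4 ln 2. Letting e tend to 0 removes it. *)
 assert (Main : forall e, 0 < e -> strip_arg (rot z) - strip_arg (rot (T z)) + e * (Re (pole z) + Re (pole (T z))) <= e * (4 * ln 2)).
 { intros e He.
  set (P1 := fun y => (- Ci * slit y + RtoC e * pole y)%C). set (P1' := fun y => (- Ci * slit' y + RtoC e * pole' y)%C).
  set (P2 := fun y => (Ci * slit y + RtoC e * pole y)%C). set (P2' := fun y => (Ci * slit' y + RtoC e * pole' y)%C).
  assert (HP1 : holo P1 P1') by (intros y Hy; apply Cder_plus; apply Cder_scal; [apply slit_holo|apply pole_holo]; auto).
  assert (HP2 : holo P2 P2') by (intros y Hy; apply Cder_plus; apply Cder_scal; [apply slit_holo|apply pole_holo]; auto).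
  set (Ph := fun y => (P1 y + P2 (T y))%C). set (Ph' := fun y => (P1' y + P2' (T y) * (/ Fa' al (T y) * (Fa' al y + 0)))%C).
  assert (HPh : forall y, U y -> Cder Ph y (Ph' y)).
  { intros y Hy. apply Cder_plus. apply HP1, Hy. apply (Cder_comp T P2). apply HTd; auto. apply HP2, HT; auto. }
  assert (Ev : forall y, Re (Ph y) = strip_arg (rot y) - strip_arg (rot (T y)) + e * (Re (pole y) + Re (pole (T y)))).
  { intros y. unfold Ph, P1, P2. rewrite <- !slit_Im. C_ring. }
  rewrite <- Ev. apply (maximum_principle U (fun y => Re (Ph y))); auto.
  - intros y [Hy _]. apply Rlt_le, Hy.
  - intros y Hy. apply Vcont_Re, (Cder_cont _ _ (Ph' y)), HPh; auto.
  - intros y Hy. destruct (HUo y Hy) as [d [Hd X]]. apply (submean_Re Ph Ph' y d Hd). intros w Hw. apply HPh, X; auto.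
  - intros u l M' HM HUu Lu HnU HMn.
   assert (Hu : forall n, inD (u n)) by (intros n; apply HUu).
   assert (HTu : forall n, inD (T (u n))) by (intros n; apply HT; auto).
   assert (Hstrip : forall y, inD y -> - (PI / 2) <= strip_arg (rot y) <= PI / 2).
   { intros y Hy. destruct (disc_re y Hy) as [R1 R2]. apply strip_arg_bound; auto.
    assert (Q := Cmod_sqr (rot y)). rewrite Cmod_rot in Q. unfold inD in Hy. Cnneg y. nra. }
   assert (HMv : forall n, M' <= strip_arg (rot (u n)) - strip_arg (rot (T (u n))) + e * (Re (pole (u n)) + Re (pole (T (u n))))).
   { intros n. rewrite <- Ev. apply HMn. }
   set (K := (PI - M') / e + 2 * ln 2).
   assert (EK : e * K = PI - M' + e * (2 * ln 2)) by (unfold K; field; lra).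
   assert (B1 : forall n, - K <= Re (pole (u n))).
   { intros n. specialize (HMv n). pose proof (Hstrip _ (Hu n)). pose proof (Hstrip _ (HTu n)). pose proof (pole_le _ (HTu n)).
    apply Rmult_le_reg_l with e; auto. nra. }
   assert (B2 : forall n, - K <= Re (pole (T (u n)))).
   { intros n. specialize (HMv n). pose proof (Hstrip _ (Hu n)). pose proof (Hstrip _ (HTu n)). pose proof (pole_le _ (Hu n)).
    apply Rmult_le_reg_l with e; auto. nra. }
   destruct (BW_C (fun n => T (u n)) 1) as [s [l' [Hs Ll']]]. { intros n. apply Rlt_le, HTu. }
   assert (Lus := Clim_ext_sub _ _ _ Hs Lu). cbv beta in Lus.
   destruct (pole_escape u l K Hu Lu B1) as [N1 N2].
   destruct (pole_escape (fun n => T (u (s n))) l' K (fun n => HTu (s n)) Ll' (fun n => B2 (s n))) as [N3 N4].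
   assert (Ml := Clim_inD_le u l Hu Lu). assert (Ml' := Clim_inD_le _ l' (fun n => HTu (s n)) Ll').
   assert (Cl := closed_disc_re (rot l)). rewrite Cmod_rot in Cl. destruct (Cl Ml N1 N2) as [C1 [C2 C3]]. clear Cl.
   assert (Cl := closed_disc_re (rot l')). rewrite Cmod_rot in Cl. destruct (Cl Ml' N3 N4) as [C4 [C5 C6]]. clear Cl.
   assert (Bl := strip_arg_bound _ C1 C2 C3). assert (Bl' := strip_arg_bound _ C4 C5 C6).
   assert (Hgt : strip_arg (rot l') < strip_arg (rot l)).
   { assert (M' - e * (4 * ln 2) <= strip_arg (rot l) - strip_arg (rot l')); [|lra].
    assert (L : Un_cv (fun n => strip_arg (rot (u (s n))) - strip_arg (rot (T (u (s n))))) (strip_arg (rot l) - strip_arg (rot l'))).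
    { apply CV_minus. apply (strip_arg_Clim (fun n => u (s n))); auto. apply (strip_arg_Clim (fun n => T (u (s n)))); auto. }
    apply (Un_cv_le _ _ _ _ (Un_cv_const _) L). exists 0%nat. intros n _. specialize (HMv (s n)).
    pose proof (pole_le _ (HTu (s n))). pose proof (pole_le _ (Hu (s n))). nra. }
   assert (Hsh := fun n => vertical_shift_bounds al (u (s n)) (T (u (s n))) tau (Hu (s n)) (HTu (s n)) Htau (proj2 (HT _ (HUu (s n))))).
   apply choice in Hsh. destruct Hsh as [q Hq].
   assert (Hc : 0 < (1 - k) / (1 + k) * tau) by (apply Rmult_lt_0_compat; auto; pos_div).
   assert (Erot : forall x, Im (x * cis (- be)) = Im (rot x)) by (intros x; unfold rot; f_equal; ring).
   assert (Hreal : forall x, Cmod x = 1 -> rot x <> 1 -> rot x <> - (1) -> Im (rot x) <> 0).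
   { intros x Hx R1 R2 E. assert (Q := Cmod_sqr (rot x)). rewrite Cmod_rot, Hx, E in Q.
    destruct (Rle_lt_dec 0 (Re (rot x))).
    - apply R1. apply Ceq; [change (Re (RtoC 1)) with 1; nra|rewrite E; reflexivity].
    - apply R2. apply Ceq; [change (Re (RtoC (- (1)))) with (- (1)); nra|rewrite E; reflexivity]. }
   destruct (Req_dec (Cmod l) 1) as [E|E].
   + destruct (strip_arg_circle (rot l)) as [S1 S2]; auto. rewrite Cmod_rot; auto.
    destruct (Rtotal_order (Im (rot l)) 0) as [Hi|[Hi|Hi]].
    * specialize (S2 Hi). lra.
    * apply (Hreal l); auto.
    * destruct (upper_arc_goes_up _ _ _ _ _ _ _ _ _ (fun n => u (s n)) (fun n => T (u (s n))) q l l' ((1 - k) / (1 + k) * tau) ((1 + k) / (1 - k) * tau) AP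
      (fun n => Hu (s n)) (fun n => HTu (s n)) Lus E) as [Q1 Q2]; auto.
     rewrite Erot; auto. intros n; apply Hq. intros n; apply Hq.
     rewrite Erot in Q2. assert (Im (rot l') <> 0) by (apply Hreal; auto).
     destruct (strip_arg_circle (rot l')) as [S3 _]; auto. rewrite Cmod_rot; auto. rewrite S3 in Hgt by lra. lra.
   + assert (Hl : inD l) by (unfold inD; lra).
    assert (E' : Cmod l' = 1).
    { destruct (Req_dec (Cmod l') 1) as [E'|E']; auto. exfalso. apply HnU. split; auto. exists l'. assert (Hl' : inD l') by (unfold inD; lra). split; auto.
     apply (Clim_unique (fun n => Fa al (T (u (s n))))).
     - apply (Clim_cont (Fa al) (fun n => T (u (s n)))); auto. apply (holo_cont _ _ (Fa_holo al)); auto.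
     - assert (L : Clim (fun n => Fa al (u (s n)) + Ci * RtoC tau)%C (Fa al l + Ci * RtoC tau)).
      { apply Clim_plus. 2: apply Clim_const. apply (Clim_cont (Fa al) (fun n => u (s n))); auto. apply (holo_cont _ _ (Fa_holo al)); auto. }
      intros d Hd. destruct (L d Hd) as [N X]. exists N. intros n Hn. rewrite (proj2 (HT _ (HUu (s n)))). apply X; auto. }
    destruct (strip_arg_circle (rot l')) as [S1 S2]; auto. rewrite Cmod_rot; auto.
    destruct (Rtotal_order (Im (rot l')) 0) as [Hi|[Hi|Hi]].
    * destruct (lower_arc_goes_down _ _ _ _ _ _ _ _ _ (fun n => u (s n)) (fun n => T (u (s n))) q l l' ((1 - k) / (1 + k) * tau) ((1 + k) / (1 - k) * tau) AP
      (fun n => Hu (s n)) (fun n => HTu (s n)) Lus) as [Q1 Q2]; auto.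
     rewrite Erot; auto. intros n; apply Hq. intros n; apply Hq.
    * apply (Hreal l'); auto.
    * specialize (S1 Hi). lra.
  - split; auto. }
 apply Rnot_lt_le. intros Hlt. set (x := strip_arg (rot z) - strip_arg (rot (T z))) in *.
 set (Q := Rabs (Re (pole z) + Re (pole (T z))) + Rabs (4 * ln 2) + 1).
 pose proof (Rabs_pos (Re (pole z) + Re (pole (T z)))). pose proof (Rabs_pos (4 * ln 2)).
 assert (HQ : 0 < Q) by (unfold Q; lra). assert (Hx : 0 < x) by (unfold x; lra).
 specialize (Main (x / (2 * Q)) ltac:(pos_div)).
 pose proof (Rle_abs (4 * ln 2)). pose proof (Rle_abs (- (Re (pole z) + Re (pole (T z))))). rewrite Rabs_Ropp in *.
 assert (x / (2 * Q) * Q = x / 2) by (field; lra).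
 assert (0 < x / (2 * Q)) by pos_div. unfold Q in *. nra.
Qed.

(** In the variable of the shear, [slit] has an imaginary part that does not decrease upwards, so
    its derivative there has nonnegative real part. This derivative is 2 divided by the expression
    of the statement, and a reciprocal keeps the sign of the real part. *)
Theorem starlike_coordinate z : inD z -> 0 <= Re (cis be * (1 - rot z * rot z) * Fa' al z).
Proof.
 intros Hz. set (H := fun y => slit (Gf al y)).
 assert (HF : FOm al (Fa al z)) by (exists z; auto).
 assert (EG : Gf al (Fa al z) = z) by (apply Gf_Fa; auto).
 assert (HD : Cder H (Fa al z) (slit' z * / Fa' al z)).
 { assert (X := Cder_comp (Gf al) slit (Fa al z) (/ Fa' al (Gf al (Fa al z))) (slit' (Gf al (Fa al z))) (Gf_Cder al _ HF)
   (slit_holo _ (proj1 (Gf_spec al _ HF)))). rewrite EG in X. exact X. }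
 destruct (disc_re z Hz) as [R1 R2]. assert (N1 := Re_pos_neq_0 _ R1). assert (N2 := Re_pos_neq_0 _ R2). assert (N3 := Fa'_nz al z Hz).
 assert (N4 : cis be <> 0) by (apply Cmod_gt_0; rewrite Cmod_polar1; lra).
 set (l := (slit' z * / Fa' al z)%C) in *.
 assert (Hl : 0 <= Re l).
 { apply Rnot_lt_le. intros Hneg. destruct (HD (- Re l / 2)) as [d [Hd X]]; [lra|].
  destruct (FOm_open al _ HF) as [d2 [Hd2 X2]]. set (tau := Rmin d d2 / 2).
  assert (Hm : 0 < Rmin d d2) by (apply Rmin_pos; auto). pose proof (Rmin_l d d2). pose proof (Rmin_r d d2).
  assert (MCi : Cmod Ci = 1). { unfold Cmod, Ci; simpl. replace (0 * (0 * 1) + 1 * (1 * 1)) with 1 by ring. apply sqrt_1. }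
  assert (Mt : Cmod (Fa al z + Ci * RtoC tau - Fa al z) = tau).
  { replace (Fa al z + Ci * RtoC tau - Fa al z)%C with (Ci * RtoC tau)%C by ring. rewrite Cmod_mult, MCi, Cmod_R, Rabs_right; unfold tau; lra. }
  assert (I := strip_arg_increasing tau z ltac:(unfold tau; lra) Hz ltac:(apply X2; rewrite Mt; unfold tau; lra)).
  specialize (X (Fa al z + Ci * RtoC tau)%C ltac:(rewrite Mt; unfold tau; lra)). rewrite Mt in X.
  unfold H in X. rewrite EG in X. rewrite <- !slit_Im in I.
  set (g1 := slit (Gf al (Fa al z + Ci * RtoC tau))) in *.
  replace (Fa al z + Ci * RtoC tau - Fa al z)%C with (Ci * RtoC tau)%C in X by ring.
  pose proof (im_le_Cmod (g1 - slit z - l * (Ci * RtoC tau))) as Q. apply Rabs_le_between in Q.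
  replace (Im (g1 - slit z - l * (Ci * RtoC tau))) with (Im g1 - Im (slit z) - Re l * tau) in Q by C_ring.
  assert (0 < tau) by (unfold tau; lra). nra. }
 set (x := (cis be * (1 - rot z * rot z) * Fa' al z)%C).
 assert (El : l = (RtoC 2 * / x)%C).
 { unfold l, slit', x.
  assert (Ep : cis (- be) = (/ cis be)%C). { replace (cis (- be)) with ((cis (- be) * cis be) * / cis be)%C by (field; auto). rewrite polar1_inv. ring. }
  rewrite Ep. replace (1 - rot z * rot z)%C with ((1 - rot z) * (1 + rot z))%C by ring. field. auto. }
 assert (Nx : x <> 0). { unfold x. replace (1 - rot z * rot z)%C with ((1 - rot z) * (1 + rot z))%C by ring. repeat apply Cmult_neq_0; auto. }
 assert (Ex' : Re x * 2 = Re l * (Cmod x * Cmod x)).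
 { rewrite El. rewrite Cmod_sqr. apply Cmod_gt_0 in Nx. assert (S := Cmod_sqr x). assert (0 < Re x * Re x + Im x * Im x) by nra.
  destruct x as [x y]. unfold Re, Im in *; simpl in *. field. simpl. lra. }
 assert (0 <= Re l * (Cmod x * Cmod x)) by (apply Rmult_le_pos; auto; apply Rle_0_sqr). lra.
Qed.
End Monotone.
End ArgumentLift.

Theorem exists_starlike_coordinate : exists al be, forall z, inD z ->
 0 <= Re (cis be * (1 - (cis (- be) * z) * (cis (- be) * z)) * (cis al * h' z + cis (- al) * g' z)).
Proof.
 destruct argument_lift as [lam [L0 [L1 L2]]].
 destruct (antipodal_exists lam L1 L2) as [aln [al [be [b [a [pb [pa [pb0 [pa0 AP]]]]]]]]].
 exists al, be. intros z Hz. apply (starlike_coordinate lam L0 L1 L2 _ _ _ _ _ _ _ _ _ AP z Hz).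
Qed.
End ConvexQC.

(** * Harmonic measure of arcs and rearrangement *)

(* Harmonic measure at [x] of the arc [|arg| < b] of the unit circle. *)
Definition arcU (b : R) (x : C) : R := (b + Im (Clog (1 - x * cis (- b))) - Im (Clog (1 - x * cis b))) / PI.

Lemma Re_one_minus (x : C) t : Cmod x < 1 -> 0 < Re (1 - x * cis t).
Proof.
 intros Hx. pose proof (re_le_Cmod (x * cis t)) as Q. rewrite Cmod_mult, Cmod_polar1, Rmult_1_r in Q.
 apply Rabs_le_between in Q. rewrite re_minus. change (Re (RtoC 1)) with 1. lra.
Qed.

(** The expression is half of Re ((1 + y)/(1 - y)), the Poisson kernel. *)
Lemma Re_Poisson_pos (y : C) : Cmod y < 1 -> 0 < 1/2 + Re (y / (1 - y)).
Proof.
 intros Hy. assert (S := Cmod_sqr y). Cnneg y. assert (Cmod y * Cmod y < 1) by nra.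
 pose proof (re_le_Cmod y) as Q. apply Rabs_le_between in Q.
 assert (D : 0 < (1 - Re y) * (1 - Re y) + Im y * Im y) by nra.
 assert (E : Re (y / (1 - y)) = (Re y - (Re y * Re y + Im y * Im y)) / ((1 - Re y) * (1 - Re y) + Im y * Im y)).
 { destruct y as [a b]. unfold Re, Im in *; simpl in *. field. lra. }
 rewrite E. apply Rmult_lt_reg_r with ((1 - Re y) * (1 - Re y) + Im y * Im y); auto. rewrite Rmult_0_l, Rmult_plus_distr_r.
 unfold Rdiv at 2. rewrite Rmult_assoc, Rinv_l by lra. nra.
Qed.

(** The derivative is the sum of the Poisson kernels at the two ends of the arc, divided by 2 pi. *)
Lemma arcU_derive x b : Cmod x < 1 -> is_derive (fun b => arcU b x) b
 ((1 + Re (x * cis (- b) / (1 - x * cis (- b))) + Re (x * cis b / (1 - x * cis b))) / PI).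
Proof.
 intros Hx. pose proof PI_RGT_0 as HPI.
 assert (Key : forall (c : R), is_derive (fun b => Im (Clog (1 - x * cis (c * b)))) b (- c * Re (x * cis (c * b) / (1 - x * cis (c * b))))).
 { intros c. assert (R := Re_one_minus x (c * b) Hx). assert (N := Re_pos_neq_0 _ R).
  destruct (curve_Cder (fun b => 1 - x * cis (c * b))%C Clog b (- (RtoC c * Ci * (x * cis (c * b))))%C (/ (1 - x * cis (c * b)))%C) as [_ D].
  - destruct x as [x1 x2]. unfold polar, Re, Im; simpl. auto_derive; auto. ring.
  - destruct x as [x1 x2]. unfold polar, Re, Im; simpl. auto_derive; auto. ring.
  - apply Clog_Cder; auto.
  - replace (- c * Re (x * cis (c * b) / (1 - x * cis (c * b)))) with
    (Im (/ (1 - x * cis (c * b)) * - (RtoC c * Ci * (x * cis (c * b))))); auto.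
   unfold Cdiv. set (y := (x * cis (c * b))%C). set (i := (/ (1 - y))%C). C_ring. }
 assert (K1 := Key (-1)). assert (K2 := Key 1).
 replace (-1 * b) with (- b) in K1 by ring. rewrite Rmult_1_l in K2.
 assert (E : is_derive (fun b => / PI * (b + Im (Clog (1 - x * cis (-1 * b))) - Im (Clog (1 - x * cis (1 * b))))) b
  (/ PI * ((1 + - -1 * Re (x * cis (- b) / (1 - x * cis (- b)))) - - 1 * Re (x * cis b / (1 - x * cis b))))).
 { apply is_derive_scal. apply (is_derive_minus (V := R_NormedModule)); auto. apply (is_derive_plus (V := R_NormedModule)); auto. apply (is_derive_id (K := R_AbsRing)). }
 replace ((1 + Re (x * cis (- b) / (1 - x * cis (- b))) + Re (x * cis b / (1 - x * cis b))) / PI) with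
  (/ PI * ((1 + - -1 * Re (x * cis (- b) / (1 - x * cis (- b)))) - - 1 * Re (x * cis b / (1 - x * cis b)))) by (field; lra).
 eapply is_derive_ext; [|exact E]. intros t. cbv beta. replace (-1 * t) with (- t) by ring. rewrite Rmult_1_l. apply Rmult_comm.
Qed.

Lemma arcU_0 x : arcU 0 x = 0.
Proof. unfold arcU. rewrite Ropp_0. field. apply PI_neq0. Qed.

Lemma arcU_PI x : arcU PI x = 1.
Proof.
 unfold arcU. replace (cis (- PI)) with (cis PI).
 field. apply PI_neq0. unfold polar. rewrite cos_neg, sin_neg, sin_PI. f_equal; ring.
Qed.

(** By positivity of the Poisson kernel [arcU] increases with the arc, from 0 for the empty arc to 1
    for the full circle. *)
Lemma arcU_bounds x b : Cmod x < 1 -> 0 <= b <= PI -> 0 <= arcU b x <= 1.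
Proof.
 intros Hx Hb. pose proof PI_RGT_0 as HPI.
 assert (Hinc : forall s t, s <= t -> arcU s x <= arcU t x).
 { intros s t [Hst| ->]; [|lra]. left.
  apply (incr_function (fun b => arcU b x) m_infty p_infty (fun b => ((1 + Re (x * cis (- b) / (1 - x * cis (- b))) + Re (x * cis b / (1 - x * cis b))) / PI))); try exact I; try exact Hst.
  - intros y _ _. apply arcU_derive; auto.
  - intros y _ _. apply Rdiv_lt_0_compat; auto.
   assert (A : forall t, Cmod (x * cis t) < 1) by (intros u; rewrite Cmod_mult, Cmod_polar1, Rmult_1_r; auto).
   pose proof (Re_Poisson_pos _ (A (- y))). pose proof (Re_Poisson_pos _ (A y)). lra. }
 split. rewrite <- (arcU_0 x). apply Hinc; lra. rewrite <- (arcU_PI x). apply Hinc; lra.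
Qed.

(** 1 - e^(i psi) = -2 i sin(psi/2) e^(i psi/2), and the sine is negative on this range. *)
Lemma Clog_chord_arg psi : - (2 * PI) < psi < 0 -> Im (Clog (1 - cis psi)) = psi / 2 + PI / 2.
Proof.
 intros Hp. set (s := psi / 2). assert (Es : psi = 2 * s) by (unfold s; field).
 assert (Hs : sin s < 0). { replace s with (- (- s)) by ring. rewrite sin_neg. assert (0 < sin (- s)) by (apply sin_gt_0; lra). lra. }
 unfold Clog, polar, Re, Im; simpl. rewrite Es, sin_2a, cos_2a_sin.
 replace ((0 + - (1 * (2 * sin s * cos s))) / (1 + - (1 * (1 - 2 * sin s * sin s)))) with (tan (s + PI / 2)).
 apply atan_tan. lra. unfold tan. rewrite sin_plus, cos_plus, sin_PI2, cos_PI2. field. split; nra.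
Qed.

Lemma arcU_circle l b : Cmod l = 1 -> 0 < b < PI -> cos b < Re l -> arcU b l = 1 /\ (l * cis (- b))%C <> 1 /\ (l * cis b)%C <> 1.
Proof.
 intros Hl Hb Hc. pose proof PI_RGT_0 as HPI. destruct (exists_arg_from l (- PI)) as [t [Ht Htb]].
 assert (El : l = cis t) by (unfold isarg in Ht; rewrite Hl in Ht; auto).
 assert (Hcos : cos b < cos t) by (rewrite El in Hc; unfold polar, Re in Hc; simpl in Hc; lra).
 assert (Htb2 : - b < t < b).
 { assert (Rabs t < b). { apply Rnot_le_lt. intros H. assert (cos (Rabs t) <= cos b).
   { apply cos_decr_1; try lra. unfold Rabs; destruct (Rcase_abs t); lra. }
   replace (cos (Rabs t)) with (cos t) in H0. lra. unfold Rabs; destruct (Rcase_abs t); auto. rewrite cos_neg; auto. }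
  apply Rabs_def2 in H. lra. }
 assert (E1 : (l * cis (- b) = cis (t - b))%C) by (rewrite El, polar_mult; f_equal; ring).
 assert (E2 : (l * cis b = cis (t + b - 2 * PI))%C).
 { rewrite El, polar_mult, <- (polar_plus_2PI (t + b - 2 * PI)). f_equal; ring. }
 assert (Hne : forall u, - (2 * PI) < u < 0 -> cis u <> 1).
 { intros u Hu E. assert (X := Clog_chord_arg u Hu). rewrite E in X. replace (1 - 1)%C with (RtoC 0) in X by ring.
  assert (sin u = 0). { apply (f_equal Im) in E. unfold polar, Im in E; simpl in E. lra. }
  assert (cos u = 1). { apply (f_equal Re) in E. unfold polar, Re in E; simpl in E. lra. }
  assert (sin (u / 2) = 0). { assert (cos u = 1 - 2 * sin (u / 2) * sin (u / 2)). { replace u with (2 * (u / 2)) at 1 by field. apply cos_2a_sin. } nra. }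
  assert (0 < sin (- (u / 2))) by (apply sin_gt_0; lra). rewrite sin_neg in H2. lra. }
 rewrite E1, E2. split; [|split; apply Hne; lra].
 unfold arcU. rewrite E1, E2, !Clog_chord_arg by lra. field. lra.
Qed.

Lemma Re_one_minus_circle (y : C) : Cmod y = 1 -> y <> 1 -> 0 < Re (1 - y).
Proof.
 intros Hy Hne. assert (S := Cmod_sqr y). rewrite Hy in S. rewrite re_minus. change (Re (RtoC 1)) with 1.
 destruct (Rlt_le_dec (Re y) 1); [lra|]. exfalso. apply Hne. apply Ceq; simpl. nra. unfold Im at 1; simpl. fold (Im y). nra.
Qed.

Lemma arcU_Clim (x : nat -> C) l b : Clim x l -> Cmod l = 1 -> 0 < b < PI -> cos b < Re l -> Un_cv (fun n => arcU b (x n)) 1.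
Proof.
 intros Hx Hl Hb Hc. destruct (arcU_circle l b Hl Hb Hc) as [E [N1 N2]].
 assert (L : forall t, (l * cis t)%C <> 1 -> Un_cv (fun n => Im (Clog (1 - x n * cis t))) (Im (Clog (1 - l * cis t)))).
 { intros t Ht. apply Clim_Im. apply (Clim_cont Clog (fun n => 1 - x n * cis t)%C).
  - apply Clog_cont, Re_one_minus_circle; auto. rewrite Cmod_mult, Cmod_polar1; lra.
  - intros e He. destruct (Hx e He) as [N X]. exists N. intros n Hn. specialize (X n Hn).
   replace (1 - x n * cis t - (1 - l * cis t))%C with (- ((x n - l) * cis t))%C by ring.
   rewrite Cmod_opp, Cmod_mult, Cmod_polar1. lra. }
 rewrite <- E. unfold arcU, Rdiv. apply CV_mult; [|apply Un_cv_const].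
 apply CV_minus; auto. apply CV_plus; auto. apply Un_cv_const.
Qed.

Definition arcUhol (b : R) (x : C) : C :=
 (RtoC (b / PI) + - (RtoC (/ PI) * Ci) * (Clog (1 - x * cis (- b)) - Clog (1 - x * cis b)))%C.

Lemma arcUhol_Re b x : Re (arcUhol b x) = arcU b x.
Proof.
 unfold arcUhol, arcU. set (u := Clog (1 - x * cis (- b))). set (v := Clog (1 - x * cis b)).
 unfold Re, Im; simpl. field. apply PI_neq0.
Qed.

Lemma arcUhol_Cder b x : Cmod x < 1 -> exists l, Cder (arcUhol b) x l.
Proof.
 intros Hx. pose proof (Re_one_minus x (- b) Hx). pose proof (Re_one_minus x b Hx).
 assert (A : forall t, Cder (fun x => Clog (1 - x * cis t)) x (/ (1 - x * cis t) * (0 - (1 * cis t + x * 0)))).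
 { intros t. apply (Cder_comp (fun x => 1 - x * cis t)%C Clog). 2: apply Clog_Cder, Re_one_minus; auto.
  apply Cder_minus. apply Cder_const. apply Cder_mult. apply Cder_id. apply Cder_const. }
 eexists. apply Cder_plus. apply Cder_const. apply Cder_scal. apply Cder_minus; apply A.
Qed.

Lemma arcUhol_holo b : exists D, holo (arcUhol b) D.
Proof.
 destruct (choice (fun x l => Cmod x < 1 -> Cder (arcUhol b) x l)) as [D HD].
 - intros x. destruct (Rlt_le_dec (Cmod x) 1) as [H|H].
  + destruct (arcUhol_Cder b x H) as [l Hl]. exists l; auto.
  + exists 0. intros; lra.
 - exists D. exact HD.
Qed.

(** As X fixes 0, the mean over a circle is the harmonic measure b/pi of the arc seen from 0,
    whatever X is. This independence is what makes subordination compatible with rearrangement. *)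
Lemma arcU_mean (X X' : C -> C) b r d : 0 < r < d -> (forall w, Cmod w < d -> Cder X w (X' w) /\ Cmod (X w) < 1) -> X 0 = 0 ->
 RInt (fun t => arcU b (X (polar r t))) 0 (2 * PI) = 2 * b.
Proof.
 intros Hr HX X0. destruct (arcUhol_holo b) as [D HD].
 assert (Q := mean_value_local (fun w => arcUhol b (X w)) (fun w => (D (X w) * X' w)%C) 0 d r).
 assert (Q2 := Q ltac:(intros w Hw; replace (w - 0)%C with w in Hw by ring; apply Cder_comp; [apply HX; auto|apply HD, HX; auto]) Hr).
 cbv beta in Q2. rewrite X0 in Q2. apply (f_equal Re) in Q2.
 replace (Re (RtoC (2 * PI) * arcUhol b 0)) with (2 * b) in Q2.
 - rewrite <- Q2. unfold CInt, Re at 1; simpl. apply RInt_ext. intros t _. rewrite <- arcUhol_Re, Cplus_0_l. reflexivity.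
 - replace (Re (RtoC (2 * PI) * arcUhol b 0)) with (2 * PI * Re (arcUhol b 0)) by C_ring.
  rewrite arcUhol_Re. unfold arcU. replace (0 * cis (- b))%C with (RtoC 0) by ring. replace (0 * cis b)%C with (RtoC 0) by ring.
  field. apply PI_neq0.
Qed.

Lemma Re_polar r t : Re (polar r t) = r * cos t.
Proof. reflexivity. Qed.

Lemma ex_RInt_cont (u : R -> R) a b : (forall t, continuous u t) -> ex_RInt u a b.
Proof. intros H. apply ex_RInt_continuous_R. intros; auto. Qed.

Lemma Rsum_le u v n : (forall i, (i < n)%nat -> u i <= v i) -> Rsum u n <= Rsum v n.
Proof.
 induction n; intros H; cbn [Rsum]. lra. assert (Rsum u n <= Rsum v n) by (apply IHn; auto). specialize (H n ltac:(lia)). lra.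
Qed.

Lemma Rsum_ext u v n : (forall i, (i < n)%nat -> u i = v i) -> Rsum u n = Rsum v n.
Proof. intros H. apply Rle_antisym; apply Rsum_le; intros i Hi; rewrite H; auto; lra. Qed.

Lemma Rsum_scal c u n : Rsum (fun i => c * u i) n = c * Rsum u n.
Proof. induction n; cbn [Rsum]. ring. rewrite IHn. ring. Qed.

Lemma Rsum_plus u v n : Rsum (fun i => u i + v i) n = Rsum u n + Rsum v n.
Proof. induction n; cbn [Rsum]. ring. rewrite IHn. ring. Qed.

Lemma RInt_Rsum (u : nat -> R -> R) n a b : (forall i t, continuous (u i) t) ->
 RInt (fun t => Rsum (fun i => u i t) n) a b = Rsum (fun i => RInt (u i) a b) n.
Proof.
 intros H. induction n; cbn [Rsum].
 - rewrite RInt_const. unfold scal; simpl. unfold mult; simpl. ring.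
 - rewrite RInt_plus_R, IHn; auto. apply ex_RInt_cont. intros t. apply (Rsum_continuous (fun i s => u i s)). auto. apply ex_RInt_cont; auto.
Qed.

Lemma Rsum_telescope (f : nat -> R) i0 n : (i0 <= n)%nat ->
 Rsum (fun i => if (i0 <=? i)%nat then f i - f (S i) else 0) n = f i0 - f n.
Proof.
 induction n; intros Hi; cbn [Rsum].
 - replace i0 with 0%nat by lia. ring.
 - destruct (Nat.leb_spec i0 n).
  + rewrite IHn by auto. ring.
  + replace i0 with (S n) by lia. rewrite (Rsum_ext _ (fun _ => 0)).
   * replace (Rsum (fun _ => 0) n) with 0. ring. clear. induction n; cbn [Rsum]; lra.
   * intros i Hin. destruct (Nat.leb_spec (S n) i); auto. lia.
Qed.

(** The coefficient of G j collects the drops f i - f (i+1) for i >= j, which add up to f j because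
    f N = 0; the minimum encodes the truncation at m. *)
Lemma Rsum_by_parts (f G : nat -> R) N m : (m <= N)%nat -> f N = 0 ->
 Rsum (fun i => (f i - f (S i)) * Rsum G (Nat.min m (S i))) N = Rsum (fun i => f i * G i) m.
Proof.
 intros Hm HN. induction m; cbn [Rsum].
 - rewrite (Rsum_ext _ (fun i => 0 * f i)). rewrite Rsum_scal. ring. intros i _. simpl. ring.
 - rewrite <- IHm by lia. replace (f m * G m) with (G m * (f m - f N)) by (rewrite HN; ring).
  rewrite <- (Rsum_telescope f m N) by lia. rewrite <- Rsum_scal, <- Rsum_plus. apply Rsum_ext. intros i Hi.
  destruct (Nat.leb_spec m i).
  + replace (Nat.min (S m) (S i)) with (S m) by lia. replace (Nat.min m (S i)) with m by lia. cbn [Rsum]. ring.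
  + replace (Nat.min (S m) (S i)) with (S i) by lia. replace (Nat.min m (S i)) with (S i) by lia. ring.
Qed.

(** Majorisation of [Phi] by a decreasing step function [f] on N equal steps. [U s] plays the
    indicator of a set occupying the share s/N of the circle, but may take any values in [0,1]. *)
Record dominated (N : nat) (Phi : R -> R) (f : nat -> R) (U : nat -> R -> R) : Prop := {
 dom_cont : forall t, continuous Phi t;
 dom_pos : forall t, 0 <= Phi t;
 dom_end : f N = 0;
 dom_decr : forall i, (i < N)%nat -> f (S i) <= f i;
 dom_Ucont : forall s t, continuous (U s) t;
 dom_Ubd : forall s t, (s <= N)%nat -> 0 <= U s t <= 1;
 dom_Uint : forall s, (s <= N)%nat -> RInt (U s) 0 (2 * PI) = 2 * PI * (INR s / INR N);
 dom_le : forall t, Phi t <= Rsum (fun i => (f i - f (S i)) * U (S i) t) N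
}.

Definition prod_fun (l : list ((R -> R) * (nat -> R))) (t : R) : R := fold_right (fun q x => fst q t * x) 1 l.
Definition prod_seq (l : list ((R -> R) * (nat -> R))) (i : nat) : R := fold_right (fun q x => snd q i * x) 1 l.

(** A Hardy-Littlewood inequality for several factors, by induction on the list. The weight W is
    what makes the induction work: after expansion of the leading factor, each U (i+1) is absorbed
    into the weight, whose mass becomes at most the share min(m, i+1)/N of the circle, and summation
    by parts reassembles the product of the step functions. *)
Theorem rearrangement N l : (1 <= N)%nat -> List.Forall (fun q => exists U, dominated N (fst q) (snd q) U) l ->
 (forall t, continuous (prod_fun l) t) /\ (forall t, 0 <= prod_fun l t) /\
 forall W m, (m <= N)%nat -> (forall t, continuous W t) -> (forall t, 0 <= W t <= 1) ->
  RInt W 0 (2 * PI) <= 2 * PI * (INR m / INR N) ->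
  RInt (fun t => W t * prod_fun l t) 0 (2 * PI) <= 2 * PI / INR N * Rsum (prod_seq l) m.
Proof.
 intros HN Hl. pose proof PI_RGT_0 as HPI. assert (HN0 : 0 < INR N) by (apply lt_0_INR; lia).
 induction Hl as [|[Phi f] l [U [D1 D2 D3 D4 D5 D6 D7 D8]] Hl IH]; cbn [fst snd] in *.
 - unfold prod_fun, prod_seq; simpl. split; [|split].
  + intros t. apply continuous_const.
  + intros; lra.
  + intros W m Hm Wc Wb Wi. rewrite (RInt_ext _ W) by (intros; apply Rmult_1_r).
   replace (Rsum (fun _ => 1) m) with (INR m). replace (2 * PI / INR N * INR m) with (2 * PI * (INR m / INR N)) by (field; lra). auto.
   clear. induction m. reflexivity. rewrite S_INR. cbn [Rsum]. lra.
 - destruct IH as [C1 [C2 C3]]. change (prod_fun ((Phi, f) :: l)) with (fun t => Phi t * prod_fun l t).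
  change (prod_seq ((Phi, f) :: l)) with (fun i => f i * prod_seq l i).
  set (G := prod_fun l) in *. set (g := prod_seq l) in *. split; [|split].
  + intros t. apply (continuous_Rmult Phi); auto.
  + intros t. apply Rmult_le_pos; auto.
  + intros W m Hm Wc Wb Wi.
   assert (Hc : forall i t, continuous (fun t => (f i - f (S i)) * (W t * U (S i) t * G t)) t).
   { intros i t. apply (continuous_Rmult (fun _ => f i - f (S i))). apply continuous_const.
    apply (continuous_Rmult (fun t => W t * U (S i) t)); auto. apply (continuous_Rmult W); auto. }
   apply Rle_trans with (RInt (fun t => Rsum (fun i => (f i - f (S i)) * (W t * U (S i) t * G t)) N) 0 (2 * PI)).
   * apply RInt_le. lra.
    { apply ex_RInt_cont. intros t. apply (continuous_Rmult W); auto. apply (continuous_Rmult Phi); auto. }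
    { apply ex_RInt_cont. intros t. apply (Rsum_continuous (fun i s => (f i - f (S i)) * (W s * U (S i) s * G s))). intros; apply Hc. }
    intros t _. rewrite (Rsum_ext _ (fun i => (W t * G t) * ((f i - f (S i)) * U (S i) t))) by (intros; ring).
    rewrite Rsum_scal. replace (W t * (Phi t * G t)) with (W t * G t * Phi t) by ring. apply Rmult_le_compat_l; auto.
    apply Rmult_le_pos; auto. apply Wb.
   * rewrite (RInt_Rsum (fun i t => (f i - f (S i)) * (W t * U (S i) t * G t)) N) by apply Hc.
    rewrite <- (Rsum_by_parts f g N m Hm D3), <- Rsum_scal. apply Rsum_le. intros i Hi.
    assert (Wc' : forall t, continuous (fun t => W t * U (S i) t) t) by (intros t; apply (continuous_Rmult W); auto).
    assert (Wb' : forall t, 0 <= W t * U (S i) t <= 1) by (intros t; specialize (Wb t); specialize (D6 (S i) t ltac:(lia)); nra).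
    rewrite RInt_scal_R.
    2:{ apply ex_RInt_cont. intros t. apply (continuous_Rmult (fun t => W t * U (S i) t)); auto. }
    replace (2 * PI / INR N * ((f i - f (S i)) * Rsum g (Nat.min m (S i)))) with ((f i - f (S i)) * (2 * PI / INR N * Rsum g (Nat.min m (S i)))) by ring.
    apply Rmult_le_compat_l. specialize (D4 i Hi). lra.
    apply (C3 (fun t => W t * U (S i) t)); auto. lia.
    destruct (Nat.min_spec m (S i)) as [[_ ->]|[_ ->]].
    { eapply Rle_trans; [|exact Wi]. apply RInt_le. lra. apply ex_RInt_cont; auto. apply ex_RInt_cont; auto.
     intros t _. specialize (Wb t). specialize (D6 (S i) t ltac:(lia)). nra. }
    { rewrite <- (D7 (S i)) by lia. apply RInt_le. lra. apply ex_RInt_cont; auto. apply ex_RInt_cont; auto.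
     intros t _. specialize (Wb t). specialize (D6 (S i) t ltac:(lia)). nra. }
Qed.

(** * Majorants by harmonic measures and subordination *)

Definition circle_monotone (L : C -> C) : Prop := forall z w, inD z -> inD w -> Cmod z = Cmod w -> Re z <= Re w -> Re (L z) <= Re (L w).

(** On the i-th of N equal arcs of the upper half-circle, the value at the end nearest to the
    positive axis, where exp(p Re L) is largest. The value 0 at index N lets the drops telescope. *)
Definition arc_values (L : C -> C) (p rho : R) (N i : nat) : R :=
 if (i <? N)%nat then exp (p * Re (L (polar rho (PI * INR i / INR N)))) else 0.

Lemma grid_bounds N i : (1 <= N)%nat -> (i <= N)%nat -> 0 <= PI * INR i / INR N <= PI.
Proof.
 intros HN Hi. pose proof PI_RGT_0. assert (0 < INR N) by (apply lt_0_INR; lia). pose proof (pos_INR i). apply le_INR in Hi.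
 replace (PI * INR i / INR N) with (PI * (INR i / INR N)) by (field; lra).
 assert (0 <= INR i / INR N <= 1); [|nra]. split. apply Rmult_le_pos; auto. apply Rlt_le, Rinv_0_lt_compat; auto.
 apply Rmult_le_reg_r with (INR N); auto. unfold Rdiv. rewrite Rmult_assoc, Rinv_l; lra.
Qed.

Lemma grid_lt N i j : (1 <= N)%nat -> (i < j)%nat -> PI * INR i / INR N < PI * INR j / INR N.
Proof.
 intros HN Hij. pose proof PI_RGT_0. assert (0 < / INR N) by (apply Rinv_0_lt_compat, lt_0_INR; lia). apply lt_INR in Hij.
 unfold Rdiv. apply Rmult_lt_compat_r; auto. apply Rmult_lt_compat_l; lra.
Qed.

Lemma grid_end N : (1 <= N)%nat -> PI * INR N / INR N = PI.
Proof. intros HN. field. apply not_0_INR. lia. Qed.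

Lemma arc_values_end L p rho N : arc_values L p rho N N = 0.
Proof. unfold arc_values. destruct (Nat.ltb_spec N N); [lia|reflexivity]. Qed.

Lemma arc_values_decr L p rho N i : circle_monotone L -> 0 < p -> 0 < rho < 1 -> (i < N)%nat ->
 arc_values L p rho N (S i) <= arc_values L p rho N i.
Proof.
 intros Hmono Hp Hrho Hi. unfold arc_values. destruct (Nat.ltb_spec i N); [|lia].
 destruct (Nat.ltb_spec (S i) N); [|apply Rlt_le, exp_pos].
 assert (Q : Re (L (polar rho (PI * INR (S i) / INR N))) <= Re (L (polar rho (PI * INR i / INR N)))).
 { apply Hmono; try (unfold inD; rewrite Cmod_polar; lra). rewrite !Cmod_polar; lra. rewrite !Re_polar. apply Rmult_le_compat_l. lra.
  pose proof (grid_bounds N i ltac:(lia) ltac:(lia)). pose proof (grid_bounds N (S i) ltac:(lia) ltac:(lia)).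
  pose proof (grid_lt N i (S i) ltac:(lia) ltac:(lia)). apply cos_decr_1; lra. }
 assert (Q2 : p * Re (L (polar rho (PI * INR (S i) / INR N))) <= p * Re (L (polar rho (PI * INR i / INR N)))) by nra.
 destruct Q2 as [E|E]. left; apply exp_increasing; auto. rewrite E; lra.
Qed.

Lemma submean_plus u v z d : 0 < d -> (forall w, Cmod (w - z) < d -> Vcont u w /\ Vcont v w) -> submean u z -> submean v z ->
 submean (fun w => u w + v w) z.
Proof.
 intros Hd Hc [d1 [Hd1 X1]] [d2 [Hd2 X2]]. exists (Rmin d (Rmin d1 d2)). split. repeat apply Rmin_pos; auto.
 intros r Hr. pose proof (Rmin_l d (Rmin d1 d2)). pose proof (Rmin_r d (Rmin d1 d2)). pose proof (Rmin_l d1 d2). pose proof (Rmin_r d1 d2).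
 specialize (X1 r ltac:(lra)). specialize (X2 r ltac:(lra)).
 assert (Hcv : forall t, curve (fun t => z + polar r t)%C t) by (intros t; apply curve_plus; [apply curve_const|apply polar_curve]).
 assert (Hin : forall t, Cmod (z + polar r t - z) < d).
 { intros t. replace (z + polar r t - z)%C with (polar r t) by ring. rewrite Cmod_polar; lra. }
 rewrite RInt_plus_R. lra.
 - apply ex_RInt_cont. intros t. apply (Vcont_curve u (fun t => z + polar r t)%C); auto. apply Hc; auto.
 - apply ex_RInt_cont. intros t. apply (Vcont_curve v (fun t => z + polar r t)%C); auto. apply Hc; auto.
Qed.

Lemma arc_combination (c b : nat -> R) n : exists H H', holo H H' /\ forall x, Re (H x) = - Rsum (fun i => c i * arcU (b i) x) n.
Proof.
 induction n as [|n [H [H' [HH E]]]].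
 - exists (fun _ => 0), (fun _ => 0). split. intros z _. apply Cder_const. intros x. simpl. ring.
 - destruct (arcUhol_holo (b n)) as [D HD].
  exists (fun x => H x + RtoC (- c n) * arcUhol (b n) x)%C, (fun x => H' x + RtoC (- c n) * D x)%C. split.
  + intros z Hz. apply Cder_plus; auto. apply Cder_scal; auto.
  + intros x. cbn [Rsum]. replace (Re (H x + RtoC (- c n) * arcUhol (b n) x)) with (Re (H x) + - c n * Re (arcUhol (b n) x))
    by C_ring. rewrite E, arcUhol_Re. ring.
Qed.

Lemma grid_floor (b phi : R) n : 0 <= phi -> exists i, (i <= n)%nat /\ INR i * b <= phi /\ (phi < INR (S i) * b \/ i = n).
Proof.
 intros Hp. induction n as [|n [i [Hi [H1 H2]]]].
 - exists 0%nat. simpl. split; auto. split. lra. auto.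
 - destruct H2 as [H2|H2].
  + exists i. auto.
  + destruct (Rlt_le_dec phi (INR (S n) * b)). exists i. rewrite H2 in *. auto. exists (S n). auto.
Qed.

Lemma Un_cv_Rsum (u : nat -> nat -> R) (l : nat -> R) n : (forall i, (i < n)%nat -> Un_cv (u i) (l i)) ->
 Un_cv (fun m => Rsum (fun i => u i m) n) (Rsum l n).
Proof.
 induction n; intros H; cbn [Rsum]. apply Un_cv_const. apply CV_plus; auto.
Qed.

(** The left side is the squared modulus of exp(p L(rho x)/2), while the right side is harmonic with
    the step function as boundary values, which dominates because of the monotonicity on circles.
    The maximum principle carries the inequality inside. *)
Lemma arc_majorant (L L' : C -> C) p rho N x : holo L L' -> circle_monotone L -> 0 < p -> 0 < rho < 1 -> (1 <= N)%nat -> inD x ->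
 exp (p * Re (L (RtoC rho * x)%C)) <=
  Rsum (fun i => (arc_values L p rho N i - arc_values L p rho N (S i)) * arcU (PI * INR (S i) / INR N) x) N.
Proof.
 intros HL Hmono Hp Hrho HN Hx. pose proof PI_RGT_0 as HPI. assert (HN0 : 0 < INR N) by (apply lt_0_INR; lia).
 set (f := arc_values L p rho N). set (c := fun i => f i - f (S i)). set (b := fun i => PI * INR (S i) / INR N).
 set (F := fun z => exp (p * Re (L z))).
 assert (Hb : forall i, (i < N)%nat -> 0 < b i <= PI).
 { intros i Hi. unfold b. pose proof (grid_bounds N (S i) HN Hi). pose proof (grid_lt N 0 (S i) HN ltac:(lia)).
  replace (PI * INR 0 / INR N) with 0 in * by (simpl; field; lra). lra. }
 assert (Hgrid : forall i, (i < N)%nat -> 0 <= PI * INR i / INR N < PI).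
 { intros i Hi. pose proof (grid_bounds N i HN ltac:(lia)). pose proof (grid_lt N i N HN Hi). rewrite grid_end in *; auto. lra. }
 assert (Hexp : forall z w, inD z -> inD w -> Cmod z = Cmod w -> Re z <= Re w -> F z <= F w).
 { intros z w Hz Hw E1 E2. specialize (Hmono z w Hz Hw E1 E2). unfold F. assert (Hle : p * Re (L z) <= p * Re (L w)) by nra.
  destruct Hle as [H|H]. left; apply exp_increasing; auto. rewrite H; lra. }
 assert (HpD : forall t, inD (polar rho t)) by (intros t; unfold inD; rewrite Cmod_polar; lra).
 assert (Hfval : forall i, (i < N)%nat -> f i = F (polar rho (PI * INR i / INR N))).
 { intros i Hi. unfold f, arc_values. destruct (Nat.ltb_spec i N); [reflexivity|lia]. }
 assert (HfN : f N = 0) by apply arc_values_end.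
 assert (Hc : forall i, (i < N)%nat -> 0 <= c i).
 { intros i Hi. unfold c, f. pose proof (arc_values_decr L p rho N i Hmono Hp Hrho Hi). lra. }
 destruct (arc_combination c b N) as [H [H' [HH HE]]].
 set (G := fun x => Cexp (RtoC (p / 2) * L (RtoC rho * x)%C)). set (Gd := fun x => (Cexp (RtoC (p / 2) * L (RtoC rho * x)%C) * (RtoC (p / 2) * (L' (RtoC rho * x)%C * (RtoC rho * 1))))%C).
 assert (HrD : forall y, Cmod y <= 1 -> inD (RtoC rho * y)).
 { intros y Hy. unfold inD. rewrite Cmod_scal by lra. Cnneg y. nra. }
 assert (HG : holo G Gd).
 { intros y Hy. unfold G, Gd. apply (Cder_comp (fun x => RtoC (p / 2) * L (RtoC rho * x)%C)%C Cexp). 2: apply Cexp_Cder.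
  apply Cder_scal. apply (Cder_comp (fun x => RtoC rho * x)%C L). apply Cder_scal, Cder_id. apply HL, HrD. unfold inD in Hy; lra. }
 assert (HGF : forall y, Cmod (G y) * Cmod (G y) = F (RtoC rho * y)%C).
 { intros y. unfold G, F. rewrite Cmod_Cexp, <- exp_plus. f_equal.
  replace (Re (RtoC (p / 2) * L (RtoC rho * y)%C)) with (p / 2 * Re (L (RtoC rho * y)%C)) by C_ring. field. }
 set (v := fun y => Cmod (G y) * Cmod (G y) + Re (H y)).
 assert (HV : forall y, inD y -> Vcont (fun y => Cmod (G y) * Cmod (G y)) y /\ Vcont (fun y => Re (H y)) y).
 { intros y Hy. split. apply Vcont_mult; apply Vcont_Cmod, (holo_cont _ _ HG); auto. apply Vcont_Re, (holo_cont _ _ HH); auto. }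
 assert (Hv : v x <= 0).
 { apply (maximum_principle inD v 0); auto.
  - apply inD_open.
  - intros z Hz. apply Rlt_le, Hz.
  - intros z Hz. destruct (HV z Hz) as [V1 V2]. intros e He. destruct (V1 (e / 2)) as [d1 [Hd1 X1]]; [lra|]. destruct (V2 (e / 2)) as [d2 [Hd2 X2]]; [lra|].
   exists (Rmin d1 d2). split. apply Rmin_pos; auto. intros w Hw. pose proof (Rmin_l d1 d2). pose proof (Rmin_r d1 d2).
   specialize (X1 w ltac:(lra)). specialize (X2 w ltac:(lra)). unfold v. apply Rabs_def2 in X1, X2. apply Rabs_def1; lra.
  - intros z Hz. destruct (inD_open z Hz) as [d [Hd X]]. apply (submean_plus _ _ z d); auto.
   + apply (submean_Cmod2 G Gd z d); [exact Hd|]. intros w Hw. apply HG, X, Hw.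
   + apply (submean_Re H H' z d); [exact Hd|]. intros w Hw. apply HH, X, Hw.
  - intros u l M' HM Hu Lu Hl HMn.
   assert (Ml : Cmod l = 1).
   { assert (Cmod l <= 1). { apply (Un_cv_le _ _ _ _ (Clim_Cmod _ _ Lu) (Un_cv_const 1)). exists 0%nat. intros n _. apply Rlt_le, Hu. } unfold inD in Hl. lra. }
   set (phi := acos (Re l)).
   assert (Rl : -1 <= Re l <= 1). { pose proof (re_le_Cmod l) as Q. rewrite Ml in Q. apply Rabs_le_between in Q. lra. }
   assert (Hphi : 0 <= phi <= PI) by apply acos_bound. assert (Ecos : cos phi = Re l) by (apply cos_acos; lra).
   (* [i0] is the index of the step containing the angle of l. The harmonic measures with i >= i0
      tend to 1, and the remaining terms are nonnegative and may be dropped. Index N - 1 corresponds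
      to the full circle and is treated apart. *)
   destruct (grid_floor (PI / INR N) phi (N - 1)) as [i0 [Hi0 [H1 H2]]]; [lra|].
   assert (Hi0N : (i0 < N)%nat) by lia.
   set (V := fun i m => if (i0 <=? i)%nat then c i * arcU (b i) (u m) else 0).
   assert (LV : Un_cv (fun m => Rsum (fun i => V i m) N) (f i0)).
   { replace (f i0) with (f i0 - f N) by (rewrite HfN; ring). rewrite <- (Rsum_telescope f i0 N) by lia.
    apply Un_cv_Rsum. intros i Hi. unfold V. destruct (Nat.leb_spec i0 i) as [Hii|Hii]; [|apply Un_cv_const].
    assert (LU : Un_cv (fun m => arcU (b i) (u m)) 1).
    2:{ assert (Q := CV_mult _ _ _ _ (Un_cv_const (c i)) LU). rewrite Rmult_1_r in Q. exact Q. }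
    destruct (Nat.eq_dec (S i) N) as [E|E].
    - assert (Eb : b i = PI) by (unfold b; rewrite E; field; lra). rewrite Eb. intros e He. exists 0%nat. intros m _. rewrite arcU_PI.
     unfold Rdist. rewrite Rminus_diag, Rabs_R0. auto.
    - pose proof (Hb i Hi). assert (b i < PI) by (unfold b; apply (Hgrid (S i)); lia).
     apply (arcU_Clim u l); auto. lra. rewrite <- Ecos. apply cos_decreasing_1; try lra.
     destruct H2 as [H2|H2]; [|lia]. eapply Rlt_le_trans; [exact H2|]. unfold b.
     replace (PI * INR (S i) / INR N) with (INR (S i) * (PI / INR N)) by (field; lra).
     apply Rmult_le_compat_r. apply Rlt_le, Rdiv_lt_0_compat; lra. apply le_INR; lia. }
   assert (HCL : Ccont (fun y => L (RtoC rho * y)%C) l).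
   { apply (Ccont_comp (fun y => RtoC rho * y)%C L). apply Ccont_mult; [apply Ccont_const|apply Ccont_id]. apply (holo_cont _ _ HL), HrD. lra. }
   assert (HCG : Ccont G l).
   { unfold G. apply (Ccont_comp (fun x => RtoC (p / 2) * L (RtoC rho * x)%C)%C Cexp). apply Ccont_mult; auto. apply Ccont_const. apply (Cder_cont _ _ _ (Cexp_Cder _)). }
   assert (LG : Un_cv (fun m => Cmod (G (u m)) * Cmod (G (u m))) (F (RtoC rho * l)%C)).
   { rewrite <- HGF. apply CV_mult; apply Clim_Cmod, (Clim_cont G); auto. }
   assert (Hbound : M' <= F (RtoC rho * l)%C - f i0).
   { apply (Un_cv_le _ _ _ _ (Un_cv_const M') (CV_minus _ _ _ _ LG LV)). exists 0%nat. intros m _. specialize (HMn m). unfold v in HMn. rewrite HE in HMn.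
    assert (Rsum (fun i => V i m) N <= Rsum (fun i => c i * arcU (b i) (u m)) N); [|lra].
    apply Rsum_le. intros i Hi. unfold V. destruct (i0 <=? i)%nat; [lra|]. apply Rmult_le_pos; auto. apply arcU_bounds. apply Hu.
    pose proof (Hb i Hi). lra. }
   assert (F (RtoC rho * l)%C <= f i0); [|lra].
   rewrite Hfval by auto. apply Hexp. apply HrD; lra. apply HpD.
   rewrite Cmod_mult, Cmod_R, Rabs_right, Ml, Cmod_polar by lra. ring.
   replace (Re (RtoC rho * l)) with (rho * Re l) by C_ring.
   rewrite Re_polar, <- Ecos. apply Rmult_le_compat_l. lra. pose proof (Hgrid i0 Hi0N).
   apply cos_decr_1; lra. }
 unfold v in Hv. rewrite HGF, HE in Hv. unfold F in Hv. fold (c 0%nat). unfold c, b in Hv. lra.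
Qed.

(** sg = rho X, where X maps |w| < rho into the unit disc and fixes 0. Composing the majorant of
    [arc_majorant] with X keeps the means of the harmonic measures. The gap r < rho < 1 avoids the
    singularities of L on the unit circle. *)
Lemma Schwarz_dominated (L L' sg sg' : C -> C) p r rho N : holo L L' -> circle_monotone L -> 0 < p -> 0 < r < rho -> rho < 1 -> (1 <= N)%nat ->
 holo sg sg' -> (forall z, inD z -> Cmod (sg z) <= Cmod z) ->
 exists U, dominated N (fun t => exp (p * Re (L (sg (polar r t))))) (arc_values L p rho N) U.
Proof.
 intros HL Hmono Hp Hr Hrho HN Hsg Hle. pose proof PI_RGT_0 as HPI. assert (HN0 : 0 < INR N) by (apply lt_0_INR; lia).
 set (X := fun w => (RtoC (/ rho) * sg w)%C).
 assert (HX : forall w, Cmod w < rho -> Cmod (X w) < 1).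
 { intros w Hw. unfold X. rewrite Cmod_scal by (apply Rlt_le, Rinv_0_lt_compat; lra).
  specialize (Hle w). unfold inD in Hle. specialize (Hle ltac:(lra)). apply Rmult_lt_reg_l with rho. lra.
  rewrite <- Rmult_assoc, Rinv_r by lra. lra. }
 assert (HXd : forall w, Cmod w < rho -> Cder X w (RtoC (/ rho) * sg' w)%C).
 { intros w Hw. apply Cder_scal, Hsg. unfold inD; lra. }
 assert (Hpr : forall t, Cmod (polar r t) < rho) by (intros t; rewrite Cmod_polar; lra).
 assert (HX0 : X 0 = 0). { unfold X. specialize (Hle 0 inD0). rewrite Cmod_0 in Hle. Cnneg (sg 0).
  rewrite (Cmod_eq_0 (sg 0)) by lra. ring. }
 assert (Xc : forall t, curve (fun t => X (polar r t)) t).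
 { intros t. apply (curve_comp X (polar r)). apply polar_curve. apply (Cder_cont _ _ _ (HXd _ (Hpr t))). }
 assert (HFX : forall t, sg (polar r t) = (RtoC rho * X (polar r t))%C).
 { intros t. unfold X. rewrite Cmult_assoc, <- RtoC_mult, Rinv_r, Cmult_1_l by lra. reflexivity. }
 exists (fun s t => arcU (PI * INR s / INR N) (X (polar r t))). split.
 - intros t. apply (continuous_comp (fun t => p * Re (L (sg (polar r t)))) exp).
  + apply (continuous_Rmult (fun _ => p)). apply continuous_const.
   apply (curve_comp (fun z => L (sg z)) (polar r)). apply polar_curve.
   assert (I : inD (polar r t)) by (unfold inD; specialize (Hpr t); lra).
   apply (Ccont_comp sg L). apply (holo_cont _ _ Hsg); auto. apply (holo_cont _ _ HL). specialize (Hle _ I). unfold inD in *; lra.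
  + smooth.
 - intros t. apply Rlt_le, exp_pos.
 - apply arc_values_end.
 - intros i Hi. apply arc_values_decr; auto. lra.
 - intros s t. destruct (arcUhol_holo (PI * INR s / INR N)) as [D HD].
  assert (Hc : curve (fun t => arcUhol (PI * INR s / INR N) (X (polar r t))) t).
  { apply (curve_comp (arcUhol (PI * INR s / INR N)) (fun t => X (polar r t))); auto. apply (holo_cont _ _ HD). apply HX, Hpr. }
  apply (continuous_ext (fun t => Re (arcUhol (PI * INR s / INR N) (X (polar r t))))). intros y. apply arcUhol_Re. apply Hc.
 - intros s t Hs. apply arcU_bounds. apply HX, Hpr. apply grid_bounds; auto.
 - intros s Hs. transitivity (2 * (PI * INR s / INR N)). apply (arcU_mean X (fun w => RtoC (/ rho) * sg' w)%C _ r rho); auto.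
  change (@eq R (2 * (PI * INR s / INR N)) (2 * PI * (INR s / INR N))). field; lra.
 - intros t. rewrite HFX. apply (arc_majorant L L' p rho N); auto. lra. apply HX, Hpr.
Qed.

Lemma RInt_const_R a b (c : R) : (b - a) * c = RInt (fun _ => c) a b.
Proof. symmetry. exact (RInt_const a b c). Qed.

(** Every term but the one at 0 is at most the integral over the preceding step. *)
Lemma decreasing_Riemann_sum (G : R -> R) b n : 0 < b -> (forall t, continuous G t) ->
 (forall s t, 0 <= s <= t -> t <= INR n * b -> G t <= G s) ->
 b * Rsum (fun i => G (INR i * b)) (S n) <= RInt G 0 (INR n * b) + b * G 0.
Proof.
 intros Hb Hc. induction n; intros Hd.
 - simpl. rewrite Rmult_0_l. rewrite (RInt_point (V := R_CompleteNormedModule)). unfold zero; simpl. lra.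
 - assert (E : RInt G 0 (INR (S n) * b) = RInt G 0 (INR n * b) + RInt G (INR n * b) (INR (S n) * b)).
  { symmetry. apply RInt_Chasles_R; apply ex_RInt_cont; auto. }
  assert (Hn : 0 <= INR n * b) by (apply Rmult_le_pos; [apply pos_INR|lra]).
  assert (ES : INR (S n) * b = INR n * b + b) by (rewrite S_INR; ring).
  assert (Q : b * G (INR (S n) * b) <= RInt G (INR n * b) (INR (S n) * b)).
  { assert (EC : b * G (INR (S n) * b) = RInt (fun _ => G (INR (S n) * b)) (INR n * b) (INR (S n) * b)) by (rewrite <- RInt_const_R, ES; ring).
   rewrite EC. apply RInt_le. lra. apply ex_RInt_cont. intros t; apply continuous_const. apply ex_RInt_cont; auto.
   intros t Ht. apply Hd; lra. }
  rewrite E. change (Rsum (fun i => G (INR i * b)) (S (S n))) with (Rsum (fun i => G (INR i * b)) (S n) + G (INR (S n) * b)).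
  assert (IH : b * Rsum (fun i => G (INR i * b)) (S n) <= RInt G 0 (INR n * b) + b * G 0) by (apply IHn; intros s t Hs Ht; apply Hd; lra).
  lra.
Qed.

Lemma le_of_le_plus_inv (x y c : R) : (forall n, x <= y + c * / INR (S n)) -> x <= y.
Proof.
 intros H. apply Rnot_lt_le. intros Hlt.
 destruct (inv_INR_small ((x - y) / (Rabs c + 1))) as [N X]. { apply Rdiv_lt_0_compat. lra. pose proof (Rabs_pos c); lra. }
 specialize (X N (Nat.le_refl N)). specialize (H N). pose proof (inv_INR_pos N). pose proof (Rle_abs c). pose proof (Rabs_pos c).
 apply Rmult_lt_compat_r with (r := Rabs c + 1) in X; [|lra]. unfold Rdiv in X. rewrite Rmult_assoc, Rinv_l in X by lra. nra.
Qed.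

Definition sum_along (l : list ((C -> C) * (C -> C))) (z : C) : R := fold_right (fun q x => Re (fst q (snd q z)) + x) 0 l.
Definition sum_ident (l : list ((C -> C) * (C -> C))) (z : C) : R := fold_right (fun q x => Re (fst q z) + x) 0 l.

Definition admissible (q : (C -> C) * (C -> C)) : Prop := exists L' sg', holo (fst q) L' /\ circle_monotone (fst q) /\
 holo (snd q) sg' /\ forall z, inD z -> Cmod (snd q z) <= Cmod z.

(** [rearrangement] with the constant weight 1 on N = n + 1 steps. The step functions multiply to
    samples of the integrand with identities inside, so the bound is a Riemann sum over the
    half-circle, with an error 2 pi G(0)/N that vanishes as N grows. *)
Theorem subordination_integral_bound (l : list ((C -> C) * (C -> C))) p r rho : 0 < p -> 0 < r < rho -> rho < 1 -> List.Forall admissible l ->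
 RInt (fun t => exp (p * sum_along l (polar r t))) 0 (2 * PI) <= 2 * RInt (fun t => exp (p * sum_ident l (polar rho t))) 0 PI.
Proof.
 intros Hp Hr Hrho Hl. pose proof PI_RGT_0 as HPI.
 set (G := fun t => exp (p * sum_ident l (polar rho t))).
 assert (Hpr : forall t, inD (polar rho t)) by (intros t; unfold inD; rewrite Cmod_polar; lra).
 assert (Gc : forall t, continuous G t).
 { intros t. apply (continuous_comp (fun t => p * sum_ident l (polar rho t)) exp).
  2: smooth.
  apply (continuous_Rmult (fun _ => p)). apply continuous_const.
  clear G. induction Hl as [|[L sg] l [L' [sg' [A1 [A2 [A3 A4]]]]] Hl IH]; simpl. apply continuous_const.
  apply (continuous_plus (fun t => Re (L (polar rho t)))); auto.
  apply (curve_comp L (polar rho)). apply polar_curve. apply (holo_cont _ _ A1); auto. }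
 assert (Gd : forall s t, 0 <= s <= t -> t <= PI -> G t <= G s).
 { intros s t Hs Ht. assert (Q : sum_ident l (polar rho t) <= sum_ident l (polar rho s)).
  { clear G Gc. induction Hl as [|[L sg] l [L' [sg' [A1 [A2 [A3 A4]]]]] Hl IH]; simpl. lra.
   apply Rplus_le_compat; auto. apply A2; auto. rewrite !Cmod_polar; lra. rewrite !Re_polar. apply Rmult_le_compat_l. lra. apply cos_decr_1; lra. }
  assert (Q2 : p * sum_ident l (polar rho t) <= p * sum_ident l (polar rho s)) by nra.
  unfold G. destruct Q2 as [E|E]. left; apply exp_increasing; auto. rewrite E; lra. }
 assert (Gp : forall t, 0 <= G t) by (intros t; apply Rlt_le, exp_pos).
 apply (le_of_le_plus_inv _ _ (2 * PI * G 0)). intros n.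
 set (N := S n). assert (HN0 : 0 < INR N) by (apply lt_0_INR; unfold N; lia).
 set (ls := map (fun q : (C -> C) * (C -> C) => (fun t => exp (p * Re (fst q (snd q (polar r t)))), arc_values (fst q) p rho N)) l).
 destruct (rearrangement N ls) as [_ [_ B]].
 { unfold N; lia. }
 { unfold ls. clear - Hl Hp Hr Hrho. induction Hl as [|[L sg] l [L' [sg' [A1 [A2 [A3 A4]]]]] Hl IH]; simpl; constructor; auto.
  apply (Schwarz_dominated L L' sg sg' p r rho N); auto. unfold N; lia. }
 specialize (B (fun _ => 1) N (Nat.le_refl N) (fun t => continuous_const _ _) ltac:(intros; lra)).
 rewrite <- RInt_const_R in B.
 assert (BI : (2 * PI - 0) * 1 <= 2 * PI * (INR N / INR N)). { replace (INR N / INR N) with 1 by (field; lra). lra. }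
 assert (B2 := B BI).
 assert (E1 : RInt (fun t => exp (p * sum_along l (polar r t))) 0 (2 * PI) = RInt (fun t => 1 * prod_fun ls t) 0 (2 * PI)).
 { apply RInt_ext. intros t _. transitivity (prod_fun ls t); [|symmetry; apply Rmult_1_l]. unfold ls. clear.
  induction l as [|q l IH]; simpl. rewrite Rmult_0_r, exp_0. reflexivity. rewrite Rmult_plus_distr_l, exp_plus, IH. reflexivity. }
 assert (E2 : Rsum (prod_seq ls) N = Rsum (fun i => G (INR i * (PI / INR N))) N).
 { apply Rsum_ext. intros i Hi. unfold ls, G. replace (INR i * (PI / INR N)) with (PI * INR i / INR N) by (field; lra). clear - Hi.
  induction l as [|q l IH]. unfold prod_seq, sum_ident; simpl. rewrite Rmult_0_r, exp_0. reflexivity.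
  set (z := polar rho (PI * INR i / INR N)) in *. change (sum_ident (q :: l) z) with (Re (fst q z) + sum_ident l z).
  rewrite Rmult_plus_distr_l, exp_plus, <- IH. cbn [map]. unfold prod_seq at 1; cbn [fold_right snd]. unfold arc_values at 1.
  destruct (Nat.ltb_spec i N); [reflexivity|lia]. }
 rewrite E1. eapply Rle_trans; [exact B2|]. rewrite E2.
 set (b := PI / INR N). assert (Hb : 0 < b) by pos_div.
 assert (Enb : INR n * b <= PI).
 { unfold b. replace PI with (INR N * (PI / INR N)) at 2 by (field; lra). apply Rmult_le_compat_r. fold b; lra. apply le_INR. unfold N; lia. }
 assert (Hn : 0 <= INR n * b) by (apply Rmult_le_pos; [apply pos_INR|lra]).
 assert (Q := decreasing_Riemann_sum G b n Hb Gc ltac:(intros; apply Gd; lra)). fold N in Q.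
 assert (Q2 : RInt G 0 (INR n * b) <= RInt G 0 PI).
 { assert (E : RInt G 0 PI = RInt G 0 (INR n * b) + RInt G (INR n * b) PI) by (symmetry; apply RInt_Chasles_R; apply ex_RInt_cont; auto).
  assert (0 <= RInt G (INR n * b) PI) by (apply RInt_ge_0; auto; apply ex_RInt_cont; auto). lra. }
 replace (2 * PI / INR N * Rsum (fun i => G (INR i * b)) N) with (2 * (b * Rsum (fun i => G (INR i * b)) N)) by (unfold b; field; lra).
 replace (2 * PI * G 0 * / INR N) with (2 * (b * G 0)) by (unfold b; field; lra). fold G. lra.
Qed.

(** * The factors of the kernel and the factorization of h' *)

Lemma Cmod_one_plus (c : R) (z : C) : Cmod (1 + RtoC c * z) * Cmod (1 + RtoC c * z) = 1 + 2 * c * Re z + c * c * (Cmod z * Cmod z).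
Proof. rewrite !Cmod_sqr. destruct z; C_ring. Qed.

Lemma Re_one_plus (c : R) (z : C) : -1 <= c <= 1 -> inD z -> 0 < Re (1 + RtoC c * z).
Proof.
 intros Hc Hz. unfold inD in Hz. pose proof (re_le_Cmod z) as Q. apply Rabs_le_between in Q.
 replace (Re (1 + RtoC c * z)) with (1 + c * Re z) by C_ring.
 assert (- (1) < c * Re z); [|lra]. destruct (Rle_lt_dec 0 c); nra.
Qed.

Lemma log_factor_holo (s c : R) : -1 <= c <= 1 -> exists L', holo (fun z => RtoC s * Clog (1 + RtoC c * z))%C L'.
Proof.
 intros Hc. exists (fun z => RtoC s * (/ (1 + RtoC c * z) * (0 + RtoC c * 1)))%C. intros z Hz.
 apply Cder_scal. apply (Cder_comp (fun z => 1 + RtoC c * z)%C Clog). apply Cder_plus. apply Cder_const. apply Cder_scal, Cder_id.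
 apply Clog_Cder, Re_one_plus; auto.
Qed.

Lemma Re_log_factor s c z : Re (RtoC s * Clog (1 + RtoC c * z)) = s * ln (Cmod (1 + RtoC c * z)).
Proof. set (x := (1 + RtoC c * z)%C). unfold Clog, Re, Im; simpl. ring. Qed.

(** On a circle |1 + c z|^2 is affine in Re z with slope 2 c, and the condition on s c orients the
    power accordingly. *)
Lemma log_factor_monotone s c : -1 <= c <= 1 -> 0 <= s * c -> circle_monotone (fun z => RtoC s * Clog (1 + RtoC c * z))%C.
Proof.
 intros Hc Hsc z w Hz Hw Em Er. rewrite !Re_log_factor.
 assert (Pz : 0 < Cmod (1 + RtoC c * z)) by (apply Cmod_gt_0, Re_pos_neq_0, Re_one_plus; auto).
 assert (Pw : 0 < Cmod (1 + RtoC c * w)) by (apply Cmod_gt_0, Re_pos_neq_0, Re_one_plus; auto).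
 pose proof (Cmod_one_plus c z) as Q1. pose proof (Cmod_one_plus c w) as Q2. rewrite Em in Q1.
 assert (Hln : forall x y, 0 < x -> x <= y -> ln x <= ln y).
 { intros x y Hx [H| ->]; [left; apply ln_increasing; auto|lra]. }
 destruct (Rtotal_order c 0) as [H|[H|H]].
 - assert (s <= 0) by nra. assert (c * Re w <= c * Re z) by nra.
  assert (Cmod (1 + RtoC c * w) <= Cmod (1 + RtoC c * z)) by (apply Rnot_lt_le; intros Hlt; nra).
  pose proof (Hln _ _ Pw H2). nra.
 - subst c. replace (1 + 0 * z)%C with (RtoC 1) by ring. replace (1 + 0 * w)%C with (RtoC 1) by ring. lra.
 - assert (0 <= s) by nra. assert (c * Re z <= c * Re w) by nra.
  assert (Cmod (1 + RtoC c * z) <= Cmod (1 + RtoC c * w)) by (apply Rnot_lt_le; intros Hlt; nra).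
  pose proof (Hln _ _ Pz H2). nra.
Qed.

Lemma log_factor_admissible s c sg sg' : -1 <= c <= 1 -> 0 <= s * c -> holo sg sg' -> (forall z, inD z -> Cmod (sg z) <= Cmod z) ->
 admissible (fun z => RtoC s * Clog (1 + RtoC c * z), sg)%C.
Proof.
 intros Hc Hsc Hh Hs. destruct (log_factor_holo s c Hc) as [L' HL]. exists L', sg'. split; [exact HL|]. split; [apply log_factor_monotone; auto|]. auto.
Qed.

Definition Schwarz_function (s : C -> C) : Prop := (exists s', holo s s') /\ forall z, inD z -> Cmod (s z) <= Cmod z.

Lemma Schwarz_function_intro s s' : holo s s' -> s 0 = 0 -> (forall z, inD z -> Cmod (s z) <= 1) -> Schwarz_function s.
Proof.
 intros H H0 H1. split. exists s'; auto. intros z Hz. destruct (Schwarz_disc s s' 1 H H0 H1) as [Q _]. specialize (Q z Hz). lra.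
Qed.

Lemma dilatation_holo (h' g' h'' g'' : C -> C) k : holo h' h'' -> holo g' g'' -> (forall z, inD z -> h' z <> 0) ->
 (forall z, inD z -> Cmod (g' z) <= k * Cmod (h' z)) ->
 (exists om', holo (fun z => g' z / h' z)%C om') /\ forall z, inD z -> Cmod (g' z / h' z) <= k.
Proof.
 intros Hh Hg Hn Hd. split.
 - exists (fun z => (g'' z * h' z - g' z * h'' z) / (h' z * h' z))%C. intros z Hz. apply Cder_div; auto.
 - intros z Hz. specialize (Hn z Hz). specialize (Hd z Hz). unfold Cdiv. rewrite Cmod_mult, Cmod_inv by auto.
  apply Cmod_gt_0 in Hn. apply Rmult_le_reg_r with (Cmod (h' z)); auto. rewrite Rmult_assoc, Rinv_l by lra. lra.
Qed.

Lemma dilatation_Schwarz (h' g' h'' g'' : C -> C) k : holo h' h'' -> holo g' g'' -> (forall z, inD z -> h' z <> 0) ->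
 (forall z, inD z -> Cmod (g' z) <= k * Cmod (h' z)) -> h' 0 = 1 -> g' 0 = 0 ->
 forall z, inD z -> Cmod (g' z) <= k * Cmod z * Cmod (h' z).
Proof.
 intros Hh Hg Hn Hd H1 H0 z Hz. destruct (dilatation_holo h' g' h'' g'' k Hh Hg Hn Hd) as [[om' Hom] Hb].
 destruct (Schwarz_disc _ om' k Hom) as [Q _]; auto.
 - rewrite H0. unfold Cdiv. ring.
 - specialize (Q z Hz). specialize (Hn z Hz). unfold Cdiv in Q. rewrite Cmod_mult, Cmod_inv in Q by auto.
  apply Cmod_gt_0 in Hn. apply Rmult_le_reg_r with (/ Cmod (h' z)). apply Rinv_0_lt_compat; auto.
  rewrite (Rmult_assoc (k * Cmod z)), Rinv_r by lra. lra.
Qed.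

Lemma Cmod_le_of_sqr (x y : C) : Cmod x * Cmod x <= Cmod y * Cmod y -> Cmod x <= Cmod y.
Proof. intros H. apply Rnot_lt_le. intros Hlt. Cnneg x. Cnneg y. nra. Qed.

(** Let P be the function with Re P >= 0. Adding e makes the real part positive, and the Cayley
    transform s of P + e at c = P 0 + e is a Schwarz function with P + e = c (1 + (conj c / c) s)/(1
    - s); this gives s1 and s2. Since |P 0| = 1, one has |c| <= 1 + e. The remaining factors of P
    are 1 - rot^2, with s3 = rot^2, and 1 + e^(-2 i al) g'/h', where the last term is -k s4. *)
Lemma derivative_factorization (h' g' h'' g'' : C -> C) k al be e : 0 <= k < 1 -> holo h' h'' -> holo g' g'' ->
 (forall z, inD z -> h' z <> 0) -> (forall z, inD z -> Cmod (g' z) <= k * Cmod (h' z)) -> h' 0 = 1 -> g' 0 = 0 ->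
 (forall z, inD z -> 0 <= Re (cis be * (1 - (cis (- be) * z) * (cis (- be) * z)) *
   (cis al * h' z + cis (- al) * g' z))) -> 0 < e ->
 exists s1 s2 s3 s4, Schwarz_function s1 /\ Schwarz_function s2 /\ Schwarz_function s3 /\ Schwarz_function s4 /\
  forall z, inD z -> Cmod (h' z) * (Cmod (1 - s2 z) * (Cmod (1 - s3 z) * Cmod (1 - RtoC k * s4 z))) <= (1 + e) * Cmod (1 + s1 z).
Proof.
 intros Hk Hh Hg Hn Hd H1 H0 HP He.
 destruct (dilatation_holo h' g' h'' g'' k Hh Hg Hn Hd) as [[om' Hom] Hb]. set (om := fun z => (g' z / h' z)%C) in *.
 assert (om0 : om 0 = 0). { unfold om. rewrite H0. unfold Cdiv. ring. }
 assert (H4 : exists s4, Schwarz_function s4 /\ forall z, inD z -> (RtoC k * s4 z = - (cis (- (2 * al)) * om z))%C).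
 (* Division by k fails for k = 0; there g'/h' vanishes and the zero function serves as s4. *)
 { destruct (Req_dec k 0) as [E|E].
  - exists (fun _ => 0). split. split. exists (fun _ => 0). intros z _. apply Cder_const. intros z _. rewrite Cmod_0. apply Cmod_ge_0.
   intros z Hz. specialize (Hb z Hz). rewrite E in Hb. Cnneg (g' z / h' z)%C.
   assert (Q : om z = 0) by (unfold om; apply Cmod_eq_0; lra). rewrite Q, E. ring.
  - assert (Nk : RtoC k <> 0) by (intros X; apply RtoC_inj in X; lra).
   exists (fun z => - (cis (- (2 * al)) / RtoC k) * om z)%C. split.
   + apply (Schwarz_function_intro _ (fun z => - (cis (- (2 * al)) / RtoC k) * om' z)%C).
    * intros z Hz. apply Cder_scal; auto.
    * rewrite om0. ring.
    * intros z Hz. specialize (Hb z Hz). fold (om z) in Hb. rewrite Cmod_mult, Cmod_opp. unfold Cdiv.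
     rewrite Cmod_mult, Cmod_polar1, Cmod_inv, Cmod_R, Rabs_right by (auto; lra).
     apply Rmult_le_reg_l with k. lra. rewrite Rmult_1_l, <- Rmult_assoc, Rinv_r, Rmult_1_l, Rmult_1_r by lra. auto.
   + intros z Hz. field. auto. }
 destruct H4 as [s4 [Hs4 Es4]].
 set (rot := fun z => (cis (- be) * z)%C).
 assert (Mrot : forall z, Cmod (rot z) = Cmod z) by (intros z; unfold rot; rewrite Cmod_mult, Cmod_polar1; ring).
 assert (Hs3 : Schwarz_function (fun z => rot z * rot z)%C).
 { split. exists (fun z => (cis (- be) * 1) * rot z + rot z * (cis (- be) * 1))%C. intros z Hz. apply Cder_mult; apply Cder_scal, Cder_id.
  intros z Hz. rewrite Cmod_mult, Mrot. unfold inD in Hz. Cnneg z. nra. }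
 set (P := fun z => (cis be * (1 - rot z * rot z) * (cis al * h' z + cis (- al) * g' z))%C).
 change (forall z, inD z -> 0 <= Re (P z)) in HP.
 assert (HPh : exists P', holo P P').
 { exists (fun z => (cis be * (0 - ((cis (- be) * 1) * rot z + rot z * (cis (- be) * 1)))) * (cis al * h' z + cis (- al) * g' z)
   + (cis be * (1 - rot z * rot z)) * (cis al * h'' z + cis (- al) * g'' z))%C.
  intros z Hz. apply (Cder_mult (fun z => cis be * (1 - rot z * rot z))%C (fun z => cis al * h' z + cis (- al) * g' z)%C).
  - apply Cder_scal. apply Cder_minus. apply Cder_const. apply Cder_mult; apply Cder_scal, Cder_id.
  - apply (Cder_plus (fun z => cis al * h' z)%C (fun z => cis (- al) * g' z)%C); [apply (Cder_scal _ h')|apply (Cder_scal _ g')]; auto. }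
 destruct HPh as [P' HPh].
 set (c := (P 0 + RtoC e)%C).
 assert (MP0 : Cmod (P 0) = 1).
 { unfold P, rot. rewrite H1, H0. replace (cis be * (1 - cis (- be) * 0 * (cis (- be) * 0)) * (cis al * 1 + cis (- al) * 0))%C
   with (cis be * cis al)%C by ring. rewrite Cmod_mult, !Cmod_polar1. ring. }
 assert (Rc : e <= Re c). { unfold c. replace (Re (P 0 + RtoC e)) with (Re (P 0) + e) by reflexivity. pose proof (HP 0 inD0). lra. }
 assert (Mc : Cmod c <= 1 + e). { unfold c. le_via Cmod_triangle. rewrite MP0, Cmod_R, Rabs_right; lra. }
 assert (Nc : c <> 0) by (apply Re_pos_neq_0; lra).
 set (D := fun z => (P z + RtoC e + Cconj c)%C).
 assert (ND : forall z, inD z -> D z <> 0).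
 { intros z Hz. apply Re_pos_neq_0. unfold D. replace (Re (P z + RtoC e + Cconj c)) with (Re (P z) + e + Re c) by reflexivity. specialize (HP z Hz). lra. }
 set (s := fun z => ((P z + RtoC e - c) / D z)%C).
 assert (Hs : Schwarz_function s).
 { apply (Schwarz_function_intro s (fun z => ((P' z + 0 - 0) * D z - (P z + RtoC e - c) * (P' z + 0 + 0)) / (D z * D z))%C).
  - intros z Hz. unfold s. apply (Cder_div (fun z => P z + RtoC e - c)%C D); auto.
   apply Cder_minus. apply Cder_plus; auto. apply Cder_const. apply Cder_const.
   apply Cder_plus. apply Cder_plus; auto. apply Cder_const. apply Cder_const.
  - unfold s. fold c. unfold Cdiv. ring.
  - intros z Hz. unfold s, Cdiv. rewrite Cmod_mult, Cmod_inv by (apply ND; auto).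
   pose proof (proj1 (Cmod_gt_0 _) (ND z Hz)) as HDp. apply Rmult_le_reg_r with (Cmod (D z)); auto.
   rewrite Rmult_assoc, Rinv_l, Rmult_1_l, Rmult_1_r by lra. apply Cmod_le_of_sqr. rewrite !Cmod_sqr. unfold D.
   specialize (HP z Hz). destruct (P z) as [x y], c as [c1 c2]. unfold Re, Im in *; simpl in *. nra. }
 exists (fun z => (Cconj c / c) * s z)%C, s, (fun z => rot z * rot z)%C, s4.
 split; [|split; [exact Hs|split; [exact Hs3|split; [exact Hs4|]]]].
 { destruct Hs as [[s' Hs'] Hsb]. split. exists (fun z => Cconj c / c * s' z)%C. intros z Hz. apply Cder_scal; auto.
  intros z Hz. unfold Cdiv. rewrite !Cmod_mult, Cmod_inv, Cmod_conj, Rinv_r, Rmult_1_l by (auto; intros X; apply Cmod_eq_0 in X; auto). auto. }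
 intros z Hz. specialize (ND z Hz). specialize (HP z Hz).
 assert (E1 : ((P z + RtoC e) * (1 - s z) = c * (1 + Cconj c / c * s z))%C).
 { unfold s. unfold D in *. set (q := (P z + RtoC e)%C) in *. field. auto. }
 assert (EP : Cmod (P z) = Cmod (h' z) * (Cmod (1 - rot z * rot z) * Cmod (1 - RtoC k * s4 z))).
 { rewrite Es4 by auto. replace (P z) with (cis be * (cis al * (h' z * ((1 - rot z * rot z) * (1 - - (cis (- (2 * al)) * om z))))))%C.
  - rewrite !Cmod_mult, !Cmod_polar1. ring.
  - unfold P, om. replace (cis (- al)) with (cis al * cis (- (2 * al)))%C by (rewrite polar_mult; f_equal; ring). field. auto. }
 assert (EPe : Cmod (P z) <= Cmod (P z + RtoC e)).
 { apply Cmod_le_of_sqr. rewrite !Cmod_sqr. destruct (P z) as [x y]. unfold Re, Im in *; simpl in *. nra. }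
 replace (Cmod (h' z) * (Cmod (1 - s z) * (Cmod (1 - rot z * rot z) * Cmod (1 - RtoC k * s4 z)))) with (Cmod (P z) * Cmod (1 - s z)) by (rewrite EP; ring).
 apply Rle_trans with (Cmod (P z + RtoC e) * Cmod (1 - s z)). apply Rmult_le_compat_r; auto. apply Cmod_ge_0.
 rewrite <- Cmod_mult, E1, Cmod_mult. apply Rmult_le_compat_r; auto. apply Cmod_ge_0.
Qed.

(** * Powers on circles and the extremal kernel *)

Lemma rpow_pos x p : 0 < x -> rpow x p = exp (p * ln x).
Proof. intros H. unfold rpow. destruct (Req_EM_T x 0); [lra|reflexivity]. Qed.

Lemma rpow_0 p : rpow 0 p = 0.
Proof. unfold rpow. destruct (Req_EM_T 0 0); [reflexivity|lra]. Qed.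

Lemma rpow_ge_0 x p : 0 <= rpow x p.
Proof. unfold rpow. destruct (Req_EM_T x 0). lra. apply Rlt_le, exp_pos. Qed.

Lemma rpow_le x y p : 0 < p -> 0 <= x <= y -> rpow x p <= rpow y p.
Proof.
 intros Hp Hxy. destruct (Req_dec x 0) as [->|Hx]. rewrite rpow_0. apply rpow_ge_0.
 rewrite !rpow_pos by lra. destruct (proj2 Hxy) as [H|H]; [|rewrite H; lra].
 left. apply exp_increasing. apply Rmult_lt_compat_l; auto. apply ln_increasing; lra.
Qed.

Lemma rpow_mult x y p : 0 <= x -> 0 <= y -> rpow (x * y) p = rpow x p * rpow y p.
Proof.
 intros Hx Hy. destruct (Req_dec x 0) as [->|Hx0]. rewrite Rmult_0_l, rpow_0. ring.
 destruct (Req_dec y 0) as [->|Hy0]. rewrite Rmult_0_r, rpow_0. ring.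
 assert (0 < x * y) by (apply Rmult_lt_0_compat; lra).
 rewrite !rpow_pos by lra. rewrite ln_mult, <- exp_plus by lra. f_equal. ring.
Qed.

(** At a zero of u the threshold e^(1/p) gives continuity; elsewhere [rpow] is exp(p ln u) near
    t. *)
Lemma rpow_continuous (u : R -> R) p t : 0 < p -> (forall s, 0 <= u s) -> continuous u t -> continuous (fun s => rpow (u s) p) t.
Proof.
 intros Hp Hu Hc. rewrite continuous_Reps in Hc. destruct (Req_dec (u t) 0) as [E|E].
 - apply continuous_Reps. intros e He. destruct (Hc (Rpower e (/ p)) (exp_pos _)) as [d [Hd X]]. exists d. split; auto.
  intros s Hs. specialize (X s Hs). rewrite E in *. rewrite rpow_0, Rminus_0_r in *.
  rewrite Rabs_right by (apply Rle_ge, rpow_ge_0). rewrite Rabs_right in X by (apply Rle_ge; auto).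
  destruct (Req_dec (u s) 0) as [E0|E0]. rewrite E0, rpow_0. auto.
  assert (0 < u s) by (specialize (Hu s); lra). rewrite rpow_pos by auto.
  replace e with (exp (p * ln (Rpower e (/ p)))). apply exp_increasing, Rmult_lt_compat_l; auto. apply ln_increasing; auto.
  unfold Rpower. rewrite ln_exp, <- Rmult_assoc, Rinv_r, Rmult_1_l, exp_ln; lra.
 - assert (Hpos : 0 < u t) by (specialize (Hu t); lra).
  apply (continuous_ext_loc _ (fun s => exp (p * ln (u s)))).
  + destruct (Hc (u t) Hpos) as [d [Hd X]]. exists (mkposreal d Hd). intros s Hs. specialize (X s Hs). apply Rabs_def2 in X.
   symmetry. apply rpow_pos. lra.
  + rewrite <- continuous_Reps in Hc. apply (continuous_comp u (fun x => exp (p * ln x))); auto.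
   smooth.
Qed.

Lemma rpow_circle_continuous (F F' : C -> C) p r t : 0 < p -> holo F F' -> 0 <= r < 1 -> continuous (circle_pow p r F) t.
Proof.
 intros Hp HF Hr. apply (rpow_continuous (fun t => Cmod (F (polar r t)))); auto. intros; apply Cmod_ge_0.
 apply (continuous_Cmod (fun t => F (polar r t))). apply (curve_comp F (polar r)). apply polar_curve.
 apply (holo_cont _ _ HF). unfold inD. rewrite Cmod_polar; lra.
Qed.

(** Logarithms of 1 + z, 1/(1 - z), 1/(1 - z) and 1/(1 - k z) in the form s log(1 + c z) with s c >=
    0, each paired with the Schwarz function to be put inside. With identities inside, the real
    parts add up to ln |H_k|. *)
Definition kernel_factors (k : R) (s1 s2 s3 s4 : C -> C) : list ((C -> C) * (C -> C)) :=
 (fun z => RtoC 1 * Clog (1 + RtoC 1 * z), s1)%C :: (fun z => RtoC (-1) * Clog (1 + RtoC (-1) * z), s2)%C ::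
 (fun z => RtoC (-1) * Clog (1 + RtoC (-1) * z), s3)%C :: (fun z => RtoC (-1) * Clog (1 + RtoC (- k) * z), s4)%C :: nil.

Lemma RtoC_m1 : RtoC (-1) = (- RtoC 1)%C.
Proof. C_eq. Qed.

Lemma kernel_den_neq_0 k z : 0 <= k < 1 -> inD z -> (1 + z)%C <> 0 /\ (1 - z)%C <> 0 /\ (1 - RtoC k * z)%C <> 0.
Proof.
 intros Hk Hz. pose proof (Re_one_plus 1 z ltac:(lra) Hz). pose proof (Re_one_plus (-1) z ltac:(lra) Hz). pose proof (Re_one_plus (- k) z ltac:(lra) Hz).
 replace (1 + 1 * z)%C with (1 + z)%C in * by ring. replace (1 + RtoC (-1) * z)%C with (1 - z)%C in * by (rewrite RtoC_m1; ring).
 replace (1 + RtoC (- k) * z)%C with (1 - RtoC k * z)%C in * by (rewrite RtoC_opp; ring). repeat split; apply Re_pos_neq_0; auto.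
Qed.

Lemma kernel_sum_ident k s1 s2 s3 s4 p z : 0 <= k < 1 -> inD z -> exp (p * sum_ident (kernel_factors k s1 s2 s3 s4) z) = rpow (Cmod (Hk k z)) p.
Proof.
 intros Hkb Hz. destruct (kernel_den_neq_0 k z Hkb Hz) as [N1 [N2 N3]].
 unfold sum_ident, kernel_factors. cbn [fold_right fst snd]. rewrite !Re_log_factor.
 replace (1 + 1 * z)%C with (1 + z)%C by ring. replace (1 + RtoC (-1) * z)%C with (1 - z)%C by (rewrite RtoC_m1; ring).
 replace (1 + RtoC (- k) * z)%C with (1 - RtoC k * z)%C by (rewrite RtoC_opp; ring).
 assert (M : Cmod (Hk k z) = Cmod (1 + z) * / (Cmod (1 - z) * Cmod (1 - z) * Cmod (1 - RtoC k * z))).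
 { unfold Hk, Cdiv. rewrite Cmod_mult, Cmod_inv, !Cmod_mult; auto. repeat apply Cmult_neq_0; auto. }
 apply Cmod_gt_0 in N1, N2, N3.
 assert (D : 0 < Cmod (1 - z) * Cmod (1 - z) * Cmod (1 - RtoC k * z)) by (repeat apply Rmult_lt_0_compat; auto).
 rewrite M, rpow_pos, ln_mult, ln_Rinv, !ln_mult; auto; try (apply Rinv_0_lt_compat; auto).
 f_equal. ring. apply Rmult_lt_0_compat; auto. apply Rmult_lt_0_compat; auto. apply Rinv_0_lt_compat; auto.
Qed.

Lemma Hk_holo k : 0 <= k < 1 -> exists D, holo (Hk k) D.
Proof.
 intros Hkb. eexists. intros z Hz. destruct (kernel_den_neq_0 k z Hkb Hz) as [N1 [N2 N3]].
 apply (Cder_div (fun z => 1 + z)%C (fun z => (1 - z) * (1 - z) * (1 - RtoC k * z))%C). repeat apply Cmult_neq_0; auto.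
 apply Cder_plus. apply Cder_const. apply Cder_id.
 apply Cder_mult. apply Cder_mult; apply Cder_minus; (apply Cder_const || apply Cder_id).
 apply Cder_minus. apply Cder_const. apply Cder_scal, Cder_id.
Qed.

Lemma kernel_admissible k s1 s2 s3 s4 : 0 <= k < 1 -> Schwarz_function s1 -> Schwarz_function s2 -> Schwarz_function s3 -> Schwarz_function s4 ->
 List.Forall admissible (kernel_factors k s1 s2 s3 s4).
Proof.
 intros Hkb [[s1' H1] B1] [[s2' H2] B2] [[s3' H3] B3] [[s4' H4] B4].
 repeat constructor; eapply log_factor_admissible; eauto; lra.
Qed.

Lemma sum_ident_symmetric l z w : List.Forall admissible l -> inD z -> inD w -> Cmod z = Cmod w -> Re z = Re w -> sum_ident l z = sum_ident l w.
Proof.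
 intros Hl Hz Hw Em Er. induction Hl as [|[L sg] l [L' [sg' [A1 [A2 [A3 A4]]]]] Hl IH]; simpl; auto.
 rewrite IH. f_equal. apply Rle_antisym; apply A2; auto; lra.
Qed.

Lemma id_Schwarz : Schwarz_function (fun z => z).
Proof. split. exists (fun _ => 1). intros z _. apply Cder_id. intros; lra. Qed.

(** Reflection t -> 2 pi - t: the moduli of the factors depend only on |z| and Re z. *)
Lemma kernel_integral_half k p r : 0 <= k < 1 -> 0 < p -> 0 < r < 1 ->
 RInt (circle_pow p r (Hk k)) 0 (2 * PI) = 2 * RInt (circle_pow p r (Hk k)) 0 PI.
Proof.
 intros Hkb Hp Hr. destruct (Hk_holo k Hkb) as [D HD]. set (G := fun t => rpow (Cmod (Hk k (polar r t))) p).
 assert (Gc : forall t, continuous G t) by (intros t; apply (rpow_circle_continuous _ _ p r t Hp HD); lra).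
 assert (HinD : forall t, inD (polar r t)) by (intros t; unfold inD; rewrite Cmod_polar; lra).
 assert (Gs : forall t, G (-1 * t + 2 * PI) = G t).
 { intros t. unfold G. pose proof id_Schwarz as I. rewrite <- !(kernel_sum_ident k (fun z => z) (fun z => z) (fun z => z) (fun z => z) p) by auto.
  do 2 f_equal. apply sum_ident_symmetric; auto. apply kernel_admissible; auto. rewrite !Cmod_polar; lra.
  rewrite !Re_polar. f_equal. replace (-1 * t + 2 * PI) with (- t + 2 * PI) by ring. rewrite cos_plus, cos_2PI, sin_2PI, cos_neg. ring. }
 assert (E : RInt G 0 (2 * PI) = RInt G 0 PI + RInt G PI (2 * PI)) by (symmetry; apply RInt_Chasles_R; apply ex_RInt_cont; auto).
 assert (Q := RInt_comp_lin (V := R_CompleteNormedModule) G (-1) (2 * PI) 0 PI (ex_RInt_cont _ _ _ Gc)).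
 replace (-1 * 0 + 2 * PI) with (2 * PI) in Q by ring. replace (-1 * PI + 2 * PI) with PI in Q by ring.
 assert (Q2 : - RInt G 0 PI = RInt (fun y => scal (-1) (G (-1 * y + 2 * PI))) 0 PI).
 { replace (- RInt G 0 PI) with (-1 * RInt G 0 PI) by ring. rewrite <- RInt_scal_R by (apply ex_RInt_cont; auto).
  apply RInt_ext. intros x _. rewrite Gs. reflexivity. }
 assert (Q3 : RInt G PI (2 * PI) = - RInt G (2 * PI) PI) by (symmetry; apply (opp_RInt_swap (V := R_CompleteNormedModule)); apply ex_RInt_cont; auto).
 assert (Q4 : RInt G (2 * PI) PI = - RInt G 0 PI) by (rewrite Q2; symmetry; exact Q).
 apply Rminus_diag_uniq. rewrite E, Q3, Q4. ring.
Qed.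

(** Uniform continuity on a closed disc slightly larger than |z| <= r. It undoes the enlargement of
    the radius made for the majorants. *)
Lemma kernel_integral_limit k p r e : 0 <= k < 1 -> 0 < p -> 0 < r < 1 -> 0 < e -> exists rho, r < rho < 1 /\
 RInt (circle_pow p rho (Hk k)) 0 PI <= RInt (circle_pow p r (Hk k)) 0 PI + e.
Proof.
 intros Hkb Hp Hr He. pose proof PI_RGT_0 as HPI. destruct (Hk_holo k Hkb) as [D HD]. set (r1 := (1 + r) / 2). assert (Hr1 : r < r1 < 1) by (unfold r1; lra).
 set (F := fun z => RtoC (rpow (Cmod (Hk k z)) p)).
 assert (HF : forall z, Cmod z <= r1 -> Ccont F z).
 { intros z Hz eps Heps. assert (Hin : inD z) by (unfold inD; lra).
  assert (C1 : continuous (fun x => rpow (Rabs x) p) (Cmod (Hk k z))).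
  { apply (rpow_continuous Rabs); auto. intros; apply Rabs_pos. apply continuous_Rabs. }
  rewrite continuous_Reps in C1. destruct (C1 eps Heps) as [d [Hd X]].
  destruct (Vcont_Cmod _ _ (holo_cont _ _ HD z Hin) d Hd) as [d2 [Hd2 X2]]. exists d2. split; auto. intros w Hw.
  specialize (X _ (X2 w Hw)). unfold F. rewrite <- RtoC_minus, Cmod_R.
  rewrite !(Rabs_right (Cmod _)) in X by (apply Rle_ge, Cmod_ge_0). exact X. }
 destruct (unif_cont_disc F r1 HF (e / PI)) as [d [Hd X]]. { pos_div. }
 set (rho := r + Rmin (d / 2) ((r1 - r) / 2)).
 assert (0 < Rmin (d / 2) ((r1 - r) / 2)) by (apply Rmin_pos; lra). pose proof (Rmin_l (d / 2) ((r1 - r) / 2)). pose proof (Rmin_r (d / 2) ((r1 - r) / 2)).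
 assert (Hrho : r < rho < r1) by (unfold rho; lra).
 exists rho. split. lra.
 assert (Hc : forall x t, 0 < x < 1 -> continuous (circle_pow p x (Hk k)) t) by (intros x t Hx; apply (rpow_circle_continuous _ _ p x t Hp HD); lra).
 replace (RInt (circle_pow p r (Hk k)) 0 PI + e) with (RInt (fun t => rpow (Cmod (Hk k (polar r t))) p + e / PI) 0 PI).
 - apply RInt_le. lra. apply ex_RInt_cont. intros; apply Hc; lra. apply ex_RInt_cont. intros t.
  apply (continuous_plus (circle_pow p r (Hk k))). apply Hc; lra. apply continuous_const.
  intros t _. specialize (X (polar r t) (polar rho t)). rewrite !Cmod_polar in X by lra.
  replace (polar rho t - polar r t)%C with (RtoC (rho - r) * cis t)%C in X.
  2:{ unfold polar; C_eq. }
  rewrite Cmod_mult, Cmod_R, Cmod_polar, Rabs_right in X by lra.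
  specialize (X ltac:(lra) ltac:(lra) ltac:(unfold rho; lra)). unfold F in X. rewrite <- RtoC_minus, Cmod_R in X. apply Rabs_def2 in X. lra.
 - apply Rminus_diag_uniq. rewrite RInt_plus_R. rewrite <- RInt_const_R. field. lra. apply ex_RInt_cont. intros; apply Hc; lra. apply ex_RInt_cont. intros; apply continuous_const.
Qed.

(** * Comparison of the integral means *)

(** For all e > 0 and rho > r the factorization bounds the integral by (1 + e)^p times the integral
    for H_k on the radius rho. The two losses are independent of each other and are removed together
    by contradiction. *)
Theorem derivative_integral_bound (h' g' h'' g'' : C -> C) k al be p r : 0 <= k < 1 -> 0 < p -> 0 < r < 1 -> holo h' h'' -> holo g' g'' ->
 (forall z, inD z -> h' z <> 0) -> (forall z, inD z -> Cmod (g' z) <= k * Cmod (h' z)) -> h' 0 = 1 -> g' 0 = 0 ->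
 (forall z, inD z -> 0 <= Re (cis be * (1 - (cis (- be) * z) * (cis (- be) * z)) *
   (cis al * h' z + cis (- al) * g' z))) ->
 RInt (circle_pow p r h') 0 (2 * PI) <= RInt (circle_pow p r (Hk k)) 0 (2 * PI).
Proof.
 intros Hkb Hp Hr Hh Hg Hn Hd H1 H0 HP. pose proof PI_RGT_0 as HPI.
 assert (HinD : forall t x, 0 < x < 1 -> inD (polar x t)) by (intros t x Hx; unfold inD; rewrite Cmod_polar; lra).
 set (I := RInt (circle_pow p r h') 0 (2 * PI)).
 rewrite kernel_integral_half by auto. set (J := RInt (circle_pow p r (Hk k)) 0 PI).
 assert (Main : forall e rho, 0 < e -> r < rho < 1 -> I <= exp (p * ln (1 + e)) * (2 * RInt (circle_pow p rho (Hk k)) 0 PI)).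
 { intros e rho He Hrho.
  destruct (derivative_factorization h' g' h'' g'' k al be e Hkb Hh Hg Hn Hd H1 H0 HP He) as [s1 [s2 [s3 [s4 [S1 [S2 [S3 [S4 X]]]]]]]].
  set (l := kernel_factors k s1 s2 s3 s4). assert (Hl : List.Forall admissible l) by (apply kernel_admissible; auto).
  assert (Hs : forall s z, Schwarz_function s -> inD z -> inD (s z)). { intros s z [_ B] Hz. specialize (B z Hz). unfold inD in *; lra. }
  assert (Hpt : forall z, inD z -> rpow (Cmod (h' z)) p <= exp (p * ln (1 + e)) * exp (p * sum_along l z)).
  { intros z Hz. specialize (X z Hz). specialize (Hn z Hz). apply Cmod_gt_0 in Hn. rewrite rpow_pos, <- exp_plus by auto.
   assert (A1 := Re_pos_neq_0 _ (Re_one_plus 1 (s1 z) ltac:(lra) (Hs _ _ S1 Hz))). assert (A2 := Re_pos_neq_0 _ (Re_one_plus (-1) (s2 z) ltac:(lra) (Hs _ _ S2 Hz))).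
   assert (A3 := Re_pos_neq_0 _ (Re_one_plus (-1) (s3 z) ltac:(lra) (Hs _ _ S3 Hz))). assert (A4 := Re_pos_neq_0 _ (Re_one_plus (- k) (s4 z) ltac:(lra) (Hs _ _ S4 Hz))).
   apply Cmod_gt_0 in A1, A2, A3, A4.
   replace (1 - s2 z)%C with (1 + RtoC (-1) * s2 z)%C in X by (rewrite RtoC_m1; ring). replace (1 - s3 z)%C with (1 + RtoC (-1) * s3 z)%C in X by (rewrite RtoC_m1; ring).
   replace (1 - RtoC k * s4 z)%C with (1 + RtoC (- k) * s4 z)%C in X by (rewrite RtoC_opp; ring). replace (1 + s1 z)%C with (1 + RtoC 1 * s1 z)%C in X by ring.
   assert (Q : p * ln (Cmod (h' z)) <= p * ln (1 + e) + p * sum_along l z).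
   { rewrite <- Rmult_plus_distr_l. apply Rmult_le_compat_l. lra. unfold l, sum_along, kernel_factors. cbn [fold_right fst snd]. rewrite !Re_log_factor.
    set (m1 := Cmod (1 + RtoC 1 * s1 z)) in *. set (m2 := Cmod (1 + RtoC (-1) * s2 z)) in *. set (m3 := Cmod (1 + RtoC (-1) * s3 z)) in *. set (m4 := Cmod (1 + RtoC (- k) * s4 z)) in *.
    assert (P3 : 0 < m3 * m4) by (apply Rmult_lt_0_compat; auto). assert (P2 : 0 < m2 * (m3 * m4)) by (apply Rmult_lt_0_compat; auto).
    assert (P1 : 0 < Cmod (h' z) * (m2 * (m3 * m4))) by (apply Rmult_lt_0_compat; auto).
    assert (L : ln (Cmod (h' z) * (m2 * (m3 * m4))) <= ln ((1 + e) * m1)) by (destruct X as [X| ->]; [left; apply ln_increasing; auto|lra]).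
    rewrite !ln_mult in L by (auto; lra). lra. }
   destruct Q as [Q|Q]. left; apply exp_increasing; auto. rewrite Q; lra. }
  assert (Hcs : forall t, continuous (fun t => exp (p * sum_along l (polar r t))) t).
  { intros t. apply (continuous_comp (fun t => p * sum_along l (polar r t)) exp).
   2: smooth.
   apply (continuous_Rmult (fun _ => p)). apply continuous_const.
   assert (Hir : inD (polar r t)) by auto. clear - Hl Hir. induction Hl as [|[L sg] l [L' [sg' [A1 [A2 [A3 A4]]]]] Hl IH]; simpl. apply continuous_const.
   apply (continuous_plus (fun t => Re (L (sg (polar r t))))); auto.
   apply (curve_comp (fun z => L (sg z)) (polar r)). apply polar_curve. apply (Ccont_comp sg L). apply (holo_cont _ _ A3); auto.
   apply (holo_cont _ _ A1). cbn [fst snd] in A4. specialize (A4 _ Hir). unfold inD in *; lra. }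
  apply Rle_trans with (exp (p * ln (1 + e)) * RInt (fun t => exp (p * sum_along l (polar r t))) 0 (2 * PI)).
  - rewrite <- RInt_scal_R by (apply ex_RInt_cont; auto). unfold I. apply RInt_le. lra.
   + apply ex_RInt_cont. intros t. apply (rpow_circle_continuous _ _ p r t Hp Hh); lra.
   + apply ex_RInt_cont. intros t. apply (continuous_Rmult (fun _ => exp (p * ln (1 + e)))); auto. apply continuous_const.
   + intros t _. apply Hpt; auto.
  - apply Rmult_le_compat_l. apply Rlt_le, exp_pos.
   assert (B := subordination_integral_bound l p r rho Hp ltac:(lra) ltac:(lra) Hl). eapply Rle_trans; [exact B|]. right. f_equal.
   apply RInt_ext. intros t _. apply kernel_sum_ident; auto. apply HinD; lra. }
 apply Rnot_lt_le. intros Hlt.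
 assert (HJ : 0 <= J).
 { apply RInt_ge_0. lra. destruct (Hk_holo k Hkb) as [D HD]. apply ex_RInt_cont. intros t. apply (rpow_circle_continuous _ _ p r t Hp HD); lra. intros; apply rpow_ge_0. }
 destruct (kernel_integral_limit k p r ((I - 2 * J) / 4) Hkb Hp Hr ltac:(lra)) as [rho [Hrho Hb]]. fold J in Hb.
 set (J' := 2 * RInt (circle_pow p rho (Hk k)) 0 PI) in *.
 (* [m] lies between the wanted bound 2 J and I, and rho was chosen to give J' <= m. The e below
    satisfies (1 + e)^p = sqrt (I / m) < I / m, so the estimate falls below I. *)
 set (m := (2 * J + I) / 2). assert (Hm : 0 < m < I) by (unfold m; lra).
 assert (HJ'm : J' <= m) by (unfold J', m; lra).
 set (x := ln (I / m) / (2 * p)).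
 assert (Him : 1 < I / m). { apply Rmult_lt_reg_r with m. lra. unfold Rdiv. rewrite Rmult_assoc, Rinv_l; lra. }
 assert (Hln : 0 < ln (I / m)) by (rewrite <- ln_1; apply ln_increasing; lra).
 assert (Hx : 0 < x) by pos_div.
 assert (He : 0 < exp x - 1) by (pose proof (exp_increasing 0 x Hx); rewrite exp_0 in *; lra).
 specialize (Main (exp x - 1) rho He Hrho). fold J' in Main. replace (1 + (exp x - 1)) with (exp x) in Main by ring. rewrite ln_exp in Main.
 assert (Ex : p * x < ln (I / m)) by (unfold x; replace (p * (ln (I / m) / (2 * p))) with (ln (I / m) / 2) by (field; lra); lra).
 apply exp_increasing in Ex. rewrite exp_ln in Ex by lra. pose proof (exp_pos (p * x)).
 assert (exp (p * x) * J' <= exp (p * x) * m) by (apply Rmult_le_compat_l; lra).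
 assert (exp (p * x) * m < I / m * m) by (apply Rmult_lt_compat_r; lra).
 assert (Him2 : forall a b : R, b <> 0 -> a / b * b = a) by (intros; field; auto). rewrite Him2 in H3 by lra. lra.
Qed.

Lemma Mp_le p r F G : 0 < p -> 0 <= RInt (circle_pow p r F) 0 (2 * PI) ->
 RInt (circle_pow p r F) 0 (2 * PI) <= RInt (circle_pow p r G) 0 (2 * PI) -> Mp p r F <= Mp p r G.
Proof.
 intros Hp H0 H. pose proof PI_RGT_0. unfold Mp. apply rpow_le. apply Rinv_0_lt_compat; auto.
 assert (0 < / (2 * PI)) by (apply Rinv_0_lt_compat; lra). split. apply Rmult_le_pos; lra. apply Rmult_le_compat_l; lra.
Qed.

Lemma Cmod_Gk k z : 0 <= k -> Cmod (Gk k z) = k * Cmod z * Cmod (Hk k z).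
Proof.
 intros Hkb. replace (Gk k z) with (RtoC k * z * Hk k z)%C by (unfold Gk, Hk, Cdiv; ring).
 rewrite !Cmod_mult, Cmod_R, Rabs_right; lra.
Qed.

Theorem theorem1 (K p : R) (h g h' g' : C -> C) :
 1 <= K -> 0 < p ->
 in_KH0 h g h' g' ->
 K_qc K h g h' g' ->
 forall r : R, 0 < r < 1 ->
  Mp p r h' <= Mp p r (Hk ((K - 1) / (K + 1))) /\
  Mp p r g' <= Mp p r (Gk ((K - 1) / (K + 1))).
Proof.
 intros HK Hp [dh [dg [h_0 [g_0 [h'_0 [g'_0 [inj [sense conv]]]]]]]] [[_ [_ inv]] qc] r Hr. pose proof PI_RGT_0 as HPI.
 set (k := (K - 1) / (K + 1)) in *.
 assert (Hkb : 0 <= k < 1).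
 { unfold k. split. apply Rmult_le_pos. lra. apply Rlt_le, Rinv_0_lt_compat; lra.
  apply Rmult_lt_reg_r with (K + 1). lra. unfold Rdiv. rewrite Rmult_assoc, Rinv_l; lra. }
 assert (Hh : holo h h') by (exact (has_deriv_on_D_Cder h h' dh)). assert (Hg : holo g g') by (exact (has_deriv_on_D_Cder g g' dg)).
 assert (h'_nz : forall z, inD z -> h' z <> 0).
 { intros z Hz. specialize (sense z Hz). apply Cmod_gt_0. Cnneg (g' z). lra. }
 assert (dil : forall z, inD z -> Cmod (g' z) <= k * Cmod (h' z)).
 { intros z Hz. specialize (qc z Hz). specialize (h'_nz z Hz). unfold Cdiv in qc. rewrite Cmod_mult, Cmod_inv in qc by auto.
  apply Cmod_gt_0 in h'_nz. apply Rmult_le_reg_r with (/ Cmod (h' z)). apply Rinv_0_lt_compat; auto. rewrite (Rmult_assoc k), Rinv_r; lra. }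
 destruct (exists_starlike_coordinate h g h' g' k Hkb Hh Hg h_0 g_0 h'_0 g'_0 dil h'_nz conv inj inv) as [al [be HP]].
 destruct (holo_derivative h h' Hh) as [h'' Hh2]. destruct (holo_derivative g g' Hg) as [g'' Hg2].
 assert (B := derivative_integral_bound h' g' h'' g'' k al be p r Hkb Hp Hr Hh2 Hg2 h'_nz dil h'_0 g'_0 HP).
 destruct (Hk_holo k Hkb) as [D HD].
 assert (ch : forall t, continuous (circle_pow p r h') t) by (intros t; apply (rpow_circle_continuous _ _ p r t Hp Hh2); lra).
 assert (cg : forall t, continuous (circle_pow p r g') t) by (intros t; apply (rpow_circle_continuous _ _ p r t Hp Hg2); lra).
 assert (cH : forall t, continuous (circle_pow p r (Hk k)) t) by (intros t; apply (rpow_circle_continuous _ _ p r t Hp HD); lra).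
 split; apply Mp_le; auto.
 - apply RInt_ge_0. lra. apply ex_RInt_cont; auto. intros; apply rpow_ge_0.
 - apply RInt_ge_0. lra. apply ex_RInt_cont; auto. intros; apply rpow_ge_0.
 - assert (Hkr : 0 <= k * r) by (apply Rmult_le_pos; lra).
  (* On |z| = r one has |g'| <= k r |h'| and |G_k| = k r |H_k|, so this inequality is the one for h'
     multiplied by (k r)^p. *)
  apply Rle_trans with (RInt (fun t => rpow (k * r) p * rpow (Cmod (h' (polar r t))) p) 0 (2 * PI)).
  + apply RInt_le. lra. apply ex_RInt_cont; auto. apply ex_RInt_cont. intros t.
   apply (continuous_Rmult (fun _ => rpow (k * r) p)); auto. apply continuous_const.
   intros t _. rewrite <- rpow_mult by (auto; apply Cmod_ge_0). apply rpow_le; auto. split. apply Cmod_ge_0.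
   assert (Q := dilatation_Schwarz h' g' h'' g'' k Hh2 Hg2 h'_nz dil h'_0 g'_0 (polar r t)). rewrite Cmod_polar in Q by lra.
   apply Q. unfold inD. rewrite Cmod_polar; lra.
  + rewrite RInt_scal_R by (apply ex_RInt_cont; auto).
   replace (RInt (circle_pow p r (Gk k)) 0 (2 * PI)) with (rpow (k * r) p * RInt (circle_pow p r (Hk k)) 0 (2 * PI)).
   apply Rmult_le_compat_l; auto. apply rpow_ge_0.
   rewrite <- RInt_scal_R by (apply ex_RInt_cont; auto). apply RInt_ext. intros t _.
   rewrite Cmod_Gk, Cmod_polar by lra. symmetry. apply rpow_mult; auto. apply Cmod_ge_0.
Qed.
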